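(* Fix an integer $n\geq 4$. Let $k$ be a field, $R=k[x_1,\dots,x_N]$ with $N\geq 3$, and let $J$ be a grade $3$ homogeneous ideal of $R$ with minimal graded free resolution \[0\to R(-(2n+4))\oplus R(-(2n+7))\oplus R(-(3n+5))\to R(-(n+2))^2\oplus R(-(n+4))\oplus R(-(2n+3))\oplus R(-(2n+6))^2\oplus R(-(3n+4))\to R(-2)\oplus R(-(n+1))^2\oplus R(-(n+3))\oplus R(-(2n+4))\to J\to 0\] (equivalently, $J$ is any grade $3$ homogeneous ideal whose graded Betti numbers coincide with those of this resolution). Then $J$ is homogeneously licci, but $J$ is not sequentially bounded licci.
   Context: $R$ has the standard grading. A homogeneous complete intersection of grade $g$ is an ideal $C=(f_1,\dots,f_g)$ generated by a regular sequence of homogeneous forms with $\deg f_1\le\dots\le\deg f_g$; its type is $\operatorname{type}(C)=(\deg f_1,\dots,\deg f_g)$, and types are compared componentwise: $(a_1,\dots,a_g)\le(b_1,\dots,b_g)$ iff $a_i\le b_i$ for all $i$. Two homogeneous ideals $I,I'$ of grade $g$ are directly linked by a homogeneous complete intersection $C$ of grade $g$, written $I\sim_C I'$, if $I=C:I'$ and $I'=C:I$. A homogeneous perfect ideal $I$ is homogeneously licci if there is a finite sequence of direct links $I=I_0\sim_{C_0}I_1\sim_{C_1}\cdots\sim_{C_{s-1}}I_s$ with every $C_i$ a homogeneous complete intersection and $I_s$ a complete intersection. It is sequentially bounded licci (SBL) if such a sequence exists with moreover $\operatorname{type}(C_i)\ge\operatorname{type}(C_{i+1})$ for all $i$. *)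

(* Defs.v *)
From HB Require Import structures.
From mathcomp Require Import all_boot all_order all_algebra.
From mathcomp Require Import mpoly.

Set Implicit Arguments.
Unset Strict Implicit.
Unset Printing Implicit Defensive.

Import GRing.Theory.
Local Open Scope ring_scope.

Section Linkage.
Variables (k : fieldType) (N : nat).
Local Notation R := {mpoly k[N]}.

Definition ideal_eq (I J : R -> Prop) : Prop := forall f, I f <-> J f.

Definition is_ideal (I : R -> Prop) : Prop :=
  [/\ I 0, (forall f g, I f -> I g -> I (f + g)) & (forall r f, I f -> I (r * f))].

Definition is_homog_ideal (I : R -> Prop) : Prop :=
  is_ideal I /\ forall f d, I f -> I (pihomog mdeg d f).

Definition ideal_gen (fs : seq R) : R -> Prop :=
  fun f => exists c : 'I_(size fs) -> R, f = \sum_(i < size fs) c i * fs`_i.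

Definition colon (C I : R -> Prop) : R -> Prop :=
  fun f => forall h, I h -> C (f * h).

Definition regular_seq (fs : seq R) : Prop :=
  (forall i, (i < size fs)%N -> forall g,
      ideal_gen (take i fs) (g * fs`_i) -> ideal_gen (take i fs) g)
  /\ ~ ideal_gen fs 1.

Definition grade_eq (I : R -> Prop) (g : nat) : Prop :=
  (exists fs : seq R, [/\ size fs = g, regular_seq fs & forall i, (i < size fs)%N -> I fs`_i])
  /\ ~ (exists fs : seq R, [/\ size fs = g.+1, regular_seq fs & forall i, (i < size fs)%N -> I fs`_i]).

Definition ker_sub_im m p q (A : 'M[R]_(m, p)) (B : 'M[R]_(p, q)) : Prop :=
  forall v : 'cV[R]_p, A *m v = 0 -> exists w : 'cV[R]_q, v = B *m w.

(* R/I has a finite free resolution of length p: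
   0 -> F_p -> ... -> F_1 -> R -> R/I -> 0,
   F_(i+1) = R^(bs i), gens : F_1 -> R has image I, Ms i : F_(i+2) -> F_(i+1). *)
Definition free_res_length (I : R -> Prop) (p : nat) : Prop :=
  exists (bs : nat -> nat) (gens : 'rV[R]_(bs 0%N))
         (Ms : forall i, 'M[R]_(bs i, bs i.+1)),
  [/\ (forall i, (p <= i)%N -> bs i = 0%N),
      ideal_eq I (fun h => exists v : 'cV[R]_(bs 0%N), h = (gens *m v) ord0 ord0),
      gens *m Ms 0%N = 0 /\ ker_sub_im gens (Ms 0%N)
    & forall i, Ms i *m Ms i.+1 = 0 /\ ker_sub_im (Ms i) (Ms i.+1)].

Definition perfect (I : R -> Prop) : Prop :=
  exists g, grade_eq I g /\ free_res_length I g.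

Definition homog_CI (g : nat) (fs : seq R) (ds : seq nat) : Prop :=
  [/\ size fs = g, size ds = g, regular_seq fs,
      (forall i, (i < g)%N -> fs`_i \is (nth 0%N ds i).-homog)
    & sorted leq ds].

Definition is_CI (I : R -> Prop) : Prop :=
  exists fs : seq R, regular_seq fs /\ ideal_eq I (ideal_gen fs).

Definition directly_linked (g : nat) (I I' C : R -> Prop) : Prop :=
  [/\ is_homog_ideal I /\ is_homog_ideal I', grade_eq I g, grade_eq I' g,
      ideal_eq I (colon C I') & ideal_eq I' (colon C I)].

Definition homog_link_seq (I : R -> Prop) (g s : nat) (Is : nat -> R -> Prop)
    (Cf : nat -> seq R) (Cd : nat -> seq nat) : Prop :=
  [/\ ideal_eq (Is 0%N) I,
      (forall i, (i < s)%N ->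
        homog_CI g (Cf i) (Cd i) /\
        directly_linked g (Is i) (Is i.+1) (ideal_gen (Cf i)))
    & is_CI (Is s)].

Definition homog_licci (I : R -> Prop) : Prop :=
  [/\ is_homog_ideal I, perfect I &
   exists g s Is Cf Cd, grade_eq I g /\ homog_link_seq I g s Is Cf Cd].

Definition type_le (a b : seq nat) : bool := all2 leq a b.

Definition SBL (I : R -> Prop) : Prop :=
  [/\ is_homog_ideal I, perfect I &
   exists g s Is Cf Cd, [/\ grade_eq I g, homog_link_seq I g s Is Cf Cd &
      forall i, (i.+1 < s)%N -> type_le (Cd i.+1) (Cd i)]].

(* Entry condition for a homogeneous (degree-preserving) map between graded
   free modules in a minimal resolution: the entry from a basis element of
   degree b to one of degree a is homogeneous of degree b - a, and lies in the
   maximal ideal (x_1,...,x_N), i.e. it is 0 unless a < b. *)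
Definition min_entry (a b : nat) (p : R) : Prop :=
  p \is (b - a)%N.-homog /\ ((a < b)%N \/ p = 0).

End Linkage.

Definition shifts1 (n : nat) : seq nat := [:: 2; n+1; n+1; n+3; 2*n+4]%N.
Definition shifts2 (n : nat) : seq nat :=
  [:: n+2; n+2; n+4; 2*n+3; 2*n+6; 2*n+6; 3*n+4]%N.
Definition shifts3 (n : nat) : seq nat := [:: 2*n+4; 2*n+7; 3*n+5]%N.

Definition has_resolution_3p12 (k : fieldType) (N n : nat)
    (J : {mpoly k[N]} -> Prop) : Prop :=
  exists (f : 'rV[{mpoly k[N]}]_5) (M2 : 'M[{mpoly k[N]}]_(5, 7))
         (M3 : 'M[{mpoly k[N]}]_(7, 3)),
  [/\ (forall j : 'I_5, (f ord0 j) \is (nth 0%N (shifts1 n) j).-homog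
                       /\ f ord0 j != 0),
      (forall (j : 'I_5) (l : 'I_7), min_entry (nth 0%N (shifts1 n) j) (nth 0%N (shifts2 n) l) (M2 j l)),
      (forall (j : 'I_7) (l : 'I_3), min_entry (nth 0%N (shifts2 n) j) (nth 0%N (shifts3 n) l) (M3 j l)),
      ideal_eq J (fun h => exists v : 'cV[{mpoly k[N]}]_5, h = (f *m v) ord0 ord0)
    & [/\ f *m M2 = 0, ker_sub_im f M2, M2 *m M3 = 0, ker_sub_im M2 M3
        & forall v : 'cV[{mpoly k[N]}]_3, M3 *m v = 0 -> v = 0]].

(* Main.v *)
(** The last matrix of the resolution, together with the exactness of the dual complex,
    puts [J] in the form [(x l, x p, g2, g3, f5)] with linear forms [x], [l], [l2] and
    [p = x b - l2 a], [g2 = s l2 l + t p], [g3 = u l2 l + v p].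

    Licci.  Put [q = s l - t a], [r = u l - v a], [r' = t u - s v].  Linking along
    [(x l, f5, be)] and then along a companion [(x l, f5, be1)] with
    [l2 be1 = be] mod [(x, f5)] and [p be1 = - a be] mod [(l, f5)] turns [J] into
    [(x l, x a, q, r, f5)].  Since [J] lies in [(x, q, r, r')], one has
    [f5 = x z] mod [(q, r, r')], and a second pair of links along [(q, r, _)] divides by
    [x] and ends in the complete intersection [(l, a, z)].  The ground field may be
    finite, so [f5] and [z] are made coprime to [a] mod [l] by a gcd argument in [R / l];
    the remaining elements of the links may have large degree and come from homogeneous
    prime avoidance.

    Not SBL.  Along two links of decreasing type the following persists, with [tau = 2n + 4]:
    [I] contains [x l] and [x p] with [p] prime to [l], in degrees below [tau] it lies in
    [(l, p)], and [l], [p] map the low degrees of [C : I] into [C].  The persistence rests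
    on comparing the residues along two complete intersections in the same ideal.  Neither
    an ideal with these properties nor an ideal directly linked to it is a complete
    intersection. *)

(* Two consecutive links from [I] to [I1] to [I2] are treated together: the residues of [I1] along
   the two complete intersections compare [I] with [I2]. An element of degree [m] of [I2] comes from
   one of degree [m + dl] of [I], where [dl] is the fall of the total degree. Decreasing types give
   [dl >= 0], and most of the work shows that [dl = 0] apart from a single possible fall by 1; so
   the low degrees of [I] keep control of those of [I2]. The constants come from the resolution:
   [2n + 4] is the degree of the last generator, and below the bound given by the shift [2n + 7] of
   the last module, a colon ideal [C : J] is generated modulo [C] by the element belonging to the
   shift [3n + 5], which [l] and [p] kill. The obstacle is degree [2n + 4], where the ideal may
   leave [(l, p)]: only the fact that it does so in at most one dimension can be carried along. The
   licci chain escapes all this because the first degrees of its links are 2, 2, n, n. *)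
Require Import Defs.
From mathcomp Require Import all_boot all_order all_algebra.
From mathcomp Require Import mpoly.
From mathcomp Require Import ring zify.
From Stdlib Require Import Classical ClassicalEpsilon.
Set Implicit Arguments.
Unset Strict Implicit.
Unset Printing Implicit Defensive.
Import Order.TTheory GRing.Theory Num.Theory.
Local Open Scope ring_scope.

(* [lia] on the hypotheses about degrees only: its preprocessing is slow in a large context. *)
Ltac zlia0 := first [
  repeat match goal with
  | H : is_true (@Order.le _ _ _ _) |- _ => revert H
  | H : is_true (@Order.lt _ _ _ _) |- _ => revert H
  | H : is_true (leq _ _) |- _ => revert H
  | H : @eq ?T _ _ |- _ => unify T int; revert H
  | H : _ \/ _ |- _ => revert H
  end; clear; intros; lia | lia ].

(** * Regular sequences and residues *)

Section Koszul.
Variable R : idomainType.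
Implicit Types a b c d e f h u v w : R.

Definition in1 a f := exists u, f = u * a.
Definition in2 a b f := exists u v, f = u * a + v * b.
Definition in3 a b c f := exists u v w, f = u * a + v * b + w * c.
(** Weak regularity: properness of the generated ideal is stated separately, so that these notions
    survive the removal of a factor from a member. *)
Definition reg2 a b := a != 0 /\ forall u, in1 a (u * b) -> in1 a u.
Definition reg3 a b c := reg2 a b /\ forall u, in2 a b (u * c) -> in2 a b u.
Definition reg4 a b c d := reg3 a b c /\ forall u, in3 a b c (u * d) -> in3 a b c u.

(** With [eqD] and [eqM], this reduces an equation to a ring identity once the linear combination of
    hypotheses that implies it is given. *)
Lemma lcomb (a b c d : R) : c = d -> a - b = c - d -> a = b.
Proof. by move=> -> /eqP; rewrite subrr subr_eq0 => /eqP. Qed.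
Lemma eqD (a b c d : R) : a = b -> c = d -> a + c = b + d.
Proof. by move=> -> ->. Qed.
Lemma eqM (h a b : R) : a = b -> h * a = h * b.
Proof. by move=> ->. Qed.

Lemma in1_0 a : in1 a 0. Proof. by exists 0; ring. Qed.
Lemma in1D a f g : in1 a f -> in1 a g -> in1 a (f + g).
Proof. by move=> [u ->] [v ->]; exists (u + v); ring. Qed.
Lemma in1M a h f : in1 a f -> in1 a (h * f).
Proof. by move=> [u ->]; exists (h * u); ring. Qed.
Lemma in2_0 a b : in2 a b 0. Proof. by exists 0, 0; ring. Qed.
Lemma in2D a b f g : in2 a b f -> in2 a b g -> in2 a b (f + g).
Proof. by move=> [u [v ->]] [u' [v' ->]]; exists (u + u'), (v + v'); ring. Qed.
Lemma in2M a b h f : in2 a b f -> in2 a b (h * f).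
Proof. by move=> [u [v ->]]; exists (h * u), (h * v); ring. Qed.
Lemma in2N a b f : in2 a b f -> in2 a b (- f).
Proof. by move=> /(in2M (-1)); rewrite mulN1r. Qed.
Lemma in2B a b f g : in2 a b f -> in2 a b g -> in2 a b (f - g).
Proof. by move=> Hf Hg; apply: in2D => //; apply: in2N. Qed.
Lemma in3_0 a b c : in3 a b c 0. Proof. by exists 0, 0, 0; ring. Qed.
Lemma in3D a b c f g : in3 a b c f -> in3 a b c g -> in3 a b c (f + g).
Proof.
by move=> [u [v [w ->]]] [u' [v' [w' ->]]]; exists (u + u'), (v + v'), (w + w'); ring.
Qed.
Lemma in3M a b c h f : in3 a b c f -> in3 a b c (h * f).
Proof. by move=> [u [v [w ->]]]; exists (h * u), (h * v), (h * w); ring. Qed.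
Lemma in3Mr a b c h f : in3 a b c f -> in3 a b c (f * h).
Proof. by rewrite mulrC; apply: in3M. Qed.
Lemma in3N a b c f : in3 a b c f -> in3 a b c (- f).
Proof. by move=> /(in3M (-1)); rewrite mulN1r. Qed.
Lemma in3B a b c f g : in3 a b c f -> in3 a b c g -> in3 a b c (f - g).
Proof. by move=> Hf Hg; apply: in3D => //; apply: in3N. Qed.
Lemma in31 a b c : in3 a b c a. Proof. by exists 1, 0, 0; ring. Qed.
Lemma in32 a b c : in3 a b c b. Proof. by exists 0, 1, 0; ring. Qed.
Lemma in33 a b c : in3 a b c c. Proof. by exists 0, 0, 1; ring. Qed.
Lemma in2_in3 a b c f : in2 a b f -> in3 a b c f.
Proof. by move=> [u [v ->]]; exists u, v, 0; ring. Qed.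

Lemma reg2_syz a b u v : reg2 a b -> u * a + v * b = 0 -> exists w, u = w * b /\ v = - w * a.
Proof.
move=> [a0 Hb] E; have [|w Ew] := Hb v; first by exists (- u); apply: (lcomb E); ring.
exists (- w); split; last by rewrite Ew; ring.
by apply: (mulIf a0); apply: (lcomb E); rewrite Ew; ring.
Qed.

Lemma reg2_sym a b : reg2 a b -> b != 0 -> reg2 b a.
Proof.
move=> Hr b0; split=> // u [v E].
have [|w [E1 E2]] := @reg2_syz a b u (- v) Hr; first by rewrite E; ring.
by exists w.
Qed.

Lemma reg3_syz a b c u v w : reg3 a b c -> u * a + v * b + w * c = 0 ->
  exists x y z, [/\ u = b * z - c * y, v = c * x - a * z & w = a * y - b * x].
Proof.
move=> [r2 r3] E; have [|y [x Ew]] := r3 w.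
  by exists (- u), (- v); apply: (lcomb E); ring.
have [|z [E1 E2]] := @reg2_syz a b (u + c * y) (v + c * x) r2.
  by rewrite -[RHS]E Ew; ring.
exists (- x), y, z; split; [| |by rewrite Ew; ring].
  by apply: (addIr (c * y)); rewrite E1; ring.
by apply: (addIr (c * x)); rewrite E2; ring.
Qed.

Lemma reg2_prop a b c u v w : reg2 a b ->
  a * v = b * u -> a * w = c * u ->
  exists t, [/\ u = t * a, v = t * b & w = t * c].
Proof.
move=> [a0 Hb] E1 E2; have [|t Et] := Hb u; first by exists v; rewrite mulrC -E1; ring.
exists t; split=> //; apply: (mulfI a0); [rewrite E1 Et|rewrite E2 Et]; ring.
Qed.

(* [h * g_i = A_i . (a, b)]; the syzygies [g_i A_j - g_j A_i] are multiples
   [C_ij] of the Koszul syzygy, and [C] is a Koszul boundary for [g]. *)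
Lemma reg3_colon_reg2 a b g1 g2 g3 h : reg2 a b -> reg3 g1 g2 g3 ->
  in2 a b (h * g1) -> in2 a b (h * g2) -> in2 a b (h * g3) -> in2 a b h.
Proof.
move=> r2 rg [A1 [B1 E1]] [A2 [B2 E2]] [A3 [B3 E3]].
have syz i j Ai Aj Bi Bj : h * i = Ai * a + Bi * b -> h * j = Aj * a + Bj * b ->
  exists w, i * Aj - j * Ai = w * b /\ i * Bj - j * Bi = - w * a.
  move=> Ei Ej; apply: reg2_syz => //.
  transitivity (i * (Aj * a + Bj * b) - j * (Ai * a + Bi * b)); first ring.
  by rewrite -Ei -Ej; ring.
have [c12 [P12 Q12]] := syz _ _ _ _ _ _ E1 E2.
have [c13 [P13 Q13]] := syz _ _ _ _ _ _ E1 E3.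
have [c23 [P23 Q23]] := syz _ _ _ _ _ _ E2 E3.
have [a0 _] := r2.
have [||x [y [z [X1 X2 X3]]]] := @reg3_syz g1 g2 g3 c23 (- c13) c12 => //.
  apply: (mulIf a0); rewrite mul0r.
  transitivity (- (g1 * (- c23 * a) - g2 * (- c13 * a) + g3 * (- c12 * a))); first ring.
  by rewrite -Q12 -Q13 -Q23; ring.
have [r2g _] := rg; have [g10 _] := r2g.
have [|| t [T1 T2 T3]] := @reg2_prop g1 g2 g3 (A1 - b * x) (A2 - b * y) (A3 - b * z) r2g.
- have -> : g1 * (A2 - b * y) = (g1 * A2 - g2 * A1) + g2 * A1 - g1 * b * y by ring.
  by rewrite P12 X3; ring.
- have -> : g1 * (A3 - b * z) = (g1 * A3 - g3 * A1) + g3 * A1 - g1 * b * z by ring.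
  by rewrite P13 -[c13]opprK X2; ring.
have [|| s [S1 S2 S3]] := @reg2_prop g1 g2 g3 (B1 + a * x) (B2 + a * y) (B3 + a * z) r2g.
- have -> : g1 * (B2 + a * y) = (g1 * B2 - g2 * B1) + g2 * B1 + g1 * a * y by ring.
  by rewrite Q12 X3; ring.
- have -> : g1 * (B3 + a * z) = (g1 * B3 - g3 * B1) + g3 * B1 + g1 * a * z by ring.
  by rewrite Q13 -[c13]opprK X2; ring.
exists t, s; apply: (mulIf g10); rewrite E1.
transitivity ((A1 - b * x) * a + (B1 + a * x) * b); first ring.
by rewrite T1 S1; ring.
Qed.

End Koszul.

(** * Comparison of residues along two regular sequences of length three *)

Section Exchange.
Variable R : idomainType.
Implicit Types e f h : R.

Definition vec := (R * R * R)%type.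
Definition dot (u v : vec) : R := u.1.1 * v.1.1 + u.1.2 * v.1.2 + u.2 * v.2.
Definition cross (u v : vec) : vec :=
  (u.1.2 * v.2 - u.2 * v.1.2, u.2 * v.1.1 - u.1.1 * v.2, u.1.1 * v.1.2 - u.1.2 * v.1.1).
Definition vlin (r : R) (u : vec) (s : R) (v : vec) : vec :=
  (r * u.1.1 + s * v.1.1, r * u.1.2 + s * v.1.2, r * u.2 + s * v.2).
Definition vadd (u v : vec) : vec := (u.1.1 + v.1.1, u.1.2 + v.1.2, u.2 + v.2).
Definition vsc (r : R) (u : vec) : vec := (r * u.1.1, r * u.1.2, r * u.2).
Definition vreg (c : vec) := reg3 c.1.1 c.1.2 c.2.
Definition vin (c : vec) f := in3 c.1.1 c.1.2 c.2 f.

Implicit Types c g : vec.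

Lemma veq (u1 u2 u3 v1 v2 v3 : R) : u1 = v1 -> u2 = v2 -> u3 = v3 -> (u1, u2, u3) = (v1, v2, v3).
Proof. by move=> -> -> ->. Qed.

Ltac vring := rewrite /cross /vlin /vadd /vsc /=; apply: veq; ring.

Lemma vinP c f : vin c f <-> exists u, f = dot u c.
Proof.
split=> [[u [v [w ->]]]|[[[u v] w] ->]]; last by exists u, v, w.
by exists (u, v, w).
Qed.

Lemma vin0 c : vin c 0. Proof. exact: in3_0. Qed.
Lemma vinD c e f : vin c e -> vin c f -> vin c (e + f). Proof. exact: in3D. Qed.
Lemma vinB c e f : vin c e -> vin c f -> vin c (e - f). Proof. exact: in3B. Qed.
Lemma vinN c f : vin c f -> vin c (- f). Proof. exact: in3N. Qed.
Lemma vinM c h f : vin c f -> vin c (h * f). Proof. exact: in3M. Qed.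
Lemma vinMr c h f : vin c f -> vin c (f * h). Proof. exact: in3Mr. Qed.

Lemma vreg_syz c u : vreg c -> dot u c = 0 -> exists x, u = cross c x.
Proof.
case: c u => [[a b] c] [[u v] w] rc E; have [x [y [z [-> -> ->]]]] := @reg3_syz R a b c u v w rc E.
by exists (x, y, z).
Qed.

Lemma vreg_prop c u : vreg c -> cross c u = (0, 0, 0) -> exists t, u = vsc t c.
Proof.
case: c u => [[a b] c] [[u v] w] [r2 _]; rewrite /cross /= => -[E1 E2 E3].
have [||t [-> -> ->]] := @reg2_prop R a b c u v w r2; last by exists t.
- by apply: (lcomb E3); ring.
- by apply: (lcomb (eqM (-1) E2)); ring.
Qed.

(* The comparison of the residues of [e] along [c] and of [e'] along [g]: a
   zig-zag through the double complex K(c) (x) K(g). *)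
Definition exch (c g : vec) (e e' : R) :=
  exists A1 A2 A3 B12 B13 B23 : vec,
  [/\ [/\ e * g.1.1 = dot A1 c, e * g.1.2 = dot A2 c & e * g.2 = dot A3 c],
      [/\ vlin g.1.1 A2 (- g.1.2) A1 = cross c B12,
          vlin g.1.1 A3 (- g.2) A1 = cross c B13 &
          vlin g.1.2 A3 (- g.2) A2 = cross c B23] &
      vadd (vlin g.1.1 B23 (- g.1.2) B13) (vsc g.2 B12) = vsc e' c].

Lemma cross_lin c r u s v : cross c (vlin r u s v) = vlin r (cross c u) s (cross c v).
Proof. by vring. Qed.
Lemma cross_add c u v : cross c (vadd u v) = vadd (cross c u) (cross c v).
Proof. by vring. Qed.
Lemma cross_sc c r u : cross c (vsc r u) = vsc r (cross c u).
Proof. by vring. Qed.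
Lemma dot_lin r u s v c : dot (vlin r u s v) c = r * dot u c + s * dot v c.
Proof. by rewrite /dot /=; ring. Qed.
Lemma dot_cross c u : dot (cross c u) c = 0.
Proof. by rewrite /dot /=; ring. Qed.

Lemma exchD c g e e' f f' : exch c g e e' -> exch c g f f' -> exch c g (e + f) (e' + f').
Proof.
move=> [A1 [A2 [A3 [B1 [B2 [B3 [[H1 H2 H3] [H4 H5 H6] H7]]]]]]].
move=> [A1' [A2' [A3' [B1' [B2' [B3' [[H1' H2' H3'] [H4' H5' H6'] H7']]]]]]].
exists (vadd A1 A1'), (vadd A2 A2'), (vadd A3 A3'), (vadd B1 B1'), (vadd B2 B2'), (vadd B3 B3').
have dD u v : dot (vadd u v) c = dot u c + dot v c by rewrite /dot /=; ring.
split.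
- by split; rewrite dD mulrDl ?H1 ?H2 ?H3 ?H1' ?H2' ?H3'.
- split; rewrite cross_add.
  + by rewrite -H4 -H4'; vring.
  + by rewrite -H5 -H5'; vring.
  + by rewrite -H6 -H6'; vring.
- transitivity (vadd (vsc e' c) (vsc f' c)); last by vring.
  by rewrite -H7 -H7'; vring.
Qed.

Lemma exchM c g h e e' : exch c g e e' -> exch c g (h * e) (h * e').
Proof.
move=> [A1 [A2 [A3 [B1 [B2 [B3 [[H1 H2 H3] [H4 H5 H6] H7]]]]]]].
exists (vsc h A1), (vsc h A2), (vsc h A3), (vsc h B1), (vsc h B2), (vsc h B3).
have dD u : dot (vsc h u) c = h * dot u c by rewrite /dot /=; ring.
split.
- by split; rewrite dD -mulrA ?H1 ?H2 ?H3.
- split; rewrite cross_sc.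
  + by rewrite -H4; vring.
  + by rewrite -H5; vring.
  + by rewrite -H6; vring.
- transitivity (vsc h (vsc e' c)); last by vring.
  by rewrite -H7; vring.
Qed.

Lemma vsc_inj c t s : c.1.1 != 0 -> vsc t c = vsc s c -> t = s.
Proof. by move=> c0 [E _ _]; apply: (mulIf c0). Qed.

(** With [e = dot W c], each [A_i] is [g_i W] plus a Koszul boundary. Correcting the zig-zag by
    these boundaries leaves in the [B] only multiples of [c], whose factors are the coefficients of
    [e'] on [g]. *)
Lemma exch_in c g e e' : vreg c -> exch c g e e' -> vin c e -> vin g e'.
Proof.
move=> rc [A1 [A2 [A3 [B1 [B2 [B3 [[H1 H2 H3] [H4 H5 H6] H7]]]]]]] /vinP[W eW].
have c0 : c.1.1 != 0 by case: rc => -[].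
have lift i Ai : e * i = dot Ai c -> exists X, Ai = vadd (vsc i W) (cross c X).
  move=> H; have [|X HX] := @vreg_syz c (vlin 1 Ai (- i) W) rc.
    by rewrite dot_lin mul1r -H eW; ring.
  by exists X; rewrite -HX; case: Ai {H HX} => [[? ?] ?]; case: (W) => [[? ?] ?]; vring.
have [X1 E1] := lift _ _ H1; have [X2 E2] := lift _ _ H2; have [X3 E3] := lift _ _ H3.
have liftB i j Xi Xj Ai Aj B : Ai = vadd (vsc i W) (cross c Xi) ->
  Aj = vadd (vsc j W) (cross c Xj) -> vlin i Aj (- j) Ai = cross c B ->
  exists t, B = vadd (vlin i Xj (- j) Xi) (vsc t c).
  move=> -> -> H; have [|t Ht] := @vreg_prop c (vlin 1 B (- 1) (vlin i Xj (- j) Xi)) rc.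
    by rewrite cross_lin -H; vring.
  exists t; rewrite -Ht; case: B {H Ht} => [[? ?] ?]; case: (Xi) => [[? ?] ?].
  by case: (Xj) => [[? ?] ?]; vring.
have [t1 F1] := liftB _ _ _ _ _ _ _ E1 E2 H4.
have [t2 F2] := liftB _ _ _ _ _ _ _ E1 E3 H5.
have [t3 F3] := liftB _ _ _ _ _ _ _ E2 E3 H6.
exists t3, (- t2), t1; apply: (@vsc_inj c) => //.
by rewrite -H7 F1 F2 F3; vring.
Qed.

Lemma syz3_col g (b1 b2 b3 : vec) : vreg g ->
  vadd (vlin g.1.1 b3 (- g.1.2) b2) (vsc g.2 b1) = (0, 0, 0) ->
  exists X1 X2 X3, [/\ b1 = vlin g.1.1 X2 (- g.1.2) X1, b2 = vlin g.1.1 X3 (- g.2) X1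
                     & b3 = vlin g.1.2 X3 (- g.2) X2].
Proof.
case: b1 b2 b3 g => [[p1 p2] p3] [[q1 q2] q3] [[s1 s2] s3] [[g1 g2] g3] rg [/= E1 E2 E3].
have S u v w : g1 * w + - g2 * v + g3 * u = 0 -> exists x y z,
   [/\ u = g1 * y + - g2 * x, v = g1 * z + - g3 * x & w = g2 * z + - g3 * y].
  move=> E; have [|x [y [z [e1 e2 e3]]]] := @reg3_syz R g1 g2 g3 w (- v) u rg.
    by rewrite -[RHS]E; ring.
  by exists x, y, z; split; rewrite ?e1 ?e3 //; try ring; rewrite -[v]opprK e2; ring.
have [x1 [y1 [z1 [-> -> ->]]]] := S _ _ _ E1.
have [x2 [y2 [z2 [-> -> ->]]]] := S _ _ _ E2.
have [x3 [y3 [z3 [-> -> ->]]]] := S _ _ _ E3.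
by exists (x1, x2, x3), (y1, y2, y3), (z1, z2, z3).
Qed.

Lemma prop3_col g (a1 a2 a3 : vec) : vreg g ->
  vlin g.1.1 a2 (- g.1.2) a1 = (0, 0, 0) -> vlin g.1.1 a3 (- g.2) a1 = (0, 0, 0) ->
  exists W, [/\ a1 = vsc g.1.1 W, a2 = vsc g.1.2 W & a3 = vsc g.2 W].
Proof.
case: a1 a2 a3 g => [[p1 p2] p3] [[q1 q2] q3] [[s1 s2] s3] [[g1 g2] g3].
move=> [rg _] [/= E1 E2 E3] [/= F1 F2 F3].
have S u v w : g1 * v + - g2 * u = 0 -> g1 * w + - g3 * u = 0 ->
   exists t, [/\ u = g1 * t, v = g2 * t & w = g3 * t].
  move=> e1 e2; have [||t [-> -> ->]] := @reg2_prop R g1 g2 g3 u v w rg.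
  - by apply: (lcomb e1); ring.
  - by apply: (lcomb e2); ring.
  - by exists t; split; ring.
have [t1 [-> -> ->]] := S _ _ _ E1 F1.
have [t2 [-> -> ->]] := S _ _ _ E2 F2.
have [t3 [-> -> ->]] := S _ _ _ E3 F3.
by exists (t1, t2, t3).
Qed.

(** The chase in the other direction: coordinatewise exactness of the Koszul complex of [g] first
    removes the [B], then the [A]. *)
Lemma exch_out c g e e' : vreg g -> exch c g e e' -> vin g e' -> vin c e.
Proof.
move=> rg [A1 [A2 [A3 [B1 [B2 [B3 [[H1 H2 H3] [H4 H5 H6] H7]]]]]]] [t1 [t2 [t3 et]]].
have g0 : g.1.1 != 0 by case: rg => -[].
have [|X1 [X2 [X3 [E1 E2 E3]]]] :=
  @syz3_col g (vlin 1 B1 (- t3) c) (vlin 1 B2 t2 c) (vlin 1 B3 (- t1) c) rg.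
  transitivity (vlin 1 (vadd (vlin g.1.1 B3 (- g.1.2) B2) (vsc g.2 B1)) (- e') c).
    by rewrite et; vring.
  by rewrite H7; vring.
have E i j B t Ai Aj Xi Xj : vlin i Aj (- j) Ai = cross c B ->
  vlin 1 B t c = vlin i Xj (- j) Xi ->
  vlin i (vlin 1 Aj (- 1) (cross c Xj)) (- j) (vlin 1 Ai (- 1) (cross c Xi)) = (0, 0, 0).
  move=> h1 h2.
  transitivity (vlin 1 (vlin i Aj (- j) Ai) (- 1) (cross c (vlin i Xj (- j) Xi))); first by vring.
  by rewrite h1 -h2; vring.
have [||W [W1 _ _]] := @prop3_col g (vlin 1 A1 (- 1) (cross c X1))
   (vlin 1 A2 (- 1) (cross c X2)) (vlin 1 A3 (- 1) (cross c X3)) rg.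
- exact: E H4 E1.
- exact: E H5 E2.
apply/vinP; exists W; apply: (mulIf g0); rewrite H1.
have := congr1 (fun v => dot v c) W1; rewrite dot_lin dot_cross.
by rewrite mul1r mulr0 addr0 => ->; rewrite /dot /=; ring.
Qed.

(** Transposition of the double complex: up to sign, the coordinates of the [B] become the new [A]
    and those of the [A] the new [B]. *)
Lemma exch_sym c g e e' : exch c g e e' -> exch g c e' e.
Proof.
case: c => [[c1 c2] c3]; case: g => [[g1 g2] g3].
move=> [[[A11 A12] A13] [[[A21 A22] A23] [[[A31 A32] A33]]]].
move=> [[[p1 p2] p3] [[[q1 q2] q3] [[[r1 r2] r3]]]].
rewrite /dot /cross /vlin /vadd /vsc /= => -[[H1 H2 H3] [[h1 h2 h3] [k1 k2 k3] [l1 l2 l3]] [m1 m2 m3]].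
exists (r1, - q1, p1), (r2, - q2, p2), (r3, - q3, p3), (A13, A23, A33),
  (- A12, - A22, - A32), (A11, A21, A31).
rewrite /dot /cross /vlin /vadd /vsc /=; split; [split|split|].
- by rewrite -m1; ring.
- by rewrite -m2; ring.
- by rewrite -m3; ring.
- by apply: veq; [apply: (lcomb (eqM (-1) l3))|apply: (lcomb k3)|apply: (lcomb (eqM (-1) h3))]; ring.
- by apply: veq; [apply: (lcomb l2)|apply: (lcomb (eqM (-1) k2))|apply: (lcomb h2)]; ring.
- by apply: veq; [apply: (lcomb (eqM (-1) l1))|apply: (lcomb k1)|apply: (lcomb (eqM (-1) h1))]; ring.
- by apply: veq; [apply: (lcomb (eqM (-1) H1))|apply: (lcomb (eqM (-1) H2))|apply: (lcomb (eqM (-1) H3))]; ring.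
Qed.

End Exchange.
Ltac vring := rewrite /cross /vlin /vadd /vsc /=; apply: veq; ring.
Ltac lc E := first [apply: (lcomb E); ring | apply: (lcomb (eqM (-1) E)); ring].

(** * Homogeneous components with integer degrees *)

Section Graded.
Variables (k : fieldType) (N : nat).
Local Notation R := {mpoly k[N]}.
Implicit Types (f : R) (d : int).

(* Negative degrees have zero component. *)
Definition hp d f : R := if d is Posz m then pihomog mdeg m f else 0.
Definition hg d f := hp d f = f.

Lemma hgE m f : hg (Posz m) f <-> f \is m.-homog.
Proof. by rewrite homog_piE; split=> /eqP. Qed.

Lemma hp0 d : hp d 0 = 0. Proof. by case: d => // m; apply: pihomog0. Qed.
Lemma hpD d (f g : R) : hp d (f + g) = hp d f + hp d g.
Proof. by case: d => [m|m] /=; [apply: pihomogD|rewrite addr0]. Qed.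
Lemma hpN d f : hp d (- f) = - hp d f.
Proof. by case: d => [m|m] /=; [apply: pihomogN|rewrite oppr0]. Qed.
Lemma hpB d (f g : R) : hp d (f - g) = hp d f - hp d g.
Proof. by rewrite hpD hpN. Qed.
Lemma hp_hg d f : hg d (hp d f).
Proof. by case: d => [m|m] //; apply: pihomog_id. Qed.
Lemma hp_ne d (e : int) f : hg d f -> d != e -> hp e f = 0.
Proof.
case: d => [m|m]; last by move=> <- _; apply: hp0.
by case: e => // m' /hgE H ne; apply: (pihomog_ne0 _ H).
Qed.
Lemma hg0 d : hg d 0. Proof. exact: hp0. Qed.
Lemma hgD d (f g : R) : hg d f -> hg d g -> hg d (f + g).
Proof. by rewrite /hg hpD => -> ->. Qed.
Lemma hgN d f : hg d f -> hg d (- f).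
Proof. by rewrite /hg hpN => ->. Qed.
Lemma hgB d (f g : R) : hg d f -> hg d g -> hg d (f - g).
Proof. by rewrite /hg hpB => -> ->. Qed.
Lemma hg_neg d f : hg d f -> d < 0 -> f = 0.
Proof. by case: d => // m <-. Qed.
Lemma hg_ge0 d f : hg d f -> f != 0 -> 0 <= d.
Proof. by case: d => // m <-; rewrite eqxx. Qed.
Lemma hg_uniq d (e : int) f : hg d f -> hg e f -> f != 0 -> d = e.
Proof. by move=> Hd He; apply: contra_neq_eq => /(hp_ne Hd); rewrite He. Qed.
Lemma hg_c d (e : int) f : hg d f -> d = e -> hg e f.
Proof. by move=> H <-. Qed.

Lemma hp_partition f : exists n, f = \sum_(i < n) hp (Posz i) f.
Proof. by exists (msize f); apply: pihomog_partitionE. Qed.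

Lemma hp_sum d (I : finType) (F : I -> R) : hp d (\sum_i F i) = \sum_i hp d (F i).
Proof. exact: (big_morph (hp d) (hpD d) (hp0 d)). Qed.

Lemma hgM d (e : int) (f g : R) : hg d f -> hg e g -> hg (d + e) (f * g).
Proof.
case: d => [m|m]; last by move=> <- _; rewrite mul0r; apply: hg0.
case: e => [m'|m']; last by move=> _ <-; rewrite mulr0; apply: hg0.
by move=> /hgE H /hgE H'; apply/hgE; apply: dhomogM.
Qed.

Lemma hpM d (e : int) (f g : R) : hg e g -> hp d (f * g) = hp (d - e) f * g.
Proof.
move=> Hg; have [n ->] := hp_partition f.
rewrite mulr_suml !hp_sum mulr_suml; apply: eq_bigr => i _.
have Hf := hp_hg (Posz i) f; move: (hp _ f) Hf => h Hf.
have Hfg := hgM Hf Hg; case: (eqVneq (Posz i + e) d) => [Ed|ne].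
  by rewrite -Ed Hfg addrK Hf.
rewrite (hp_ne Hfg ne) (hp_ne Hf) ?mul0r //; apply: contra_neq ne => ->.
by rewrite subrK.
Qed.

Lemma hpMl d (e : int) (f g : R) : hg e g -> hp d (g * f) = g * hp (d - e) f.
Proof. by move=> H; rewrite mulrC (hpM _ _ H) mulrC. Qed.

Lemma hgM_c d (e m : int) (f g : R) : hg d f -> hg e g -> d + e = m -> hg m (f * g).
Proof. by move=> Hf Hg <-; apply: hgM. Qed.

Lemma hg_div d (e : int) (f g : R) : hg d (f * g) -> hg e g -> g != 0 -> hg (d - e) f.
Proof. by move=> H Hg g0; apply: (mulIf g0); rewrite -hpM. Qed.

Lemma hg_const f : hg 0 f -> exists c : k, f = c%:MP.
Proof.
move=> /hgE /dhomogP H; exists (f@_0); apply: msize1_polyC.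
rewrite msizeE; apply/bigmax_leqP_seq => m /H; by move=> ->.
Qed.

Lemma hgC (c : k) : hg 0 (c%:MP : R).
Proof. by rewrite -[_%:MP]mulr1 mul_mpolyC; apply/hgE; rewrite rpredZ // dhomog1. Qed.

Lemma hg1 : hg 0 (1 : R). Proof. by rewrite -mpolyC1; apply: hgC. Qed.

Lemma hg_unit f : hg 0 f -> f != 0 -> exists2 g, hg 0 g & g * f = 1.
Proof.
move=> /hg_const [c ->] c0; exists (c^-1)%:MP; first exact: hgC.
by rewrite -mpolyCM mulVf ?mpolyC1 //; apply: contra_neq c0 => ->; rewrite mpolyC0.
Qed.

Lemma in1_hg d (e : int) (f g : R) : hg d f -> hg e g -> in1 g f -> exists2 u, hg (d - e) u & f = u * g.
Proof.
by move=> Hf Hg [u E]; exists (hp (d - e) u); [apply: hp_hg|rewrite -hpM // -E Hf].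
Qed.

Lemma in2_hg d d1 d2 f g1 g2 : hg d f -> hg d1 g1 -> hg d2 g2 -> in2 g1 g2 f ->
  exists u1 u2, [/\ f = u1 * g1 + u2 * g2, hg (d - d1) u1 & hg (d - d2) u2].
Proof.
move=> Hf H1 H2 [u1 [u2 E]]; exists (hp (d - d1) u1), (hp (d - d2) u2).
by split; [rewrite -!hpM // -hpD -E Hf|apply: hp_hg|apply: hp_hg].
Qed.

Lemma in3_hg d d1 d2 d3 f g1 g2 g3 : hg d f -> hg d1 g1 -> hg d2 g2 -> hg d3 g3 ->
  in3 g1 g2 g3 f ->
  exists u1 u2 u3, [/\ f = u1 * g1 + u2 * g2 + u3 * g3,
    hg (d - d1) u1, hg (d - d2) u2 & hg (d - d3) u3].
Proof.
move=> Hf H1 H2 H3 [u1 [u2 [u3 E]]]; exists (hp (d - d1) u1), (hp (d - d2) u2), (hp (d - d3) u3).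
by split; [rewrite -!hpM // -!hpD -E Hf|apply: hp_hg|apply: hp_hg|apply: hp_hg].
Qed.

Definition deg3 := (int * int * int)%type.
Definition tot (t : deg3) := t.1.1 + t.1.2 + t.2.
Definition vhg (t : deg3) (c : vec R) := [/\ hg t.1.1 c.1.1, hg t.1.2 c.1.2 & hg t.2 c.2].
(** The degrees of the coefficients of a form of degree [m] on generators of degrees [t];
    [vhgp (m - tot t) t] is the pattern one step further up the Koszul complex. *)
Definition vhgm m (t : deg3) (c : vec R) :=
  [/\ hg (m - t.1.1) c.1.1, hg (m - t.1.2) c.1.2 & hg (m - t.2) c.2].
Definition vhgp m (t : deg3) (c : vec R) :=
  [/\ hg (m + t.1.1) c.1.1, hg (m + t.1.2) c.1.2 & hg (m + t.2) c.2].

Lemma vin_hg t (c : vec R) (m : int) f : vhg t c -> vin c f -> hg m f ->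
  exists2 u, vhgm m t u & f = dot u c.
Proof.
case: c t => [[c1 c2] c3] [[t1 t2] t3] [/= H1 H2 H3] Hf Hm.
have [u1 [u2 [u3 [E h1 h2 h3]]]] := in3_hg Hm H1 H2 H3 Hf.
by exists (u1, u2, u3).
Qed.

Lemma syz_hg t (c : vec R) (m : int) u : vreg c -> vhg t c -> vhgm m t u -> dot u c = 0 ->
  exists2 x, vhgp (m - tot t) t x & u = cross c x.
Proof.
move=> rc; case: c t u rc => [[c1 c2] c3] [[t1 t2] t3] [[u1 u2] u3] rc [/= H1 H2 H3].
rewrite /vhgm /= => -[h1 h2 h3] E.
have [[[x1 x2] x3]] := vreg_syz rc E; rewrite /cross /= => -[E1 E2 E3].
exists (hp (m - t2 - t3) x1, hp (m - t1 - t3) x2, hp (m - t1 - t2) x3).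
  rewrite /vhgp /tot /=; split; apply: (hg_c (hp_hg _ _)); zlia0.
rewrite -{}h1 -{}h2 -{}h3 {E}E1 E2 E3; apply: veq; rewrite !hpB.
- by rewrite !(hpMl _ _ H2) !(hpMl _ _ H3).
- rewrite !(hpMl _ _ H1) !(hpMl _ _ H3); congr (_ * hp _ _ - _ * hp _ _); zlia0.
- rewrite !(hpMl _ _ H1) !(hpMl _ _ H2); congr (_ * hp _ _ - _ * hp _ _); zlia0.
Qed.

Lemma prop_hg t (c : vec R) (m : int) u : vreg c -> vhg t c -> vhgp m t u -> cross c u = (0, 0, 0) ->
  exists2 s, hg m s & u = vsc s c.
Proof.
move=> rc Hc Hu E; have [s Es] := vreg_prop rc E.
have [Hc1 _ _] := Hc; have [Hu1 _ _] := Hu.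
have c0 : c.1.1 != 0 by case: rc => -[].
exists s => //; move: Hu1; rewrite Es /= => H; apply: (hg_c (hg_div H Hc1 c0)); zlia0.
Qed.

(** Three successive liftings along the Koszul complex of [c], with homogeneous lifts. The shift by
    [tot t' - tot t] is the source of all the bookkeeping of degrees along a chain of links. *)
Lemma exch_ex t t' (c g : vec R) (m : int) (e : R) : vreg c -> vhg t c -> vhg t' g -> hg m e ->
  vin c (e * g.1.1) -> vin c (e * g.1.2) -> vin c (e * g.2) ->
  exists2 e', hg (m - tot t + tot t') e' & exch c g e e'.
Proof.
case: g t' => [[g1 g2] g3] [[t1 t2] t3] /= rc Hc [/= H1 H2 H3] He.
move=> /vin_hg-/(_ _ _ Hc (hgM He H1))[A1 a1 E1].
move=> /vin_hg-/(_ _ _ Hc (hgM He H2))[A2 a2 E2].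
move=> /vin_hg-/(_ _ _ Hc (hgM He H3))[A3 a3 E3].
have step ti tj gi gj Ai Aj : hg ti gi -> hg tj gj -> vhgm (m + ti) t Ai ->
  vhgm (m + tj) t Aj -> e * gi = dot Ai c -> e * gj = dot Aj c ->
  exists2 B, vhgp (m + ti + tj - tot t) t B & vlin gi Aj (- gj) Ai = cross c B.
  move=> Hi Hj ai aj Ei Ej; apply: (syz_hg rc Hc); last first.
    by rewrite dot_lin -Ei -Ej; ring.
  case: ai => x1 x2 x3; case: aj => y1 y2 y3; split; rewrite /= mulNr.
  - by apply: hgB; [apply: (hgM_c Hi y1)|apply: (hgM_c Hj x1)]; zlia0.
  - by apply: hgB; [apply: (hgM_c Hi y2)|apply: (hgM_c Hj x2)]; zlia0.
  - by apply: hgB; [apply: (hgM_c Hi y3)|apply: (hgM_c Hj x3)]; zlia0.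
have [B12 b12 F12] := step _ _ _ _ _ _ H1 H2 a1 a2 E1 E2.
have [B13 b13 F13] := step _ _ _ _ _ _ H1 H3 a1 a3 E1 E3.
have [B23 b23 F23] := step _ _ _ _ _ _ H2 H3 a2 a3 E2 E3.
have [||e' He' Ee'] := @prop_hg t c (m - tot t + tot (t1, t2, t3))
   (vadd (vlin g1 B23 (- g2) B13) (vsc g3 B12)) rc Hc.
- case: b12 => x1 x2 x3; case: b13 => y1 y2 y3; case: b23 => z1 z2 z3.
  rewrite /vhgp /tot /= !mulNr in x1 x2 x3 y1 y2 y3 z1 z2 z3 *; split; (apply: hgD; [apply: hgB|]).
  1: apply: (hgM_c H1 z1); zlia0.
  1: apply: (hgM_c H2 y1); zlia0.
  1: apply: (hgM_c H3 x1); zlia0.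
  1: apply: (hgM_c H1 z2); zlia0.
  1: apply: (hgM_c H2 y2); zlia0.
  1: apply: (hgM_c H3 x2); zlia0.
  1: apply: (hgM_c H1 z3); zlia0.
  1: apply: (hgM_c H2 y3); zlia0.
  1: apply: (hgM_c H3 x3); zlia0.
- by rewrite cross_add cross_lin cross_sc -F12 -F13 -F23; vring.
exists e' => //; exists A1, A2, A3, B12, B13, B23; by split.
Qed.

End Graded.

(** * Linear forms and the quotient by one of them *)

Section LinearForm.
Variable k : fieldType.

Lemma lin_sum N (l : {mpoly k[N]}) : hg 1 l -> l = \sum_j l@_U_(j) *: 'X_j.
Proof.
move=> /hgE Hl; apply/mpolyP=> m; rewrite raddf_sum /=.
case: (boolP (mdeg m == 1%N)) => [/mdeg1P[i /eqP ->]|ne].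
  rewrite (bigD1 i) //= mcoeffZ mcoeffXU eqxx mulr1 big1 ?addr0 // => j ji.
  by rewrite mcoeffZ mcoeffXU (negbTE ji) mulr0.
rewrite (dhomog_nemf_coeff Hl ne) big1 // => j _.
rewrite mcoeffZ mcoeffX; case: eqP => [E|]; rewrite ?mulr0 //.
by rewrite -E mdeg1 in ne.
Qed.

Lemma hg_sum N (I : finType) (F : I -> {mpoly k[N]}) d :
  (forall i, hg d (F i)) -> hg d (\sum_i F i).
Proof. by move=> H; rewrite /hg hp_sum; apply: eq_bigr => i _; apply: H. Qed.

Lemma hgZ N d (c : k) (f : {mpoly k[N]}) : hg d f -> hg d (c *: f).
Proof. by move=> H; rewrite -mul_mpolyC; apply: (hgM_c (hgC _ c) H); rewrite add0r. Qed.

Lemma hgX N (i : 'I_N) : hg 1 ('X_i : {mpoly k[N]}).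
Proof. by apply/hgE; rewrite dhomogX; apply/eqP; apply: mdeg1. Qed.

Lemma hgXn N d (f : {mpoly k[N]}) n : hg d f -> hg (d * n%:Z) (f ^+ n).
Proof.
move=> H; elim: n => [|n IH]; first by rewrite mulr0 expr0; apply: hg1.
by rewrite exprS; apply: (hgM_c H IH); zlia0.
Qed.

Lemma hg_comp N M (lq : N.-tuple {mpoly k[M]}) d (f : {mpoly k[N]}) :
  (forall i, hg 1 (tnth lq i)) -> hg d f -> hg d (f \mPo lq).
Proof.
move=> Hq; case: d => [d /hgE Hf|d <-]; last by rewrite comp_mpoly0; apply: hg0.
rewrite comp_mpolyEX big_seq; apply: (big_ind (hg d%:Z)); [exact: hg0|by move=> *; apply: hgD|].
move=> m mf; apply: hgZ; have <- : mdeg m = d by apply: (dhomogP _ _ _ Hf).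
rewrite comp_mpolyX mdegE.
apply: (big_ind2 (fun (p : {mpoly k[M]}) n => hg n%:Z p)); first exact: hg1.
  by move=> p n p' n' h h'; apply: (hgM_c h h'); zlia0.
by move=> i _; apply: (hg_c (hgXn _ (Hq i))); rewrite mul1r.
Qed.

Lemma comp_sum N M (lq : N.-tuple {mpoly k[M]}) (I : Type) (r : seq I) (F : I -> {mpoly k[N]}) :
  (\sum_(i <- r) F i) \mPo lq = \sum_(i <- r) (F i \mPo lq).
Proof. exact: (raddf_sum (comp_mpoly lq)). Qed.

Lemma comp_mod N M (lq : N.-tuple {mpoly k[M]}) (lp : M.-tuple {mpoly k[N]}) (l f : {mpoly k[N]}) :
  (forall i, in1 l ('X_i - (tnth lq i \mPo lp))) -> in1 l (f - ((f \mPo lq) \mPo lp)).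
Proof.
move=> H; have -> : (f \mPo lq) \mPo lp = \sum_(m <- msupp f) f@_m *: (('X_[m] \mPo lq) \mPo lp).
  by rewrite (comp_mpolyEX f) comp_sum; apply: eq_bigr => m _; rewrite comp_mpolyZ.
rewrite {1}[f]mpolyE -sumrB.
apply: (big_ind (in1 l)); [exact: in1_0|by move=> *; apply: in1D|].
move=> m _; rewrite -scalerBr -mul_mpolyC; apply: in1M.
rewrite comp_mpolyX rmorph_prod mpolyXE_id /=.
apply: (big_ind2 (fun a b => in1 l (a - b))); first by rewrite subrr; apply: in1_0.
  move=> a a' b b' [u Ea] [v Eb]; exists (a * v + b' * u).
  by apply: (lcomb (eqD (eqM a Eb) (eqM b' Ea))); ring.
move=> i _; rewrite rmorphXn /=; have [u E] := H i.
elim: (m i) => [|n [v IH]]; first by rewrite !expr0 subrr; apply: in1_0.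
rewrite !exprS; exists ('X_i * v + (tnth lq i \mPo lp) ^+ n * u).
by apply: (lcomb (eqD (eqM 'X_i IH) (eqM ((tnth lq i \mPo lp) ^+ n) E))); ring.
Qed.

(* [R / l] is again a polynomial ring. *)
Lemma lin_quot M (l : {mpoly k[M.+1]}) : hg 1 l -> l != 0 ->
  exists (lq : M.+1.-tuple {mpoly k[M]}) (lp : M.-tuple {mpoly k[M.+1]}),
  [/\ forall i, hg 1 (tnth lq i), forall i, hg 1 (tnth lp i),
      l \mPo lq = 0, forall g, (g \mPo lp) \mPo lq = g
    & forall f, in1 l (f - ((f \mPo lq) \mPo lp))].
Proof.
move=> Hl l0; have El := lin_sum Hl.
have [i ci] : exists i, l@_U_(i) != 0.
  apply/existsP; apply: contraNT l0 => /existsPn H; rewrite El big1 // => j _.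
  by have := H j; rewrite negbK => /eqP ->; rewrite scale0r.
set c := l@_U_(i) in ci.
(* The value of ['X_i] obtained by solving [l = 0] for it. *)
pose s : {mpoly k[M]} := - c^-1 *: \sum_j l@_U_(lift i j) *: 'X_j.
pose lq := [tuple if unlift i j is Some j' then 'X_j' else s | j < M.+1].
pose lp := [tuple 'X_(lift i j) : {mpoly k[M.+1]} | j < M].
have Ei : tnth lq i = s by rewrite tnth_mktuple unlift_none.
have El' j : tnth lq (lift i j) = 'X_j by rewrite tnth_mktuple liftK.
have Eq j : 'X_j \mPo lq = tnth lq j by rewrite comp_mpolyXU -tnth_nth.
have Ep j : 'X_j \mPo lp = 'X_(lift i j) by rewrite comp_mpolyXU -tnth_nth tnth_mktuple.
have Hs : hg 1 s by apply: hgZ; apply: hg_sum => j; apply: hgZ; apply: hgX.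
exists lq, lp; split.
- move=> j; case: (unliftP i j) => [j' ->|->]; last by rewrite Ei.
  by rewrite El'; apply: hgX.
- by move=> j; rewrite tnth_mktuple; apply: hgX.
- rewrite [X in X \mPo _]El comp_sum (bigD1_ord i) //=.
  rewrite comp_mpolyZ Eq Ei -/c /s scalerA mulrN divff // scaleN1r.
  apply/eqP; rewrite addrC subr_eq0; apply/eqP; apply: eq_bigr => j _.
  by rewrite comp_mpolyZ Eq El'.
- move=> g; rewrite [g in RHS]mpolyE (comp_mpolyEX g) comp_sum.
  apply: eq_bigr => m _; rewrite comp_mpolyZ; congr (_ *: _).
  rewrite comp_mpolyX rmorph_prod mpolyXE_id /=; apply: eq_bigr => j _.
  by rewrite rmorphXn /= tnth_mktuple Eq El'.
- move=> f; apply: comp_mod => j; case: (unliftP i j) => [j' ->|->].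
    by rewrite El' Ep subrr; apply: in1_0.
  rewrite Ei; exists (c^-1)%:MP; rewrite mul_mpolyC [X in _ = _ *: X]El (bigD1_ord i) //=.
  rewrite -/c scalerDr scalerA mulVf // scale1r; congr (_ + _).
  rewrite /s comp_mpolyZ scaleNr opprK comp_sum; congr (_ *: _).
  by apply: eq_bigr => j0 _; rewrite comp_mpolyZ Ep.
Qed.

(** The quotient is a polynomial ring, hence a domain. This is the form of primality by which [x]
    and [l] are cancelled throughout. *)
Lemma lin_prime N (l f g : {mpoly k[N]}) : hg 1 l -> l != 0 ->
  in1 l (f * g) -> in1 l f \/ in1 l g.
Proof.
case: N l f g => [|M] l f g Hl l0 [u E].
  by move: l0; rewrite (lin_sum Hl) big_ord0 eqxx.
have [lq [lp [_ _ H0 _ H]]] := lin_quot Hl l0.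
have in0 h : h \mPo lq = 0 -> in1 l h.
  by move=> h0; have := H h; rewrite h0 comp_mpoly0 subr0.
have /eqP : (f \mPo lq) * (g \mPo lq) = 0 by rewrite -rmorphM E rmorphM /= H0 mulr0.
by rewrite mulf_eq0 => /orP[] /eqP /in0; [left|right].
Qed.

End LinearForm.

(** * Homogeneous regular sequences of length three *)

Section CI.
Variables (k : fieldType) (N : nat).
Local Notation R := {mpoly k[N]}.

Definition ci (t : deg3) (c : vec R) := [/\ vreg c, vhg t c & ~ vin c 1].

Lemma gen0 (f : R) : ideal_gen [::] f <-> f = 0.
Proof. by split=> [[c ->]|->]; [rewrite big_ord0|exists (fun=> 0); rewrite big_ord0]. Qed.
Lemma gen1 (a f : R) : ideal_gen [:: a] f <-> in1 a f.
Proof.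
split=> [[c ->]|[u ->]]; first by exists (c ord0); rewrite big_ord1.
by exists (fun=> u); rewrite big_ord1.
Qed.
Lemma gen2 (a b f : R) : ideal_gen [:: a; b] f <-> in2 a b f.
Proof.
split=> [[c ->]|[u [v ->]]].
  by exists (c ord0), (c (lift ord0 ord0)); rewrite !big_ord_recl big_ord0 addr0.
by exists (fun i => nth 0 [:: u; v] i); rewrite !big_ord_recl big_ord0 addr0.
Qed.
Lemma gen3 (a b c f : R) : ideal_gen [:: a; b; c] f <-> in3 a b c f.
Proof.
split=> [[d ->]|[u [v [w ->]]]].
  exists (d ord0), (d (lift ord0 ord0)), (d (lift ord0 (lift ord0 ord0))).
  by rewrite !big_ord_recl big_ord0 addr0 addrA.
by exists (fun i => nth 0 [:: u; v; w] i); rewrite !big_ord_recl big_ord0 addr0 addrA.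
Qed.

Lemma regular3P (a b c : R) : regular_seq [:: a; b; c] <-> reg3 a b c /\ ~ in3 a b c 1.
Proof.
split=> [[H n1]|[[[a0 rb] rc] n1]]; last first.
  split; last by rewrite gen3.
  case=> [|[|[|//]]] _ f /=.
  - by rewrite !gen0 => /eqP; rewrite mulf_eq0 (negbTE a0) orbF => /eqP.
  - by rewrite !gen1; apply: rb.
  - by rewrite !gen2; apply: rc.
split; last by rewrite -gen3.
split; first split.
- apply/eqP=> a0; have := H 0%N isT 1; rewrite !gen0 /= a0 mulr0 => /(_ erefl) /eqP.
  by rewrite oner_eq0.
- by move=> u; have := H 1%N isT u; rewrite !gen1.
- by move=> u; have := H 2%N isT u; rewrite !gen2.
Qed.

(** Multiplying by [v] moves a relation into [(u * v, b)]; there the coefficient of [b] is divisible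
    by [v], because [(v, b)] is regular as well. *)
Lemma reg3_divl (u v b c : R) : reg3 (u * v) b c -> reg3 u b c.
Proof.
have D x y : reg2 (x * y) b -> reg2 x b.
  move=> [xy0 H]; have x0 : x != 0 by apply: contra_neq xy0 => ->; rewrite mul0r.
  have y0 : y != 0 by apply: contra_neq xy0 => ->; rewrite mulr0.
  split=> // w [s E]; have [|r Er] := H (w * y).
    by exists s; rewrite mulrAC E; ring.
  by exists r; apply: (mulIf y0); rewrite Er; ring.
move=> [r2 r3]; split; first exact: D r2.
move=> w [s [r E]]; have [|s' [r' E']] := r3 (w * v).
  by exists s, (r * v); apply: (lcomb (eqM v E)); ring.
have [v0 Hv] : reg2 v b by apply: (D v u); rewrite mulrC.
have [|q Eq] := Hv r'; first by exists (w - s' * u); apply: (lcomb (eqM (-1) E')); ring.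
by exists s', q; apply: (mulIf v0); rewrite E' Eq; ring.
Qed.

Lemma in1_hp (a f : R) e d : hg e a -> in1 a f -> in1 a (hp d f).
Proof. by move=> Ha [u ->]; exists (hp (d - e) u); rewrite (hpM _ _ Ha). Qed.

Lemma in3_hp (a b c f : R) da db dc d : hg da a -> hg db b -> hg dc c ->
  in3 a b c f -> in3 a b c (hp d f).
Proof.
move=> Ha Hb Hc [u [v [w ->]]]; exists (hp (d - da) u), (hp (d - db) v), (hp (d - dc) w).
by rewrite !hpD (hpM _ _ Ha) (hpM _ _ Hb) (hpM _ _ Hc).
Qed.

Lemma reg3_swap (a b c : R) da db dc : hg da a -> hg db b -> hg dc c -> 0 < db ->
  reg3 a b c -> reg3 a c b.
Proof.
move=> Ha Hb Hc db0 [[a0 rb] rc].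
(* If [u * c] is in [(a)], then [u = u1 * a + u2 * b] with [u2 * c] again in [(a)], and [u2] has
   smaller degree because [b] has positive degree. *)
have Hn : forall n (d : int), d < n%:Z -> forall u, hg d u -> in1 a (u * c) -> in1 a u.
  elim=> [|n IH] d Hd u Hu H; first by rewrite (hg_neg Hu) //; apply: in1_0.
  have [|u1 [u2 [E H1 H2]]] := in2_hg Hu Ha Hb (rc u _).
    by case: H => s ->; exists s, 0; ring.
  rewrite E; apply: in1D; first by exists u1.
  rewrite mulrC; apply: in1M; apply: (IH (d - db)) => //; first zlia0.
  apply: rb; case: H => s Es; exists (s - u1 * c).
  by apply: (lcomb Es); rewrite E; ring.
have rc1 u : in1 a (u * c) -> in1 a u.
  move=> H; have [n En] := hp_partition u; rewrite En.
  apply: (big_ind (in1 a)); [exact: in1_0|by move=> *; apply: in1D|] => i _.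
  apply: (Hn (i.+1) i%:Z _ _ (hp_hg _ _)); first zlia0.
  by have := in1_hp (i%:Z + dc) Ha H; rewrite (hpM _ _ Hc) addrK.
split; first by split.
move=> u [s [r E]]; have [|r1 [r2 Er]] := rc r.
  by exists (- s), u; apply: (lcomb (eqM (-1) E)); ring.
have [|q Eq] := rb (u - r2 * c); first by exists (s + r1 * c); apply: (lcomb E); rewrite Er; ring.
by exists q, r2; apply: (lcomb Eq); ring.
Qed.

Lemma ci_pos t c : ci t c -> [/\ 0 < t.1.1, 0 < t.1.2 & 0 < t.2].
Proof.
case: c t => [[a b] c] [[t1 t2] t3] [[[a0 rb] rc] [/= Ha Hb Hc] n1].
have n2 : ~ in2 a b 1 by move=> [u [v E]]; apply: n1; exists u, v, 0; rewrite /= mul0r addr0.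
have b0 : b != 0.
  apply/eqP=> b0; have [|u E] := rb 1; first by rewrite /= b0 mulr0; apply: in1_0.
  by apply: n2; exists u, 0; rewrite mul0r addr0.
have c0 : c != 0.
  by apply/eqP=> c0; apply: n2; apply: rc; rewrite /= c0 mulr0; apply: in2_0.
have pos (d : int) f : hg d f -> f != 0 -> in3 a b c f -> 0 < d.
  move=> Hf f0 If; have := hg_ge0 Hf f0; case: (eqVneq d 0) => [d0 _|]; last zlia0.
  case: n1.
  by move: Hf; rewrite d0 => /hg_unit -/(_ f0) [g _ <-]; apply: in3M.
split; [apply: (pos _ a)|apply: (pos _ b)|apply: (pos _ c)] => //.
- exact: in31.
- exact: in32.
- exact: in33.
Qed.

End CI.

(** * Two complete intersections inside one ideal *)

Section Pair.
Variables (k : fieldType) (N : nat).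
Local Notation R := {mpoly k[N]}.
Implicit Types (I : R -> Prop) (c g : vec R) (t : deg3).

Definition vcolon c I (f : R) := forall h, I h -> vin c (f * h).
Definition csub c I := [/\ I c.1.1, I c.1.2 & I c.2].

Lemma exch_vin c g e e' h : vreg c -> vreg g -> exch c g e e' ->
  vin c (h * e) <-> vin g (h * e').
Proof.
by move=> rc rg /(exchM h) H; split; [apply: (exch_in rc H)|apply: (exch_out rg H)].
Qed.

(* Transport of [c : I] to [g : I] for two complete intersections in [I]. *)
Lemma colon_exch t t' c g I (m : int) e : ci t c -> ci t' g -> csub g I ->
  vcolon c I e -> hg m e ->
  exists e', [/\ hg (m - tot t + tot t') e', exch c g e e' & vcolon g I e'].
Proof.
move=> [rc Hc _] [rg Hg _] [g1 g2 g3] Ie He.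
have [e' He' E] := exch_ex rc Hc Hg He (Ie _ g1) (Ie _ g2) (Ie _ g3).
exists e'; split=> // h Ih; rewrite mulrC -(exch_vin h rc rg E) mulrC; exact: Ie.
Qed.

(** Up to the shift [tot t], [(c : I) / c] is the dual module of [I]. Degree [d] in it corresponds
    to the dual degree [tot t - d], which does not depend on [c]; the condition says that [l] and
    [p] kill the dual degrees above [s]. *)
Definition R2 t c I (l p : R) (s : int) :=
  forall (g : R) (d : int), vcolon c I g -> hg d g -> d < tot t - s -> vin c (l * g) /\ vin c (p * g).

Lemma R2_indep t t' c g I l p s : ci t c -> ci t' g -> csub c I -> R2 t c I l p s -> R2 t' g I l p s.
Proof.
move=> Cc Cg Ic H e d Ie He Hd.
have [e' [He' E Ie']] := colon_exch Cg Cc Ic Ie He.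
have [|h1 h2] := H e' _ Ie' He'; first zlia0.
by have [[rc _ _] [rg _ _]] := (Cc, Cg); split; apply/(exch_vin _ rg rc E).
Qed.

(** Membership in the second double colon is tested on homogeneous elements of [g : I], which the
    comparison of residues turns into elements of [c : I]. This transports reflexivity between
    complete intersections. *)
Lemma colon_colon_indep t t' c g I : ci t c -> ci t' g -> csub c I ->
  (forall f d, vcolon g I f -> vcolon g I (hp d f)) ->
  forall f, vcolon c (vcolon c I) f -> vcolon g (vcolon g I) f.
Proof.
move=> Cc Cg Ic homI f Hf h Ih; have [[rc _ _] [rg _ _]] := (Cc, Cg).
have [n ->] := hp_partition h; rewrite mulr_sumr.
apply: (big_ind (vin g)); [exact: vin0|by move=> *; apply: vinD|] => i _.
have [e' [_ E Ie']] := colon_exch Cg Cc Ic (homI h i%:Z Ih) (hp_hg _ _).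
by apply/(exch_vin _ rg rc E); apply: Hf.
Qed.

End Pair.

(** * Degree arguments *)

Section Basics.
Variables (k : fieldType) (N : nat).
Local Notation R := {mpoly k[N]}.
Implicit Types (a b c f g h u v w l p : R) (d : int).

Lemma hg_pos_no1 d a : hg d a -> 0 < d -> ~ in1 a 1.
Proof.
move=> Ha d0 [u E]; have := congr1 (hp 0) E; rewrite (hpM _ _ Ha) (hg1 _ _).
rewrite (hg_neg (hp_hg (0 - d) u)) ?mul0r; last zlia0.
by move/eqP; rewrite oner_eq0.
Qed.

Lemma hg_pos_no1_2 d1 (d2 : int) a b : hg d1 a -> hg d2 b -> 0 < d1 -> 0 < d2 -> ~ in2 a b 1.
Proof.
move=> Ha Hb d10 d20 [u [v E]]; have := congr1 (hp 0) E; rewrite hpD (hpM _ _ Ha) (hpM _ _ Hb) (hg1 _ _).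
rewrite (hg_neg (hp_hg (0 - d1) u)) ?mul0r ?add0r; last zlia0.
rewrite (hg_neg (hp_hg (- d2) v)) ?mul0r; last zlia0.
by move/eqP; rewrite oner_eq0.
Qed.

Lemma hg_pos_no1_3 d1 (d2 d3 : int) a b c : hg d1 a -> hg d2 b -> hg d3 c ->
  0 < d1 -> 0 < d2 -> 0 < d3 -> ~ in3 a b c 1.
Proof.
move=> Ha Hb Hc d10 d20 d30 [u [v [w E]]]; have := congr1 (hp 0) E.
rewrite !hpD (hpM _ _ Ha) (hpM _ _ Hb) (hpM _ _ Hc) (hg1 _ _).
rewrite (hg_neg (hp_hg (0 - d1) u)) ?mul0r ?add0r; last zlia0.
rewrite (hg_neg (hp_hg (- d2) v)) ?mul0r ?add0r; last zlia0.
rewrite (hg_neg (hp_hg (- d3) w)) ?mul0r; last zlia0.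
by move/eqP; rewrite oner_eq0.
Qed.

Lemma reg2_nocommon a b h : reg2 a b -> in1 h a -> in1 h b -> in1 h 1.
Proof.
move=> [a0 H] [u Eu] [v Ev]; have [|w Ew] := H u; first by exists v; rewrite {1}Ev Eu; ring.
by exists w; apply: (mulIf a0); rewrite {1}Eu Ew; ring.
Qed.

Lemma reg2_lin l p : hg 1 l -> l != 0 -> ~ in1 l p -> reg2 l p.
Proof. by move=> Hl l0 np; split=> // u /(lin_prime Hl l0) []. Qed.

Lemma in2_low d (e : int) f l p : hg d f -> hg 1 l -> hg e p -> d < e -> in2 l p f -> in1 l f.
Proof.
move=> Hf Hl Hp de /(in2_hg Hf Hl Hp) [u [v [E _ Hv]]]; exists u.
by rewrite E (hg_neg Hv) ?mul0r ?addr0 //; zlia0.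
Qed.

Lemma reg3_cancel a b c w : reg3 a b c -> in2 b c (w * a) -> in2 b c w.
Proof.
move=> H [u [v E]]; have [|x [y [z [-> _ _]]]] := @reg3_syz _ a b c w (- u) (- v) H.
  by apply: (lcomb E); ring.
by exists z, (- y); ring.
Qed.

(** With [in3_mulc], the identity [(u v, b, c) : v = (u, b, c)], by which a common factor of the
    first forms of two links is stripped off. *)
Lemma in3_cancel u v b c g : reg3 (u * v) b c -> in3 (u * v) b c (v * g) -> in3 u b c g.
Proof.
move=> H [A [B [C E]]]; have Hv : reg3 v b c by apply: (@reg3_divl _ _ v u); rewrite mulrC.
have [|s [r Es]] := @reg3_cancel v b c (g - A * u) Hv; first by exists B, C; apply: (lcomb E); ring.
by exists A, s, r; apply: (lcomb Es); ring.
Qed.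

Lemma in3_mulc u v b c g : in3 u b c g -> in3 (u * v) b c (v * g).
Proof. by move=> [A [B [C ->]]]; exists A, (v * B), (v * C); ring. Qed.

Lemma three_in2 l p a b c : reg2 l p -> reg3 a b c -> in2 l p a -> in2 l p b -> in2 l p c ->
  in2 l p 1.
Proof. by move=> rl rc Ha Hb Hc; apply: (reg3_colon_reg2 rl rc); rewrite mul1r. Qed.

Lemma hg_lt0_mul d (e : int) f g h : hg d f -> hg e g -> f = h * g -> d < e -> g != 0 -> f = 0.
Proof.
move=> Hf Hg E de g0; rewrite E (_ : h = 0) ?mul0r //.
by apply: (hg_neg (d := d - e)); [apply: hg_div Hg g0; rewrite -E|zlia0].
Qed.

Lemma in3_low1 d da db dc a b c f : hg d f -> hg da a -> hg db b -> hg dc c -> d < db -> d < dc ->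
  in3 a b c f -> in1 a f.
Proof.
move=> Hf Ha Hb Hc h1 h2 /(in3_hg Hf Ha Hb Hc) [u [v [w [-> _ Hv Hw]]]]; exists u.
by rewrite (hg_neg Hv) ?(hg_neg Hw) //; [ring|zlia0|zlia0].
Qed.

Lemma in3_low2 d da db dc a b c f : hg d f -> hg da a -> hg db b -> hg dc c -> d < dc ->
  in3 a b c f -> in2 a b f.
Proof.
move=> Hf Ha Hb Hc h2 /(in3_hg Hf Ha Hb Hc) [u [v [w [-> _ Hv Hw]]]]; exists u, v.
by rewrite (hg_neg Hw) //; [ring|zlia0].
Qed.

Lemma in3_low0 d da db dc a b c f : hg d f -> hg da a -> hg db b -> hg dc c ->
  d < da -> d < db -> d < dc -> in3 a b c f -> f = 0.
Proof.
move=> Hf Ha Hb Hc h0 h1 h2 /(in3_hg Hf Ha Hb Hc) [u [v [w [-> Hu Hv Hw]]]].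
by rewrite (hg_neg Hu) ?(hg_neg Hv) ?(hg_neg Hw) //; [ring|zlia0|zlia0|zlia0].
Qed.

Lemma exch_modg (c g : vec R) e e' f : exch c g e e' -> vin g f -> exch c g e (e' + f).
Proof.
move=> H [u [v [w Ef]]]; rewrite -[e]addr0; apply: exchD => //.
exists (0, 0, 0), (0, 0, 0), (0, 0, 0), (vsc w c), (vsc (- v) c), (vsc u c).
rewrite Ef /dot; split; [split| split|] => /=; try ring; try (vring).
Qed.

Lemma exch_modc (c g : vec R) e e' f : exch c g e e' -> vin c f -> exch c g (e + f) e'.
Proof. by move=> /exch_sym H /(exch_modg H) /exch_sym. Qed.

Lemma nz_mul_const d f g : hg d f -> d <= 0 -> f != 0 -> exists u, hg 0 u /\ u * f = 1.
Proof.
move=> Hf d0 f0; have Ed : d = 0 by have := hg_ge0 Hf f0; zlia0.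
by move: Hf; rewrite Ed => /hg_unit -/(_ f0) [u]; exists u.
Qed.

(* Mod [x], the two regular pairs generate the same ideal in degrees below [m]. *)
Lemma pair_transfer x b c b1 c1 (db dc db1 dc1 m d : int) g :
  hg 1 x -> hg db b -> hg dc c -> hg db1 b1 -> hg dc1 c1 ->
  reg3 x b1 c1 -> ~ in3 x b1 c1 1 -> db <= dc -> db1 <= dc1 -> db1 <= db -> dc1 <= dc ->
  (db1 < m -> in3 x b c b1) -> (dc1 < m -> in3 x b c c1) ->
  hg d g -> d < m -> in3 x b c g -> in3 x b1 c1 g.
Proof.
move=> Hx Hb Hc Hb1 Hc1 rg n1 bc bc1 b1b c1c mb mc Hg dm Ig.
have [[x0 rb] rc] := rg.
have unit0 (e : int) f : hg e f -> e <= 0 -> in3 x b1 c1 f -> f = 0.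
  move=> Hf e0 If; apply/eqP/negP => /negP f0; have [u [_ E]] := nz_mul_const 0 Hf e0 f0.
  by apply: n1; rewrite -E; apply: in3M.
have nb1 : ~ in1 x b1.
  move=> [s E]; apply: n1; have [|u E1] := rb 1; first by exists s; rewrite mul1r.
  by exists u, 0, 0; rewrite E1; ring.
case: (ltP d db) => [db_|bd].
  by have [u ->] := in3_low1 Hg Hx Hb Hc db_ ltac:(zlia0) Ig; exists u, 0, 0; ring.
have [u1 [u2 [u3 [E1 h1 h2 h3]]]] := in3_hg Hb1 Hx Hb Hc (mb ltac:(zlia0)).
case: (ltP d dc) => [dc_|cd].
  have z3 : u3 = 0 by apply: (hg_neg h3); zlia0.
  have u20 : u2 != 0.
    by apply/eqP=> z2; apply: nb1; exists u1; rewrite E1 z2 z3; ring.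
  have [u [_ Eu]] := nz_mul_const 0 h2 ltac:(zlia0) u20.
  have Ib : in3 x b1 c1 b.
    exists (- u * u1), u, 0; rewrite E1 z3.
    transitivity ((u * u2) * b); [by rewrite Eu mul1r|ring].
  have [s [r ->]] := in3_low2 Hg Hx Hb Hc dc_ Ig.
  by apply: in3D; apply: in3M => //; apply: in31.
have [v1 [v2 [v3 [E2 k1 k2 k3]]]] := in3_hg Hc1 Hx Hb Hc (mc ltac:(zlia0)).
(* The determinant of the change of generators modulo [x]. Its degree is at most 0, so it is zero or
   a unit; if it were zero, [b1] would be a multiple of [x]. *)
pose D := u2 * v3 - u3 * v2.
have HD : hg (db1 + dc1 - db - dc) D.
  by apply: hgB; [apply: (hgM_c h2 k3)|apply: (hgM_c h3 k2)]; zlia0.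
have Eb : D * b = v3 * b1 - u3 * c1 - (v3 * u1 - u3 * v1) * x by rewrite E1 E2 /D; ring.
have Ec : D * c = u2 * c1 - v2 * b1 - (u2 * v1 - v2 * u1) * x by rewrite E1 E2 /D; ring.
have [D0|D0] := eqVneq D 0; last first.
  have [u [_ Eu]] := nz_mul_const 0 HD ltac:(zlia0) D0.
  have Ib : in3 x b1 c1 b.
    rewrite -[b]mul1r -Eu -mulrA Eb; apply: in3M.
    by exists (- (v3 * u1 - u3 * v1)), v3, (- u3); ring.
  have Ic : in3 x b1 c1 c.
    rewrite -[c]mul1r -Eu -mulrA Ec; apply: in3M.
    by exists (- (u2 * v1 - v2 * u1)), (- v2), u2; ring.
  case: Ig => s [r [q ->]]; apply: in3D; first apply: in3D; apply: in3M => //; exact: in31.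
have u30 : u3 = 0.
  apply: (unit0 _ _ h3); first zlia0; apply: in2_in3; apply: rc.
  exists (- (v3 * u1 - u3 * v1)), v3; move: Eb; rewrite D0 mul0r => E.
  by lc E.
have u20 : u2 = 0.
  apply: (unit0 _ _ h2); first zlia0; apply: in2_in3; apply: rc.
  exists (u2 * v1 - v2 * u1), v2; move: Ec; rewrite D0 mul0r => E.
  by lc E.
by case: nb1; exists u1; rewrite E1 u20 u30; ring.
Qed.

End Basics.

(** * The properties that persist along a chain of links *)

Section States.
Variables (k : fieldType) (N : nat).
Local Notation R := {mpoly k[N]}.

Definition hideal (I : R -> Prop) :=
  [/\ I 0, (forall f g, I f -> I g -> I (f + g)), (forall h f, I f -> I (h * f))
    & forall f d, I f -> I (hp d f)].

Definition linked (c : vec R) (I I' : R -> Prop) :=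
  (forall f, I f <-> vcolon c I' f) /\ (forall f, I' f <-> vcolon c I f).

(** The part of [I] of degree [tau] has dimension at most one modulo [(l, p)], expressed by pairwise
    dependence instead of a quotient space. *)
Definition one_dim (I : R -> Prop) (tau : int) (l p : R) :=
  forall e1 e2, I e1 -> I e2 -> hg tau e1 -> hg tau e2 ->
  exists c1 c2 : k, (c1 != 0 \/ c2 != 0) /\ in2 l p (c1%:MP * e1 + c2%:MP * e2).

(** [pi], the degree of [p], is [n] at first and may fall to [n - 1]. For [pi = n] the bound
    [pi + n + 7] is the shift [2n + 7] of the last module of the resolution, and [one_dim] concerns
    the degree of the last generator of [J]. *)
Definition S2 (n : int) (I : R -> Prop) (x l p : R) (pi : int) :=
  [/\ [/\ hg 1 x, x != 0, hg 1 l & l != 0], hg pi p /\ ~ in1 l p, I (x * l) /\ I (x * p),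
      (forall f d, I f -> hg d f -> d <= pi -> in1 (x * l) f) /\
      (forall f d, I f -> hg d f -> d < 2 * n + 4 -> in2 l p f)
    & (pi = n -> one_dim I (2 * n + 4) l p) /\
      (forall t c, ci t c -> csub c I -> R2 t c I l p (pi + n + 7))].

Lemma linked_csub c I I' : linked c I I' -> csub c I /\ csub c I'.
Proof.
have H J : csub c (vcolon c J).
  by split=> h _; [apply/in3Mr/in31|apply/in3Mr/in32|apply/in3Mr/in33].
move=> [H1 H2]; have [a1 a2 a3] := H I'; have [b1 b2 b3] := H I.
by split; split; apply/H1 || apply/H2.
Qed.

End States.

Ltac zlia := first [
  repeat match goal with
  | H : is_true (@Order.le _ _ _ _) |- _ => revert H
  | H : is_true (@Order.lt _ _ _ _) |- _ => revert H
  | H : is_true (leq _ _) |- _ => revert H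
  | H : @eq ?T _ _ |- _ => unify T int; revert H
  | H : _ \/ _ |- _ => revert H
  end; clear; intros; lia
| repeat match goal with
  | H : hg _ _ |- _ => clear H
  | H : vin _ _ |- _ => clear H
  | H : in1 _ _ |- _ => clear H
  | H : in2 _ _ _ |- _ => clear H
  | H : in3 _ _ _ _ |- _ => clear H
  | H : reg2 _ _ |- _ => clear H
  | H : reg3 _ _ _ |- _ => clear H
  | H : vreg _ |- _ => clear H
  | H : ci _ _ |- _ => clear H
  | H : linked _ _ _ |- _ => clear H
  | H : csub _ _ |- _ => clear H
  | H : exch _ _ _ _ |- _ => clear H
  | H : hideal _ |- _ => clear H
  | H : S2 _ _ _ _ _ _ |- _ => clear H
  | H : _ <-> _ |- _ => clear H
  | H : forall _, _ |- _ => clear H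
  | H : ~ (in1 _ _) |- _ => clear H
  | H : ~ (in2 _ _ _) |- _ => clear H
  | H : ~ (in3 _ _ _ _) |- _ => clear H
  | H : ~ (vin _ _) |- _ => clear H
  | H : @eq (mpoly _ _) _ _ |- _ => clear H
  end; lia ].

Lemma const_dep (k : fieldType) N (u v : {mpoly k[N]}) : hg 0 u -> hg 0 v ->
  exists c1 c2 : k, (c1 != 0 \/ c2 != 0) /\ c1%:MP * u + c2%:MP * v = 0.
Proof.
move=> /hg_const [a ->] /hg_const [b ->]; case: (eqVneq a 0) => [->|a0].
  by exists 1, 0; split; [left; apply: oner_neq0|rewrite mpolyC0; ring].
by exists b, (- a); split; [right; rewrite oppr_eq0|rewrite mpolyCN; ring].
Qed.

(** * Chains of links of decreasing type *)

Section RStep.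
Variables (k : fieldType) (N : nat).
Local Notation R := {mpoly k[N]}.
Variables (n pi b c a1 b1 c1 : int) (I I1 I2 : R -> Prop) (x l p be ph al1 be1 ph1 : R).
Hypotheses (n4 : 4 <= n) (pin : pi = n \/ pi = n - 1).
Hypothesis HS : S2 n I x l p pi.
Let c0 : vec R := (x * l, be, ph).
Let g0 : vec R := (al1, be1, ph1).
Let tau := 2 * n + 4.
Hypotheses (C0 : ci (2, b, c) c0) (C1 : ci (a1, b1, c1) g0).
Hypotheses (bc : b <= c) (bc1 : b1 <= c1) (a12 : a1 <= 2) (bb : b1 <= b) (cc : c1 <= c).
Hypotheses (L0 : linked c0 I I1) (L1 : linked g0 I1 I2).
(** A normal form: if [be] and [ph] both have degree [tau], [one_dim] provides a combination of them
    in [(l, p)], and a change of generators makes it the second form. [rstep] performs this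
    change. *)
Hypothesis NF : b = tau -> c = tau -> pi = n -> in2 l p be.

Let Hx : hg 1 x. Proof. by case: HS => -[]. Qed.
Let x0 : x != 0. Proof. by case: HS => -[]. Qed.
Let Hl : hg 1 l. Proof. by case: HS => -[]. Qed.
Let l0 : l != 0. Proof. by case: HS => -[]. Qed.
Let Hp : hg pi p. Proof. by case: HS => _ []. Qed.
Let lp : ~ in1 l p. Proof. by case: HS => _ []. Qed.
Let Ixl : I (x * l). Proof. by case: HS => _ _ []. Qed.
Let Ixp : I (x * p). Proof. by case: HS => _ _ []. Qed.
Let P0 f d : I f -> hg d f -> d <= pi -> in1 (x * l) f.
Proof. by case: HS => _ _ _ [H _] _; apply: H. Qed.
Let P f d : I f -> hg d f -> d < tau -> in2 l p f.
Proof. by case: HS => _ _ _ [_ H] _; apply: H. Qed.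
Let S5 : pi = n -> one_dim I tau l p. Proof. by case: HS => _ _ _ _ []. Qed.
Let rc : reg3 (x * l) be ph. Proof. by case: C0. Qed.
Let rg : reg3 al1 be1 ph1. Proof. by case: C1. Qed.
Let Hbe : hg b be. Proof. by case: C0 => _ []. Qed.
Let Hph : hg c ph. Proof. by case: C0 => _ []. Qed.
Let Hal1 : hg a1 al1. Proof. by case: C1 => _ []. Qed.
Let Hbe1 : hg b1 be1. Proof. by case: C1 => _ []. Qed.
Let Hph1 : hg c1 ph1. Proof. by case: C1 => _ []. Qed.
Let Hxl : hg 2 (x * l). Proof. by apply: (hgM_c Hx Hl). Qed.
Let rlp : reg2 l p. Proof. exact: reg2_lin. Qed.
Let rxb : reg3 x be ph. Proof. exact: reg3_divl rc. Qed.
Let rlb : reg3 l be ph. Proof. by apply: (@reg3_divl _ _ l x); rewrite mulrC. Qed.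
Let Ibe : I be. Proof. by case: (linked_csub L0) => -[]. Qed.
Let Iph : I ph. Proof. by case: (linked_csub L0) => -[]. Qed.

Let nxbe : ~ in1 x be.
Proof.
move=> H; apply: (hg_pos_no1 Hx) => //; apply: (reg2_nocommon (proj1 rc) _ H).
by exists l; ring.
Qed.
Let nlbe : ~ in1 l be.
Proof.
move=> H; apply: (hg_pos_no1 Hl) => //; apply: (reg2_nocommon (proj1 rc) _ H).
by exists x; ring.
Qed.
Let nlpb : ~ in2 l p 1.
Proof. by apply: (hg_pos_no1_2 Hl Hp) => //; zlia. Qed.
Let Ilp_be_ph : in2 l p be -> in2 l p ph -> False.
Proof.
move=> Hb Hph'; apply: nlpb; apply: (three_in2 rlp rc) => //.
by exists x, 0; ring.
Qed.
Let bpi : pi + 1 <= b.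
Proof.
case: (leP b pi) => [h|]; last zlia.
by case: (P0 Ibe Hbe h) => u E; case: nxbe; exists (u * l); rewrite E; ring.
Qed.
Let ctau : tau <= c.
Proof.
case: (ltP c tau) => [h|]; last zlia.
by case: Ilp_be_ph; [apply: (P Ibe Hbe); zlia|apply: (P Iph Hph)].
Qed.

Let Rt g d : I1 g -> hg d g -> d < 2 + b + c - (pi + n + 7) -> vin c0 (l * g) /\ vin c0 (p * g).
Proof.
move=> Ig Hg Hd; case: HS => _ _ _ _ [_ H].
have [cs _] := linked_csub L0.
by apply: (H _ _ C0 cs g d) => //; case: L0 => _ E; apply/E.
Qed.

Let low_in g d : I1 g -> hg d g -> d < 2 + b + c - (pi + n + 7) -> in3 x be ph g.
Proof. by move=> Ig Hg Hd; have [H _] := Rt Ig Hg Hd; apply: (in3_cancel rc H). Qed.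

Let xp_not : ~ vin c0 (x * p).
Proof.
move=> H; have Hxp : hg (pi + 1) (x * p) by apply: (hgM_c Hx Hp); zlia.
have [u [v [E _ Hv]]] := in2_hg Hxp Hxl Hbe (in3_low2 Hxp Hxl Hbe Hph ltac:(zlia) H).
have [v0|v0] := eqVneq v 0.
  by apply: lp; exists u; apply: (mulfI x0); rewrite E v0; ring.
have [w [_ Ew]] := nz_mul_const 0 Hv ltac:(zlia) v0.
apply: nxbe; exists (w * (p - u * l)); rewrite -[be]mul1r -Ew.
by lc (eqM w E).
Qed.

(** The degree of [al1] is below the bound of [R2], so [l * al1] is in [c0]; cancelling [l] leaves
    [(x, be, ph)], where only multiples of [x] have so low a degree. In degree 1, [al1] would be a
    constant times [x], and [p * al1] would put [x * p] in [c0]. *)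
Lemma rstep_l : exists l', [/\ hg 1 l', l' != 0, al1 = x * l' & a1 = 2].
Proof.
have Ia1 : I1 al1 by case: (linked_csub L1) => -[].
have := low_in Ia1 Hal1 ltac:(zlia).
move=> /(in3_low1 Hal1 Hx Hbe Hph) -/(_ ltac:(zlia) ltac:(zlia)) [l' El'].
have al0 : al1 != 0 by case: rg => -[].
have l'0 : l' != 0 by apply: contra_neq al0; rewrite El' => ->; rewrite mul0r.
have Hl' : hg (a1 - 1) l' by apply: (hg_div _ Hx x0); rewrite -El'.
have a1ge := hg_ge0 Hl' l'0.
have a1E : a1 = 2.
  case: (eqVneq a1 1) => [a11|]; last by zlia.
  have [w [_ Ew]] := nz_mul_const 0 Hl' ltac:(zlia) l'0.
  case: xp_not; have [_] := Rt Ia1 Hal1 ltac:(zlia); rewrite El'.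
  move=> /(vinM w); rewrite (_ : w * (p * (l' * x)) = (w * l') * (x * p)); last ring.
  by rewrite Ew mul1r.
exists l'; split=> //; last by rewrite El' mulrC.
by apply: (hg_c Hl'); zlia.
Qed.

Variables (l' p2 : R).
Hypotheses (Hl' : hg 1 l') (l'0 : l' != 0) (El' : al1 = x * l') (a1E : a1 = 2).
Let dl := 2 + b + c - (2 + b1 + c1).

Let rg' : reg3 (x * l') be1 ph1. Proof. by rewrite -El'. Qed.
Let rl'b1 : reg3 (l' * x) be1 ph1. Proof. by rewrite mulrC -El'. Qed.
Let rxb1 : reg3 x be1 ph1. Proof. exact: reg3_divl rg'. Qed.
Let Ig0 : csub g0 I1. Proof. by case: (linked_csub L1). Qed.

(** [p * x * l'] is in [c0] and its degree [pi + 2] is below [c]. Cancelling [x] gives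
    [p * l' = u * l + s * be]: if [s = 0] then [l] divides [l'], otherwise [be] has degree at most
    [pi + 1]. *)
Let l'_dich : in1 l l' \/ b = pi + 1 /\ ~ in1 l' l.
Proof.
case: (classic (in1 l l')) => h; [by left|right].
have [Ia1 _ _] := Ig0; have [_] := Rt Ia1 Hal1 ltac:(zlia); rewrite [g0.1.1]El' => H.
have Hd : hg (pi + 2) (p * (x * l')) by apply: (hgM_c Hp (hgM Hx Hl')); zlia.
have [u [v [E _ Hv]]] := in2_hg Hd Hxl Hbe (in3_low2 Hd Hxl Hbe Hph ltac:(zlia) H).
have [|s Es] := (proj1 rxb).2 v; first by exists (p * l' - u * l); lc E.
have E1 : p * l' = u * l + s * be by apply: (mulfI x0); rewrite Es in E; lc E.
have [s0|s0] := eqVneq s 0.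
  case: (lin_prime Hl l0 (f := p) (g := l')) => //; exists u; rewrite E1 s0; ring.
have Hs : hg (pi + 1 - b) s.
  by apply: (hg_c (hg_div (d := pi + 2 - b) (e := 1) _ Hx x0)); [rewrite -Es|zlia].
split; first by have := hg_ge0 Hs s0; zlia.
move=> [u' Eu']; have Hu' : hg 0 u' by apply: (hg_c (hg_div (d := 1) (e := 1) _ Hl' l'0)); rewrite -?Eu'.
have u'0 : u' != 0 by apply: contra_neq l0; rewrite Eu' => ->; rewrite mul0r.
have [w _ Ew] := hg_unit Hu' u'0; apply: h; exists w.
by rewrite Eu' mulrA Ew mul1r.
Qed.

(** A [be1] of degree below both [b] and the bound would, like [al1], be a multiple of [x]. In
    [c1_low] the whole second complete intersection would similarly lie in [(x, be)]. *)
Let b1_low : b1 < 2 + b + c - (pi + n + 7) -> b <= b1.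
Proof.
move=> h; case: (leP b b1) => // b1b; have [_ Ib1 _] := Ig0.
have := low_in Ib1 Hbe1 h; move=> /(in3_low1 Hbe1 Hx Hbe Hph) -/(_ ltac:(zlia) ltac:(zlia)) H.
case: (hg_pos_no1 Hx) => //; apply: (reg2_nocommon (proj1 rg) _ H).
by exists l'; rewrite El'; ring.
Qed.

Let c1_low : c1 < 2 + b + c - (pi + n + 7) -> c <= c1.
Proof.
move=> h; case: (leP c c1) => // c1c; have [_ Ib1 Ic1] := Ig0.
have := low_in Ib1 Hbe1 ltac:(zlia); move=> /(in3_low2 Hbe1 Hx Hbe Hph) -/(_ ltac:(zlia)) H1.
have := low_in Ic1 Hph1 h; move=> /(in3_low2 Hph1 Hx Hbe Hph) -/(_ ltac:(zlia)) H2.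
case: (hg_pos_no1_2 Hx Hbe) => //; first zlia.
apply: (three_in2 (proj1 rxb) rg) => //.
by exists l', 0; rewrite El'; ring.
Qed.

(** Write [be = be0 * l + C * p]. For [g] in [I1] of degree below [c], [x * p * g] is in [c0];
    cancelling [x] and reducing modulo [l] gives [g] in [(l, C)]. If [c1 < c], this ideal would
    contain a regular sequence of length three. *)
Let caseA : in2 l p be -> c1 = c.
Proof.
move=> Ilp; case: (eqVneq c1 c) => // ne.
have [be0 [C [Ebe _ HC]]] := in2_hg Hbe Hl Hp Ilp.
have nlC : ~ in1 l C by move=> [s Es]; apply: nlbe; exists (be0 + s * p); rewrite Ebe Es; ring.
have key g d : I1 g -> hg d g -> d < c -> in2 l C g.
  move=> Ig Hg Hd.
  have : vin c0 (x * (g * p)).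
    case: L0 => _ E; have := (proj1 (E g)) Ig _ Ixp; by rewrite mulrCA.
  move=> H; have {}H : in3 l be ph (g * p).
    by apply: (@in3_cancel _ _ l x); rewrite mulrC.
  have Hgp : hg (d + pi) (g * p) by apply: hgM.
  have [A [B [E0 [E _ _ HE]]]] := in3_hg Hgp Hl Hbe Hph H.
  have IE : in2 l p E0.
    apply: (reg3_colon_reg2 rlp rc).
    - by exists (E0 * x), 0; ring.
    - exact: in2M.
    - exists (- A - B * be0), (g - B * C); move: E; rewrite {1}Ebe => E; lc E.
  have [E1 EE1] := in2_low HE Hl Hp ltac:(zlia) IE.
  case: (lin_prime Hl l0 (f := g - B * C) (g := p)) => //.
    by exists (A + B * be0 + E1 * ph); move: E; rewrite {1}Ebe EE1 => E; lc E.
  by move=> [s Es]; exists s, B; lc Es.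
have [Ia1 Ib1 Ic1] := Ig0.
case: (hg_pos_no1_2 Hl HC); [by []|zlia|].
apply: (three_in2 _ rg); first exact: reg2_lin.
- by apply: (key _ a1) => //; zlia.
- by apply: (key _ b1) => //; zlia.
- by apply: (key _ c1) => //; zlia.
Qed.

(** Since [c >= tau], the bound [2 + b + c - (pi + n + 7)] is at least [b - 1], and at least [b]
    unless [pi = n] and [c = tau]; so [b] falls by at most one. If [be] is not in [(l, p)], then
    [b >= tau] and the same count applies to [c]. *)
Let dlP : dl = 0 /\ b1 = b /\ c1 = c \/ dl = 1 /\ pi = n /\
  (in2 l p be /\ c = tau /\ b1 = b - 1 /\ c1 = c \/
   ~ in2 l p be /\ b = tau /\ tau < c /\ b1 = b /\ c1 = c - 1).
Proof.
rewrite /dl; case: (classic (in2 l p be)) => h.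
  have Ec := caseA h; have Hb := b1_low.
  case: (ltP b1 (2 + b + c - (pi + n + 7))) => hb; first by have := Hb hb; zlia.
  case: (eqVneq b1 b) => [|ne]; [left; zlia|right].
  by split; [zlia|split; [zlia|left; split; [exact: h|zlia]]].
have bt : tau <= b by case: (ltP b tau) => // hb; case: h; apply: (P Ibe Hbe).
have nbc : ~ (b = tau /\ c = tau /\ pi = n) by move=> [? [? ?]]; apply: h; apply: NF.
have Eb : b1 = b.
  case: (ltP b1 (2 + b + c - (pi + n + 7))) => hb; first by have := b1_low hb; zlia.
  by case: (eqVneq b1 b) => //; zlia.
case: (ltP c1 (2 + b + c - (pi + n + 7))) => hc; first by have := c1_low hc; zlia.
case: (eqVneq c1 c) => [|ne]; [left; zlia|right].
by split; [zlia|split; [zlia|right; split=> //; zlia]].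
Qed.

(** [p2] is read off the residue of [x * p] along [g0]: since [p * al1] is in [c0], that residue is
    killed by [l'], hence is a multiple of [x] modulo [be1] and [ph1]. *)
Lemma rstep_p : exists p2, hg (pi - dl) p2 /\ exch c0 g0 (x * p) (x * p2).
Proof.
have Hxp : hg (pi + 1) (x * p) by apply: (hgM_c Hx Hp); zlia.
have [E0 E1] := L0.
have [f2 [Hf2 Ef2 _]] : exists f2, [/\ hg (pi + 1 - tot (2, b, c) + tot (a1, b1, c1)) f2,
   exch c0 g0 (x * p) f2 & True].
  have [Ia1 Ib1 Ic1] := Ig0; case: (C0) => rc' Hc' _; case: (C1) => rg'' Hg' _.
  have [] := @exch_ex k N (2, b, c) (a1, b1, c1) c0 g0 (pi + 1) (x * p) rc' Hc' Hg' Hxp;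
    try by rewrite mulrC; apply: ((proj1 (E1 _))).
  by move=> f2 h1 h2; exists f2.
have H : vin g0 (l' * f2).
  apply/(exch_vin l' _ _ Ef2); try by case: C0; case: C1.
  have [Ia1 _ _] := Ig0; have [_] := Rt Ia1 Hal1 ltac:(zlia); rewrite [g0.1.1]El'.
  by rewrite (_ : p * (x * l') = l' * (x * p)) //; ring.
have {}H : in3 x be1 ph1 f2 by apply: (@in3_cancel _ _ x l'); rewrite // -El'.
have Hf : hg (pi + 1 - dl) f2 by apply: (hg_c Hf2); rewrite /tot /dl /=; zlia.
have [A [B [G [E HA HB HG]]]] := in3_hg Hf Hx Hbe1 Hph1 H.
exists A; split; first by apply: (hg_c HA); zlia.
rewrite (_ : x * A = f2 + (- B * be1 - G * ph1)); last by lc E.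
by apply: exch_modg => //; exists 0, (- B), (- G); rewrite /=; ring.
Qed.

Hypotheses (Hp2 : hg (pi - dl) p2) (Ep2 : exch c0 g0 (x * p) (x * p2)).

Let rc' : vreg c0. Proof. by case: C0. Qed.
Let rgv : vreg g0. Proof. by case: C1. Qed.

Let l'p2 : ~ in1 l' p2.
Proof.
move=> [s Es]; apply: xp_not.
have := (exch_vin 1 rc' rgv Ep2); rewrite !mul1r => H; apply/H.
by exists s, 0, 0; rewrite Es /= El'; ring.
Qed.

(** A form [C] of degree [b - pi] with [C * x * p] in [c0], not divisible by [l'], gives
    [C * p2 = A * l' + nu * be1 + ga * ph1] after comparison. If [l'] is a multiple of [l], [C] is
    the coefficient of [be] on [p]; otherwise [l] itself serves. *)
Let comb : in2 l p be \/ ~ in1 l l' -> exists nu ga, [/\ hg (b - dl - b1) nu, hg (b - dl - c1) ga,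
  in2 l' p2 (nu * be1 + ga * ph1) & nu != 0 \/ ga != 0].
Proof.
move=> Hor.
have fin C : hg (b - pi) C -> vin c0 (C * (x * p)) -> ~ in1 l' C ->
  exists nu ga, [/\ hg (b - dl - b1) nu, hg (b - dl - c1) ga,
  in2 l' p2 (nu * be1 + ga * ph1) & nu != 0 \/ ga != 0].
  move=> HC /(exch_vin C rc' rgv Ep2) H nC.
  have {}H : in3 l' be1 ph1 (C * p2).
    apply: (@in3_cancel _ _ l' x) => //; rewrite (_ : x * (C * p2) = C * (x * p2)); last ring.
    by rewrite mulrC -El'.
  have HCp : hg (b - dl) (C * p2) by apply: (hgM_c HC Hp2); zlia.
  have [A [nu [ga [E HA Hnu Hga]]]] := in3_hg HCp Hl' Hbe1 Hph1 H.
  exists nu, ga; split=> //; first by exists (- A), C; lc E.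
  case: (eqVneq nu 0) => [nu0|]; [|by left]; case: (eqVneq ga 0) => [ga0|]; [|by right].
  case: (lin_prime Hl' l'0 (f := C) (g := p2)) => //.
  by exists A; rewrite E nu0 ga0; ring.
case: l'_dich => [h|[bp h]].
  case: Hor => // Ilp; have [be0 [C [Ebe _ HC]]] := in2_hg Hbe Hl Hp Ilp.
  apply: (fin C) => //.
    by exists (- be0), x, 0 => /=; rewrite {1}Ebe; ring.
  move=> [s Es]; apply: nlbe; case: h => u Eu; exists (be0 + s * u * p).
  by rewrite Ebe Es Eu; ring.
apply: (fin l) => //; first by apply: (hg_c Hl); zlia.
by exists p, 0, 0 => /=; ring.
Qed.

(** Only [x * p] has a known residue, not [p], so the comparison is made after multiplication by
    [x], which is cancelled at the end. *)
Let core e s f m : exch c0 g0 e f -> hg m f -> hg (m + dl) e -> hg (m + dl) s -> vin c0 s ->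
  in2 l p (e - s) -> exists e2 A B G, [/\ f = e2 * p2 + A * l' + B * be1 + G * ph1,
    hg (m - b1) B & hg (m - c1) G].
Proof.
move=> Ee Hf He Hs Is Ilp.
have [e1 [e2 [E _ He2]]] := in2_hg (hgB He Hs) Hl Hp Ilp.
have H : vin g0 (x * (f - e2 * p2)).
  have E3 := exchD (exchM x Ee) (exchM (- e2) Ep2).
  have := exch_in rc' E3; rewrite (_ : x * f + _ = x * (f - e2 * p2)); last ring.
  apply; rewrite (_ : _ + _ = e1 * (x * l) + x * s); last by lc (eqM x E).
  by apply: vinD; apply: vinM => //; apply: in31.
have {}H : in3 l' be1 ph1 (f - e2 * p2).
  by apply: (@in3_cancel _ _ l' x) => //; rewrite [l' * x]mulrC -El'.
have Hfe : hg m (f - e2 * p2) by apply: hgB => //; apply: (hgM_c He2 Hp2); zlia.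
have [A [B [G [E4 _ HB HG]]]] := in3_hg Hfe Hl' Hbe1 Hph1 H.
by exists e2, A, B, G; split=> //; lc E4.
Qed.

Let ctau1 : tau <= c1. Proof. by case: dlP; zlia. Qed.

Let be1_in : b1 < tau \/ (in2 l p be /\ b < c) -> in2 l' p2 be1.
Proof.
move=> h; have Ilp : in2 l p be.
  case: h => [h|[]//]; case: (ltP b tau) => hb; first exact: (P Ibe Hbe).
  by case: dlP => [|[_ [_ [[]//|]]]]; zlia.
have [nu [ga [Hnu Hga H nz]]] := comb (or_introl Ilp).
have dle : dl <= 1 /\ b - dl - b1 <= 0 /\ b - dl - c1 < 0 \/ False.
  by case: dlP => [|[_ [_ [|[]//]]]]; case: h; zlia.
have ga0 : ga = 0 by apply: (hg_neg Hga); zlia.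
have nu0 : nu != 0 by case: nz => //; rewrite ga0 eqxx.
have [w [_ Ew]] := nz_mul_const 0 Hnu ltac:(zlia) nu0.
by have := in2M w H; rewrite ga0 mul0r addr0 mulrA Ew mul1r.
Qed.

Let bwd f m : I2 f -> hg m f -> exists e, [/\ hg (m + dl) e, exch c0 g0 e f & I e].
Proof.
move=> If Hf; have [E1 E2] := L1; have [D1 D2] := L0.
have cI2 : vcolon g0 I1 f by apply/E2.
have cs : csub c0 I1 by case: (linked_csub L0).
have [e [He Ee Ie]] := colon_exch C1 C0 cs cI2 Hf.
exists e; split; [|exact: exch_sym|by apply/D1].
by apply: (hg_c He); rewrite /tot /dl /=; zlia.
Qed.

(** In degree [tau] a form [be] or [ph] outside [(l, p)] represents the one dimension of [I] modulo
    [(l, p)]; every element then lies in [(l, p)] up to an element of [c0]. *)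
Let rep e d : I e -> hg d e -> d < tau \/ [/\ d = tau, pi = n &
    (c = tau \/ b = tau) /\ ~ (in2 l p be /\ tau < c)] ->
  exists s, [/\ hg d s, vin c0 s & in2 l p (e - s)].
Proof.
move=> Ie He [h|[Ed En Hg]].
  by exists 0; split; [exact: hg0|exact: vin0|rewrite subr0; apply: (P Ie He)].
have go g : I g -> hg tau g -> vin c0 g -> ~ in2 l p g -> exists s, [/\ hg d s, vin c0 s & in2 l p (e - s)].
  move=> Ig Hgg Vg ng; rewrite Ed in He *.
  have [c1' [c2 [nz H]]] := S5 En Ie Ig He Hgg.
  have c10 : c1' != 0.
    apply/eqP=> z; rewrite z mpolyC0 mul0r add0r eqxx in nz H; apply: ng; case: nz => // c20.
    by have := in2M (c2^-1)%:MP H; rewrite mulrA -mpolyCM mulVf // mpolyC1 mul1r.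
  exists (- (c1'^-1 * c2)%:MP * g); split.
  - by rewrite mulNr; apply: hgN; apply: (hgM_c (hgC _ _) Hgg); rewrite add0r.
  - exact: vinM.
  - rewrite mulNr opprK; have := in2M (c1'^-1)%:MP H.
    by rewrite mulrDr !mulrA -!mpolyCM mulVf // mpolyC1 mul1r.
case: Hg => Hor Hn; case: (eqVneq c tau) => [ct|nc].
  case: (classic (in2 l p be)) => hb.
    apply: (go ph) => //; [by rewrite -ct|by apply: in33|exact: Ilp_be_ph].
  have bt : b <> tau by move=> bt; apply: hb; apply: NF.
  by case: hb; apply: (P Ibe Hbe); zlia.
have bt : b = tau by case: Hor => //; zlia.
apply: (go be) => //; [by rewrite -bt|by apply: in32|].
by move=> hb; apply: Hn; split=> //; zlia.
Qed.

Let P0' f d : I2 f -> hg d f -> d <= pi - dl -> in1 (x * l') f.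
Proof.
move=> If Hf Hd; have [e [He Ee Ie]] := bwd If Hf.
have [u Eu] := P0 Ie He ltac:(zlia).
have : vin g0 f by apply: (exch_in rc' Ee); exists u, 0, 0; rewrite Eu /=; ring.
have Hxl' : hg 2 (x * l') by apply: (hgM_c Hx Hl').
rewrite /g0 /vin /= El'; apply: (in3_low1 Hf Hxl' Hbe1 Hph1); case: dlP; zlia.
Qed.

Let P' f d : I2 f -> hg d f -> d < tau -> in2 l' p2 f.
Proof.
move=> If Hf Hd; have [e [He Ee Ie]] := bwd If Hf.
have [|s [Hs Is Ies]] := rep Ie He.
  case: (ltP (d + dl) tau) => h; [by left|right].
  case: dlP => [|[E1 [E2 E3]]]; first zlia.
  split=> //; first zlia; case: E3 => [[h1 [h2 _]]|[h1 [h2 h3]]]; split.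
  - by left.
  - by zlia.
  - by right.
  - by case.
have [e2 [A [B [G [E HB HG]]]]] := core Ee Hf He Hs Is Ies.
have G0 : G = 0 by apply: (hg_neg HG); zlia.
rewrite E G0 mul0r addr0; apply: in2D; first by exists A, e2; ring.
case: (ltP d b1) => h; first by rewrite (hg_neg HB) ?mul0r; [exact: in2_0|zlia].
by apply: in2M; apply: be1_in; left; zlia.
Qed.

(** If no generator of [c0] of degree [tau] is outside [(l, p)], the dependence is carried over from
    [I]. Otherwise both elements are first brought into [(l, p)] modulo [c0]. What remains modulo
    [(l', p2)] is either a constant multiple of [be1] or a combination of [be1] and [ph1], which
    [comb] cuts down to one dimension. *)
Let S5' : pi - dl = n -> one_dim I2 tau l' p2.
Proof.
move=> Epi f1 f2 If1 If2 Hf1 Hf2.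
have [d0 [Eb Ec]] : dl = 0 /\ b1 = b /\ c1 = c by case: dlP => //; zlia.
have En : pi = n by zlia.
have [e1 [He1 Ee1 Ie1]] := bwd If1 Hf1; have [e2 [He2 Ee2 Ie2]] := bwd If2 Hf2.
have sc (c' : k) f m : hg m f -> hg m (c'%:MP * f) by move=> H; apply: (hgM_c (hgC _ _) H); rewrite add0r.
case: (classic ((c = tau \/ b = tau) /\ ~ (in2 l p be /\ tau < c))) => hyp; last first.
  have [||c1' [c2 [nz H]]] := S5 En Ie1 Ie2; try by [apply: (hg_c He1); zlia|apply: (hg_c He2); zlia].
  exists c1', c2; split=> //.
  have [|||||e' [A [B [G [E HB HG]]]]] := @core _ 0 _ tau (exchD (exchM c1'%:MP Ee1) (exchM c2%:MP Ee2)).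
  - by apply: hgD; apply: sc.
  - by apply: hgD; apply: sc.
  - exact: hg0.
  - exact: vin0.
  - by rewrite subr0.
  have nct : c <> tau.
    move=> ct; apply: hyp; split; [by left|zlia].
  have G0 : G = 0 by apply: (hg_neg HG); zlia.
  rewrite E G0 mul0r addr0; apply: in2D; first by exists A, e'; ring.
  case: (ltP tau b1) => h; first by rewrite (hg_neg HB) ?mul0r; [exact: in2_0|zlia].
  apply: in2M; apply: be1_in; case: (eqVneq b1 tau) => [bt|]; [right|left; zlia].
  split; last zlia; apply: NNPP => nb; apply: hyp; split; [right; zlia|].
  by case.
have [|s1 [Hs1 Is1 Ies1]] := rep Ie1 He1; first by right; split=> //; zlia.
have [|s2 [Hs2 Is2 Ies2]] := rep Ie2 He2; first by right; split=> //; zlia.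
have [e1' [A1 [B1 [G1 [E1 HB1 HG1]]]]] := core Ee1 Hf1 He1 Hs1 Is1 Ies1.
have [e2' [A2 [B2 [G2 [E2 HB2 HG2]]]]] := core Ee2 Hf2 He2 Hs2 Is2 Ies2.
case: (classic (in2 l p be)) => hb; last first.
  have ct : c <> tau by move=> ct; case: hb; case: (ltP b tau) => bt; [exact: (P Ibe Hbe)|apply: NF; zlia].
  have G10 : G1 = 0 by apply: (hg_neg HG1); zlia.
  have G20 : G2 = 0 by apply: (hg_neg HG2); zlia.
  have bt : b = tau by zlia.
  have [|| c1' [c2 [nz E0]]] := @const_dep _ _ B1 B2; try by [apply: (hg_c HB1); zlia|apply: (hg_c HB2); zlia].
  exists c1', c2; split=> //; rewrite E1 E2 G10 G20.
  exists (c1'%:MP * A1 + c2%:MP * A2), (c1'%:MP * e1' + c2%:MP * e2').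
  by lc (eqM be1 E0).
have ct : c = tau by case: hyp => _ h; case: (eqVneq c tau) => // ne; case: h; split=> //; zlia.
have [nu [ga [Hnu Hga Hng nz]]] := comb (or_introl hb).
(* [B * be1 + G * ph1] is a multiple of the known relation [nu * be1 + ga * ph1] once
   [B * ga = G * nu]; these determinants have degree 0, so a combination of the two vanishes. *)
have [||c1' [c2 [nz' E0]]] := @const_dep _ _ (B1 * ga - G1 * nu) (B2 * ga - G2 * nu).
- by apply: hgB; [apply: (hgM_c HB1 Hga)|apply: (hgM_c HG1 Hnu)]; zlia.
- by apply: hgB; [apply: (hgM_c HB2 Hga)|apply: (hgM_c HG2 Hnu)]; zlia.
exists c1', c2; split=> //.
have H : in2 l' p2 ((c1'%:MP * B1 + c2%:MP * B2) * be1 + (c1'%:MP * G1 + c2%:MP * G2) * ph1).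
  set B := c1'%:MP * B1 + _ in E0 *; set G := c1'%:MP * G1 + _ in E0 *.
  have {}E0 : B * ga = G * nu by rewrite /B /G; lc E0.
  have Hnu0 : hg 0 nu by apply: (hg_c Hnu); zlia.
  case: (eqVneq ga 0) => [ga0|gan0].
    have nun0 : nu != 0 by case: nz => //; rewrite ga0 eqxx.
    have G0 : G = 0 by apply: (mulIf nun0); rewrite -E0 ga0; ring.
    have [w _ Ew] := hg_unit Hnu0 nun0.
    rewrite G0 mul0r addr0; apply: in2M; have := in2M w Hng.
    by rewrite ga0 mul0r addr0 mulrA Ew mul1r.
  have Hga0 : hg 0 ga by apply: (hg_c Hga); have := hg_ge0 Hga gan0; zlia.
  have [w _ Ew] := hg_unit Hga0 gan0.
  have -> : B * be1 + G * ph1 = (w * G) * (nu * be1 + ga * ph1).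
    transitivity (w * (B * ga) * be1 + (w * ga) * G * ph1); last by rewrite E0; ring.
    by rewrite Ew -[in LHS](mul1r B) -{1}Ew; ring.
  exact: in2M.
rewrite E1 E2; case: H => u [v H].
exists (c1'%:MP * A1 + c2%:MP * A2 + u), (c1'%:MP * e1' + c2%:MP * e2' + v).
by lc H.
Qed.

(** The test is made along [g0], where the colon ideal is [I1]. The fall of [tot] by [dl] is
    compensated by that of [pi], so the bound is the one known for [c0], and [pair_transfer] passes
    from [(x, be, ph)] to [(x, be1, ph1)]. *)
Let R2' (t' : deg3) (cv : vec R) : ci t' cv -> csub cv I2 -> R2 t' cv I2 l' p2 (pi - dl + n + 7).
Proof.
move=> Ct Cs; have cs : csub g0 I2 by case: (linked_csub L1).
apply: (R2_indep C1 Ct cs) => g d Ig Hg Hd.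
have {}Ig : I1 g by case: L1 => E _; apply/E.
have n1 : ~ in3 x be1 ph1 1.
  by have [_ ? ?] := ci_pos C1; apply: (hg_pos_no1_3 Hx Hbe1 Hph1).
have Hd0 : d < 2 + b + c - (pi + n + 7) by move: Hd; rewrite /tot /dl /=; zlia.
have Ix : in3 x be1 ph1 g.
  have [_ Ib1 Ic1] := Ig0.
  apply: (pair_transfer Hx Hbe Hph Hbe1 Hph1 rxb1 n1 bc bc1 bb cc _ _ Hg Hd0 (low_in Ig Hg Hd0)).
  - exact: (low_in Ib1 Hbe1).
  - exact: (low_in Ic1 Hph1).
split; first by rewrite /vin /g0 /= El'; apply: in3_mulc.
have [_ Hpg] := Rt Ig Hg Hd0.
have [A [B [G [E _ HB HG]]]] := in3_hg Hg Hx Hbe1 Hph1 Ix.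
have kill h (dh m : int) Q : hg dh h -> I1 h -> hg (d - dh) Q -> vin c0 (p * (Q * h)).
  move=> Hh Ih HQ; case: (eqVneq Q 0) => [->|Q0]; first by rewrite mul0r mulr0; apply: vin0.
  rewrite mulrCA; apply: vinM; have [] := Rt Ih Hh _ => //.
  by have := hg_ge0 HQ Q0; zlia.
have [_ Ib1 Ic1] := Ig0.
have H1 : vin c0 (A * (x * p)).
  rewrite (_ : A * (x * p) = p * g - p * (B * be1) - p * (G * ph1)); last by rewrite E; ring.
  by apply: vinB; [apply: vinB => //; apply: (kill _ b1 0)|apply: (kill _ c1 0)].
have := (proj1 (exch_vin A rc' rgv Ep2)) H1 => H2.
rewrite (_ : p2 * g = A * (x * p2) + p2 * B * be1 + p2 * G * ph1); last by rewrite E; ring.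
by apply: vinD; first apply: vinD => //; apply: vinM; [apply: in32|apply: in33].
Qed.

Lemma rstep_S2 : (dl = 0 \/ dl = 1 /\ pi = n) /\ S2 n I2 x l' p2 (pi - dl).
Proof.
split; first by case: dlP => [|[? [? _]]]; [left; zlia|right].
have [E1 E2] := L1; split; [by []|by []| |by []|by split; [exact: S5'|exact: R2']].
split; first by have [h _ _] := (linked_csub L1).2; move: h; rewrite /= El'.
apply/E2 => g Ig; rewrite mulrC; apply/(exch_vin g rc' rgv Ep2).
by case: L0 => _ D; apply: (proj1 (D g)) Ig _ Ixp.
Qed.

End RStep.

(** * Normal form of a double link, and links whose first form is a multiple of [x * l] *)

Section Steps.
Variables (k : fieldType) (N : nat).
Local Notation R := {mpoly k[N]}.

Lemma linked_ext (c c' : vec R) I I' : (forall f, vin c f <-> vin c' f) ->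
  linked c I I' -> linked c' I I'.
Proof.
move=> E [H1 H2]; split=> f; [rewrite H1|rewrite H2]; split=> H h /H; by rewrite E.
Qed.

Lemma vin_sub (c c' : vec R) : vin c' c.1.1 -> vin c' c.1.2 -> vin c' c.2 ->
  forall f, vin c f -> vin c' f.
Proof.
by move=> h1 h2 h3 f [u [v [w ->]]]; apply: vinD; first apply: vinD; apply: vinM.
Qed.

(** Two forms of degree at most [pi] share the factor [x * l], and three forms of degree below
    [2n + 4] lie in [(l, p)]; a regular sequence allows neither. *)
Lemma S2_bc n I (x l p : R) pi a b c (v : vec R) : S2 n I x l p pi -> 4 <= n -> n - 1 <= pi ->
  ci (a, b, c) v -> csub v I -> a <= b -> b <= c -> pi + 1 <= b /\ 2 * n + 4 <= c.
Proof.
case: v => [[al be] ph].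
move=> [[Hx x0 Hl l0] [Hp lp] _ [P0 P] _] n4 pin [rc [/= Ha Hb Hc] n1] [/= Ia Ib Ic] ab bc.
split.
  case: (ltP pi b) => [|h]; first zlia.
  have Hxl : hg 2 (x * l) by apply: (hgM_c Hx Hl).
  case: (hg_pos_no1 Hxl) => //; apply: (reg2_nocommon (proj1 rc)) => /=.
    by apply: (P0 _ a) => //; zlia.
  exact: (P0 _ b).
case: (ltP c (2 * n + 4)) => [h|]; last zlia.
case: (hg_pos_no1_2 Hl Hp) => //; first zlia.
apply: (three_in2 (reg2_lin Hl l0 lp) rc); [apply: (P _ a)|apply: (P _ b)|apply: (P _ c)] => //; zlia.
Qed.

Lemma rstep n pi b c a1 b1 c1 (I I1 I2 : R -> Prop) (x l p be ph al1 be1 ph1 : R) :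
  4 <= n -> pi = n \/ pi = n - 1 -> S2 n I x l p pi ->
  ci (2, b, c) (x * l, be, ph) -> ci (a1, b1, c1) (al1, be1, ph1) ->
  b <= c -> b1 <= c1 -> a1 <= 2 -> b1 <= b -> c1 <= c ->
  linked (x * l, be, ph) I I1 -> linked (al1, be1, ph1) I1 I2 ->
  exists l' p' dl, [/\ dl = 2 + b + c - (a1 + b1 + c1), dl = 0 \/ dl = 1 /\ pi = n &
    S2 n I2 x l' p' (pi - dl)].
Proof.
move=> n4 pin HS C0 C1 bc bc1 a12 bb cc L0 L1.
have main be' ph' : ci (2, b, c) (x * l, be', ph') -> linked (x * l, be', ph') I I1 ->
  (b = 2 * n + 4 -> c = 2 * n + 4 -> pi = n -> in2 l p be') ->
  exists l' p' dl, [/\ dl = 2 + b + c - (a1 + b1 + c1), dl = 0 \/ dl = 1 /\ pi = n &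
    S2 n I2 x l' p' (pi - dl)].
  move=> C0' L0' NF.
  have [l' [Hl' l'0 El' Ea1]] : exists l', [/\ hg 1 l', l' != 0, al1 = x * l' & a1 = 2].
    by apply: (@rstep_l _ _ n pi b c a1 b1 c1 I I1 I2 x l p be' ph' al1 be1 ph1).
  set dl := 2 + b + c - (2 + b1 + c1).
  have [p2 [Hp2 Ep2]] : exists p2, hg (pi - dl) p2 /\
      exch (x * l, be', ph') (al1, be1, ph1) (x * p) (x * p2).
    by apply: (@rstep_p _ _ n pi b c a1 b1 c1 I I1 I2 x l p be' ph' al1 be1 ph1 _ _ _ _ _ _ _ _ _ _ _ _ _ l').
  have [Hd HS'] : (dl = 0 \/ dl = 1 /\ pi = n) /\ S2 n I2 x l' p2 (pi - dl).
    by apply: (@rstep_S2 _ _ n pi b c a1 b1 c1 I I1 I2 x l p be' ph' al1 be1 ph1).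
  by exists l', p2, (2 + b + c - (2 + b1 + c1)); split=> //; rewrite Ea1.
(* Only here may the generators have to change. If [c2 = 0] then [be] itself is in [(l, p)];
   otherwise the combination becomes the second form and [be] the third. *)
case: (classic (b = 2 * n + 4 /\ c = 2 * n + 4 /\ pi = n)) => [[bt [ct En]]|h]; last first.
  by apply: (main _ _ C0 L0) => h1 h2 h3; case: h.
have [[_ Ib Ic] _] := linked_csub L0.
case: (C0) => rc [/= Ha Hb Hc] n1.
have [c1' [c2 [nz Hin]]] : exists c1 c2 : k, (c1 != 0 \/ c2 != 0) /\ in2 l p (c1%:MP * be + c2%:MP * ph).
  by case: HS => _ _ _ _ [S5 _]; apply: (S5 En) => //; [rewrite -bt|rewrite -ct].
case: (eqVneq c2 0) => [c20|c20].
  apply: (main _ _ C0 L0) => _ _ _; move: Hin nz; rewrite c20 mpolyC0 mul0r addr0 eqxx => Hin [] // nz.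
  by have := in2M (c1'^-1)%:MP Hin; rewrite mulrA -mpolyCM mulVf // mpolyC1 mul1r.
have c2E : (c2^-1)%:MP * c2%:MP = 1 :> R by rewrite -mpolyCM mulVf // mpolyC1.
set be' := c1'%:MP * be + c2%:MP * ph in Hin.
have Hb' : hg b be' by apply: hgD; [apply: (hgM_c (hgC _ _) Hb)|apply: (hgM_c (hgC _ _) Hc)]; zlia.
have vE f : vin (x * l, be, ph) f <-> vin (x * l, be', be) f.
  split; apply: vin_sub => /=; try exact: in31; try exact: in32; try exact: in33.
    exists 0, (c2^-1)%:MP, (- (c2^-1)%:MP * c1'%:MP) => /=; rewrite /be'.
    by transitivity (((c2^-1)%:MP * c2%:MP) * ph); [rewrite c2E mul1r|ring].
  by exists 0, c1'%:MP, c2%:MP => /=; rewrite /be'; ring.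
apply: (main be' be) => //; last exact: linked_ext L0.
split; last by rewrite -vE.
- have [r2 r3] := rc; apply: (@reg3_swap _ _ _ _ _ 2 b b) => //; first by have [] := ci_pos C0.
  split=> // u [s [r E]]; apply: r3.
  exists ((c2^-1)%:MP * s), ((c2^-1)%:MP * (r - u * c1'%:MP)).
  transitivity (((c2^-1)%:MP * c2%:MP) * (u * ph)); first by rewrite c2E mul1r.
  by rewrite /= /be' in E *; lc (eqM (c2^-1)%:MP E).
- by split=> //=; rewrite ct -bt.
Qed.

(** The first form is [th * (x * l)] for its degree is at most [n]. The residue [xi] of [x * l]
    satisfies [th * xi] in the second complete intersection, and if the total degree does not fall
    this makes [al1] a multiple of [th]. Dividing both links by [th] replaces [I1] by [I1 : th] and
    reduces to first degree 2. *)
Lemma thstep n a b c a1 b1 c1 (I I1 I2 : R -> Prop) (x l p al be ph al1 be1 ph1 : R) :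
  4 <= n -> S2 n I x l p n ->
  ci (a, b, c) (al, be, ph) -> ci (a1, b1, c1) (al1, be1, ph1) ->
  3 <= a -> a <= n -> a <= b -> b <= c -> a1 <= b1 -> b1 <= c1 -> a1 <= a -> b1 <= b -> c1 <= c ->
  hideal I -> hideal I1 -> hideal I2 ->
  linked (al, be, ph) I I1 -> linked (al1, be1, ph1) I1 I2 ->
  exists l' p', S2 n I2 x l' p' n.
Proof.
move=> n4 HS C0 C1 a3 an ab bc ab1 bc1 aa bb cc idI idI1 idI2 L0 L1.
have [cI cI1] := linked_csub L0; have [gI1 gI2] := linked_csub L1.
have [bn ct] := S2_bc HS n4 ltac:(zlia) C0 cI ab bc.
case: (HS) => -[Hx x0 Hl l0] [Hp lp] [Ixl Ixp] [P0 P] [_ R2H].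
have [Ia Ib Ic] := cI; case: (C0) => rc [/= Ha Hb Hc] n1; case: (C1) => rg [/= Ha1 Hb1 Hc1] _.
have Hxl : hg 2 (x * l) by apply: (hgM_c Hx Hl).
have xl0 : x * l != 0 by rewrite mulf_neq0.
have [th Eth] := P0 _ _ Ia Ha an; rewrite /= in Eth.
have al0 : al != 0 by case: rc => -[].
have th0 : th != 0 by apply: contra_neq al0; rewrite Eth => ->; rewrite mul0r.
have Hth : hg (a - 2) th by apply: (hg_div _ Hxl xl0); rewrite -Eth.
have Rt g d : I1 g -> hg d g -> d < a + b + c - (n + n + 7) ->
    vin (al, be, ph) (l * g) /\ vin (al, be, ph) (p * g).
  by move=> Ig Hg Hd; apply: (R2H _ _ C0 cI g d) => //; case: L0 => _ E; apply/E.
have [D1 D2] := L0; have [D3 D4] := L1.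
have [xi [Hxi Exi Ixi]] := colon_exch C0 C1 gI1 ((proj1 (D1 _)) Ixl) Hxl.
have {}Ixi : I2 xi by apply/D4.
set dl := (a + b + c) - (a1 + b1 + c1).
have {}Hxi : hg (2 - dl) xi by apply: (hg_c Hxi); rewrite /tot /dl /=; zlia.
have thxi : vin (al1, be1, ph1) (th * xi).
  by apply/(exch_vin th rc rg Exi); exists 1, 0, 0; rewrite /= Eth; ring.
have Ithxi : I1 (th * xi).
  case: thxi => u [v [w ->]] /=; case: idI1 => _ iD iM _.
  by case: gI1 => h1 h2 h3; apply: (iD); first apply: (iD); apply: iM.
have xi0 : xi != 0.
  apply/eqP=> z; have : vin (al, be, ph) (x * l).
    by apply: (exch_out rg Exi); rewrite z; apply: vin0.
  move=> /(in3_low0 Hxl Ha Hb Hc) -/(_ ltac:(zlia) ltac:(zlia) ltac:(zlia)) /eqP.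
  by rewrite (negbTE xl0).
have dl2 := hg_ge0 Hxi xi0.
have Hthxi : hg (a - dl) (th * xi) by apply: (hgM_c Hth Hxi); zlia.
have dlge : 0 <= dl by rewrite /dl; zlia.
have [lthxi pthxi] := Rt _ _ Ithxi Hthxi ltac:(zlia).
have thxi0 : th * xi != 0 by rewrite mulf_neq0.
(* If the degree fell, [l * th * xi] would be a multiple of [al], so [xi] a constant times [x]; then
   [p * th * x] lies in [(al, be)], and cancelling [th * x] makes [l] divide [p]. *)
have dl0 : dl = 0.
  case: (eqVneq dl 0) => // dlne.
  have Hl3 : hg (a + 1 - dl) (l * (th * xi)) by apply: (hgM_c Hl Hthxi); zlia.
  have [y Ey] := in3_low1 Hl3 Ha Hb Hc ltac:(zlia) ltac:(zlia) lthxi.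
  have Ey' : xi = y * x.
    apply: (mulfI th0); apply: (mulfI l0); rewrite Ey Eth; ring.
  have y0 : y != 0 by apply: contra_neq xi0; rewrite Ey' => ->; rewrite mul0r.
  have Hy : hg (1 - dl) y by apply: (hg_c (hg_div (d := 2 - dl) _ Hx x0)); [rewrite -Ey'|zlia].
  have [w [_ Ew]] := nz_mul_const 0 Hy ltac:(zlia) y0.
  have Hpt : hg (n + (a - 1)) (p * (th * x)) by apply: (hgM_c Hp (hgM Hth Hx)); zlia.
  have : vin (al, be, ph) (p * (th * x)).
    have := vinM w pthxi; rewrite (_ : w * _ = (w * y) * (p * (th * x))); last by rewrite Ey'; ring.
    by rewrite Ew mul1r.
  move=> /(in3_low2 Hpt Ha Hb Hc) -/(_ ltac:(zlia)) /(in2_hg Hpt Ha Hb) [A [B [E _ HB]]].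
  have rtx : reg3 (th * x) be ph.
    by apply: (@reg3_divl _ _ (th * x) l); rewrite -mulrA -Eth.
  have [|B0 EB] := (proj1 rtx).2 B; first by exists (p - A * l); rewrite Eth in E; lc E.
  have B00 : B0 = 0.
    have Htx : hg (a - 1) (th * x) by apply: (hgM_c Hth Hx); zlia.
    apply: (hg_neg (d := n - b)); last zlia.
    by apply: (hg_c (hg_div (d := n + (a - 1) - b) (e := a - 1) _ Htx _)); [rewrite -EB|rewrite mulf_neq0|zlia].
  case: lp; exists A; apply: (mulIf (x := th * x)); first by rewrite mulf_neq0.
  by rewrite E EB B00 Eth; ring.
have [E1 [E2 E3]] : a1 = a /\ b1 = b /\ c1 = c by rewrite /dl in dl0; zlia.
subst a1 b1 c1.
have [u Eu] := in3_low1 Hthxi Ha1 Hb1 Hc1 ltac:(zlia) ltac:(zlia) thxi.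
have al10 : al1 != 0 by case: rg => -[].
have u0 : u != 0 by apply: contra_neq thxi0; rewrite Eu => ->; rewrite mul0r.
have Hu : hg 0 u by apply: (hg_c (hg_div (d := a - dl) _ Ha1 al10)); [rewrite -Eu|zlia].
have [w Hw Ew] := hg_unit Hu u0.
pose xi2 := w * xi; have Exi2 : al1 = th * xi2.
  by rewrite /xi2 mulrCA Eu mulrA Ew mul1r.
have Hxi2 : hg 2 xi2 by apply: (hgM_c Hw Hxi); zlia.
have [_ iD2 iM2 _] := idI2.
have Ixi2 : I2 xi2 by apply: iM2.
pose I1' g := I1 (th * g).
have rc' : reg3 (x * l) be ph by apply: (@reg3_divl _ _ _ th); rewrite mulrC -Eth.
have rg' : reg3 xi2 be1 ph1 by apply: (@reg3_divl _ _ _ th); rewrite mulrC -Exi2.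
have C0' : ci (2, b, c) (x * l, be, ph).
  by split=> //; apply: (hg_pos_no1_3 Hxl Hb Hc); have [] := ci_pos C0.
have C1' : ci (2, b, c) (xi2, be1, ph1).
  by split=> //; apply: (hg_pos_no1_3 Hxi2 Hb1 Hc1); have [] := ci_pos C1.
have t0 f : vin (x * l, be, ph) f <-> vin (al, be, ph) (th * f).
  split; first by move=> H; have := in3_mulc th H; rewrite mulrC -Eth.
  by move=> H; apply: (@in3_cancel _ _ (x * l) th); rewrite mulrC -Eth.
have t1 f : vin (xi2, be1, ph1) f <-> vin (al1, be1, ph1) (th * f).
  split; first by move=> H; have := in3_mulc th H; rewrite mulrC -Exi2.
  by move=> H; apply: (@in3_cancel _ _ xi2 th); rewrite mulrC -Exi2.
have J0 g : I1' g <-> vcolon (x * l, be, ph) I g.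
  by rewrite /I1' D2; split=> H h /H; rewrite t0 mulrA.
have J1 g : I1' g <-> vcolon (xi2, be1, ph1) I2 g.
  by rewrite /I1' D3; split=> H h /H; rewrite t1 mulrA.
have homI1' f d : I1' f -> I1' (hp d f).
  case: idI1 => _ _ _ ih; move=> /(ih _ (d + (a - 2))); rewrite /I1' (hpMl _ _ Hth).
  by rewrite addrK.
(* Reflexivity survives the division by [th] since the double colon does not depend on the complete
   intersection. *)
have L0' : linked (x * l, be, ph) I I1'.
  split=> // f; split.
    by move=> If h /J0 Hh; rewrite [f * h]mulrC; apply: Hh.
  move=> H; apply/D1; suff H2 : vcolon (al, be, ph) (vcolon (al, be, ph) I) f.
    by move=> h /D2 Hh; apply: H2.
  apply: (colon_colon_indep C0' C0); first by [].
    by move=> g d /D2 Hg; apply/D2; case: idI1 => _ _ _; apply.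
  by move=> h /J0 Hh; apply: H.
have L1' : linked (xi2, be1, ph1) I1' I2.
  split=> // f; split.
    by move=> If h /J1 Hh; rewrite [f * h]mulrC; apply: Hh.
  move=> H; apply/D4; suff H2 : vcolon (al1, be1, ph1) (vcolon (al1, be1, ph1) I2) f.
    by move=> h /D3 Hh; apply: H2.
  have gI2' : csub (xi2, be1, ph1) I2 by case: gI2.
  apply: (colon_colon_indep C1' C1); first by [].
    by move=> g d /D3 Hg; apply/D3; case: idI1 => _ _ _; apply.
  by move=> h /J1 Hh; apply: H.
have [l' [p' [dl' [Ed _ HS']]]] := rstep n4 (or_introl erefl) HS C0' C1' bc bc (lexx _) (lexx _) (lexx _) L0' L1'.
by exists l', p'; move: HS'; rewrite Ed subrr subr0.
Qed.

End Steps.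

(** * A dimension count for linear relations *)

Section LinearAlgebra.
Variables (K : fieldType) (r : nat).

(** [P] plays the part of a subspace of codimension at most one, given only by the property of
    meeting every plane. If a unit vector [i0] is outside [P], every other unit vector is moved into
    [P] by a multiple of it. *)
Lemma indep_family (P : 'rV[K]_r.+2 -> Prop) :
  (forall v w, exists c1 c2 : K, (c1 != 0 \/ c2 != 0) /\ P (c1 *: v + c2 *: w)) ->
  (forall c v, P v -> P (c *: v)) ->
  exists V : 'M[K]_(r.+1, r.+2), (forall j, P (row j V)) /\ forall s : 'rV_r.+1, s *m V = 0 -> s = 0.
Proof.
move=> HP Psc.
have [i0 Hi0] : exists i0, forall j, exists c, P (delta_mx 0 (lift i0 j) + c *: delta_mx 0 i0).
  case: (classic (exists i0, ~ P (delta_mx 0 i0))) => [[i0 H]|H].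
    exists i0 => j; have [c1 [c2 [nz Hc]]] := HP (delta_mx 0 (lift i0 j)) (delta_mx 0 i0).
    have c10 : c1 != 0.
      apply/eqP=> z; rewrite z scale0r add0r eqxx in nz Hc; case: nz => // c20; apply: H.
      by have := Psc c2^-1 _ Hc; rewrite scalerA mulVf // scale1r.
    exists (c1^-1 * c2); have := Psc c1^-1 _ Hc.
    by rewrite scalerDr !scalerA mulVf // scale1r.
  exists 0 => j; exists 0; rewrite scale0r addr0; apply: NNPP => H1; apply: H.
  by exists (lift 0 j).
have [cf Hcf] := fin_all_exists Hi0.
exists (\matrix_j (delta_mx 0 (lift i0 j) + cf j *: delta_mx 0 i0)); split=> [j|s Hs].
  by rewrite rowK.
apply/rowP=> j; have := congr1 (fun M : 'rV_r.+2 => M 0 (lift i0 j)) Hs.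
rewrite !mxE (bigD1 j) //= !mxE !eqxx /= [lift i0 j == i0]eq_sym (negbTE (neq_lift i0 j)).
rewrite mulr0 addr0 mulr1 big1 ?addr0 // => j' jj'.
rewrite !mxE eqxx /= [lift i0 j == i0]eq_sym (negbTE (neq_lift i0 j)) mulr0 addr0.
by rewrite (inj_eq (@lift_inj _ i0)) eq_sym (negbTE jj') mulr0.
Qed.

(** [T] is a relation since the coefficients it records are not unique. Choosing images in dimension
    [r] for [r + 1] independent vectors forces a combination related to 0. *)
Lemma linear_rel_kernel (P : 'rV[K]_r.+2 -> Prop) (T : 'rV[K]_r.+2 -> 'rV[K]_r -> Prop) :
  (forall v w, exists c1 c2 : K, (c1 != 0 \/ c2 != 0) /\ P (c1 *: v + c2 *: w)) ->
  (forall c v, P v -> P (c *: v)) ->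
  (forall v, P v -> exists u, T v u) -> T 0 0 ->
  (forall c v u v' u', T v u -> T v' u' -> T (c *: v + v') (c *: u + u')) ->
  exists2 v, v != 0 & T v 0.
Proof.
move=> HP Psc PT T0 Tlin; have [V [HV Vi]] := indep_family HP Psc.
have [u Hu] := fin_all_exists (fun j => PT _ (HV j)).
have /rowV0Pn [s /sub_kermxP sU s0] : kermx (\matrix_j u j) != 0.
  rewrite kermx_eq0 /row_free; apply/eqP => E.
  by have := rank_leq_col (\matrix_j u j); rewrite E ltnn.
exists (s *m V); first by apply: contra_neq s0 => /Vi.
rewrite -sU !mulmx_sum_row; apply: (big_ind2 T) => //.
  by move=> v u1 v' u1' H H'; have := Tlin 1 _ _ _ _ H H'; rewrite !scale1r.
move=> j _; rewrite rowK; have := Tlin (s 0 j) _ _ _ _ (Hu j) T0; by rewrite !addr0.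
Qed.

End LinearAlgebra.

(** * Comparison of residues along two regular pairs *)

Section Exch2.
Variable R : idomainType.
Implicit Types a b e l p : R.

(** The analogue of [exch] for pairs, with a zig-zag shorter by one step. *)
Definition exch2 a b a1 b1 e e' := exists p1 q1 p2 q2,
  [/\ e * a1 = p1 * a + q1 * b, e * b1 = p2 * a + q2 * b,
      a1 * p2 - b1 * p1 = e' * b & a1 * q2 - b1 * q1 = - e' * a].

Lemma exch2D a b a1 b1 e e' f f' : exch2 a b a1 b1 e e' -> exch2 a b a1 b1 f f' ->
  exch2 a b a1 b1 (e + f) (e' + f').
Proof.
move=> [p1 [q1 [p2 [q2 [E1 E2 E3 E4]]]]] [P1 [Q1 [P2 [Q2 [F1 F2 F3 F4]]]]].
exists (p1 + P1), (q1 + Q1), (p2 + P2), (q2 + Q2); split.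
- by lc (eqD E1 F1).
- by lc (eqD E2 F2).
- by lc (eqD E3 F3).
- by lc (eqD E4 F4).
Qed.

Lemma exch2M a b a1 b1 h e e' : exch2 a b a1 b1 e e' -> exch2 a b a1 b1 (h * e) (h * e').
Proof.
move=> [p1 [q1 [p2 [q2 [E1 E2 E3 E4]]]]].
exists (h * p1), (h * q1), (h * p2), (h * q2); split.
- by lc (eqM h E1).
- by lc (eqM h E2).
- by lc (eqM h E3).
- by lc (eqM h E4).
Qed.

Lemma exch2_in a b a1 b1 e e' : reg2 a b -> b != 0 -> exch2 a b a1 b1 e e' -> in2 a b e -> in2 a1 b1 e'.
Proof.
move=> r2 b0 [p1 [q1 [p2 [q2 [E1 E2 E3 E4]]]]] [s [t Ee]]; rewrite Ee in E1 E2.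
have [|w1 [W1 _]] := @reg2_syz _ a b (p1 - s * a1) (q1 - t * a1) r2; first by lc E1.
have [|w2 [W2 _]] := @reg2_syz _ a b (p2 - s * b1) (q2 - t * b1) r2; first by lc E2.
exists w2, (- w1); apply: (mulIf b0); rewrite -E3.
by lc (eqD (eqM a1 W2) (eqM (- b1) W1)).
Qed.

Lemma exch2_out a b a1 b1 e e' : reg2 a1 b1 -> exch2 a b a1 b1 e e' -> in2 a1 b1 e' -> in2 a b e.
Proof.
move=> r2 [p1 [q1 [p2 [q2 [E1 E2 E3 E4]]]]] [w2 [w1 Ee]]; rewrite Ee in E3 E4.
have [a10 _] := r2.
have [|s [S1 _]] := @reg2_syz _ a1 b1 (p2 - w2 * b) (- p1 - w1 * b) r2; first by lc E3.
have [|t [T1 _]] := @reg2_syz _ a1 b1 (q2 + w2 * a) (- q1 + w1 * a) r2; first by lc E4.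
have [|s' [_ S2]] := @reg2_syz _ a1 b1 (p2 - w2 * b) (- p1 - w1 * b) r2; first by lc E3.
have [|t' [_ T2]] := @reg2_syz _ a1 b1 (q2 + w2 * a) (- q1 + w1 * a) r2; first by lc E4.
exists s', t'; apply: (mulIf a10); rewrite E1.
by lc (eqD (eqM a S2) (eqM b T2)).
Qed.

(* With [Delta = l p' - l' p], the kernel of [e1 l + e2 p |-> e1 l' + e2 p'] mod [Delta]. *)
Lemma star_kernel l p l' p' e1 e2 : reg2 l' p' ->
  in1 (l * p' - l' * p) (e1 * l' + e2 * p') -> in1 (l * p' - l' * p) (e1 * l + e2 * p).
Proof.
move=> r2 [h E]; have [|q [Q1 Q2]] := @reg2_syz _ l' p' (e1 + h * p) (e2 - h * l) r2; first by lc E.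
by exists q; lc (eqD (eqM l Q1) (eqM p Q2)).
Qed.

End Exch2.

Section Gen2.
Variables (k : fieldType) (N : nat).
Local Notation R := {mpoly k[N]}.

Lemma exch2_hg (a b a1 b1 e e' : R) (da db da1 db1 d : int) : hg da a -> hg db b -> hg da1 a1 -> hg db1 b1 ->
  hg d e -> reg2 a b -> b != 0 -> in2 a b (e * a1) -> in2 a b (e * b1) ->
  exists2 e', hg (d - da - db + da1 + db1) e' & exch2 a b a1 b1 e e'.
Proof.
move=> Ha Hb Ha1 Hb1 He r2 b0 /(in2_hg (hgM He Ha1) Ha Hb) [p1 [q1 [E1 Hp1 Hq1]]].
move=> /(in2_hg (hgM He Hb1) Ha Hb) [p2 [q2 [E2 Hp2 Hq2]]].
have [|w [W1 W2]] := @reg2_syz _ a b (a1 * p2 - b1 * p1) (a1 * q2 - b1 * q1) r2.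
  transitivity (a1 * (p2 * a + q2 * b) - b1 * (p1 * a + q1 * b)); first ring.
  by rewrite -E1 -E2; ring.
exists w; last by exists p1, q1, p2, q2; split=> //; rewrite W2.
apply: (hg_c (hg_div (d := d + da1 + db1 - da) (e := db) _ Hb b0)); last zlia.
by rewrite -W1; apply: hgB; [apply: (hgM_c Ha1 Hp2)|apply: (hgM_c Hb1 Hp1)]; zlia.
Qed.

(** The determinant expressing [s], [t] through [a], [b] has degree 0. If it is a unit it can be
    inverted; if it is zero, [s] divides [t]. *)
Lemma pair_generate (a b s t : R) (da db : int) : hg da a -> hg db b -> hg da s -> hg db t -> da <= db ->
  in2 a b s -> in2 a b t -> s != 0 -> ~ in1 s t -> in2 s t a /\ in2 s t b.
Proof.
move=> Ha Hb Hs Ht ab /(in2_hg Hs Ha Hb) [u [v [Es Hu Hv]]] /(in2_hg Ht Ha Hb) [u' [v' [Et Hu' Hv']]] s0 st.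
pose D := u * v' - v * u'.
have HD : hg 0 D by apply: hgB; [apply: (hgM_c Hu Hv')|apply: (hgM_c Hv Hu')]; zlia.
have [D0|D0] := eqVneq D 0; last first.
  have [w _ Ew] := hg_unit HD D0; split.
    exists (w * v'), (- w * v); rewrite Es Et.
    by transitivity ((w * D) * a); [rewrite Ew mul1r|rewrite /D; ring].
  exists (- w * u'), (w * u); rewrite Es Et.
  by transitivity ((w * D) * b); [rewrite Ew mul1r|rewrite /D; ring].
have Hu0 : hg 0 u by apply: (hg_c Hu); zlia.
have Hv'0 : hg 0 v' by apply: (hg_c Hv'); zlia.
case: st; case: (eqVneq u 0) => [u0|u0].
  have v0 : v != 0 by apply: contra_neq s0 => v0; rewrite Es u0 v0; ring.
  have Hv0 : hg 0 v by apply: (hg_c Hv); have := hg_ge0 Hv v0; zlia.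
  have [w _ Ew] := hg_unit Hv0 v0.
  have u'0 : u' = 0.
    by apply: (mulfI v0); rewrite mulr0; move: D0; rewrite /D u0 => E; lc E.
  exists (v' * w); rewrite Es Et u0 u'0.
  by transitivity (v' * (w * v) * b); [rewrite Ew; ring|ring].
have [w _ Ew] := hg_unit Hu0 u0.
exists (u' * w); rewrite Es Et.
transitivity (u' * (w * u) * a + v' * (w * u) * b); first by rewrite Ew; ring.
by move: D0; rewrite /D => E; lc (eqM (w * b) E).
Qed.

End Gen2.

(** * Double links with [a > n] and [a + b >= 2n + 8] *)

Section S1.
Variables (k : fieldType) (N : nat).
Local Notation R := {mpoly k[N]}.

(** The last clause refines [(l, p)] to the elements [f0 * l + C * p] with [f0] in the pencil
    [(x, l2)]; [Hsplit] and [Hjoin] pass between the two descriptions. *)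
Definition S1 (n : int) (I : R -> Prop) (x l l2 p : R) :=
  [/\ S2 n I x l p n, hg 1 l2, in2 x l2 p &
      forall f d, I f -> hg d f -> d < 2 * n + 4 -> in3 (x * l) (l2 * l) p f].

Lemma Hsplit (x l l2 p f : R) : in3 (x * l) (l2 * l) p f ->
  exists f0 C, f = f0 * l + C * p /\ in2 x l2 f0.
Proof.
by move=> [A [B [C ->]]]; exists (A * x + B * l2), C; split; [ring|exists A, B].
Qed.

Lemma Hsplit_hg (x l l2 p f : R) (d n : int) : hg 1 x -> hg 1 l -> hg 1 l2 -> hg n p -> hg d f ->
  in3 (x * l) (l2 * l) p f ->
  exists f0 C, [/\ f = f0 * l + C * p, in2 x l2 f0, hg (d - 1) f0 & hg (d - n) C].
Proof.
move=> Hx Hl Hl2 Hp Hf /(in3_hg Hf (hgM Hx Hl) (hgM Hl2 Hl) Hp) [A [B [C [-> HA HB HC]]]].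
exists (A * x + B * l2), C; split=> //; [ring|by exists A, B|].
by apply: hgD; [apply: (hgM_c HA Hx)|apply: (hgM_c HB Hl2)]; zlia.
Qed.

Lemma Hjoin (x l l2 p f0 C : R) : in2 x l2 f0 -> in3 (x * l) (l2 * l) p (f0 * l + C * p).
Proof. by move=> [A [B ->]]; exists A, B, C; ring. Qed.

Lemma H_lp (x l l2 p f : R) : in3 (x * l) (l2 * l) p f -> in2 l p f.
Proof. by move=> /Hsplit [f0 [C [-> _]]]; exists f0, C. Qed.

(* [Delta = l p' - l' p] is either zero, or it generates together with one
   more starred generator; in both cases the new pencil stays in [(x, l2)]. *)
Lemma Delta_zero (l p l' p' : R) : hg 1 l -> l != 0 -> hg 1 l' -> l' != 0 -> ~ in1 l p ->
  l * p' - l' * p = 0 -> exists2 la, hg 0 la & [/\ la != 0, l' = la * l & p' = la * p].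
Proof.
move=> Hl l0 Hl' l'0 lp D0; case: (lin_prime Hl l0 (f := l') (g := p)) => //.
  by exists p'; lc D0.
move=> [la E]; exists la.
  by apply: (hg_c (hg_div (d := 1) (e := 1) _ Hl l0)); rewrite -?E // subrr.
have la0 : la != 0 by apply: contra_neq l'0; rewrite E => ->; rewrite mul0r.
by split=> //; apply: (mulfI l0); rewrite E in D0; lc D0.
Qed.

(** Writing the element as [f0 * l + C * p] and comparing with [l * p' - l' * p] shows that
    [p' - f0] is a multiple of [p]. *)
Lemma Delta_p' (x l l2 p l' p' : R) : hg 1 l -> l != 0 -> ~ in1 l p -> in2 x l2 p ->
  in3 (x * l) (l2 * l) p (l * p' - l' * p) -> in2 x l2 p'.
Proof.
move=> Hl l0 lp pin /Hsplit [f0 [C [E f0in]]].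
have [|w [W1 W2]] := @reg2_syz _ l p (p' - f0) (- l' - C) (reg2_lin Hl l0 lp); first by lc E.
rewrite (_ : p' = f0 + w * p); last by lc W1.
by apply: in2D => //; apply: in2M.
Qed.

Lemma Delta_H (x l l2 p l' p' : R) : in2 x l2 p -> in3 (x * l') (l2 * l') p' (l * p' - l' * p).
Proof. by move=> [A [B ->]]; exists (- A), (- B), l; ring. Qed.

(** The star sends [f0 * l + C * p] to [f0 * l' + C * p'], up to multiples of Delta. By
    [pair_generate], [al1] and [be1] come from two starred elements: those of [al] and [be] if Delta
    is zero, when the star is a constant multiplication; otherwise Delta and the star of a form that
    Delta does not divide. *)
Lemma low_gens (x l l2 p l' p' al be al1 be1 : R) (a b n : int) :
  hg 1 x -> hg 1 l2 -> hg n p -> hg n p' -> hg 1 l -> l != 0 -> hg 1 l' -> l' != 0 -> ~ in1 l p -> ~ in1 l' p' -> in2 x l2 p ->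
  hg a al -> hg b be -> hg a al1 -> hg b be1 -> a <= b -> al != 0 -> ~ in1 al be ->
  (forall f0 C d, d <= b -> hg d (f0 * l' + C * p') -> in2 al be (f0 * l + C * p) ->
    in2 al1 be1 (f0 * l' + C * p')) ->
  in3 (x * l) (l2 * l) p al -> in3 (x * l) (l2 * l) p be ->
  in2 al be (l * p' - l' * p) -> in2 al1 be1 (l * p' - l' * p) ->
  (l * p' - l' * p != 0 -> hg a (l * p' - l' * p)) ->
  in2 x l2 p' /\ in3 (x * l') (l2 * l') p' al1 /\ in3 (x * l') (l2 * l') p' be1.
Proof.
move=> Hx Hl2 Hp Hp' Hl l0 Hl' l'0 lp lp' pin Hal Hbe Hal1 Hbe1 ab al0 albe star Ha Hb D0 D1 HD.
have fin s t : hg a s -> hg b t -> in2 al1 be1 s -> in2 al1 be1 t -> s != 0 -> ~ in1 s t ->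
  in3 (x * l') (l2 * l') p' s -> in3 (x * l') (l2 * l') p' t ->
  in3 (x * l') (l2 * l') p' al1 /\ in3 (x * l') (l2 * l') p' be1.
  move=> Hs Ht Is It s0 st hs ht; have [[u [v ->]] [u' [v' ->]]] := pair_generate Hal1 Hbe1 Hs Ht ab Is It s0 st.
  by split; apply: in3D; apply: in3M.
have p'in : in2 x l2 p'.
  apply: (@Delta_p' x l l2 p l' p') => //; case: D0 => u [v ->].
  by apply: in3D; apply: in3M.
split=> //; case: (eqVneq (l * p' - l' * p) 0) => [z|nz].
  have [la Hla [la0 El Ep]] := Delta_zero Hl l0 Hl' l'0 lp z.
  have [w _ Ew] := hg_unit Hla la0.
  have tr f : in3 (x * l) (l2 * l) p f -> in3 (x * l') (l2 * l') p' f.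
    move=> [A [B [C ->]]]; exists (A * w), (B * w), (C * w); rewrite El Ep.
    transitivity ((w * la) * (A * (x * l) + B * (l2 * l) + C * p)); first by rewrite Ew mul1r.
    ring.
  have st f d : hg d f -> d <= b -> in3 (x * l) (l2 * l) p f -> in2 al be f -> in2 al1 be1 f.
    move=> Hf db /(Hsplit_hg Hx Hl Hl2 Hp Hf) [f0 [C [E _ Hf0 HC]]]; rewrite E.
    move=> Hin; have := star _ _ d db _ Hin; move/(_ _)=> H.
    have {H} := H ltac:(by apply: hgD; [apply: (hgM_c Hf0 Hl')|apply: (hgM_c HC Hp')]; zlia).
    move=> /(in2M w); rewrite El Ep (_ : w * _ = (w * la) * (f0 * l + C * p)); last ring.
    by rewrite Ew mul1r.
  apply: (fin al be) => //; try exact: tr; [apply: (st _ a)|apply: (st _ b)] => //.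
    by exists 1, 0; ring.
  by exists 0, 1; ring.
have Hs := HD nz; set D := l * p' - l' * p in D0 D1 nz Hs *.
have DH : in3 (x * l') (l2 * l') p' D by apply: Delta_H.
have rl' : reg2 l' p' by apply: reg2_lin.
have go e : hg b e -> in3 (x * l) (l2 * l) p e -> in2 al be e -> ~ in1 D e ->
  in3 (x * l') (l2 * l') p' al1 /\ in3 (x * l') (l2 * l') p' be1.
  move=> He /(Hsplit_hg Hx Hl Hl2 Hp He) [f0 [C [E f0in Hf0 HC]]] Ie nD.
  apply: (fin D (f0 * l' + C * p')) => //.
  - by apply: hgD; [apply: (hgM_c Hf0 Hl')|apply: (hgM_c HC Hp')]; zlia.
  - apply: (star _ _ b); rewrite -?E //.
    by apply: hgD; [apply: (hgM_c Hf0 Hl')|apply: (hgM_c HC Hp')]; zlia.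
  - by rewrite E in nD => H; apply: nD; apply: star_kernel H.
  - exact: Hjoin.
(* If Delta divides [be], it does not divide [al], and the degrees [a] and [b] must agree; [al] then
   takes the place of [be]. *)
case: (classic (in1 D be)) => [[q Eq]|nD]; last first.
  by apply: (go be) => //; exists 0, 1; ring.
have nal : ~ in1 D al.
  move=> /(in1_hg Hal Hs) [q' Hq' E']; apply: albe.
  have q'0 : q' != 0 by apply: contra_neq al0; rewrite E' => ->; rewrite mul0r.
  have [w [_ Ew]] := nz_mul_const 0 Hq' ltac:(zlia) q'0.
  exists (q * w); rewrite Eq E'; transitivity (q * (w * q') * D); [by rewrite Ew; ring|ring].
have ba : b = a.
  case: (eqVneq a b) => // ne; case: nal.
  have [u [v [E Hu Hv]]] := in2_hg Hs Hal Hbe D0.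
  have v0 : v = 0 by apply: (hg_neg Hv); zlia.
  have u0 : u != 0 by apply: contra_neq nz => u0; rewrite E u0 v0; ring.
  have [w [_ Ew]] := nz_mul_const 0 Hu ltac:(zlia) u0.
  by exists w; rewrite E v0 mul0r addr0 mulrA Ew mul1r.
by apply: (go al) => //; [rewrite ba|exists 1, 0; ring].
Qed.

(** The inequality [a + b >= 2n + 8] puts all three generators of the second complete intersection
    below the bound of [R2], so [l] and [p] themselves have residues [l'] and [p']. *)
Lemma pstep n a b c a1 b1 c1 (I I1 I2 : R -> Prop) (x l l2 p al be ph al1 be1 ph1 : R) :
  4 <= n -> S1 n I x l l2 p ->
  ci (a, b, c) (al, be, ph) -> ci (a1, b1, c1) (al1, be1, ph1) ->
  n + 1 <= a -> 2 * n + 8 <= a + b -> a <= b -> b <= c -> a1 <= b1 -> b1 <= c1 ->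
  a1 <= a -> b1 <= b -> c1 <= c ->
  linked (al, be, ph) I I1 -> linked (al1, be1, ph1) I1 I2 ->
  exists l' p', S1 n I2 x l' l2 p'.
Proof.
move=> n4 HS1 C0 C1 an abn ab bc ab1 bc1 aa bb cc L0 L1.
case: (HS1) => HS Hl2 pin PH; have [cI cI1] := linked_csub L0; have [gI1 gI2] := linked_csub L1.
have [bn ct] := S2_bc HS n4 ltac:(zlia) C0 cI ab bc.
case: (HS) => -[Hx x0 Hl l0] [Hp lp] [Ixl Ixp] [P0 P] [S5 R2H].
have [Ia Ib Ic] := cI; case: (C0) => rc [/= Ha Hb Hc] n1; case: (C1) => rg [/= Ha1 Hb1 Hc1] _.
have [D1 D2] := L0; have [D3 D4] := L1.
set c0 := (al, be, ph) in C0 L0 cI cI1 rc D1 D2 n1 *.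
set g0 := (al1, be1, ph1) in C1 L1 gI1 gI2 rg D3 D4 *.
have Rt g d : I1 g -> hg d g -> d < a + b + c - (n + n + 7) -> vin c0 (l * g) /\ vin c0 (p * g).
  by move=> Ig Hg Hd; apply: (R2H _ _ C0 cI g d) => //; apply/D2.
have [Ia1 Ib1 Ic1] := gI1.
have [ra1 ra2] := Rt _ _ Ia1 Ha1 ltac:(zlia).
have [rb1 rb2] := Rt _ _ Ib1 Hb1 ltac:(zlia).
have [rp1 rp2] := Rt _ _ Ic1 Hc1 ltac:(zlia).
set dl := a + b + c - (a1 + b1 + c1).
have [l' Hl'_ El] : exists2 l', hg (1 - dl) l' & exch c0 g0 l l'.
  case: (C0) => _ Hc0 _; case: (C1) => _ Hg0 _.
  have [l' H1 H2] := exch_ex rc Hc0 Hg0 Hl ra1 rb1 rp1.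
  by exists l' => //; apply: (hg_c H1); rewrite /tot /dl /=; zlia.
have [p' Hp'_ Ep] : exists2 p', hg (n - dl) p' & exch c0 g0 p p'.
  case: (C0) => _ Hc0 _; case: (C1) => _ Hg0 _.
  have [p' H1 H2] := exch_ex rc Hc0 Hg0 Hp ra2 rb2 rp2.
  by exists p' => //; apply: (hg_c H1); rewrite /tot /dl /=; zlia.
have low0 d f : hg d f -> d < a -> vin c0 f -> f = 0.
  by move=> Hf da; apply: (in3_low0 Hf Ha Hb Hc) => //; zlia.
have star e1 e2 : exch c0 g0 (e1 * l + e2 * p) (e1 * l' + e2 * p').
  by apply: exchD; apply: exchM.
have l'0 : l' != 0.
  apply/eqP=> z; have := exch_out rg El; rewrite z => /(_ (vin0 _)) /(low0 _ _ Hl) -/(_ ltac:(zlia)).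
  by move/eqP; rewrite (negbTE l0).
have npl h (d : int) : hg d h -> d = n - 1 -> ~ vin g0 (p' - h * l').
  move=> Hh dn H; apply: lp; exists h; apply/eqP; rewrite -subr_eq0; apply/eqP.
  apply: (low0 n); [by apply: hgB => //; apply: (hgM_c Hh Hl); zlia|zlia|].
  have := exch_out rg (star (- h) 1); rewrite (_ : - h * l' + 1 * p' = p' - h * l'); last ring.
  by rewrite (_ : - h * l + 1 * p = p - h * l); [apply|ring].
(* [l'] has degree [1 - dl]. If this were 0, [p'] would be a multiple of the constant [l'], and
   going back would make [l] divide [p]. *)
have dl0 : dl = 0.
  have := hg_ge0 Hl'_ l'0; case: (eqVneq dl 1) => [d1 _|]; last by rewrite /dl; zlia.
  have [w [Hw Ew]] := nz_mul_const 0 Hl'_ ltac:(zlia) l'0.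
  case: (npl (p' * w) (n - 1)) => //.
    by apply: (hgM_c Hp'_ Hw); zlia.
  by rewrite -mulrA Ew mulr1 subrr; apply: vin0.
have [E1 [E2 E3]] : a1 = a /\ b1 = b /\ c1 = c by rewrite /dl in dl0; zlia.
subst a1 b1 c1.
have Hl' : hg 1 l' by apply: (hg_c Hl'_); zlia.
have Hp' : hg n p' by apply: (hg_c Hp'_); zlia.
have lp' : ~ in1 l' p'.
  move=> /(in1_hg Hp' Hl') [h Hh E]; apply: (npl h (n - 1)) => //.
  by rewrite E subrr; apply: vin0.
have al0 : al != 0 by case: rc => -[].
have albe : ~ in1 al be.
  move=> H; have [_ rb] := proj1 rc; case: n1; have [|u E] := rb 1; first by rewrite mul1r.
  by exists u, 0, 0; rewrite E /=; ring.
have [apos bpos cpos] := ci_pos C0; rewrite /= in apos bpos cpos.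
pose Dl := l * p' - l' * p.
have HDl : hg (n + 1) Dl by apply: hgB; [apply: (hgM_c Hl Hp')|apply: (hgM_c Hl' Hp)]; zlia.
have DC0 : vin c0 Dl.
  apply: (exch_out (e' := p' * l' + - l' * p') rg).
    by have := star p' (- l'); rewrite (_ : p' * l + - l' * p = Dl) //; rewrite /Dl; ring.
  by rewrite (_ : _ + _ = 0); [apply: vin0|ring].
have DC1 : vin g0 Dl.
  apply: (exch_in (e := - p * l + l * p) rc).
    by have := star (- p) l; rewrite (_ : - p * l' + l * p' = Dl) //; rewrite /Dl; ring.
  by rewrite (_ : _ + _ = 0); [apply: vin0|ring].
have al10 : al1 != 0 by case: rg => -[].
have starin f0 C d : hg d (f0 * l' + C * p') -> d < c -> vin c0 (f0 * l + C * p) ->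
    in2 al1 be1 (f0 * l' + C * p').
  move=> Hd dc H; apply: (in3_low2 Hd Ha1 Hb1 Hc1 dc); exact: (exch_in rc (star _ _)).
(* [Dl] has degree [n + 1] and lies in [c0], so it vanishes unless [a = n + 1]; in that case
   [a + b >= 2n + 8] forces [a < b]. *)
have Dcase : Dl = 0 \/ a = n + 1 /\ a < b.
  case: (ltP (n + 1) a) => h; [left; apply: (low0 _ _ HDl h DC0)|right; zlia].
have DH' : in3 (x * l') (l2 * l') p' Dl by apply: Delta_H.
have in_al : a < b -> forall f, hg a f -> vin c0 f -> f != 0 -> exists2 u, u * f = al & hg 0 u.
  move=> hab f Hf If f0; have [u Hu E] := in1_hg Hf Ha (in3_low1 Hf Ha Hb Hc ltac:(zlia) ltac:(zlia) If).
  have u0 : u != 0 by apply: contra_neq f0; rewrite E => ->; rewrite mul0r.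
  have [w [Hw Ew]] := nz_mul_const 0 Hu ltac:(zlia) u0.
  by exists w => //; rewrite E mulrA Ew mul1r.
have in_al1 : a < b -> forall f, hg a f -> vin g0 f -> f != 0 -> exists2 u, u * f = al1 & hg 0 u.
  move=> hab f Hf If f0; have [u Hu E] := in1_hg Hf Ha1 (in3_low1 Hf Ha1 Hb1 Hc1 ltac:(zlia) ltac:(zlia) If).
  have u0 : u != 0 by apply: contra_neq f0; rewrite E => ->; rewrite mul0r.
  have [w [Hw Ew]] := nz_mul_const 0 Hu ltac:(zlia) u0.
  by exists w => //; rewrite E mulrA Ew mul1r.
have trH : Dl = 0 -> exists2 la, hg 0 la & [/\ la != 0, l' = la * l, p' = la * p &
    forall f, in3 (x * l) (l2 * l) p f -> in3 (x * l') (l2 * l') p' f].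
  move=> z; have [la Hla [la0 El_ Ep_]] := Delta_zero Hl l0 Hl' l'0 lp z.
  exists la => //; split=> // f [A [B [C ->]]]; have [w _ Ew] := hg_unit Hla la0.
  exists (A * w), (B * w), (C * w); rewrite El_ Ep_.
  transitivity ((w * la) * (A * (x * l) + B * (l2 * l) + C * p)); first by rewrite Ew mul1r.
  ring.
have starhg f0 C d : hg (d - 1) f0 -> hg (d - n) C -> hg d (f0 * l' + C * p').
  by move=> h1 h2; apply: hgD; [apply: (hgM_c h1 Hl')|apply: (hgM_c h2 Hp')]; zlia.
have Dal : Dl != 0 -> exists2 u, u * Dl = al & hg 0 u.
  move=> nz; case: Dcase => [z|[an1 ab']]; first by rewrite z eqxx in nz.
  by apply: in_al => //; rewrite an1.
have al1E : a < b -> a < 2 * n + 4 -> Dl = 0 /\ (exists u, al1 = u * al) \/ (exists u, al1 = u * Dl).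
  move=> hab ha; case: (eqVneq Dl 0) => [z|nz]; last first.
    right; case: Dcase => [z|[an1 _]]; first by rewrite z eqxx in nz.
    by have [u E _] := in_al1 hab _ (hg_c HDl (esym an1)) DC1 nz; exists u.
  left; split=> //; have [la Hla [la0 El_ Ep_ _]] := trH z.
  have [f0 [C [E _ Hf0 HC]]] := Hsplit_hg Hx Hl Hl2 Hp Ha (PH _ _ Ia Ha ha).
  have H : vin g0 (f0 * l' + C * p').
    by apply: (exch_in rc (star _ _)); rewrite -E; apply: in31.
  have E' : f0 * l' + C * p' = la * al by rewrite E El_ Ep_; ring.
  have [||u Eu _] := in_al1 hab _ _ H; first exact: starhg.
    by rewrite E' mulf_neq0.
  by exists (u * la); rewrite -Eu E' mulrA.
have [p'in [lowa lowb]] : in2 x l2 p' /\ (a < 2 * n + 4 -> in3 (x * l') (l2 * l') p' al1) /\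
    (b < 2 * n + 4 -> in3 (x * l') (l2 * l') p' be1).
  case: (ltP b (2 * n + 4)) => hb.
    have [] : in2 x l2 p' /\ in3 (x * l') (l2 * l') p' al1 /\ in3 (x * l') (l2 * l') p' be1.
      apply: (@low_gens x l l2 p l' p' al be al1 be1 a b n) => //.
      - move=> f0 C d db Hd Hin; apply: (starin _ _ d) => //; first zlia.
        exact: in2_in3.
      - by apply: (PH _ a) => //; zlia.
      - by apply: (PH _ b).
      - by apply: (in3_low2 HDl Ha Hb Hc) => //; zlia.
      - by apply: (in3_low2 HDl Ha1 Hb1 Hc1) => //; zlia.
      - by move=> nz; case: Dcase => [z|[-> _]]; [rewrite -/Dl z eqxx in nz|exact: HDl].
    by move=> h1 [h2 h3].
  split.
    case: (eqVneq Dl 0) => [z|nz].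
      by have [la _ [_ _ -> _]] := trH z; apply: in2M.
    apply: (@Delta_p' x l l2 p l' p') => //; rewrite -/Dl.
    case: Dcase => [z|[an1 _]]; first by rewrite z eqxx in nz.
    have [u] := in3_low1 HDl Ha Hb Hc ltac:(zlia) ltac:(zlia) DC0; move=> ->; apply: in3M.
    by apply: (PH _ a) => //; zlia.
  split=> [ha|]; last zlia.
  case: (al1E ltac:(zlia) ha) => [[z [u ->]]|[u ->]]; apply: in3M => //.
  by have [la _ [_ _ _ tr]] := trH z; apply: tr; apply: (PH _ a).
have bwd f m : I2 f -> hg m f -> exists e, [/\ hg m e, exch c0 g0 e f & I e].
  move=> If Hf; have [e [He Ee Ie]] := colon_exch C1 C0 cI1 ((proj1 (D4 f)) If) Hf.
  exists e; split; [|exact: exch_sym|by apply/D1].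
  by apply: (hg_c He); rewrite /tot /=; zlia.
have PH' f d : I2 f -> hg d f -> d < 2 * n + 4 -> in3 (x * l') (l2 * l') p' f.
  move=> If Hf Hd; have [e [He Ee Ie]] := bwd _ _ If Hf.
  have [f0 [C [E f0in Hf0 HC]]] := Hsplit_hg Hx Hl Hl2 Hp He (PH _ _ Ie He Hd).
  have H : vin g0 (f - (f0 * l' + C * p')).
    have := exch_in rc (exchD Ee (exchM (-1) (star f0 C))); rewrite !mulN1r; apply.
    by rewrite E subrr; apply: vin0.
  have [u [v [w [E' Hu Hv Hw]]]] := in3_hg (hgB Hf (starhg _ _ _ Hf0 HC)) Ha1 Hb1 Hc1 H.
  rewrite (_ : f = (f0 * l' + C * p') + u * al1 + v * be1 + w * ph1); last by lc E'.
  rewrite (hg_neg Hw) ?mul0r ?addr0; last zlia.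
  apply: in3D; first apply: in3D; first exact: Hjoin.
    case: (ltP d a) => da; first by rewrite (hg_neg Hu) ?mul0r; [apply: in3_0|zlia].
    by apply: in3M; apply: lowa; zlia.
  case: (ltP d b) => db; first by rewrite (hg_neg Hv) ?mul0r; [apply: in3_0|zlia].
  by apply: in3M; apply: lowb; zlia.
exists l', p'; split=> //; split=> //.
- split; apply/D4 => g Ig; rewrite mulrC.
    have := (exch_vin g rc rg (exchM x El)); move=> [H _]; apply: H.
    exact: (proj1 (D2 g)).
  have := (exch_vin g rc rg (exchM x Ep)); move=> [H _]; apply: H.
  exact: (proj1 (D2 g)).
- split; last by move=> f d If Hf Hd; apply: H_lp; apply: PH' Hd.
  move=> f d If Hf Hd; have [e [He Ee Ie]] := bwd _ _ If Hf.
  have [h Eh] := P0 _ _ Ie He Hd.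
  exists h; apply/eqP; rewrite -subr_eq0; apply/eqP.
  have H : vin g0 (f - h * (x * l')).
    have := exch_in rc (exchD Ee (exchM (- h * x) El)).
    rewrite (_ : f + - h * x * l' = f - h * (x * l')); last ring.
    by apply; rewrite Eh (_ : _ + _ = 0); [apply: vin0|ring].
  have Hxl : hg 2 (x * l) by apply: (hgM_c Hx Hl).
  have xl0 : x * l != 0 by rewrite mulf_neq0.
  have Hh : hg (d - 2) h by apply: (hg_div _ Hxl xl0); rewrite -Eh.
  apply: (in3_low0 (d := d) _ Ha1 Hb1 Hc1 _ _ _ H); try zlia.
  by apply: hgB => //; apply: (hgM_c Hh (hgM Hx Hl')); zlia.
split; last first.
  move=> t cv Ct Cs; apply: (R2_indep C1 Ct gI2) => g d Ig Hg Hd.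
  have {}Ig : I1 g by apply/D3.
  have [h1 h2] := Rt g d Ig Hg ltac:(rewrite /tot /= in Hd; zlia).
  by split; rewrite mulrC; [apply/(exch_vin _ rc rg El)|apply/(exch_vin _ rc rg Ep)]; rewrite mulrC.
move=> _ f1 f2 If1 If2 Hf1 Hf2.
have [e1 [He1 Ee1 Ie1]] := bwd _ _ If1 Hf1; have [e2 [He2 Ee2 Ie2]] := bwd _ _ If2 Hf2.
set tau := 2 * n + 4 in S5 lowa lowb Hf1 Hf2 He1 He2 al1E ct *.
have albe_lp : a < tau -> in2 l p al by move=> h; apply: (P _ a).
(* Injectivity on the generators of [c0] of degree [tau]. It excludes a kernel vector below in which
   neither [e1] nor [e2] occurs. *)
have Zker u1 u2 u3 eps1 eps2 : hg 0 u1 -> hg 0 u2 -> hg 0 u3 ->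
    (a != tau -> u1 = 0) -> (b != tau -> u2 = 0) -> (c != tau -> u3 = 0) ->
    u1 * al + u2 * be + u3 * ph = eps1 * l + eps2 * p ->
    in2 (if a < tau then al1 else 0) (if b < tau then be1 else 0) (eps1 * l' + eps2 * p') ->
    [/\ u1 = 0, u2 = 0 & u3 = 0].
  move=> h1 h2 h3 m1 m2 m3 E Hst.
  case: (ltP b tau) => hb.
    have u10 : u1 = 0 by apply: m1; zlia.
    have u20 : u2 = 0 by apply: m2; zlia.
    split=> //; apply/eqP/negP => /negP u30; have [w [_ Ew]] := nz_mul_const 0 h3 (lexx _) u30.
    case: (hg_pos_no1_2 Hl Hp) => //; first zlia.
    apply: (three_in2 (reg2_lin Hl l0 lp) rc); [by apply: (P _ a) => //; zlia|by apply: (P _ b)|].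
    exists (w * eps1), (w * eps2); rewrite /= -[X in X = _]mul1r -Ew; rewrite u10 u20 in E.
    by lc (eqM w E).
  have hb' : (b < tau) = false by apply/negbTE; rewrite -leNgt.
  rewrite hb' in Hst.
  have [q [Eq q0]] : exists q, u1 * al + u2 * be + u3 * ph = q * al /\ (tau <= a -> q = 0).
    case: (ltP a tau) Hst => [ha [s [s' Es]]|ha [s [s' Es]]].
      have [u0 Eu0] : exists u0, eps1 * l' + eps2 * p' = u0 * Dl \/ Dl = 0 /\ eps1 * l' + eps2 * p' = u0 * al.
        case: (al1E ltac:(zlia) ha) => [[z [u Eu]]|[u Eu]]; exists (s * u); [right; split=> //|left].
          by rewrite Es Eu; ring.
        by rewrite Es Eu; ring.
      have [q Eq] : in1 al (eps1 * l + eps2 * p).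
        case: Eu0 => [H|[z H]].
          have [q Eq] : in1 Dl (eps1 * l + eps2 * p).
            by apply: (star_kernel (l' := l') (p' := p')); [apply: reg2_lin|exists u0].
          rewrite Eq; case: (eqVneq Dl 0) => [->|nz]; first by rewrite mulr0; apply: in1_0.
          case: Dcase => [z|[an1 _]]; first by rewrite z eqxx in nz.
          by apply: in1M; apply: (in3_low1 HDl Ha Hb Hc) => //; zlia.
        have [la Hla [la0 El_ Ep_ _]] := trH z; have [w _ Ew] := hg_unit Hla la0.
        exists (w * u0); rewrite El_ Ep_ in H.
        rewrite -[LHS]mul1r -Ew -mulrA; rewrite -[RHS]mulrA -H; congr (_ * _); ring.
      by exists q; split; [rewrite E|zlia].
    have z : Dl = 0 by case: Dcase => //; rewrite /tau in ha *; zlia.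
    have [q Eq] : in1 Dl (eps1 * l + eps2 * p).
      by apply: (star_kernel (l' := l') (p' := p')); [apply: reg2_lin|exists 0; rewrite Es; ring].
    by exists 0; split=> //; rewrite E Eq z; ring.
  have noconst u : hg 0 u -> in2 al be u -> u = 0.
    move=> Hu Iu; apply/eqP/negP => /negP u0; have [w [_ Ew]] := nz_mul_const 0 Hu (lexx _) u0.
    by apply: n1; apply: in2_in3; rewrite -Ew; apply: in2M.
  have u30 : u3 = 0.
    by apply: noconst => //; apply: (proj2 rc); exists (q - u1), (- u2); rewrite /=; lc Eq.
  have u20 : u2 = 0.
    apply: noconst => //; have [|s ->] := (proj2 (proj1 rc)) u2; last by exists s, 0; rewrite /=; ring.
    by exists (q - u1); rewrite u30 in Eq; rewrite /=; lc Eq.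
  split=> //; case: (eqVneq a tau) => at_; last exact: m1.
  rewrite u20 u30 q0 in Eq; last zlia.
  by apply: (mulIf al0); rewrite mul0r; lc Eq.
(* The dimension count in degree [tau]. A vector [v] holds the coefficients of [e1], [e2] and of the
   generators of [c0] of degree [tau]; by [one_dim], lying in [(l, p)] costs at most one dimension.
   [T] records the constants [u] on the generators of [g0] of degree [tau] that are needed to match
   the star of [E v]. Four dimensions against three give a nonzero [v] with [u = 0]. *)
pose j0 : 'I_5 := Ordinal (erefl : (0 < 5)%N); pose j1 : 'I_5 := Ordinal (erefl : (1 < 5)%N).
pose j2 : 'I_5 := Ordinal (erefl : (2 < 5)%N); pose j3 : 'I_5 := Ordinal (erefl : (3 < 5)%N).
pose j4 : 'I_5 := Ordinal (erefl : (4 < 5)%N).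
pose i0 : 'I_3 := Ordinal (erefl : (0 < 3)%N); pose i1 : 'I_3 := Ordinal (erefl : (1 < 3)%N).
pose i2 : 'I_3 := Ordinal (erefl : (2 < 3)%N).
pose ga1 := if a == tau then al else 0; pose ga2 := if b == tau then be else 0.
pose ga3 := if c == tau then ph else 0.
pose ga1' := if a == tau then al1 else 0; pose ga2' := if b == tau then be1 else 0.
pose ga3' := if c == tau then ph1 else 0.
pose A1 := if a < tau then al1 else 0; pose B1 := if b < tau then be1 else 0.
pose E (v : 'rV[k]_5) : R := (v 0 j0)%:MP * e1 + (v 0 j1)%:MP * e2 + (v 0 j2)%:MP * ga1 +
  (v 0 j3)%:MP * ga2 + (v 0 j4)%:MP * ga3.
pose F (v : 'rV[k]_5) (u : 'rV[k]_3) : R := (v 0 j0)%:MP * f1 + (v 0 j1)%:MP * f2 + (u 0 i0)%:MP * ga1' +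
  (u 0 i1)%:MP * ga2' + (u 0 i2)%:MP * ga3'.
(* A generator whose degree is not [tau] leaves a padded slot: its [ga] is 0 and [T] copies the
   coordinate, so that [u = 0] kills it. *)
pose T v u := exists eps1 eps2, [/\ E v = eps1 * l + eps2 * p,
  in2 A1 B1 (F v u - (eps1 * l' + eps2 * p')) & [/\ (a != tau -> u 0 i0 = v 0 j2),
  (b != tau -> u 0 i1 = v 0 j3) & (c != tau -> u 0 i2 = v 0 j4)]].
have ElinD q v w : E (q *: v + w) = q%:MP * E v + E w.
  by rewrite /E !mxE !mpolyCD !mpolyCM; ring.
have Esc q v : E (q *: v) = q%:MP * E v by rewrite /E !mxE !mpolyCM; ring.
have FlinD q v w u u' : F (q *: v + w) (q *: u + u') = q%:MP * F v u + F w u'.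
  by rewrite /F !mxE !mpolyCD !mpolyCM; ring.
have Hga : [/\ hg tau ga1, hg tau ga2 & hg tau ga3].
  by rewrite /ga1 /ga2 /ga3; split; case: eqP => [<-|_] //; apply: hg0.
have Vga : [/\ vin c0 ga1, vin c0 ga2 & vin c0 ga3].
  rewrite /ga1 /ga2 /ga3; split; case: eqP => _; try exact: vin0.
  - exact: in31.
  - exact: in32.
  - exact: in33.
have IE v : I (E v) /\ hg tau (E v).
  have [h1 h2 h3] := Hga; have [v1 v2 v3] := Vga.
  have sc (q : k) f : hg tau f -> hg tau (q%:MP * f) by move=> Hf; apply: (hgM_c (hgC _ q) Hf); rewrite add0r.
  split; last by rewrite /E; do !apply: hgD; apply: sc.
  apply/D1 => g Ig; rewrite /E !mulrDl -!mulrA.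
  have I_e e : I e -> vin c0 (e * g) by move=> Ie; exact: (proj1 (D1 e)).
  by do !apply: vinD; apply: vinM; try (by apply: I_e); apply: vinMr.
have EF v : exch c0 g0 (E v) ((v 0 j0)%:MP * f1 + (v 0 j1)%:MP * f2).
  have [v1 v2 v3] := Vga; rewrite /E -!addrA addrA.
  apply: exch_modc; first by apply: exchD; apply: exchM.
  by do !apply: vinD; apply: vinM.
have [v v0 [eps1 [eps2 [T1 T2 [T3 T4 T5]]]]] : exists2 v, v != 0 & T v 0.
  apply: (@linear_rel_kernel k 3 (fun v => in2 l p (E v))).
  - move=> v w; have [Iv Hv] := IE v; have [Iw Hw] := IE w.
    have [q1 [q2 [nz H]]] := S5 erefl _ _ Iv Iw Hv Hw; exists q1, q2; split=> //.
    by rewrite ElinD Esc.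
  - by move=> q v H; rewrite Esc; apply: in2M.
  - move=> v H; have [_ Hv] := IE v; have [eps1 [eps2 [Ev h1 h2]]] := in2_hg Hv Hl Hp H.
    have Hst := starhg _ _ _ h1 h2.
    have HF : hg tau ((v 0 j0)%:MP * f1 + (v 0 j1)%:MP * f2).
      by apply: hgD; [apply: (hgM_c (hgC _ _) Hf1)|apply: (hgM_c (hgC _ _) Hf2)]; rewrite add0r.
    have H1 : vin g0 (eps1 * l' + eps2 * p' - ((v 0 j0)%:MP * f1 + (v 0 j1)%:MP * f2)).
      have := exch_in rc (exchD (star eps1 eps2) (exchM (-1) (EF v))); rewrite !mulN1r; apply.
      by rewrite Ev subrr; apply: vin0.
    have [w1 [w2 [w3 [Ew Hw1 Hw2 Hw3]]]] := in3_hg (hgB Hst HF) Ha1 Hb1 Hc1 H1.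
    have cst (q : k) (t : int) (w g gg AA : R) : hg (tau - t) w -> gg = (if t == tau then g else 0) ->
       AA = (if t < tau then g else 0) ->
       exists uu : k, (t != tau -> uu = q) /\ exists s, w * g = uu%:MP * gg + s * AA.
      move=> Hw -> ->; case: (ltgtP t tau) => tt.
      - by exists q; split=> //; exists w; ring.
      - by exists q; split=> //; exists 0; rewrite (hg_neg Hw); [ring|zlia].
      - have [|uu Euu] := @hg_const _ _ w; first by apply: (hg_c Hw); zlia.
        by exists uu; split=> //; exists 0; rewrite Euu; ring.
    have c3 : 0 = (if c < tau then ph1 else 0) by rewrite ltNge ct.
    have [uu1 [m1 [s1 Es1]]] := cst (v 0 j2) a w1 al1 ga1' A1 Hw1 erefl erefl.
    have [uu2 [m2 [s2 Es2]]] := cst (v 0 j3) b w2 be1 ga2' B1 Hw2 erefl erefl.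
    have [uu3 [m3 [s3 Es3]]] := cst (v 0 j4) c w3 ph1 ga3' 0 Hw3 erefl c3.
    exists (\row_i nth 0 [:: uu1; uu2; uu3] i), eps1, eps2.
    split=> //; last by split; rewrite mxE.
    exists (- s1), (- s2); rewrite /F !mxE /=.
    by apply: (lcomb (eqM (-1) (eqD (eqD Ew Es1) (eqD Es2 Es3)))); ring.
  - exists 0, 0; split; last by split; rewrite !mxE.
      by rewrite /E !mxE !mpolyC0; ring.
    by exists 0, 0; rewrite /F !mxE !mpolyC0; ring.
  - move=> q v u v' u' [x1 [x2 [X1 [y1 [y2 X2]] [X3 X4 X5]]]] [z1 [z2 [Z1 [y1' [y2' Z2]] [Z3 Z4 Z5]]]].
    exists (q%:MP * x1 + z1), (q%:MP * x2 + z2); split.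
    + by rewrite ElinD X1 Z1; ring.
    + exists (q%:MP * y1 + y1'), (q%:MP * y2 + y2'); rewrite FlinD.
      by lc (eqD (eqM q%:MP X2) Z2).
    + by split=> h; rewrite !mxE ?(X3 h) ?(X4 h) ?(X5 h) ?(Z3 h) ?(Z4 h) ?(Z5 h).
exists (v 0 j0), (v 0 j1).
rewrite !mxE in T3 T4 T5.
have low2 : in2 l' p' (F v 0 - (eps1 * l' + eps2 * p')).
  case: T2 => s1 [s2 ->]; apply: in2D; apply: in2M.
    by rewrite /A1; case: ifP => h; [apply: (H_lp (lowa h))|apply: in2_0].
  by rewrite /B1; case: ifP => h; [apply: (H_lp (lowb h))|apply: in2_0].
have F0 : F v 0 = (v 0 j0)%:MP * f1 + (v 0 j1)%:MP * f2.
  by rewrite /F !mxE !mpolyC0; ring.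
split; last first.
  rewrite -F0; case: low2 => s1 [s2 Es]; exists (s1 + eps1), (s2 + eps2); by lc Es.
case: (eqVneq (v 0 j0) 0) => [z0|]; [right|by left].
apply/eqP=> z1.
have [||||||||k1 k2 k3] := Zker (v 0 j2)%:MP (v 0 j3)%:MP (v 0 j4)%:MP eps1 eps2; try exact: hgC.
- by move=> h; rewrite -(T3 h) mpolyC0.
- by move=> h; rewrite -(T4 h) mpolyC0.
- by move=> h; rewrite -(T5 h) mpolyC0.
- rewrite -T1 /E z0 z1 !mpolyC0 !mul0r !add0r /ga1 /ga2 /ga3.
  congr (_ + _ + _); case: eqP => //= /eqP h; rewrite -?(T3 h) -?(T4 h) -?(T5 h) ?mpolyC0; ring.
- case: T2 => s1 [s2 Es]; exists (- s1), (- s2); rewrite -/A1 -/B1.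
  rewrite F0 z0 z1 !mpolyC0 in Es; by lc Es.
case/eqP: v0; apply/rowP=> i; rewrite mxE.
have inj0 (q : k) : q%:MP = 0 :> R -> q = 0 by move=> h; apply/eqP; rewrite -(mpolyC_eq0 N) h.
case: i => [[|[|[|[|[|m]]]]] Hi] //.
- by rewrite -z0; congr (v 0 _); apply: val_inj.
- by rewrite -z1; congr (v 0 _); apply: val_inj.
- by rewrite -(inj0 _ k1); congr (v 0 _); apply: val_inj.
- by rewrite -(inj0 _ k2); congr (v 0 _); apply: val_inj.
- by rewrite -(inj0 _ k3); congr (v 0 _); apply: val_inj.
Qed.

End S1.

(** * Duality for [(l, p)] and for the Hilbert-Burch ideal [(x l, l2 l, p)] *)

Section HilbertBurchDuality.
Variable R : idomainType.
Implicit Types e l p : R.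

(** When [e] multiplies [al1] and [be1] into [(al, be)], the comparison for triples reduces to that
    for pairs, applied to the coefficient [Z] of [ph] in [e * ph1]. *)
Lemma exch_of_exch2 (al be ph al1 be1 ph1 e Z e' : R) : reg2 al be -> be != 0 ->
  in2 al be (e * al1) -> in2 al be (e * be1) ->
  (exists X Y, e * ph1 = X * al + Y * be + Z * ph) -> exch2 al be al1 be1 Z e' ->
  exch (al, be, ph) (al1, be1, ph1) e e'.
Proof.
move=> r2 b0 [P1 [Q1 E1]] [P2 [Q2 E2]] [X [Y E3]] [p1 [q1 [p2 [q2 [F1 F2 F3 F4]]]]].
have [|eh [G1 G2]] := @reg2_syz _ al be (al1 * P2 - be1 * P1) (al1 * Q2 - be1 * Q1) r2.
  by lc (eqD (eqM be1 E1) (eqM (- al1) E2)).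
have [|m1 [M1 M2]] := @reg2_syz _ al be (al1 * X - ph1 * P1 + ph * p1) (al1 * Y - ph1 * Q1 + ph * q1) r2.
  by lc (eqD (eqD (eqM (- al1) E3) (eqM ph1 E1)) (eqM (- ph) F1)).
have [|m2 [N1 N2]] := @reg2_syz _ al be (be1 * X - ph1 * P2 + ph * p2) (be1 * Y - ph1 * Q2 + ph * q2) r2.
  by lc (eqD (eqD (eqM (- be1) E3) (eqM ph1 E2)) (eqM (- ph) F2)).
exists (P1, Q1, 0), (P2, Q2, 0), (X, Y, Z), (0, 0, eh), (- q1, p1, m1), (- q2, p2, m2).
rewrite /dot /cross /vlin /vadd /vsc /=; split; [split|split|].
- by lc E1.
- by lc E2.
- by lc E3.
- by apply: veq; [lc G1|lc G2|ring].
- by apply: veq; [lc M1|lc M2|lc F1].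
- by apply: veq; [lc N1|lc N2|lc F2].
- apply: veq; [by lc F4|by lc F3|apply: (mulIf b0)].
  by apply: (lcomb (eqD (eqD (eqM (- al1) N1) (eqM be1 M1)) (eqD (eqM (- ph1) G1) (eqM ph F3)))); ring.
Qed.

(** With [kill_lp] this is the classical equality of [(l, p)] with the colon of [(al, be)] by the
    determinant that expresses [al], [be] through [l], [p]. *)
Lemma dual_lp (l p al be al0 C1 be0 C2 e : R) : al = al0 * l + C1 * p -> be = be0 * l + C2 * p ->
  reg2 al be -> in2 al be (e * (al0 * C2 - be0 * C1)) -> in2 l p e.
Proof.
move=> Ea Eb r2 [P [Q E]].
have [|X [X1 X2]] := @reg2_syz _ al be (e * C2 - l * P) (- e * C1 - l * Q) r2.
  by apply: (lcomb (eqM l E)); rewrite Ea Eb; ring.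
have [|Y [Y1 Y2]] := @reg2_syz _ al be (- e * be0 - p * P) (e * al0 - p * Q) r2.
  by apply: (lcomb (eqM p E)); rewrite Ea Eb; ring.
exists (- Y), X; apply: (mulIf (proj1 r2)).
by apply: (lcomb (eqD (eqD (eqM l Y2) (eqM (- p) X2)) (eqM e Ea))); ring.
Qed.

Lemma kill_lp (l p al be al0 C1 be0 C2 e : R) : al = al0 * l + C1 * p -> be = be0 * l + C2 * p ->
  in2 l p e -> in2 al be ((al0 * C2 - be0 * C1) * e).
Proof.
move=> -> -> [s [t ->]]; exists (s * C2 - t * be0), (t * al0 - s * C1); ring.
Qed.

(** For [p = x B - l2 A] the forms [x l], [l2 l], [p] are the maximal minors of the rows
    [(x, l2, 0)] and [(A, B, l)]. Completing the coefficient rows of [al] and [be] by the syzygy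
    [(B, -A, -l)] gives the determinant [hb_v], and by [(l2, -x, 0)] the form [u] below. As in a
    mapping cone, these two describe the ideal linked along [(al, be)]. *)
Definition hb_v (l A B A1 B1 C1 A2 B2 C2 : R) : R :=
  (B1 * C2 - C1 * B2) * B - (C1 * A2 - A1 * C2) * A - (A1 * B2 - B1 * A2) * l.

Section HB.
Variables (x l l2 p A B al be A1 B1 C1 A2 B2 C2 : R).
Hypotheses (Ep : p = x * B - l2 * A) (Ea : al = A1 * (x * l) + B1 * (l2 * l) + C1 * p)
  (Eb : be = A2 * (x * l) + B2 * (l2 * l) + C2 * p).
Let u := (A1 * x + B1 * l2) * C2 - (A2 * x + B2 * l2) * C1.
Let v := hb_v l A B A1 B1 C1 A2 B2 C2.

Let I1 : al * A2 - be * A1 = v * l2 - u * B.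
Proof. by rewrite Ea Eb Ep /v /u /hb_v; ring. Qed.
Let I2 : al * B2 - be * B1 = - v * x + u * A.
Proof. by rewrite Ea Eb Ep /v /u /hb_v; ring. Qed.
Let I3 : al * C2 - be * C1 = u * l.
Proof. by rewrite Ea Eb Ep /v /u /hb_v; ring. Qed.

Lemma hb_kill e : in3 (x * l) (l2 * l) p e -> in2 al be (v * e).
Proof.
move=> [s [t [r ->]]].
exists (s * (A * C2 - l * B2) + t * (l * A2 + B * C2) - r * (B * B2 + A * A2)),
  (s * (- A * C1 + l * B1) + t * (- l * A1 - B * C1) + r * (B * B1 + A * A1)).
apply: (lcomb (eqD (eqD (eqM (s * l) I2) (eqM (- s * A) I3)) (eqD (eqD (eqM (- t * l) I1) (eqM (- t * B) I3))
  (eqD (eqM (r * B) I2) (eqM (r * A) I1))))).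
by rewrite {1}Ep; ring.
Qed.

Lemma hb_dual e : reg2 al be -> in2 al be (e * u) -> in2 al be (e * v) -> in3 (x * l) (l2 * l) p e.
Proof.
move=> r2 [P [Q E]] [P' [Q' E']].
have [|X1 [_ X1']] := @reg2_syz _ al be (e * A2 - P' * l2 + P * B) (- e * A1 - Q' * l2 + Q * B) r2.
  by apply: (lcomb (eqD (eqM e I1) (eqD (eqM l2 E') (eqM (- B) E)))); ring.
have [|X2 [_ X2']] := @reg2_syz _ al be (e * B2 + P' * x - P * A) (- e * B1 + Q' * x - Q * A) r2.
  by apply: (lcomb (eqD (eqM e I2) (eqD (eqM (- x) E') (eqM A E)))); ring.
have [|X3 [_ X3']] := @reg2_syz _ al be (e * C2 - P * l) (- e * C1 - Q * l) r2.
  by apply: (lcomb (eqD (eqM e I3) (eqM l E))); ring.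
exists X1, X2, X3; apply: (mulIf (proj1 r2)).
apply: (lcomb (eqD (eqM e Ea) (eqD (eqM (- (x * l)) X1') (eqD (eqM (- (l2 * l)) X2') (eqM (- p) X3'))))).
by rewrite Ep; ring.
Qed.

End HB.
End HilbertBurchDuality.

(** * Double links with [a > n] and [a + b <= 2n + 7] *)

Section QStep.
Variables (k : fieldType) (N : nat).
Local Notation R := {mpoly k[N]}.

(** Both [a] and [b] are at most [n + 6 < 2n + 4], so [al] and [be] lie in [(x l, l2 l, p)]. As
    [ph1] may be beyond the bound of [R2], residues are compared along the pairs, and [ph1] acts
    through the coefficient of [ph], which duality keeps in the same ideal. This may replace [x] by
    another member [y] of the pencil [(x, l2)]. *)
Lemma qstep n a b c a1 b1 c1 (I I1 I2 : R -> Prop) (x l l2 p al be ph al1 be1 ph1 : R) :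
  4 <= n -> S1 n I x l l2 p ->
  ci (a, b, c) (al, be, ph) -> ci (a1, b1, c1) (al1, be1, ph1) ->
  n + 1 <= a -> a + b <= 2 * n + 7 -> a <= b -> b <= c -> a1 <= b1 -> b1 <= c1 ->
  a1 <= a -> b1 <= b -> c1 <= c ->
  linked (al, be, ph) I I1 -> linked (al1, be1, ph1) I1 I2 ->
  exists y l' l2' p', S1 n I2 y l' l2' p'.
Proof.
move=> n4 HS1 C0 C1 an abn ab bc ab1 bc1 aa bb cc L0 L1.
case: (HS1) => HS Hl2 pin PH; have [cI cI1] := linked_csub L0; have [gI1 gI2] := linked_csub L1.
have [bn ct] := S2_bc HS n4 ltac:(zlia) C0 cI ab bc.
case: (HS) => -[Hx x0 Hl l0] [Hp lp] [Ixl Ixp] [P0 P] [S5 R2H].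
have [Ia Ib Ic] := cI; case: (C0) => rc [/= Ha Hb Hc] n1; case: (C1) => rg [/= Ha1 Hb1 Hc1] _.
have [D1 D2] := L0; have [D3 D4] := L1.
set c0 := (al, be, ph) in C0 L0 cI cI1 rc D1 D2 n1 *.
set g0 := (al1, be1, ph1) in C1 L1 gI1 gI2 rg D3 D4 *.
have Rt g d : I1 g -> hg d g -> d < a + b + c - (n + n + 7) -> vin c0 (l * g) /\ vin c0 (p * g).
  by move=> Ig Hg Hd; apply: (R2H _ _ C0 cI g d) => //; apply/D2.
have [Ia1 Ib1 Ic1] := gI1; rewrite /= in Ia1 Ib1 Ic1.
have r2 : reg2 al be by case: rc.
have r3 w : in2 al be (w * ph) -> in2 al be w by case: rc => _; apply.
have al0 : al != 0 by case: r2.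
have be0 : be != 0.
  apply/eqP=> z; apply: n1; have [|w E] := (proj2 r2) 1; first by rewrite z mulr0; apply: in1_0.
  by exists w, 0, 0; rewrite E /=; ring.
have Hxl : hg 2 (x * l) by apply: (hgM_c Hx Hl).
have xl0 : x * l != 0 by rewrite mulf_neq0.
have low0 d f : hg d f -> d < a -> in2 al be f -> f = 0.
  by move=> Hf da If; apply: (in3_low0 Hf Ha Hb Hc) => //; try zlia; apply: in2_in3.
have [B [A' Ep0]] := pin; pose A := - A'.
have Ep : p = x * B - l2 * A by rewrite Ep0 /A; ring.
have [A1 [B1 [C1_ Ea]]] := PH _ _ Ia Ha ltac:(zlia).
have [A2 [B2 [C2_ Eb]]] := PH _ _ Ib Hb ltac:(zlia).
rewrite /= in Ea Eb.
pose al_ := A1 * x + B1 * l2; pose be_ := A2 * x + B2 * l2.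
have Ea' : al = al_ * l + C1_ * p by rewrite Ea /al_; ring.
have Eb' : be = be_ * l + C2_ * p by rewrite Eb /be_; ring.
pose u := al_ * C2_ - be_ * C1_.
pose v := hb_v l A B A1 B1 C1_ A2 B2 C2_.
(* [u] and [v] multiply [e] into [(al, be)], so they multiply [Z * ph] into it; [ph] is regular
   there, and duality applies to [Z]. *)
have ZH g e X Y Z : I1 g -> in3 (x * l) (l2 * l) p e -> g * e = X * al + Y * be + Z * ph ->
    in3 (x * l) (l2 * l) p Z.
  move=> Ig He E; apply: (hb_dual Ep Ea Eb r2); apply: r3.
    have [s [t Es]] : in2 al be (u * e) := kill_lp Ea' Eb' (H_lp He).
    change (in2 al be (Z * u * ph)).
    by exists (g * s - u * X), (g * t - u * Y); lc (eqD (eqM g Es) (eqM (- u) E)).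
  have [s [t Es]] : in2 al be (v * e) := hb_kill Ep Ea Eb He.
  change (in2 al be (Z * v * ph)).
  by exists (g * s - v * X), (g * t - v * Y); lc (eqD (eqM g Es) (eqM (- v) E)).
have Zlp g e X Y Z : in2 l p e -> g * e = X * al + Y * be + Z * ph -> in2 l p Z.
  move=> He E; apply: (dual_lp Ea' Eb' r2); apply: r3.
  have [s [t Es]] : in2 al be (u * e) := kill_lp Ea' Eb' He.
  change (in2 al be (Z * u * ph)).
  by exists (g * s - u * X), (g * t - u * Y); lc (eqD (eqM g Es) (eqM (- u) E)).
have xlH : in3 (x * l) (l2 * l) p (x * l) by exact: in31.
have H_low d f : hg d f -> d <= 1 -> in3 (x * l) (l2 * l) p f -> f = 0.
  by move=> Hf Hd; apply: (in3_low0 Hf Hxl (hgM Hl2 Hl) Hp); zlia.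
have xlnot : ~ in2 al be (x * l).
  by move=> H; have := low0 _ _ Hxl ltac:(zlia) H; apply/eqP.
have lowxl g d : I1 g -> hg d g -> d < c -> in2 al be ((x * l) * g).
  move=> Ig Hg Hd; have H : vin c0 (g * (x * l)) by exact: (proj1 (D2 g)).
  have [X [Y [Z [E _ _ HZ]]]] := in3_hg (hgM Hg Hxl) Ha Hb Hc H.
  have Z0 : Z = 0 by apply: (H_low _ _ HZ); [zlia|apply: (ZH _ _ _ _ _ Ig xlH E)].
  by exists X, Y; rewrite mulrC E Z0; ring.
(* Otherwise the three new generators have degree below [c]; [x * l] multiplies each into
   [(al, be)], hence lies there itself, against its degree. *)
have c1c : c1 = c.
  case: (eqVneq c1 c) => // ne; case: xlnot; apply: (reg3_colon_reg2 r2 rg).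
  - by apply: (lowxl _ a1) => //; zlia.
  - by apply: (lowxl _ b1) => //; zlia.
  - by apply: (lowxl _ c1) => //; zlia.
have noph : ~ in2 l p ph.
  move=> H; case: (hg_pos_no1_2 Hl Hp) => //; first zlia.
  by apply: (three_in2 (reg2_lin Hl l0 lp) rc) => //; [exists al_, C1_|exists be_, C2_].
have killlp g d : I1 g -> hg d g -> d < a + b + c - (n + n + 7) -> d < c ->
    in2 al be (l * g) /\ in2 al be (p * g).
  move=> Ig Hg Hd Hdc; have [h1 h2] := Rt g d Ig Hg Hd.
  have hl : in2 al be (l * g).
    have [X [Y [Z [E _ _ HZ]]]] := in3_hg (hgM Hl Hg) Ha Hb Hc h1.
    have [Z0|Z0] := eqVneq Z 0; first by exists X, Y; rewrite E Z0; ring.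
    have [w [_ Ew]] := nz_mul_const 0 HZ ltac:(zlia) Z0.
    case: noph; exists (w * (g - X * al_ - Y * be_)), (- w * (X * C1_ + Y * C2_)).
    transitivity ((w * Z) * ph); first by rewrite Ew mul1r.
    by rewrite Ea' Eb' in E; lc (eqM w E).
  split=> //; have [X [Y [Z [E _ _ HZ]]]] := in3_hg (hgM Hp Hg) Ha Hb Hc h2.
  suff Z0 : Z = 0 by exists X, Y; rewrite E Z0; ring.
  apply: (mulfI l0); rewrite mulr0.
  apply: (low0 (1 + (n + d - c))); [exact: hgM|zlia|apply: r3].
  case: hl => s [t Es]; exists (p * s - l * X), (p * t - l * Y).
  by apply: (lcomb (eqD (eqM p Es) (eqM (- l) E))); ring.
have [la1 pa1] := killlp _ _ Ia1 Ha1 ltac:(zlia) ltac:(zlia).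
have [lb1 pb1] := killlp _ _ Ib1 Hb1 ltac:(zlia) ltac:(zlia).
have [l' Hl'_ El] := exch2_hg l Ha Hb Ha1 Hb1 Hl r2 be0 la1 lb1.
have [p' Hp'_ Epp] := exch2_hg p Ha Hb Ha1 Hb1 Hp r2 be0 pa1 pb1.
have r2g : reg2 al1 be1 by case: rg.
have star e1 e2 : exch2 al be al1 be1 (e1 * l + e2 * p) (e1 * l' + e2 * p').
  by apply: exch2D; apply: exch2M.
have l'0 : l' != 0.
  apply/eqP=> z; have := exch2_out r2g El; rewrite z => /(_ (in2_0 _ _)) /(low0 _ _ Hl) -/(_ ltac:(zlia)).
  by move/eqP; rewrite (negbTE l0).
have npl h (d : int) : hg d h -> d = n - 1 -> ~ in2 al1 be1 (p' - h * l').
  move=> Hh dn H; apply: lp; exists h; apply/eqP; rewrite -subr_eq0; apply/eqP.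
  apply: (low0 n); [by apply: hgB => //; apply: (hgM_c Hh Hl); zlia|zlia|].
  have := exch2_out r2g (star (- h) 1); rewrite (_ : - h * l' + 1 * p' = p' - h * l'); last ring.
  by rewrite (_ : - h * l + 1 * p = p - h * l); [apply|ring].
have dl0 : a1 = a /\ b1 = b.
  have := hg_ge0 Hl'_ l'0; case: (eqVneq (a + b) (a1 + b1 + 1)) => [d1 _|]; last by zlia.
  have [w [Hw Ew]] := nz_mul_const 0 Hl'_ ltac:(zlia) l'0.
  case: (npl (p' * w) (n - 1)) => //.
    by apply: (hgM_c Hp'_ Hw); zlia.
  by rewrite -mulrA Ew mulr1 subrr; apply: in2_0.
case: dl0 => E1 E2; subst a1 b1 c1.
have Hl' : hg 1 l' by apply: (hg_c Hl'_); zlia.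
have Hp' : hg n p' by apply: (hg_c Hp'_); zlia.
have lp' : ~ in1 l' p'.
  move=> /(in1_hg Hp' Hl') [h Hh E]; apply: (npl h (n - 1)) => //.
  by rewrite E subrr; apply: in2_0.
have albe : ~ in1 al be.
  move=> H; case: n1; have [|w E] := (proj2 r2) 1; first by rewrite mul1r.
  by exists w, 0, 0; rewrite E /=; ring.
have starin e1 e2 : in2 al be (e1 * l + e2 * p) -> in2 al1 be1 (e1 * l' + e2 * p').
  exact: (exch2_in r2 be0 (star _ _)).
pose Dl := l * p' - l' * p.
have HDl : hg (n + 1) Dl by apply: hgB; [apply: (hgM_c Hl Hp')|apply: (hgM_c Hl' Hp)]; zlia.
have DC0 : in2 al be Dl.
  apply: (exch2_out (e' := p' * l' + - l' * p') r2g).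
    by have := star p' (- l'); rewrite (_ : p' * l + - l' * p = Dl) //; rewrite /Dl; ring.
  by rewrite (_ : _ + _ = 0); [apply: in2_0|ring].
have DC1 : in2 al1 be1 Dl.
  rewrite (_ : Dl = - p * l' + l * p'); last by rewrite /Dl; ring.
  by apply: starin; rewrite (_ : _ + _ = 0); [apply: in2_0|ring].
have [p'in [lowa lowb]] : in2 x l2 p' /\ in3 (x * l') (l2 * l') p' al1 /\ in3 (x * l') (l2 * l') p' be1.
  apply: (@low_gens _ _ x l l2 p l' p' al be al1 be1 a b n) => //.
  - by move=> f0 C d _ _; apply: starin.
  - by exists A1, B1, C1_.
  - by exists A2, B2, C2_.
  - move=> nz; suff -> : a = n + 1 by exact: HDl.
    case: (ltP (n + 1) a) => h; last zlia.
    by move: nz; rewrite -/Dl (low0 _ _ HDl h DC0) eqxx.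
have Eex e d : I e -> hg d e -> exists X Y Z, ph1 * e = X * al + Y * be + Z * ph /\ hg d Z.
  move=> Ie He; have H : vin c0 (ph1 * e) by exact: (proj1 (D2 ph1)).
  have [X [Y [Z [E _ _ HZ]]]] := in3_hg (hgM Hc1 He) Ha Hb Hc H.
  by exists X, Y, Z; split=> //; apply: (hg_c HZ); zlia.
have part e X Y e1 e2 : in2 l p e -> ph1 * e = X * al + Y * be + (e1 * l + e2 * p) * ph ->
    exch c0 g0 e (e1 * l' + e2 * p').
  move=> [s [t Ee]] E; apply: (@exch_of_exch2 _ _ _ _ _ _ _ _ (e1 * l + e2 * p)) => //.
  - by rewrite Ee mulrDl -!mulrA; apply: in2D; apply: in2M.
  - by rewrite Ee mulrDl -!mulrA; apply: in2D; apply: in2M.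
  - by exists X, Y; rewrite mulrC.
have [X1 [Y1 [Z1 [EZ1 HZ1]]]] := Eex _ _ Ixl Hxl.
have [y1 [y2 [y3 [EZ1' Hy1 Hy2 Hy3]]]] := in3_hg HZ1 Hxl (hgM Hl2 Hl) Hp (ZH _ _ _ _ _ Ic1 xlH EZ1).
have y30 : y3 = 0 by apply: (hg_neg Hy3); zlia.
(* The coefficient of [ph] in [ph1 * (x * l)] has degree 2, too low for [p], so it is a multiple of
   [l] by a form of the pencil. *)
pose y := y1 * x + y2 * l2.
have EZy : Z1 = y * l by rewrite EZ1' y30 /y; ring.
have Hy : hg 1 y by apply: hgD; [apply: (hgM_c Hy1 Hx)|apply: (hgM_c Hy2 Hl2)]; zlia.
have y0 : y != 0.
  apply/eqP=> z; apply: xlnot; apply: (reg3_colon_reg2 r2 rg).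
  - by rewrite /= -mulrA; apply: in2M.
  - by rewrite /= -mulrA; apply: in2M.
  - by exists X1, Y1; rewrite /= mulrC EZ1 EZy z; ring.
have Hxp : hg (n + 1) (x * p) by apply: (hgM_c Hx Hp); zlia.
have [X2 [Y2 [Z2 [EZ2 HZ2]]]] := Eex _ _ Ixp Hxp.
(* Modulo [(al, be)] the difference [rho] is killed by [l] and by the coefficients of [p] in [al]
   and [be]. In [l * rho = s * al + t * be], duality puts [s] and [t] in [(l, p)], their degrees
   make them multiples of [l], and [l] cancels. *)
have [P1 [Q1 Erho]] : in2 al be (Z2 - y * p).
  set rho := Z2 - y * p.
  have Hrho : hg (n + 1) rho by apply: hgB => //; apply: (hgM_c Hy Hp); zlia.
  have lrho : in2 al be (l * rho).
    apply: r3; exists (p * X1 - l * X2), (p * Y1 - l * Y2).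
    by rewrite /rho; rewrite EZy in EZ1; apply: (lcomb (eqD (eqM p EZ1) (eqM (- l) EZ2))); ring.
  have [s [t [Es Hs Ht]]] := in2_hg (hgM Hl Hrho) Ha Hb lrho.
  have c1rho : in2 al be (C1_ * rho).
    apply: r3; exists (x * ph1 - al_ * X1 - C1_ * X2 - y * ph), (- al_ * Y1 - C1_ * Y2).
    rewrite /rho; rewrite EZy in EZ1.
    by apply: (lcomb (eqD (eqD (eqM (- al_) EZ1) (eqM (- C1_) EZ2)) (eqM (x * ph1 - y * ph) (esym Ea')))); ring.
  have c2rho : in2 al be (C2_ * rho).
    apply: r3; exists (- be_ * X1 - C2_ * X2), (x * ph1 - be_ * Y1 - C2_ * Y2 - y * ph).
    rewrite /rho; rewrite EZy in EZ1.
    by apply: (lcomb (eqD (eqD (eqM (- be_) EZ1) (eqM (- C2_) EZ2)) (eqM (x * ph1 - y * ph) (esym Eb')))); ring.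
  have [|m [Em Em']] := @reg2_syz _ l p (rho - s * al_ - t * be_) (- s * C1_ - t * C2_) (reg2_lin Hl l0 lp).
    by rewrite Ea' Eb' in Es; lc Es.
  have tu : in2 al be (t * u).
    rewrite (_ : t * u = m * al - C1_ * rho); last first.
      by rewrite Ea' /u; apply: (lcomb (eqD (eqM C1_ Em) (eqM (- al_) Em'))); ring.
    by apply: in2B => //; exists m, 0; ring.
  have su : in2 al be (s * u).
    rewrite (_ : s * u = C2_ * rho - m * be); last first.
      by rewrite Eb' /u; apply: (lcomb (eqD (eqM (- C2_) Em) (eqM be_ Em'))); ring.
    by apply: in2B => //; exists 0, m; ring.
  have [s' Es'] := in2_low Hs Hl Hp ltac:(zlia) (dual_lp Ea' Eb' r2 su).
  have [t' Et'] := in2_low Ht Hl Hp ltac:(zlia) (dual_lp Ea' Eb' r2 tu).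
  by exists s', t'; apply: (mulfI l0); rewrite Es Es' Et'; ring.
have exl : exch c0 g0 (x * l) (y * l').
  have := @part (x * l) X1 Y1 y 0; rewrite !mul0r !addr0; apply; last by rewrite -EZy.
  by exists x, 0; ring.
have exp_ : exch c0 g0 (x * p) (y * p').
  have := @part (x * p) (X2 + P1 * ph) (Y2 + Q1 * ph) 0 y; rewrite !mul0r !add0r; apply.
    by exists 0, x; ring.
  by apply: (lcomb (eqD EZ2 (eqM ph Erho))); ring.
have bwd f m : I2 f -> hg m f -> exists e, [/\ hg m e, exch c0 g0 e f & I e].
  move=> If Hf; have [e [He Ee Ie]] := colon_exch C1 C0 cI1 ((proj1 (D4 f)) If) Hf.
  exists e; split; [|exact: exch_sym|by apply/D1].
  by apply: (hg_c He); rewrite /tot /=; zlia.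
have diffC1 e f f' : exch c0 g0 e f -> exch c0 g0 e f' -> vin g0 (f - f').
  move=> h1 h2; have := exch_in rc (exchD h1 (exchM (-1) h2)); rewrite !mulN1r subrr; apply.
  exact: vin0.
have PH' f d : I2 f -> hg d f -> d < 2 * n + 4 -> in3 (x * l') (l2 * l') p' f.
  move=> If Hf Hd; have [e [He Ee Ie]] := bwd _ _ If Hf.
  have eH := PH _ _ Ie He Hd; have [X [Y [Z [EZ HZ]]]] := Eex _ _ Ie He.
  have [f0 [C [E f0in Hf0 HC]]] := Hsplit_hg Hx Hl Hl2 Hp HZ (ZH _ _ _ _ _ Ic1 eH EZ).
  rewrite E in EZ; have H := diffC1 _ _ _ Ee (part _ _ _ _ _ (H_lp eH) EZ).
  have Hst : hg d (f0 * l' + C * p') by apply: hgD; [apply: (hgM_c Hf0 Hl')|apply: (hgM_c HC Hp')]; zlia.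
  have [s [t E']] := in3_low2 (hgB Hf Hst) Ha1 Hb1 Hc1 ltac:(zlia) H.
  rewrite (_ : f = (f0 * l' + C * p') + s * al1 + t * be1); last by lc E'.
  by apply: in3D; first apply: in3D; [apply: Hjoin|apply: in3M|apply: in3M].
have [l2' [Hl2' sub]] : exists l2', hg 1 l2' /\ forall f, in2 x l2 f -> in2 y l2' f.
  have [z|y10] := eqVneq y1 0.
    exists x; split=> // f [s [t ->]].
    have y20 : y2 != 0 by apply: contra_neq y0 => z2; rewrite /y z z2; ring.
    have [w [_ Ew]] := nz_mul_const 0 Hy2 ltac:(zlia) y20.
    exists (t * w), s; rewrite /y z; transitivity (s * x + t * (w * y2) * l2); last ring.
    by rewrite Ew; ring.
  exists l2; split=> // f [s [t ->]].
  have [w [_ Ew]] := nz_mul_const 0 Hy1 ltac:(zlia) y10.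
  exists (s * w), (t - s * w * y2); rewrite /y; transitivity (s * (w * y1) * x + t * l2); last ring.
  by rewrite Ew; ring.
have subH f : in3 (x * l') (l2 * l') p' f -> in3 (y * l') (l2' * l') p' f.
  by move=> /Hsplit [f0 [C [-> h]]]; apply: Hjoin; apply: sub.
exists y, l', l2', p'; split=> //; first last.
- by move=> f d If Hf Hd; apply: subH; apply: PH' Hd.
- exact: sub.
have starlp f m : I2 f -> hg m f -> forall e s, I e -> hg m e -> exch c0 g0 e f -> hg m s -> vin c0 s -> in2 l p (e - s) ->
   exists F w, [/\ in2 l' p' F, f = F + w * ph1 & hg (m - c) w].
  move=> If Hf e s Ie He Ee Hs Is Hlp.
  have Ies : I (e - s).
    apply/D1 => g Ig; rewrite mulrBl; apply: vinB; first exact: (proj1 (D1 e)).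
    exact: vinMr.
  have [X [Y [Z [EZ HZ]]]] := Eex _ _ Ies (hgB He Hs).
  have [e1 [e2 [EZ' h1 h2]]] := in2_hg HZ Hl Hp (Zlp _ _ _ _ _ Hlp EZ).
  rewrite EZ' in EZ.
  have H := diffC1 _ _ _ (exch_modc Ee (vinN Is)) (part _ _ _ _ _ Hlp EZ).
  have Hst : hg m (e1 * l' + e2 * p') by apply: hgD; [apply: (hgM_c h1 Hl')|apply: (hgM_c h2 Hp')]; zlia.
  have [w1 [w2 [w3 [E' _ _ Hw]]]] := in3_hg (hgB Hf Hst) Ha1 Hb1 Hc1 H.
  exists (e1 * l' + e2 * p' + w1 * al1 + w2 * be1), w3; split=> //; last by lc E'.
  apply: in2D; first apply: in2D; first by exists e1, e2.
    by apply: in2M; apply: H_lp lowa.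
  by apply: in2M; apply: H_lp lowb.
split=> //.
- split; apply/D4 => g Ig; rewrite mulrC.
    by apply/(exch_vin g rc rg exl); exact: (proj1 (D2 g)).
  by apply/(exch_vin g rc rg exp_); exact: (proj1 (D2 g)).
- split; last by move=> f d If Hf Hd; apply: H_lp; apply: PH' Hd.
  move=> f d If Hf Hd; have [e [He Ee Ie]] := bwd _ _ If Hf.
  have [h Eh] := P0 _ _ Ie He Hd.
  exists h; apply/eqP; rewrite -subr_eq0; apply/eqP.
  rewrite Eh in Ee; have H := diffC1 _ _ _ Ee (exchM h exl).
  have Hh : hg (d - 2) h by apply: (hg_div _ Hxl xl0); rewrite -Eh.
  apply: (in3_low0 (d := d) _ Ha1 Hb1 Hc1 _ _ _ H); try zlia.
  by apply: hgB => //; apply: (hgM_c Hh (hgM Hy Hl')); zlia.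
split; last first.
  move=> t cv Ct Cs; apply: (R2_indep C1 Ct gI2) => g d Ig Hg Hd.
  have {}Ig : I1 g by apply/D3.
  have Hd' : d < a + b + c - (n + n + 7) by rewrite /tot /= in Hd; zlia.
  have [h1 h2] := killlp g d Ig Hg Hd' ltac:(zlia).
  split; rewrite mulrC; apply: in2_in3.
    by apply: (exch2_in r2 be0 (exch2M g El)); rewrite mulrC.
  by apply: (exch2_in r2 be0 (exch2M g Epp)); rewrite mulrC.
move=> _ f1 f2 If1 If2 Hf1 Hf2.
have [e1 [He1 Ee1 Ie1]] := bwd _ _ If1 Hf1; have [e2 [He2 Ee2 Ie2]] := bwd _ _ If2 Hf2.
(* If [c > 2n + 4], [ph1] does not occur in this degree and the dependence comes from [I]. If
   [c = 2n + 4], [ph] represents the one dimension modulo [(l, p)], and the coefficients of [ph1]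
   are constants. *)
case: (eqVneq c (2 * n + 4)) => [ct'|cne]; last first.
  have [q1 [q2 [nz H]]] := S5 erefl _ _ Ie1 Ie2 He1 He2.
  exists q1, q2; split=> //.
  have sc (q : k) f : hg (2 * n + 4) f -> hg (2 * n + 4) (q%:MP * f :> R).
    by move=> Hf; apply: (hgM_c (hgC _ q) Hf); rewrite add0r.
  have IDM e e' h h' : I e -> I e' -> I (h * e + h' * e').
    move=> Ie Ie'; apply/D1 => g Ig; rewrite mulrDl -!mulrA.
    by apply: vinD; apply: vinM; [exact: (proj1 (D1 e))|exact: (proj1 (D1 e'))].
  have I2DM e e' h h' : I2 e -> I2 e' -> I2 (h * e + h' * e').
    move=> Ie Ie'; apply/D4 => g Ig; rewrite mulrDl -!mulrA.
    by apply: vinD; apply: vinM; [exact: (proj1 (D4 e))|exact: (proj1 (D4 e'))].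
  have [||||||||F [w [hF -> Hw]]] := @starlp (q1%:MP * f1 + q2%:MP * f2) (2 * n + 4) _ _ (q1%:MP * e1 + q2%:MP * e2) 0.
  - exact: I2DM.
  - by apply: hgD; apply: sc.
  - exact: IDM.
  - by apply: hgD; apply: sc.
  - by apply: exchD; apply: exchM.
  - exact: hg0.
  - exact: vin0.
  - by rewrite subr0.
  by rewrite (hg_neg Hw) ?mul0r ?addr0 //; zlia.
have Hph : hg (2 * n + 4) ph by rewrite -ct'.
have rep e : I e -> hg (2 * n + 4) e -> exists s, [/\ hg (2 * n + 4) s, vin c0 s & in2 l p (e - s)].
  move=> Ie He; have [q1 [q2 [nz H]]] := S5 erefl _ _ Ie Ic He Hph; rewrite /= in H.
  have q10 : q1 != 0.
    apply/eqP=> z; rewrite z mpolyC0 mul0r add0r eqxx in nz H; apply: noph; case: nz => // q20.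
    by have := in2M (q2^-1)%:MP H; rewrite mulrA -mpolyCM mulVf // mpolyC1 mul1r.
  exists (- (q1^-1 * q2)%:MP * ph); split.
  - by rewrite mulNr; apply: hgN; apply: (hgM_c (hgC _ _) Hph); rewrite add0r.
  - by apply: vinM; apply: in33.
  - rewrite mulNr opprK; have := in2M (q1^-1)%:MP H.
    by rewrite mulrDr !mulrA -!mpolyCM mulVf // mpolyC1 mul1r.
have [s1 [Hs1 Is1 Ls1]] := rep _ Ie1 He1; have [s2 [Hs2 Is2 Ls2]] := rep _ Ie2 He2.
have [F1 [w1 [hF1 E1 Hw1]]] := starlp _ _ If1 Hf1 _ _ Ie1 He1 Ee1 Hs1 Is1 Ls1.
have [F2 [w2 [hF2 E2 Hw2]]] := starlp _ _ If2 Hf2 _ _ Ie2 He2 Ee2 Hs2 Is2 Ls2.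
have [||q1 [q2 [nz E0]]] := @const_dep _ _ w1 w2; try by [apply: (hg_c Hw1); zlia|apply: (hg_c Hw2); zlia].
exists q1, q2; split=> //.
rewrite E1 E2 (_ : _ + _ = q1%:MP * F1 + q2%:MP * F2 + (q1%:MP * w1 + q2%:MP * w2) * ph1); last ring.
by rewrite E0 mul0r addr0; apply: in2D; apply: in2M.
Qed.

End QStep.

(** * Regular sequences of arbitrary length *)

Section RegularSeq.
Variables (k : fieldType) (N : nat).
Local Notation R := {mpoly k[N]}.
Implicit Types (fs : seq R) (I : R -> Prop).

Lemma genP fs f : ideal_gen fs f <-> exists d : nat -> R, f = \sum_(i < size fs) d i * fs`_i.
Proof.
split=> [[c ->]|[d ->]]; last by exists (fun i => d i).
exists (fun j => if insub j is Some i then c i else 0).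
by apply: eq_bigr => i _; rewrite valK.
Qed.

Lemma gen_take fs m f : (m <= size fs)%N ->
  ideal_gen (take m fs) f <-> exists d : nat -> R, f = \sum_(i < m) d i * fs`_i.
Proof.
move=> mfs; rewrite genP size_take_min (minn_idPl mfs).
by split=> -[d ->]; exists d; apply: eq_bigr => i _; rewrite nth_take.
Qed.

Lemma gen_mono fs m m' f : (m <= m')%N -> (m' <= size fs)%N ->
  ideal_gen (take m fs) f -> ideal_gen (take m' fs) f.
Proof.
move=> mm mfs; rewrite !gen_take //; last exact: leq_trans mm mfs.
move=> [d ->]; exists (fun i => if (i < m)%N then d i else 0).
rewrite (big_ord_widen _ (fun i => d i * fs`_i) mm) [RHS]big_mkcond [LHS]big_mkcond /=.
by apply: eq_bigr => i _; case: ifP => // _; rewrite mul0r.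
Qed.

Lemma gen_ideal fs : is_ideal (ideal_gen fs).
Proof.
split.
- by apply/genP; exists (fun=> 0); rewrite big1 // => i _; rewrite mul0r.
- move=> f g /genP[d ->] /genP[e ->]; apply/genP; exists (fun i => d i + e i).
  by rewrite -big_split; apply: eq_bigr => i _; rewrite mulrDl.
- move=> r f /genP[d ->]; apply/genP; exists (fun i => r * d i).
  by rewrite mulr_sumr; apply: eq_bigr => i _; rewrite mulrA.
Qed.

Lemma gen_nth fs i : (i < size fs)%N -> ideal_gen fs fs`_i.
Proof.
move=> ifs; apply/genP; exists (fun j => (j == i)%:R).
rewrite (bigD1 (Ordinal ifs)) //= eqxx mul1r big1 ?addr0 // => j /negbTE ne.
by rewrite (_ : (nat_of_ord j == i) = false) ?mul0r // -ne.
Qed.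

Lemma regular_take fs m : regular_seq fs -> regular_seq (take m fs).
Proof.
case: (leqP (size fs) m) => [/take_oversize-> //|/ltnW mfs].
move=> [H n1]; split; last first.
  by move=> h; apply: n1; have := gen_mono mfs (leqnn _) h; rewrite take_size.
rewrite size_take_min (minn_idPl mfs) => i im g; rewrite take_takel ?(ltnW im) // nth_take //.
by apply: H; apply: leq_trans mfs.
Qed.

Lemma grade_uniq I g g' : grade_eq I g -> grade_eq I g' -> g = g'.
Proof.
have le i j : grade_eq I i -> grade_eq I j -> (i <= j)%N.
  move=> [[fs [sz rf If]] _] [_ H]; rewrite leqNgt; apply/negP => ij; apply: H.
  exists (take j.+1 fs); split; [by rewrite size_takel ?sz|exact: regular_take|].
  move=> a; rewrite size_takel ?sz // => aj; rewrite nth_take //; apply: If.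
  by rewrite sz; apply: leq_trans aj ij.
by move=> H H'; apply/eqP; rewrite eqn_leq !le.
Qed.

Lemma regular_syz fs (c : nat -> R) : regular_seq fs ->
  \sum_(i < size fs) c i * fs`_i = 0 -> forall i, (i < size fs)%N -> ideal_gen fs (c i).
Proof.
move=> [H _].
suff S m : (m <= size fs)%N -> forall c : nat -> R, \sum_(i < m) c i * fs`_i = 0 ->
    forall i, (i < m)%N -> ideal_gen (take m fs) (c i).
  by move=> E i ifs; have := S _ (leqnn _) _ E i ifs; rewrite take_size.
elim: m => [//|m IH] mfs {}c; rewrite big_ord_recr /= => E.
have [|d Ed] := (proj1 (gen_take _ (ltnW mfs))) (H m mfs (c m) _).
  apply/gen_take; first exact: ltnW.
  exists (fun i => - c i); rewrite (_ : c m * _ = - \sum_(i < m) c i * fs`_i); last by lc E.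
  by rewrite -sumrN; apply: eq_bigr => i _; rewrite mulNr.
have E' : \sum_(i < m) (c i + d i * fs`_m) * fs`_i = 0.
  rewrite -[RHS]E Ed mulr_suml -big_split; apply: eq_bigr => i _ /=; ring.
have Hi := IH (ltnW mfs) (fun i => c i + d i * fs`_m) E'.
have [_ gD gM] := gen_ideal (take m.+1 fs).
have gm : ideal_gen (take m.+1 fs) fs`_m.
  by rewrite -(nth_take 0 (ltnSn m)); apply: gen_nth; rewrite size_takel.
move=> i; rewrite ltnS leq_eqVlt => /orP[/eqP->|im].
  by apply: (gen_mono (leqnSn m) mfs); apply/gen_take; [exact: ltnW|exists d].
rewrite (_ : c i = (c i + d i * fs`_m) + - d i * fs`_m); last ring.
by apply: gD; [apply: (gen_mono (leqnSn m) mfs); apply: Hi|apply: gM].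
Qed.

End RegularSeq.

(** * The ideals reached are not complete intersections *)

Section Ends.
Variables (k : fieldType) (N : nat).
Local Notation R := {mpoly k[N]}.

(* If all graded pieces of [h] below degree [d] lie in the graded ideal [C],
   then so does the part of [hp d (a * h)] coming from [a] of positive order. *)
Lemma hp_mul_low (C : R -> Prop) d (a h : R) : hideal C ->
  (forall i : int, i < d -> C (hp i h)) -> C (hp d (a * h) - hp 0 a * hp d h).
Proof.
move=> [C0 CD CM Ch] H; have CN f : C f -> C (- f) by rewrite -mulN1r; apply: CM.
have [m E] := hp_partition a.
have S : hp d (a * h) = \sum_(i < m) hp (Posz i) a * hp (d - Posz i) h.
  rewrite {1}E mulr_suml hp_sum; apply: eq_bigr => i _.
  by rewrite (hpMl _ _ (hp_hg _ _)).
rewrite S; case: m E {S} => [E|m E].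
  by rewrite big_ord0 E big_ord0 hp0 mul0r subr0.
rewrite big_ord_recl /= subr0 addrC addKr.
apply: (big_ind C) => // i _; apply: CM; apply: H; rewrite /bump /=; zlia.
Qed.

(** Expanding [l * (x p) = p * (x l)] on a regular sequence of generators puts the coefficients
    [l b_i - p a_i] in [I]. In degree [pi] they are multiples of [x * l], which forces the constant
    term of each [a_i] to vanish; but [x * l] has the lowest degree in [I]. *)
Lemma even_end n I (x l p : R) pi : 4 <= n -> n - 1 <= pi -> hideal I -> S2 n I x l p pi -> ~ is_CI I.
Proof.
move=> n4 pin idI [[Hx x0 Hl l0] [Hp lp] [Ixl Ixp] [P0 _] _] [fs [rfs EI]].
have [I0 ID IM Ih] := idI.
have /EI/genP[a Ea] := Ixl; have /EI/genP[b Eb] := Ixp.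
have Hxl : hg 2 (x * l) by apply: (hgM_c Hx Hl).
have low i f : i < 2 -> I f -> hp i f = 0.
  move=> i2 If; have [u E] := P0 _ _ (Ih _ i If) (hp_hg _ _) ltac:(zlia).
  apply: (hg_lt0_mul (hp_hg i f) Hxl E) => //; exact: mulf_neq0.
have syz : \sum_(i < size fs) (l * b i - p * a i) * fs`_i = 0.
  transitivity (l * (x * p) - p * (x * l)); last ring.
  by rewrite Ea Eb !mulr_sumr -sumrB; apply: eq_bigr => i _; ring.
have a0 i : (i < size fs)%N -> hp 0 (a i) = 0.
  move=> ifs; have /EI Hi := @regular_syz _ _ fs (fun i => l * b i - p * a i) rfs syz i ifs.
  have [u] := P0 _ _ (Ih _ pi Hi) (hp_hg _ _) (lexx _).
  rewrite hpB (hpMl _ _ Hl) (hpMl _ _ Hp) subrr => E.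
  case: (lin_prime Hl l0 (f := p) (g := hp 0 (a i))) => //.
    by exists (hp (pi - 1) (b i) - u * x); lc E.
  move=> [w Ew]; apply: (hg_lt0_mul (hp_hg 0 (a i)) Hl Ew) => //.
have : x * l = 0.
  rewrite -[LHS]Hxl Ea hp_sum big1 // => i _.
  have Ifi : I fs`_i by apply/EI; apply: gen_nth.
  have := @hp_mul_low (fun f => f = 0) 2 (a i) fs`_i; rewrite a0 // mul0r subr0; apply.
    split=> // [f g -> ->|h f ->|f d ->]; [by rewrite addr0|by rewrite mulr0|by rewrite hp0].
  by move=> j j2; apply: low.
by apply/eqP; apply: mulf_neq0.
Qed.

Lemma exch_ex0 (c g : vec R) e : vreg c -> vin c (e * g.1.1) -> vin c (e * g.1.2) -> vin c (e * g.2) ->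
  exists e', exch c g e e'.
Proof.
move=> rc /vinP[A1 E1] /vinP[A2 E2] /vinP[A3 E3].
have step i j Ai Aj : e * i = dot Ai c -> e * j = dot Aj c ->
  exists B, vlin i Aj (- j) Ai = cross c B.
  by move=> Ei Ej; apply: vreg_syz => //; rewrite dot_lin -Ei -Ej; ring.
have [B12 F12] := step _ _ _ _ E1 E2; have [B13 F13] := step _ _ _ _ E1 E3.
have [B23 F23] := step _ _ _ _ E2 E3.
have [|e' Ee'] := @vreg_prop _ c (vadd (vlin g.1.1 B23 (- g.1.2) B13) (vsc g.2 B12)) rc.
  by rewrite cross_add cross_lin cross_sc -F12 -F13 -F23; vring.
by exists e', A1, A2, A3, B12, B13, B23; split.
Qed.

Lemma hideal_vin t (c : vec R) : vhg t c -> hideal (vin c).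
Proof.
case: c t => [[a b] c] [[ta tb] tc] [/= Ha Hb Hc]; split.
- exact: vin0.
- by move=> *; apply: vinD.
- by move=> *; apply: vinM.
- by move=> f d; apply: (in3_hp _ Ha Hb Hc).
Qed.

(** A graded Nakayama argument; [D] may be inhomogeneous, since the generators in [is_CI] are
    arbitrary. The lowest component of [D] is a constant multiple of [e0] modulo [C]; each higher
    one is, modulo [C], a multiple of [D] by a coefficient without constant term, so induction on
    the degree applies. *)
Lemma cyclic_lowest (I C : R -> Prop) D d0 e0 : hideal I -> hideal C ->
  I D -> (forall e, I e -> exists y, C (e - y * D)) ->
  (forall f d, I f -> hg d f -> d < d0 -> C f) -> I e0 -> hg d0 e0 -> ~ C e0 ->
  forall e, I e -> exists y, C (e - y * e0).
Proof.
move=> [I0 ID IM Ih] idC HD gen low Ie0 He0 ne0; have [C0 CD CM Ch] := idC.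
have CN f : C f -> C (- f) by rewrite -mulN1r; apply: CM.
have lowD i : i < d0 -> C (hp i D) by move=> i0; apply: (low _ i) => //; [apply: Ih|apply: hp_hg].
have CB f g : C f -> C g -> C (f - g) by move=> h1 h2; apply: CD => //; apply: CN.
have [w Hw] := gen _ Ie0.
have E0 : C (e0 - hp 0 w * hp d0 D).
  have h1 := Ch _ d0 Hw; rewrite hpB He0 in h1.
  by have := CD _ _ h1 (hp_mul_low w idC lowD); rewrite addrA subrK.
have w0 : hp 0 w != 0.
  by apply/eqP=> z; apply: ne0; rewrite z mul0r subr0 in E0.
have [u Hu Eu] := hg_unit (hp_hg 0 w) w0.
pose Q f := exists y, C (f - y * e0).
have QD f g : Q f -> Q g -> Q (f + g).
  move=> [y Hy] [z Hz]; exists (y + z).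
  by rewrite (_ : _ - _ = (f - y * e0) + (g - z * e0)); [apply: CD|ring].
have QM h f : Q f -> Q (h * f).
  by move=> [y Hy]; exists (h * y); rewrite -mulrA -mulrBr; apply: CM.
have QC f : C f -> Q f by move=> Cf; exists 0; rewrite mul0r subr0.
have Dd0 : Q (hp d0 D).
  exists u; rewrite (_ : _ - _ = - u * (e0 - hp 0 w * hp d0 D)); first exact: CM.
  by transitivity ((u * hp 0 w) * hp d0 D - u * e0); [rewrite Eu mul1r|ring].
have nD : ~ C (hp d0 D).
  by move=> H; apply: ne0; have := CD _ _ E0 (CM (hp 0 w) _ H); rewrite subrK.
have QDm (m : nat) : forall i, i < d0 + m%:Z -> Q (hp i D).
  elim: m => [|m IH] i Hi; first by apply/QC/lowD; zlia.
  case: (ltP i (d0 + m%:Z)) => [|him]; first exact: IH.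
  case: (eqVneq i d0) => [->//|ne].
  have [wi Hwi] := gen _ (Ih _ i HD).
  have h1 := Ch _ d0 Hwi; rewrite hpB (hp_ne (hp_hg i D)) // sub0r in h1.
  have := CD _ _ h1 (hp_mul_low wi idC lowD); rewrite addrA addNr add0r => h2.
  have wi0 : hp 0 wi = 0.
    apply/eqP/negP => /negP wn0; apply: nD; have [v _ Ev] := hg_unit (hp_hg 0 wi) wn0.
    have := CM (- v) _ h2; rewrite mulrNN mulrA Ev mul1r; exact.
  have h3 := Ch _ i Hwi; rewrite hpB hp_hg in h3.
  have idQ : hideal Q.
    split=> //; first by exists 0; rewrite mul0r subr0.
    move=> f d [y Hy]; exists (hp (d - d0) y); have := Ch _ d Hy.
    by rewrite hpB (hpM _ _ He0).
  have := @hp_mul_low Q i wi D idQ; rewrite wi0 mul0r subr0 => h4.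
  rewrite (_ : hp i D = (hp i D - hp i (wi * D)) + hp i (wi * D)); last ring.
  by apply: QD; [apply: QC|apply: h4 => j ji; apply: IH; zlia].
move=> e /gen [y Hy]; have [m E] := hp_partition D.
have QDD : Q D.
  rewrite E; apply: (big_ind Q); [by exists 0; rewrite mul0r subr0|exact: QD|] => i _.
  by apply: (QDm (`|d0|%N + i.+1)%N); zlia.
have [z Hz] := QM y _ QDD; exists z.
by rewrite (_ : _ - _ = (e - y * D) + (y * D - z * e0)); [apply: CD|ring].
Qed.

Lemma reg2_divl (x y b : R) : reg2 (x * y) b -> reg2 x b.
Proof.
move=> [xy0 H]; have x0 : x != 0 by apply: contra_neq xy0 => ->; rewrite mul0r.
have y0 : y != 0 by apply: contra_neq xy0 => ->; rewrite mulr0.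
split=> // w [s E]; have [|r Er] := H (w * y); first by exists s; rewrite mulrAC E; ring.
by exists r; apply: (mulIf y0); rewrite Er; ring.
Qed.

(** [is_CI] fixes neither the length nor the degrees of its sequence; the grade determines the
    length. *)
Lemma CI_three (I : R -> Prop) : grade_eq I 3 -> is_CI I ->
  exists h : vec R, vreg h /\ forall f, I f <-> vin h f.
Proof.
move=> [[gs [sg rg Ig]] n4] [fs [rf EI]].
case: gs sg rg Ig => [|g1 [|g2 [|g3 [|]]]] // _ /regular3P [rg n1] Ig.
have {}Ig : [/\ I g1, I g2 & I g3] by split; [apply: (Ig 0%N)|apply: (Ig 1%N)|apply: (Ig 2%N)].
case: Ig => I1 I2 I3.
case: fs rf EI => [|h1 [|h2 [|h3 [|h4 fs]]]] rf EI.
- by have /EI/gen0 z := I1; case: rg => -[]; rewrite z eqxx.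
- have /EI/gen1 z1 := I1; have /EI/gen1 z2 := I2; case: rf => _; case.
  by apply/gen1; apply: (reg2_nocommon (proj1 rg)).
- have /EI/gen2 z1 := I1; have /EI/gen2 z2 := I2; have /EI/gen2 z3 := I3; case: (rf) => H; case.
  apply/gen2; apply: (three_in2 _ rg) => //; split.
    apply/eqP=> z; have := H 0%N isT 1; rewrite !gen0 /= z mulr0 => /(_ erefl) /eqP.
    by rewrite oner_eq0.
  by move=> u; have := H 1%N isT u; rewrite !gen1.
- exists (h1, h2, h3); split; first by case/regular3P: rf.
  by move=> f; rewrite EI gen3.
- case: n4; exists (take 4 [:: h1, h2, h3, h4 & fs]); split.
  + by rewrite /= take0.
  + exact: regular_take.
  + move=> i; rewrite size_takel // => i4; apply/EI; rewrite nth_take //.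
    by apply: gen_nth; apply: leq_trans i4 _.
Qed.

(** If [I1] is a complete intersection, [I] is generated modulo [c0] by the element [Dl] with
    residue 1, hence by its lowest form outside [c0]. For [a <= 2] this is [x * p], so [l] is in
    [I1]; for [a > 2] it is [x * l], so some [q = p - h * l] is in [I1]. [R2] applied to [l] or [q]
    then contradicts the regularity of [(al, be)] or makes [l] divide [p]. *)
Lemma odd_end n I I1 (x l p al be ph : R) pi a b c : 4 <= n -> pi = n \/ pi = n - 1 ->
  hideal I -> S2 n I x l p pi -> ci (a, b, c) (al, be, ph) -> a <= b -> b <= c ->
  linked (al, be, ph) I I1 -> (pi = n - 1 -> a <= 2) -> grade_eq I1 3 -> is_CI I1 -> False.
Proof.
move=> n4 pin idI HS C0 ab bc L0 pia gI1 CI1.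
have [[[h1 h2] h3] [rh EI1]] := CI_three gI1 CI1.
have [cI cI1] := linked_csub L0.
have [bn ct] := S2_bc HS n4 ltac:(zlia) C0 cI ab bc.
case: (HS) => -[Hx x0 Hl l0] [Hp lp] [Ixl Ixp] [P0 P] [S5 R2H].
have [Ia Ib Ic] := cI; case: (C0) => rc [/= Ha Hb Hc] n1.
have [D1 D2] := L0; set c0 := (al, be, ph) in C0 L0 cI cI1 rc D1 D2 n1 *.
have Rt g d : I1 g -> hg d g -> d < a + b + c - (pi + n + 7) -> vin c0 (l * g) /\ vin c0 (p * g).
  by move=> Ig Hg Hd; apply: (R2H _ _ C0 cI g d) => //; apply/D2.
have Hxl : hg 2 (x * l) by apply: (hgM_c Hx Hl).
have xl0 : x * l != 0 by rewrite mulf_neq0.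
have al0 : al != 0 by case: rc => -[].
have idC : hideal (vin c0) by case: (C0) => _ H _; apply: hideal_vin H.
have [Dl HD1] : exists Dl, exch c0 (h1, h2, h3) Dl 1.
  have [] := @exch_ex0 (h1, h2, h3) c0 1 rh; rewrite ?mul1r; try by apply/EI1; case: cI1.
  by move=> Dl H; exists Dl; apply: exch_sym.
have IDl : I Dl.
  by apply/D1 => g /EI1 Ig; rewrite mulrC; apply/(exch_vin g rc rh HD1); rewrite mulr1.
have gen e : I e -> exists y, vin c0 (e - y * Dl).
  move=> /D1 Ie.
  have Ih : [/\ I1 h1, I1 h2 & I1 h3].
    by split; apply/EI1; [apply: in31|apply: in32|apply: in33].
  have [e' He'] : exists e', exch c0 (h1, h2, h3) e e'.
    by case: Ih => i1 i2 i3; apply: exch_ex0 => //=; apply: Ie.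
  exists e'; rewrite -mulNr; apply: (exch_out rh (exchD He' (exchM (- e') HD1))).
  by rewrite mulr1 subrr; apply: vin0.
have nocommon h (d : int) : hg d h -> 0 < d -> in1 h al -> in1 h be -> False.
  move=> Hh d0 i1 i2; apply: (hg_pos_no1 Hh d0); exact: (reg2_nocommon (proj1 rc)).
have Hxp : hg (pi + 1) (x * p) by apply: (hgM_c Hx Hp); zlia.
case: (leP a 2) => a2.
  have [u Eu] := P0 _ _ Ia Ha ltac:(zlia); rewrite /= in Eu.
  have u0 : u != 0 by apply: contra_neq al0; rewrite Eu => ->; rewrite mul0r.
  have Hu : hg (a - 2) u by apply: (hg_div _ Hxl xl0); rewrite -Eu.
  have [w [_ Ew]] := nz_mul_const 0 Hu ltac:(zlia) u0.
  have Vxl : vin c0 (x * l).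
    by exists w, 0, 0; rewrite /= Eu mulrA Ew; ring.
  have nxp : ~ vin c0 (x * p).
    move=> H; have [s [t [E _ Ht]]] := in2_hg Hxp Ha Hb (in3_low2 Hxp Ha Hb Hc ltac:(zlia) H).
    have [t0|t0] := eqVneq t 0.
      by apply: lp; exists (s * u); apply: (mulfI x0); rewrite E t0 Eu; ring.
    have [w' [_ Ew']] := nz_mul_const 0 Ht ltac:(zlia) t0.
    apply: (nocommon x 1) => //; first by exists (u * l); rewrite Eu; ring.
    exists (w' * (p - s * u * l)); rewrite -[be]mul1r -Ew'; rewrite Eu in E; by lc (eqM w' E).
  have cyc := @cyclic_lowest I (vin c0) Dl (pi + 1) (x * p) idI idC IDl gen _ Ixp Hxp nxp.
  have {}cyc : forall e, I e -> exists y, vin c0 (e - y * (x * p)).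
    apply: cyc => f d If Hf Hd; have [s ->] := P0 _ _ If Hf ltac:(zlia); exact: vinM.
  have Il : I1 l.
    apply/D2 => e /cyc [y Hy]; rewrite (_ : l * e = l * (e - y * (x * p)) + y * p * (x * l)); last ring.
    by apply: vinD; apply: vinM.
  have a2' := hg_ge0 Hu u0.
  have [ll pl] := Rt _ _ Il Hl ltac:(zlia).
  have Hll : hg 2 (l * l) by apply: (hgM_c Hl Hl).
  have [A EA] := in3_low1 Hll Ha Hb Hc ltac:(zlia) ltac:(zlia) ll.
  have EA' : l = A * u * x by apply: (mulIf l0); rewrite EA Eu; ring.
  have Hpl : hg (pi + 1) (p * l) by apply: (hgM_c Hp Hl).
  have [s [t [E _ Ht]]] := in2_hg Hpl Ha Hb (in3_low2 Hpl Ha Hb Hc ltac:(zlia) pl).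
  have [t0|t0] := eqVneq t 0.
    have Ep : p = s * u * x by apply: (mulIf l0); rewrite E t0 Eu; ring.
    have HAu : hg 0 (A * u) by apply: (hg_c (hg_div (d := 1) (e := 1) _ Hx x0)); rewrite -?EA'.
    have Au0 : A * u != 0 by apply: contra_neq l0; rewrite EA' => ->; rewrite mul0r.
    have [w' _ Ew'] := hg_unit HAu Au0.
    apply: lp; exists (s * u * w'); rewrite Ep EA'.
    by transitivity (s * u * (w' * (A * u)) * x); [rewrite Ew'; ring|ring].
  have [w' [_ Ew']] := nz_mul_const 0 Ht ltac:(zlia) t0.
  apply: (nocommon l 1) => //; first by exists (u * x); rewrite Eu; ring.
  exists (w' * (p - s * u * x)); rewrite -[be]mul1r -Ew'; rewrite Eu in E; by lc (eqM w' E).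
have Epi : pi = n by case: pin => // /pia; zlia.
subst pi.
have nxl : ~ vin c0 (x * l).
  move=> H; have := in3_low0 Hxl Ha Hb Hc ltac:(zlia) ltac:(zlia) ltac:(zlia) H; exact/eqP.
have cyc : forall e, I e -> exists y, vin c0 (e - y * (x * l)).
  apply: (@cyclic_lowest I (vin c0) Dl 2 (x * l) idI idC IDl gen _ Ixl Hxl nxl).
  move=> f d If Hf Hd; have [s E] := P0 _ _ If Hf ltac:(zlia).
  by rewrite (hg_lt0_mul Hf Hxl E Hd xl0); apply: vin0.
have [h0 Hh0] := cyc _ Ixp; pose h := hp (n - 1) h0.
have Hh : hg (n - 1) h := hp_hg _ _.
pose q := p - h * l.
have Hq : hg n q by apply: hgB => //; apply: (hgM_c Hh Hl); zlia.
have lq : ~ in1 l q by move=> [s E]; apply: lp; exists (s + h); rewrite /q in E; lc E.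
have q0 : q != 0 by apply/eqP=> z; apply: lq; rewrite z; apply: in1_0.
have xq : vin c0 (x * q).
  case: idC => _ _ _ Ch; have := Ch _ (n + 1) Hh0.
  rewrite hpB Hxp (hpM _ _ Hxl) (_ : n + 1 - 2 = n - 1); last zlia.
  by rewrite -/h (_ : _ - _ = x * q) //; rewrite /q; ring.
have Iq : I1 q.
  apply/D2 => e /cyc [y Hy]; rewrite (_ : q * e = q * (e - y * (x * l)) + y * l * (x * q)); last ring.
  by apply: vinD; apply: vinM.
have [lq' pq'] := Rt _ _ Iq Hq ltac:(zlia).
have Hxq : hg (n + 1) (x * q) by apply: (hgM_c Hx Hq); zlia.
have Hlq : hg (n + 1) (l * q) by apply: (hgM_c Hl Hq); zlia.
have Hpq : hg (n + n) (p * q) by apply: (hgM_c Hp Hq).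
case: (leP a n) => an.
  have [th Eth] := P0 _ _ Ia Ha an; rewrite /= in Eth.
  have [s [t [E _ Ht]]] := in2_hg Hxq Ha Hb (in3_low2 Hxq Ha Hb Hc ltac:(zlia) xq).
  have [t0|t0] := eqVneq t 0.
    by apply: lq; exists (s * th); apply: (mulfI x0); rewrite E t0 Eth; ring.
  have [w' [_ Ew']] := nz_mul_const 0 Ht ltac:(zlia) t0.
  apply: (nocommon x 1) => //; first by exists (th * l); rewrite Eth; ring.
  exists (w' * (q - s * th * l)); rewrite -[be]mul1r -Ew'; rewrite Eth in E; by lc (eqM w' E).
have [s [t [E Hs Ht]]] := in2_hg Hlq Ha Hb (in3_low2 Hlq Ha Hb Hc ltac:(zlia) lq').
have [A [B [E' HA HB]]] := in2_hg Hpq Ha Hb (in3_low2 Hpq Ha Hb Hc ltac:(zlia) pq').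
have lq0 : l * q != 0 by rewrite mulf_neq0.
have [t0|t0] := eqVneq t 0.
  have s0 : s != 0 by apply: contra_neq lq0 => z; rewrite E z t0; ring.
  have [w [_ Ew]] := nz_mul_const 0 Hs ltac:(zlia) s0.
  have Eal : al = q * (w * l).
    by rewrite -[LHS]mul1r -Ew; rewrite t0 in E; lc (eqM w E).
  have rq : reg2 q be by apply: (@reg2_divl _ (w * l)); rewrite -Eal; case: rc.
  have [|B' EB] := (proj2 rq) B; first by exists (p - A * w * l); rewrite Eal in E'; lc E'.
  have HB' : hg (n - b) B' by apply: (hg_c (hg_div (d := n + n - b) (e := n) _ Hq q0)); [rewrite -EB|zlia].
  apply: lp; exists (A * w); apply: (mulIf q0); rewrite E' EB (hg_neg HB') ?Eal; [ring|zlia].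
have [w [_ Ew]] := nz_mul_const 0 Ht ltac:(zlia) t0.
have Eb : be = w * (l * q - s * al) by rewrite -[LHS]mul1r -Ew; lc (eqM w E).
have rq : reg2 q al.
  apply: (@reg2_divl _ l); rewrite mulrC; apply: reg2_sym; last by [].
  split=> // u [v Ev]; apply: (proj2 (proj1 rc)); exists (w * (v - u * s)).
  by rewrite /= Eb; lc (eqM w Ev).
have [|B' EB] := (proj2 rq) (A - B * w * s); first by exists (p - B * w * l); rewrite Eb in E'; lc E'.
have HAB : hg (n + n - a) (A - B * w * s).
  have Hw : hg 0 w by apply: (hg_c (hg_div (d := 0) (e := n + 1 - b) _ Ht t0)); rewrite ?Ew; [apply: hg1|have := hg_ge0 Ht t0; zlia].
  by apply: hgB => //; apply: (hgM_c (hgM HB Hw) Hs); have := hg_ge0 Ht t0; zlia.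
have HB' : hg (n - a) B' by apply: (hg_c (hg_div (d := n + n - a) (e := n) _ Hq q0)); [rewrite -EB|zlia].
rewrite (hg_neg HB') in EB; last zlia.
apply: lp; exists (B * w); apply: (mulIf q0); rewrite E' Eb.
by apply: (lcomb (eqM al EB)); ring.
Qed.

End Ends.

(** * Induction along a chain of links of decreasing type *)

Section Chain.
Variables (k : fieldType) (N : nat).
Local Notation R := {mpoly k[N]}.

(** [a] bounds the first degree of the next link. The refined state lasts while that degree may
    exceed [n]; the fall of [pi] to [n - 1] occurs only in a link of first degree 2. *)
Definition Inv n (I : R -> Prop) (a : int) :=
  [\/ exists x l l2 p, S1 n I x l l2 p,
      a <= n /\ exists x l p, S2 n I x l p n |
      a <= 2 /\ exists x l p, S2 n I x l p (n - 1)].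

Lemma Inv_mono n I a a' : a' <= a -> Inv n I a -> Inv n I a'.
Proof.
move=> aa [H|[h H]|[h H]]; [exact: Or31|apply: Or32|apply: Or33]; split=> //; zlia.
Qed.

Lemma Inv_step n I I1 I2 a b c a1 b1 c1 (v w : vec R) : 4 <= n ->
  hideal I -> hideal I1 -> hideal I2 -> ci (a, b, c) v -> ci (a1, b1, c1) w ->
  a <= b -> b <= c -> a1 <= b1 -> b1 <= c1 -> a1 <= a -> b1 <= b -> c1 <= c ->
  linked v I I1 -> linked w I1 I2 -> Inv n I a -> Inv n I2 a1.
Proof.
case: v w => [[al be] ph] [[al1 be1] ph1] n4 idI idI1 idI2 C0 C1 ab bc ab1 bc1 aa bb cc L0 L1 H.
have [cI _] := linked_csub L0.
have low x l p pi : S2 n I x l p pi -> n - 1 <= pi -> pi = n \/ pi = n - 1 -> a <= 2 ->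
    Inv n I2 a1.
  move=> HS pn pin a2; case: (HS) => -[Hx x0 Hl l0] _ _ [P0 _] _.
  have [Ia Ib Ic] := cI; case: (C0) => rc [/= Ha Hb Hc] n1.
  have Hxl : hg 2 (x * l) by apply: (hgM_c Hx Hl).
  have xl0 : x * l != 0 by rewrite mulf_neq0.
  have al0 : al != 0 by case: rc => -[].
  have [u Eu] := P0 _ _ Ia Ha ltac:(zlia); rewrite /= in Eu.
  have u0 : u != 0 by apply: contra_neq al0; rewrite Eu => ->; rewrite mul0r.
  have Hu : hg (a - 2) u by apply: (hg_div _ Hxl xl0); rewrite -Eu.
  have a2' := hg_ge0 Hu u0.
  have [w [_ Ew]] := nz_mul_const 0 Hu ltac:(zlia) u0.
  have vE f : vin (al, be, ph) f <-> vin (x * l, be, ph) f.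
    split; apply: vin_sub => /=; try exact: in32; try exact: in33.
      by exists u, 0, 0; rewrite /= Eu; ring.
    by exists w, 0, 0; rewrite /= Eu mulrA Ew; ring.
  have C0' : ci (2, b, c) (x * l, be, ph).
    split; last by rewrite -vE.
      by apply: (@reg3_divl _ _ _ u); rewrite mulrC -Eu.
    by split.
  have [l' [p' [dl [Ed Hd HS']]]] := rstep n4 pin HS C0' C1 bc bc1 ltac:(zlia) bb cc (linked_ext vE L0) L1.
  case: Hd => [d0|[d1 pn']].
    case: pin => Epi; [apply: Or32|apply: Or33]; (split; first zlia); exists x, l', p'.
      by move: HS'; rewrite d0 subr0 Epi.
    by move: HS'; rewrite d0 subr0 Epi.
  by apply: Or33; split; [zlia|exists x, l', p'; move: HS'; rewrite d1 pn'].
have mid x l p : S2 n I x l p n -> a <= n -> Inv n I2 a1.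
  move=> HS an; case: (leP a 2) => a2; first by apply: (low x l p n) => //; [zlia|left].
  have [l' [p' HS']] := thstep n4 HS C0 C1 ltac:(zlia) an ab bc ab1 bc1 aa bb cc idI idI1 idI2 L0 L1.
  by apply: Or32; split; [zlia|exists x, l', p'].
case: H => [[x [l [l2 [p HS]]]]|[an [x [l [p HS]]]]|[an [x [l [p HS]]]]].
- case: (leP a n) => an; first by apply: (mid x l p) => //; case: HS.
  case: (leP (2 * n + 8) (a + b)) => abn.
    have [l' [p' HS']] := pstep n4 HS C0 C1 ltac:(zlia) abn ab bc ab1 bc1 aa bb cc L0 L1.
    by apply: Or31; exists x, l', l2, p'.
  have [y [l' [l2' [p' HS']]]] := qstep n4 HS C0 C1 ltac:(zlia) ltac:(zlia) ab bc ab1 bc1 aa bb cc L0 L1.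
  by apply: Or31; exists y, l', l2', p'.
- exact: mid HS an.
- by apply: (low x l p (n - 1)) => //; right.
Qed.

Lemma hideal_of (I : R -> Prop) : is_homog_ideal I -> hideal I.
Proof. by move=> [[I0 ID IM] Ih]; split=> // f [d|d] If //; apply: Ih. Qed.

Definition glink (I I' : R -> Prop) (fs : seq R) (ds : seq nat) :=
  homog_CI 3 fs ds /\ directly_linked 3 I I' (ideal_gen fs).

Lemma glinkP I I' fs ds : glink I I' fs ds -> exists (v : vec R) (a b c : nat),
  [/\ ds = [:: a; b; c], ci (a%:Z, b%:Z, c%:Z) v, (a <= b)%N /\ (b <= c)%N, linked v I I' &
      hideal I /\ hideal I'].
Proof.
move=> [[sf sd rf Hf srt] [[idI idI'] _ _ E1 E2]].
case: fs sf rf Hf E1 E2 => [|f1 [|f2 [|f3 [|]]]] // _ rf Hf E1 E2.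
case: ds sd Hf srt => [|a [|b [|c [|]]]] // _ Hf /= /and3P[ab bc _].
have [rg n1] := (proj1 (regular3P _ _ _)) rf.
exists (f1, f2, f3), a, b, c; split=> //.
- split=> //; split; apply/hgE; [exact: (Hf 0%N)|exact: (Hf 1%N)|exact: (Hf 2%N)].
- split=> f; [rewrite E1|rewrite E2]; split=> H h Ih; apply/gen3; exact: H.
- by split; apply: hideal_of.
Qed.

(** Links are consumed in pairs, so the parity of [s] decides between [even_end] and [odd_end]. [a0]
    bounds the first degree of the next link; at the start of the chain it can be that degree
    itself. *)
Lemma chain_false n s Is Cf Cd : 4 <= n ->
  (forall i, (i < s)%N -> glink (Is i) (Is i.+1) (Cf i) (Cd i)) ->
  (forall i, (i.+1 < s)%N -> type_le (Cd i.+1) (Cd i)) -> is_CI (Is s) -> hideal (Is 0%N) ->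
  (exists a0 : nat, Inv n (Is 0%N) a0%:Z /\
    forall a t, (0 < s)%N -> Cd 0%N = a :: t -> (a <= a0)%N) -> False.
Proof.
move=> n4; elim: s {-2}s (leqnn s) Is Cf Cd => [|m IH] s.
  rewrite leqn0 => /eqP -> Is Cf Cd _ _ CI id0 [a0 [HI _]].
  case: HI => [[x [l [l2 [p [HS _ _ _]]]]]|[_ [x [l [p HS]]]]|[_ [x [l [p HS]]]]].
  - by apply: (even_end n4 _ id0 HS) => //; zlia.
  - by apply: (even_end n4 _ id0 HS) => //; zlia.
  - by apply: (even_end n4 _ id0 HS) => //; zlia.
case: s => [|s] sm Is Cf Cd Hl Ht CI id0 HI.
  by apply: (IH 0%N (leq0n _) Is Cf Cd).
have [v [a [b [c [E0 C0 [ab bc] L0 [_ id1]]]]]] := glinkP (Hl 0%N (ltn0Sn _)).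
case: HI => a0 [HI Ha0]; have aa0 := Ha0 _ _ (ltn0Sn _) E0.
have {a0 Ha0 aa0}HI : Inv n (Is 0%N) a%:Z by apply: Inv_mono HI; zlia.
case: s sm Hl Ht CI => [|s] sm Hl Ht CI.
  have gr : grade_eq (Is 1%N) 3 by case: (Hl 0%N isT) => _ [].
  case: v C0 L0 => [[al be] ph] C0 L0.
  case: HI => [[x [l [l2 [p [HS _ _ _]]]]]|[h [x [l [p HS]]]]|[h [x [l [p HS]]]]].
  - by apply: (odd_end n4 (or_introl erefl) id0 HS C0 _ _ L0 _ gr CI) => //; zlia.
  - by apply: (odd_end n4 (or_introl erefl) id0 HS C0 _ _ L0 _ gr CI) => //; zlia.
  - by apply: (odd_end n4 (or_intror erefl) id0 HS C0 _ _ L0 _ gr CI) => //; zlia.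
have [w [a1 [b1 [c1 [E1 C1 [ab1 bc1] L1 [_ id2]]]]]] := glinkP (Hl 1%N isT).
have := Ht 0%N isT; rewrite E0 E1 /type_le /= => /and4P[aa bb cc _].
have HI2 : Inv n (Is 2%N) a1%:Z.
  by apply: (Inv_step n4 id0 id1 id2 C0 C1 _ _ _ _ _ _ _ L0 L1 HI); zlia.
apply: (IH s _ (fun i => Is i.+2) (fun i => Cf i.+2) (fun i => Cd i.+2)) => //.
- zlia.
- by move=> i is_; apply: Hl.
- by move=> i is_; apply: Ht.
exists a1; split=> // a2 t s0 E2.
have := Ht 1%N s0; rewrite E1 E2 /type_le /=.
by case: t {E2} => [|b2 t] /andP[].
Qed.

Lemma not_SBL (n : nat) J : (4 <= n)%N -> grade_eq J 3 ->
  (exists x l l2 p : R, S1 n%:Z J x l l2 p) -> ~ SBL J.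
Proof.
move=> n4 gJ HS [hJ _ [g [s [Is [Cf [Cd [gJ' [E0 Hl CI] Ht]]]]]]].
have Eg := grade_uniq gJ' gJ; subst g.
have HS' : exists x l l2 p, S1 n%:Z (Is 0%N) x l l2 p.
  case: HS => x [l [l2 [p [[h1 h2 [i1 i2] [P0 P] [S5 R2H]] h3 h4 PH]]]]; exists x, l, l2, p.
  have E f : Is 0%N f <-> J f := E0 f.
  have vcE t c l' p' sg : R2 t c J l' p' sg -> R2 t c (Is 0%N) l' p' sg.
    by move=> H g' d Hg; apply: H => h /E; apply: Hg.
  split=> //; last by move=> f d /E; apply: PH.
  split=> //; first by split; apply/E.
    by split=> f d /E; [apply: P0|apply: P].
  split=> [En e1 e2 /E He1 /E He2|t c Ct [/E c1 /E c2 /E c3]]; first exact: S5.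
  by apply: vcE; apply: R2H.
have n4' : 4 <= n%:Z by zlia.
apply: (@chain_false n%:Z s Is Cf Cd n4' Hl Ht CI).
  have [[J0 JD JM] Jh] := hJ.
  by apply: hideal_of; split; [split; [exact/E0|by move=> f g /E0 h1 /E0 h2; apply/E0; apply: JD|
     by move=> r f /E0 h; apply/E0; apply: JM]|by move=> f d /E0 h; apply/E0; apply: Jh].
exists (head 0%N (Cd 0%N)); split; first exact: Or31.
by move=> a t _ ->.
Qed.

End Chain.

(** * Resolutions and duality *)

Section MatrixLift.
Variables (k : fieldType) (N : nat).
Local Notation R := {mpoly k[N]}.

Lemma mulmx_col m p r (A : 'M[R]_(m, p)) (X : 'M[R]_(p, r)) j : A *m col j X = col j (A *m X).
Proof. by apply/matrixP=> a b; rewrite !mxE; apply: eq_bigr => i _; rewrite mxE. Qed.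

Lemma ker_lift m p q r (A : 'M[R]_(m, p)) (B : 'M[R]_(p, q)) (X : 'M[R]_(p, r)) :
  ker_sub_im A B -> A *m X = 0 -> exists Y, X = B *m Y.
Proof.
move=> H E; have Hc j : exists w : 'cV_q, col j X = B *m w.
  by apply: H; rewrite mulmx_col E; apply/matrixP=> a b; rewrite !mxE.
have [w Hw] := fin_all_exists Hc.
exists (\matrix_(i, j) w j i 0); apply/matrixP=> i j.
have := congr1 (fun M : 'cV_p => M i 0) (Hw j); rewrite !mxE => ->.
by apply: eq_bigr => a _; rewrite !mxE.
Qed.

(* [r i] and [s j] are the degrees of the basis elements of target and source. *)
Definition gmx m p (r : 'I_m -> int) (s : 'I_p -> int) (A : 'M[R]_(m, p)) :=
  forall i j, hg (s j - r i) (A i j).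

Lemma gmx_lift m p q (r : 'I_m -> int) (t : 'I_p -> int) (s : 'I_q -> int) B X Y :
  gmx r t B -> gmx r s X -> X = B *m Y -> exists2 Y', gmx t s Y' & X = B *m Y'.
Proof.
move=> HB HX E; exists (\matrix_(i, j) hp (s j - t i) (Y i j)).
  by move=> i j; rewrite mxE; apply: hp_hg.
apply/matrixP=> i j; rewrite -(HX i j) {1}E !mxE hp_sum; apply: eq_bigr => a _.
by rewrite mxE (hpMl _ _ (HB i a)); congr (_ * hp _ _); zlia.
Qed.

Lemma gmxM m p q (r : 'I_m -> int) (t : 'I_p -> int) (s : 'I_q -> int) A B :
  gmx r t A -> gmx t s B -> gmx r s (A *m B).
Proof.
move=> HA HB i j; rewrite mxE; apply: hg_sum => a.
by apply: (hgM_c (HA i a) (HB a j)); zlia.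
Qed.

Lemma gmx_ker_lift m p q r (dm : 'I_m -> int) (dp : 'I_p -> int) (dq : 'I_q -> int)
    (dr : 'I_r -> int) (A : 'M[R]_(m, p)) (B : 'M[R]_(p, q)) (X : 'M[R]_(p, r)) :
  ker_sub_im A B -> gmx dp dq B -> gmx dp dr X -> A *m X = 0 ->
  exists2 Y, gmx dq dr Y & X = B *m Y.
Proof. by move=> H HB HX /(ker_lift H) [Y E]; apply: gmx_lift HB HX E. Qed.

Variable c : vec R.
Definition K1 : 'rV[R]_3 := \row_j nth 0 [:: c.1.1; c.1.2; c.2] j.
(** Chosen antisymmetric, with [K3] the transpose of [K1], so that exactness of the dual Koszul
    complex follows by transposition. *)
Definition K2 : 'M[R]_3 := \matrix_(i, j) nth 0 (nth [::] [:: [:: 0; - c.2; c.1.2];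
  [:: c.2; 0; - c.1.1]; [:: - c.1.2; c.1.1; 0]] i) j.
Definition K3 : 'cV[R]_3 := \col_j nth 0 [:: c.1.1; c.1.2; c.2] j.

Lemma K1mul m (X : 'M[R]_(3, m)) j : (K1 *m X) 0 j =
  c.1.1 * X 0 j + c.1.2 * X 1 j + c.2 * X (lift 0 1) j.
Proof.
rewrite mxE !big_ord_recl big_ord0 !mxE /= addr0 addrA.
by congr (_ * X _ _ + _ * X _ _ + _ * X _ _); apply: val_inj.
Qed.

Lemma ord3P (P : 'I_3 -> Prop) : P 0 -> P 1 -> P (lift 0 1) -> forall i, P i.
Proof.
move=> h0 h1 h2 [[|[|[|]]] Hi] //.
- by rewrite (_ : Ordinal Hi = 0) //; apply: val_inj.
- by rewrite (_ : Ordinal Hi = 1) //; apply: val_inj.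
- by rewrite (_ : Ordinal Hi = lift 0 1) //; apply: val_inj.
Qed.

Lemma K2mul m (X : 'M[R]_(3, m)) j :
  [/\ (K2 *m X) 0 j = c.1.2 * X (lift 0 1) j - c.2 * X 1 j,
      (K2 *m X) 1 j = c.2 * X 0 j - c.1.1 * X (lift 0 1) j &
      (K2 *m X) (lift 0 1) j = c.1.1 * X 1 j - c.1.2 * X 0 j].
Proof.
have E i : (K2 *m X) i j = K2 i 0 * X 0 j + K2 i 1 * X 1 j + K2 i (lift 0 1) * X (lift 0 1) j.
  rewrite mxE !big_ord_recl big_ord0 addr0 addrA.
  have -> : lift ord0 (lift ord0 ord0) = lift 0 1 :> 'I_3 by apply: val_inj.
  by have -> : lift ord0 ord0 = 1 :> 'I_3 by apply: val_inj.
by split; rewrite E !mxE /=; ring.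
Qed.

Lemma K3mul m (v : 'M[R]_(1, m)) i j : (K3 *m v) i j = K3 i 0 * v 0 j.
Proof. by rewrite mxE big_ord1. Qed.

Lemma K12 : ker_sub_im K1 K2 <-> forall v1 v2 v3, v1 * c.1.1 + v2 * c.1.2 + v3 * c.2 = 0 ->
  exists x, (v1, v2, v3) = cross c x.
Proof.
split=> [H v1 v2 v3 E|H v E].
  have [|w Ew] := H (\col_i nth 0 [:: v1; v2; v3] i).
    by apply/matrixP=> i j; rewrite ord1 K1mul !mxE /= -[RHS]E; ring.
  exists (w 0 0, w 1 0, w (lift 0 1) 0); have [e1 e2 e3] := K2mul w 0.
  by rewrite -Ew !mxE /= in e1 e2 e3; rewrite /cross /= -e1 -e2 -e3.
have [|[[x y] z]] := H (v 0 0) (v 1 0) (v (lift 0 1) 0).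
  by have := congr1 (fun M : 'M_1 => M 0 0) E; rewrite /= K1mul mxE => <-; ring.
rewrite /cross /= => -[e1 e2 e3]; exists (\col_i nth 0 [:: x; y; z] i).
apply/matrixP=> i j; rewrite ord1; move: i; apply: ord3P.
- by have [-> _ _] := K2mul (\col_i nth 0 [:: x; y; z] i) 0; rewrite !mxE.
- by have [_ -> _] := K2mul (\col_i nth 0 [:: x; y; z] i) 0; rewrite !mxE.
- by have [_ _ ->] := K2mul (\col_i nth 0 [:: x; y; z] i) 0; rewrite !mxE.
Qed.

Hypothesis rc : vreg c.

Lemma K12_exact : ker_sub_im K1 K2.
Proof. by apply/K12 => v1 v2 v3 E; apply: vreg_syz. Qed.

Lemma K23_exact : ker_sub_im K2 K3.
Proof.
move=> v E; have [e1 e2 e3] := K2mul v 0; rewrite E !mxE in e1 e2 e3.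
have [|t] := @vreg_prop _ c (v 0 0, v 1 0, v (lift 0 1) 0) rc.
  by rewrite /cross /= -e1 -e2 -e3.
rewrite /vsc => -[h1 h2 h3]; exists (\row_j t).
apply/matrixP=> i j; rewrite ord1 K3mul !mxE; move: i; apply: ord3P => /=.
- by rewrite h1; ring.
- by rewrite h2; ring.
- by rewrite h3; ring.
Qed.

Lemma K3_inj m (v : 'M[R]_(1, m)) : K3 *m v = 0 -> v = 0.
Proof.
move=> E; apply/matrixP=> i j; rewrite ord1.
have c0 : c.1.1 != 0 by case: rc => -[].
have := congr1 (fun M : 'M_(3, m) => M 0 j) E; rewrite /= K3mul !mxE /= => /eqP.
by rewrite mulf_eq0 (negbTE c0) => /eqP.
Qed.

Lemma K12_0 : K1 *m K2 = 0.
Proof.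
apply/matrixP=> i j; rewrite ord1 K1mul !mxE; move: j; apply: ord3P => /=; ring.
Qed.

Lemma K2T : K2^T = - K2.
Proof.
apply/matrixP=> i j; rewrite !mxE; move: i; apply: ord3P; move: j; apply: ord3P => /=;
  by rewrite ?oppr0 ?opprK.
Qed.
Lemma K3T : K3^T = K1. Proof. by apply/matrixP=> i j; rewrite !mxE. Qed.

Lemma K32_dual m (U : 'M[R]_(m, 3)) : U *m K3 = 0 -> exists V, U = V *m K2.
Proof.
move=> E; have E' : K1 *m U^T = 0 by rewrite -K3T -trmx_mul E trmx0.
have [Y EY] := ker_lift K12_exact E'; exists (- Y^T).
by rewrite -[LHS]trmxK EY trmx_mul K2T mulNmx mulmxN.
Qed.

Lemma K21_dual m (U : 'M[R]_(m, 3)) : U *m K2 = 0 -> exists V, U = V *m K1.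
Proof.
move=> E; have E' : K2 *m U^T = 0.
  by rewrite -[K2]opprK -K2T mulNmx -trmx_mul E trmx0 oppr0.
have [Y EY] := ker_lift K23_exact E'; exists (Y^T).
by rewrite -[LHS]trmxK EY trmx_mul K3T.
Qed.

Lemma vinK f : vin c f <-> exists V : 'cV_3, f = (K1 *m V) 0 0.
Proof.
split=> [[u [v [w ->]]]|[V ->]].
  by exists (\col_i nth 0 [:: u; v; w] i); rewrite K1mul !mxE /=; ring.
by rewrite K1mul; exists (V 0 0), (V 1 0), (V (lift 0 1) 0); ring.
Qed.

Lemma vinK_row m (X : 'rV[R]_m) : (forall j, vin c (X 0 j)) -> exists A : 'M_(3, m), X = K1 *m A.
Proof.
move=> H; have H' j : exists V : 'cV_3, X 0 j = (K1 *m V) 0 0 by apply/vinK.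
have [V HV] := fin_all_exists H'; exists (\matrix_(i, j) V j i 0).
by apply/matrixP=> i j; rewrite ord1 HV !K1mul !mxE.
Qed.

Lemma vinK_mul m p (Z : 'M[R]_(m, 3)) (V : 'M[R]_(1, p)) i j : vin c ((Z *m K3 *m V) i j).
Proof.
rewrite mxE big_ord1; apply: vinMr; rewrite mxE !big_ord_recl big_ord0 addr0 addrA !mxE /=.
by exists (Z i ord0), (Z i (lift ord0 ord0)), (Z i (lift ord0 (lift ord0 ord0))).
Qed.

Lemma vinK3 m (Z : 'M[R]_(m, 3)) i : vin c ((Z *m K3) i 0).
Proof. by have := vinK_mul Z 1%:M i 0; rewrite mulmx1. Qed.

Lemma vinK_col m (X : 'cV[R]_m) : (forall i, vin c (X i 0)) -> exists Z : 'M_(m, 3), X = Z *m K3.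
Proof.
move=> H; have [|A EA] := @vinK_row _ X^T; first by move=> j; rewrite mxE.
by exists A^T; rewrite -[LHS]trmxK EA trmx_mul -K3T trmxK.
Qed.

Lemma K23_0 : K2 *m K3 = 0.
Proof.
apply/matrixP=> i j; rewrite ord1; have [e1 e2 e3] := K2mul K3 0.
by move: i; apply: ord3P; rewrite ?e1 ?e2 ?e3 !mxE /=; ring.
Qed.

Lemma K_gmx (t : deg3) : vhg t c ->
  let d1 := fun j : 'I_3 => nth 0 [:: t.1.1; t.1.2; t.2] j in
  let d2 := fun j : 'I_3 => tot t - nth 0 [:: t.1.1; t.1.2; t.2] j in
  [/\ gmx (fun=> 0) d1 K1, gmx d1 d2 K2 & gmx d2 (fun=> tot t) K3].
Proof.
move=> [h1 h2 h3] /=; split.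
- move=> i j; rewrite mxE; move: j; apply: ord3P => /=; rewrite subr0 //.
- move=> i j; rewrite mxE /tot; move: i; apply: ord3P; move: j; apply: ord3P => /=;
    try exact: hg0; try (apply: hgN); (apply: (hg_c h1); zlia) || (apply: (hg_c h2); zlia) || (apply: (hg_c h3); zlia).
- move=> i j; rewrite mxE; move: i; apply: ord3P => /=;
    (apply: (hg_c h1); zlia) || (apply: (hg_c h2); zlia) || (apply: (hg_c h3); zlia).
Qed.

End MatrixLift.

(** * Linkage and duality from a resolution of length three *)

Section Resolution.
Variables (k : fieldType) (N b1 b2 b3 : nat).
Local Notation R := {mpoly k[N]}.
Variables (J : R -> Prop) (f : 'rV[R]_b1) (M2 : 'M[R]_(b1, b2)) (M3 : 'M[R]_(b2, b3)).
Variables (s1 : 'I_b1 -> int) (s2 : 'I_b2 -> int) (s3 : 'I_b3 -> int).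
Hypotheses (HJ : forall h, J h <-> exists v : 'cV[R]_b1, h = (f *m v) 0 0).
Hypotheses (fM2 : f *m M2 = 0) (ex1 : ker_sub_im f M2) (M23 : M2 *m M3 = 0)
  (ex2 : ker_sub_im M2 M3) (inj3 : forall v : 'cV_b3, M3 *m v = 0 -> v = 0).
Hypotheses (gf : gmx (fun=> 0) s1 f) (gM2 : gmx s1 s2 M2) (gM3 : gmx s2 s3 M3).

Lemma inj3_mx m (X : 'M[R]_(b3, m)) : M3 *m X = 0 -> X = 0.
Proof.
move=> E; apply/matrixP=> i j.
have /inj3 : M3 *m col j X = 0 by rewrite mulmx_col E; apply/matrixP=> a b; rewrite !mxE.
by move=> /(congr1 (fun M : 'cV_b3 => M i 0)); rewrite !mxE.
Qed.

(** Multiplication by an element of [J] is null-homotopic on the resolution, with homotopy [h0],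
    [h1], [h2]. *)
Lemma res_homotopy e : J e -> exists (h0 : 'cV[R]_b1) (h1 : 'M[R]_(b2, b1)) (h2 : 'M[R]_(b3, b2)),
  [/\ e%:M - h0 *m f = M2 *m h1, e%:M - h1 *m M2 = M3 *m h2 & h2 *m M3 = e%:M].
Proof.
move=> /HJ [h0 Eh0]; have E0 : f *m h0 = e%:M by rewrite [LHS]mx11_scalar -Eh0.
have [|h1 E1] := @ker_lift _ _ _ _ _ _ f M2 (e%:M - h0 *m f) ex1.
  by rewrite mulmxBr mul_mx_scalar mulmxA E0 mul_scalar_mx subrr.
have [|h2 E2] := @ker_lift _ _ _ _ _ _ M2 M3 (e%:M - h1 *m M2) ex2.
  by rewrite mulmxBr mul_mx_scalar mulmxA -E1 mulmxBl mul_scalar_mx -mulmxA fM2 mulmx0 subr0 subrr.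
exists h0, h1, h2; split=> //; apply/eqP; rewrite -subr_eq0; apply/eqP.
apply: inj3_mx; rewrite mulmxBr mulmxA -E2 mulmxBl mul_scalar_mx -mulmxA M23 mulmx0 subr0.
by rewrite mul_mx_scalar subrr.
Qed.

(** [B0], [ka], [y] lift the map from [R / c] to [R / J] to the resolutions. As in the dual mapping
    cone, [c : J] is generated by [c] and the entries of [y], and its colon ideal is [J] again. *)
Lemma res_core (c : vec R) (B0 : 'M[R]_(b1, 3)) (ka : 'M[R]_(b2, 3)) (y : 'cV[R]_b3) :
  vreg c -> K1 c = f *m B0 -> B0 *m K2 c = M2 *m ka -> ka *m K3 c = M3 *m y ->
  [/\ forall j, vin c ((M3 *m y) j 0), forall r, vcolon c J (y r 0),
      forall g, vcolon c J g -> exists rho : 'rV[R]_b3, vin c (g - (rho *m y) 0 0)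
    & forall e, (forall r, vin c (e * y r 0)) -> J e].
Proof.
move=> rc EB0 Eka Ey; split.
- by move=> j; rewrite -Ey; apply: vinK3.
- move=> r e /res_homotopy [h0 [h1 [h2 [_ _ E]]]].
  rewrite (_ : y r 0 * e = ((h2 *m ka) *m K3 c) r 0); first exact: vinK3.
  by rewrite -mulmxA Ey mulmxA E mul_scalar_mx mxE mulrC.
(* [A], [Bb], [rho] lift multiplication by [g] from [R / J] to [R / c]; [t1] and [t2] are a homotopy
   from the composite with [B0], [ka], [y] to multiplication by [g] on the Koszul complex. *)
- move=> g Hg; have [|A EA] := @vinK_row _ _ c _ (g *: f).
    move=> j; rewrite mxE; apply: Hg; apply/HJ; exists (delta_mx j 0).
    by rewrite -colE mxE.
  have [|Bb EBb] := @ker_lift _ _ _ _ _ _ _ _ (A *m M2) (K12_exact rc).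
    by rewrite mulmxA -EA -scalemxAl fM2 scaler0.
  have [|rho Erho] := @ker_lift _ _ _ _ _ _ _ _ (Bb *m M3) (K23_exact rc).
    by rewrite mulmxA -EBb -mulmxA M23 mulmx0.
  have [|t1 Et1] := @ker_lift _ _ _ _ _ _ _ _ (A *m B0 - g%:M) (K12_exact rc).
    by rewrite mulmxBr mulmxA -EA -scalemxAl -EB0 mul_mx_scalar subrr.
  have [|t2 Et2] := @ker_lift _ _ _ _ _ _ _ _ (Bb *m ka - g%:M - t1 *m K2 c) (K23_exact rc).
    rewrite !mulmxBr !mulmxA -EBb -Et1 -!mulmxA -Eka mulmxBl mul_mx_scalar mul_scalar_mx mulmxA.
    by rewrite opprB addrA subrK subrr.
  have E : rho *m y - g%:M = t2 *m K3 c.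
    apply/eqP; rewrite -subr_eq0; apply/eqP; apply: (K3_inj rc).
    rewrite !mulmxBr !mulmxA -Erho -Et2 !mulmxBl -!mulmxA -Ey K23_0 mulmx0 subr0.
    by rewrite mul_mx_scalar mul_scalar_mx subrr.
  exists rho; rewrite (_ : g - _ = - ((t2 *m K3 c) 0 0)); first by apply: vinN; apply: vinK3.
  by rewrite -E !mxE eqxx mulr1n opprB.
(* The dual chase: [e * y] in [c] is pushed down through the exact dual Koszul complex, past [ka]
   and [B0], to an expression of [e] by the entries of [f]. *)
- move=> e He; have [|Z EZ] := @vinK_col _ _ c _ (e *: y); first by move=> i; rewrite mxE.
  have [|U EU] := @K32_dual _ _ c rc _ (e *: ka - M3 *m Z).
    by rewrite mulmxBl -scalemxAl Ey -mulmxA -EZ -scalemxAr subrr.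
  have [|V EV] := @K21_dual _ _ c rc _ (e *: B0 - M2 *m U).
    rewrite mulmxBl -scalemxAl Eka -mulmxA -EU mulmxBr -scalemxAr mulmxA M23 mul0mx subr0.
    by rewrite subrr.
  have := congr1 (mulmx f) EV; rewrite mulmxBr -scalemxAr -EB0 !mulmxA fM2 mul0mx subr0.
  rewrite [f *m V]mx11_scalar mul_scalar_mx => E.
  apply/HJ; exists V; have c0 : c.1.1 != 0 by case: rc => -[].
  apply: (mulIf c0).
  by have := congr1 (fun M : 'rV_3 => M 0 0) E; rewrite ![(_ *: K1 c) _ _]mxE mxE /=.
Qed.

Lemma csub_row (c : vec R) : csub c J -> exists Y : 'M[R]_(b1, 3), K1 c = f *m Y.
Proof.
move=> [Jc1 Jc2 Jc3].
have H j : exists v : 'cV[R]_b1, K1 c 0 j = (f *m v) 0 0.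
  by apply/HJ; rewrite mxE; move: j; apply: ord3P.
have [v Hv] := fin_all_exists H; exists (\matrix_(i, j) v j i 0).
by apply/matrixP=> i j; rewrite ord1 Hv !mxE; apply: eq_bigr => a _; rewrite mxE.
Qed.

Lemma res_link0 (c : vec R) : vreg c -> csub c J -> exists y : 'cV[R]_b3,
  [/\ forall j, vin c ((M3 *m y) j 0), forall r, vcolon c J (y r 0),
      forall g, vcolon c J g -> exists rho : 'rV[R]_b3, vin c (g - (rho *m y) 0 0)
    & forall e, (forall r, vin c (e * y r 0)) -> J e].
Proof.
move=> rc /csub_row [B0 EB0].
have [|ka Eka] := @ker_lift _ _ _ _ _ _ f M2 (B0 *m K2 c) ex1; first by rewrite mulmxA -EB0 K12_0.
have [|y Ey] := @ker_lift _ _ _ _ _ _ M2 M3 (ka *m K3 c) ex2.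
  by rewrite mulmxA -Eka -mulmxA K23_0 mulmx0.
by exists y; apply: res_core rc EB0 Eka Ey.
Qed.

Lemma res_link t (c : vec R) : ci t c -> csub c J -> exists y : 'cV[R]_b3,
  gmx s3 (fun=> tot t) y /\
  [/\ forall j, vin c ((M3 *m y) j 0), forall r, vcolon c J (y r 0),
      forall g, vcolon c J g -> exists rho : 'rV[R]_b3, vin c (g - (rho *m y) 0 0)
    & forall e, (forall r, vin c (e * y r 0)) -> J e].
Proof.
move=> [rc Hc n1] /csub_row [Y EY].
pose d1 := fun j : 'I_3 => nth 0 [:: t.1.1; t.1.2; t.2] j.
pose d2 := fun j : 'I_3 => tot t - nth 0 [:: t.1.1; t.1.2; t.2] j.
have [G1 G2 G3] : [/\ gmx (fun=> 0) d1 (K1 c), gmx d1 d2 (K2 c) & gmx d2 (fun=> tot t) (K3 c)] := K_gmx Hc.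
have [B0 gB0 EB0] := gmx_lift gf G1 EY.
have [|ka gka Eka] := @gmx_ker_lift _ _ _ _ _ _ (fun=> 0) s1 s2 d2 f M2 (B0 *m K2 c) ex1 gM2 (gmxM gB0 G2).
  by rewrite mulmxA -EB0 K12_0.
have [|y gy Ey] := @gmx_ker_lift _ _ _ _ _ _ s1 s2 s3 (fun=> tot t) M2 M3 (ka *m K3 c) ex2 gM3 (gmxM gka G3).
  by rewrite mulmxA -Eka -mulmxA K23_0 mulmx0.
by exists y; split=> //; apply: res_core rc EB0 Eka Ey.
Qed.

Variables (c1 c2 c3 : R).
Hypotheses (rJ : reg3 c1 c2 c3) (J1 : J c1) (J2 : J c2) (J3 : J c3) (f0 : f != 0).

(** The homotopy solves the problem after multiplication by any element of [J]; the solutions for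
    two members of a regular sequence are compatible and can be divided. *)
Lemma res_dual1 (v : 'rV[R]_b1) : v *m M2 = 0 -> exists g, v = g *: f.
Proof.
move=> E; have step e : J e -> exists g, e *: v = g *: f.
  move=> /res_homotopy [h0 [h1 [h2 [E1 _ _]]]]; exists ((v *m h0) 0 0).
  have := congr1 (mulmx v) E1; rewrite mulmxBr mul_mx_scalar !mulmxA E mul0mx.
  by move=> /eqP; rewrite subr_eq0 => /eqP ->; rewrite {1}[v *m h0]mx11_scalar mul_scalar_mx.
have [g1 E1] := step _ J1; have [g2 E2] := step _ J2.
have [[c10 r2] _] := rJ.
have Eg : g1 * c2 = g2 * c1.
  have : (c2 * g1 - c1 * g2) *: f = 0.
    by rewrite scalerBl -!scalerA -E1 -E2 !scalerA mulrC subrr.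
  have [j fj] : exists j, f 0 j != 0.
    apply/existsP; apply: contraNT f0 => /existsPn H; apply/eqP/rowP=> j; rewrite mxE.
    by have := H j; rewrite negbK => /eqP.
  move=> /(congr1 (fun M : 'rV_b1 => M 0 j)); rewrite !mxE => /eqP.
  rewrite mulf_eq0 (negbTE fj) orbF subr_eq0 => /eqP; by rewrite mulrC [c1 * _]mulrC.
have [|g Eg'] := r2 g1; first by exists g2.
exists g; apply/rowP=> j; have := congr1 (fun M : 'rV_b1 => M 0 j) E1; rewrite !mxE Eg' => H.
by apply: (mulfI c10); rewrite H; ring.
Qed.

(** The solutions for [c1], [c2], [c3] agree up to multiples of [f] by [res_dual1]. The multipliers
    form a Koszul cocycle, and regularity of [c3] corrects [z1] to a multiple of [c1]. *)
Lemma res_dual2 (w : 'rV[R]_b2) : w *m M3 = 0 -> exists z, w = z *m M2.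
Proof.
move=> E; have step e : J e -> exists z, e *: w = z *m M2.
  move=> /res_homotopy [h0 [h1 [h2 [_ E2 _]]]]; exists (w *m h1).
  have := congr1 (mulmx w) E2; rewrite mulmxBr mul_mx_scalar !mulmxA E mul0mx.
  by move=> /eqP; rewrite subr_eq0 => /eqP.
have [z1 E1] := step _ J1; have [z2 E2] := step _ J2; have [z3 E3] := step _ J3.
have pr (a b : R) za zb : a *: w = za *m M2 -> b *: w = zb *m M2 -> exists g, b *: za - a *: zb = g *: f.
  move=> Ea Eb; apply: res_dual1; rewrite mulmxBl -!scalemxAl -Ea -Eb !scalerA mulrC subrr //.
have [g12 G12] := pr _ _ _ _ E1 E2; have [g13 G13] := pr _ _ _ _ E1 E3; have [g23 G23] := pr _ _ _ _ E2 E3.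
have [[c10 r2] r3] := rJ.
have [j fj] : exists j, f 0 j != 0.
  apply/existsP; apply: contraNT f0 => /existsPn H; apply/eqP/rowP=> j; rewrite mxE.
  by have := H j; rewrite negbK => /eqP.
have at_ j' (a b : R) za zb g : b *: za - a *: zb = g *: f -> b * za 0 j' - a * zb 0 j' = g * f 0 j'.
  by move=> /(congr1 (fun M : 'rV_b1 => M 0 j')); rewrite !mxE.
have [|u [v Euv]] := r3 g12.
  exists (- g23), g13; apply: (mulIf fj).
  apply: (lcomb (eqD (eqM (- c3) (at_ j _ _ _ _ _ G12)) (eqD (eqM c2 (at_ j _ _ _ _ _ G13)) (eqM (- c1) (at_ j _ _ _ _ _ G23))))).
  ring.
pose z1' := z1 - v *: f.
have [z Ez] : exists z, z1' = c1 *: z.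
  have H j' : exists y, z1' 0 j' = c1 * y.
    have [|y Ey] := r2 (z1' 0 j'); last by exists y; rewrite Ey mulrC.
    exists (z2 0 j' + u * f 0 j'); have := at_ j' _ _ _ _ _ G12; rewrite /z1' !mxE Euv => e.
    by lc e.
  have [y Hy] := fin_all_exists H; exists (\row_j' y j').
  by apply/rowP=> j'; rewrite Hy !mxE.
have E' : c1 *: w = c1 *: (z *m M2).
  by rewrite E1 scalemxAl -Ez /z1' mulmxBl -scalemxAl fM2 scaler0 subr0.
exists z; apply/rowP=> a; apply: (mulfI c10).
by have := congr1 (fun M : 'rV_b2 => M 0 a) E'; rewrite !mxE.
Qed.

End Resolution.

Section Entries.
Variable V : nmodType.
Lemma sum3E (F : 'I_3 -> V) : \sum_i F i = F (inord 0) + F (inord 1) + F (inord 2).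
Proof.
rewrite !big_ord_recl big_ord0 addr0 addrA.
by congr (F _ + F _ + F _); apply: val_inj; rewrite /= inordK.
Qed.
Lemma sum5E (F : 'I_5 -> V) :
  \sum_i F i = F (inord 0) + F (inord 1) + F (inord 2) + F (inord 3) + F (inord 4).
Proof.
rewrite !big_ord_recl big_ord0 addr0 !addrA.
by congr (F _ + F _ + F _ + F _ + F _); apply: val_inj; rewrite /= inordK.
Qed.
Lemma sum7E (F : 'I_7 -> V) : \sum_i F i =
  F (inord 0) + F (inord 1) + F (inord 2) + F (inord 3) + F (inord 4) + F (inord 5) + F (inord 6).
Proof.
rewrite !big_ord_recl big_ord0 addr0 !addrA.
by congr (F _ + F _ + F _ + F _ + F _ + F _ + F _); apply: val_inj; rewrite /= inordK.
Qed.
End Entries.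

Lemma lin_indep_reg2 (k : fieldType) N (x y : {mpoly k[N]}) : hg 1 x -> hg 1 y ->
  (forall c d : {mpoly k[N]}, hg 0 c -> hg 0 d -> c * x + d * y = 0 -> c = 0 /\ d = 0) -> reg2 x y.
Proof.
move=> hx hy H; have x0 : x != 0.
  apply/eqP => x0; have [] := H 1 0; rewrite ?x0; [exact: hg1|exact: hg0|ring|].
  by move/eqP; rewrite oner_eq0.
apply: reg2_lin => // /(in1_hg hy hx) [u hu E].
have [] := H u (-1); [exact: (hg_c hu)|by apply: hgN; apply: hg1|by rewrite E; ring|].
by move=> _ /eqP; rewrite oppr_eq0 oner_eq0.
Qed.

(** * Structure of [J] read off its resolution *)

Section Base.
Variables (k : fieldType) (N n : nat).
Local Notation R := {mpoly k[N]}.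
Hypothesis n4 : (4 <= n)%N.
Variables (J : R -> Prop) (f : 'rV[R]_5) (M2 : 'M[R]_(5, 7)) (M3 : 'M[R]_(7, 3)).
Hypotheses (hf : forall j : 'I_5, (f ord0 j) \is (nth 0%N (shifts1 n) j).-homog /\ f ord0 j != 0)
  (hM2 : forall (j : 'I_5) (l : 'I_7), min_entry (nth 0%N (shifts1 n) j) (nth 0%N (shifts2 n) l) (M2 j l))
  (hM3 : forall (j : 'I_7) (l : 'I_3), min_entry (nth 0%N (shifts2 n) j) (nth 0%N (shifts3 n) l) (M3 j l)).
Hypotheses (HJ : forall h, J h <-> exists v : 'cV[R]_5, h = (f *m v) 0 0).
Hypotheses (fM2 : f *m M2 = 0) (ex1 : ker_sub_im f M2) (M23 : M2 *m M3 = 0)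
  (ex2 : ker_sub_im M2 M3) (inj3 : forall v : 'cV_3, M3 *m v = 0 -> v = 0).

Definition sh1 (i : 'I_5) : int := (nth 0%N (shifts1 n) i)%:Z.
Definition sh2 (i : 'I_7) : int := (nth 0%N (shifts2 n) i)%:Z.
Definition sh3 (i : 'I_3) : int := (nth 0%N (shifts3 n) i)%:Z.

Lemma min_entry_hg a b (g : R) : min_entry a b g -> hg (b%:Z - a%:Z) g.
Proof.
case=> h [ab|->]; last exact: hg0.
have -> : b%:Z - a%:Z = (b - a)%N by zlia.
exact/hgE.
Qed.
Lemma min_entry_0 a b (g : R) : min_entry a b g -> (b <= a)%N -> g = 0.
Proof. by case=> _ [ab|//]; rewrite leqNgt ab. Qed.

Lemma gmx_f : gmx (fun=> 0) sh1 f.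
Proof. by move=> i j; rewrite ord1 subr0; apply/hgE; case: (hf j). Qed.
Lemma gmx_M2 : gmx sh1 sh2 M2. Proof. by move=> i j; apply: min_entry_hg. Qed.
Lemma gmx_M3 : gmx sh2 sh3 M3. Proof. by move=> i j; apply: min_entry_hg. Qed.

Local Notation F i := (f 0 (inord i)).
Local Notation e2 i j := (M2 (inord i) (inord j)).
Local Notation e3 i j := (M3 (inord i) (inord j)).

Ltac sh := rewrite /sh1 /sh2 /sh3 ?inordK // /shifts1 /shifts2 /shifts3 /=.
Ltac ent H := let Hent := fresh in have Hent := H;
  rewrite /shifts1 /shifts2 /shifts3 !inordK // in Hent;
  ((apply: (min_entry_0 Hent); rewrite /=; zlia) || (apply: (hg_c (min_entry_hg Hent)); rewrite /=; zlia)).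

Lemma hF : [/\ hg 2 (F 0%N), hg (n%:Z + 1) (F 1%N), hg (n%:Z + 1) (F 2%N), hg (n%:Z + 3) (F 3%N)
  & hg (2 * n%:Z + 4) (F 4%N)].
Proof.
split; [have := gmx_f 0 (inord 0)|have := gmx_f 0 (inord 1)|have := gmx_f 0 (inord 2)|
  have := gmx_f 0 (inord 3)|have := gmx_f 0 (inord 4)]; sh => H; apply: (hg_c H); zlia.
Qed.

Lemma e2_row4 : [/\ e2 4%N 0%N = 0, e2 4%N 1%N = 0, e2 4%N 2%N = 0 & e2 4%N 3%N = 0].
Proof. split; [ent (hM2 (inord 4) (inord 0))|ent (hM2 (inord 4) (inord 1))|
  ent (hM2 (inord 4) (inord 2))|ent (hM2 (inord 4) (inord 3))]. Qed.
Lemma e3_zero : [/\ e3 4%N 0%N = 0, e3 5%N 0%N = 0, e3 6%N 0%N = 0 & e3 6%N 1%N = 0].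
Proof. split; [ent (hM3 (inord 4) (inord 0))|ent (hM3 (inord 5) (inord 0))|
  ent (hM3 (inord 6) (inord 0))|ent (hM3 (inord 6) (inord 1))]. Qed.
Lemma e3_lin : [/\ hg 1 (e3 3%N 0%N), hg 1 (e3 4%N 1%N), hg 1 (e3 5%N 1%N) & hg 1 (e3 6%N 2%N)].
Proof. split; [ent (hM3 (inord 3) (inord 0))|ent (hM3 (inord 4) (inord 1))|
  ent (hM3 (inord 5) (inord 1))|ent (hM3 (inord 6) (inord 2))]. Qed.
Lemma e3_deg : hg (n%:Z - 1) (e3 4%N 2%N) /\ hg (n%:Z - 1) (e3 5%N 2%N).
Proof. split; [ent (hM3 (inord 4) (inord 2))|ent (hM3 (inord 5) (inord 2))]. Qed.

Variables (c1 c2 c3 : R).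
Hypotheses (rJ : reg3 c1 c2 c3) (J1 : J c1) (J2 : J c2) (J3 : J c3).

Lemma f_neq0 : f != 0.
Proof.
apply/eqP => E; have [_] := hf (inord 0); rewrite E mxE eqxx //.
Qed.

(** By duality [w] is a combination of rows of [M2]. The entries of column [j] have degree
    [sh2 j - sh1 i] or vanish, so nothing of smaller degree can occur. This is how minimality gives
    nondegeneracy of [M3]. *)
Lemma low_entry (w : 'rV[R]_7) j d : w *m M3 = 0 -> hg d (w 0 j) ->
  (forall i, d < sh2 j - sh1 i \/ M2 i j = 0) -> w 0 j = 0.
Proof.
move=> /(res_dual2 HJ fM2 ex1 M23 ex2 inj3 rJ J1 J2 J3 f_neq0) [z ->] Hd Hi.
rewrite -Hd mxE hp_sum big1 // => i _; case: (Hi i) => [lt|->]; last by rewrite mulr0 hp0.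
rewrite (hpM _ _ (gmx_M2 i j)) (_ : hp _ (z 0 i) = 0) ?mul0r //.
by apply: (hg_neg (hp_hg _ _)); zlia.
Qed.

Lemma low_col (w : nat -> R) j d : (j < 7)%N ->
  (forall r, (r < 3)%N -> w 0%N * e3 0%N r + w 1%N * e3 1%N r + w 2%N * e3 2%N r + w 3%N * e3 3%N r
     + w 4%N * e3 4%N r + w 5%N * e3 5%N r + w 6%N * e3 6%N r = 0) ->
  hg d (w j) -> (forall i, (i < 5)%N -> d < (nth 0%N (shifts2 n) j)%:Z - (nth 0%N (shifts1 n) i)%:Z
     \/ e2 i j = 0) -> w j = 0.
Proof.
move=> j7 H Hd Hi; pose W : 'rV[R]_7 := \row_i w i.
have Wj : W 0 (inord j) = w j by rewrite mxE inordK.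
rewrite -Wj; apply: (@low_entry W _ d).
- apply/rowP=> r; rewrite !mxE sum7E !mxE !inordK //.
  have -> : r = inord r by rewrite inord_val.
  by apply: H.
- by rewrite Wj.
- move=> i; have := Hi i (ltn_ord i); rewrite inord_val /sh2 /sh1 inordK //.
Qed.

(** Rows 4, 5, 6 of [M3] are [(0, x5, a5)], [(0, x6, a6)], [(0, 0, l)], row 3 begins with [xh], and
    [p] is the minor of rows 4 and 5. *)
Let x5 := e3 4%N 1%N. Let x6 := e3 5%N 1%N. Let a5 := e3 4%N 2%N. Let a6 := e3 5%N 2%N.
Let l := e3 6%N 2%N. Let xh := e3 3%N 0%N. Let p := x5 * a6 - x6 * a5.

Lemma lin4 : [/\ hg 1 xh, hg 1 x5, hg 1 x6 & hg 1 l]. Proof. exact: e3_lin. Qed.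

Ltac rows3 := let r := fresh in move=> r; case: r => [|[|[|//]]] _ /=.

(** Here and in the next lemmas the forbidden relation yields an explicit row killed by [M3], one of
    whose entries has a degree too small for [low_entry]. *)
Lemma l_neq0 : l != 0.
Proof.
apply/eqP=> l0; have [z1 z2 z3 z4] := e3_zero.
have : (fun j => (j == 6)%:R : R) 6%N = 0.
  apply: (@low_col (fun j => (j == 6)%:R : R) 6 0) => //=; last 2 first.
  - exact: hg1.
  - by move=> [|[|[|[|[|//]]]]] _ /=; left; zlia.
  by rows3; rewrite -/l ?l0 ?z3 ?z4; ring.
by move/eqP; rewrite oner_eq0.
Qed.

Lemma x56_indep c d : hg 0 c -> hg 0 d -> c * x5 + d * x6 = 0 -> c = 0 /\ d = 0.
Proof.
move=> hc hd E; have [z1 z2 z3 z4] := e3_zero; have [_ h5 h6 hl] := lin4.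
pose w j := nth 0 [:: 0; 0; 0; 0; l * c; l * d; - (c * a5 + d * a6)] j.
have Hw : forall r, (r < 3)%N -> w 0%N * e3 0%N r + w 1%N * e3 1%N r + w 2%N * e3 2%N r + w 3%N * e3 3%N r
     + w 4%N * e3 4%N r + w 5%N * e3 5%N r + w 6%N * e3 6%N r = 0.
  rows3; rewrite /w /=.
  - by rewrite z1 z2 z3; ring.
  - by rewrite -/x5 -/x6 z4; lc (eqM l E).
  - by rewrite -/a5 -/a6 -/l; ring.
have e4 : w 4%N = 0.
  apply: (low_col (d := 1) _ Hw) => //; first by apply: (hgM_c hl hc).
  by move=> [|[|[|[|[|//]]]]] _ /=; left; zlia.
have e5 : w 5%N = 0.
  apply: (low_col (d := 1) _ Hw) => //; first by apply: (hgM_c hl hd).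
  by move=> [|[|[|[|[|//]]]]] _ /=; left; zlia.
by move: e4 e5; rewrite /w /= => /eqP; rewrite mulf_eq0 (negbTE l_neq0) /= => /eqP -> /eqP;
  rewrite mulf_eq0 (negbTE l_neq0) /= => /eqP ->.
Qed.

Lemma x56_reg : reg2 x5 x6.
Proof. by have [_ h5 h6 hl] := lin4; apply: lin_indep_reg2 => // c d; apply: x56_indep. Qed.
Lemma x5_neq0 : x5 != 0. Proof. by case: x56_reg. Qed.

Lemma p_hg : hg n%:Z p.
Proof.
have [_ h5 h6 hl] := lin4; have [g5 g6] := e3_deg.
by apply: hgB; [apply: (hgM_c h5 g6)|apply: (hgM_c h6 g5)]; zlia.
Qed.

Lemma l_ndvd_p : ~ in1 l p.
Proof.
move=> [h Eh]; have [z1 z2 z3 z4] := e3_zero; have [_ h5 h6 hl] := lin4.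
pose w j := nth 0 [:: 0; 0; 0; 0; - x6; x5; - h] j.
have := x5_neq0; suff : w 5%N = 0 by rewrite /w /= => ->; rewrite eqxx.
apply: (low_col (d := 1)) => //; last by move=> [|[|[|[|[|//]]]]] _ /=; left; zlia.
rows3; rewrite /w /=.
- by rewrite z1 z2 z3; ring.
- by rewrite -/x5 -/x6 z4; ring.
- by rewrite -/a5 -/a6 -/l; move: Eh; rewrite /p => e; lc e.
Qed.

Lemma xh_neq0 : xh != 0.
Proof.
apply/eqP=> xh0; have [z1 z2 z3 z4] := e3_zero; have [_ h5 h6 hl] := lin4.
pose b3 := e3 3%N 1%N; pose d3 := e3 3%N 2%N.
pose w j := nth 0 [:: 0; 0; 0; l * x5; - (l * b3); 0; - (x5 * d3 - b3 * a5)] j.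
have := mulf_neq0 l_neq0 x5_neq0; suff : w 3%N = 0 by rewrite /w /= => ->; rewrite eqxx.
apply: (low_col (d := 2)) => //; last 2 first.
- by apply: (hgM_c hl h5).
- have [_ _ _ e43] := e2_row4.
  by move=> [|[|[|[|[|//]]]]] _ /=; try (left; zlia); right.
rows3; rewrite /w /=.
- by rewrite -/xh xh0 z1 z2 z3; ring.
- by rewrite -/x5 -/x6 -/b3 z4; ring.
- by rewrite -/a5 -/a6 -/l -/d3; ring.
Qed.

Lemma JP h : J h <-> exists v : nat -> R,
  h = v 0%N * F 0%N + v 1%N * F 1%N + v 2%N * F 2%N + v 3%N * F 3%N + v 4%N * F 4%N.
Proof.
rewrite HJ; split=> [[v ->]|[v ->]].
  by exists (fun i => v (inord i) 0); rewrite mxE sum5E; ring.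
by exists (\col_i v i); rewrite mxE sum5E !mxE !inordK //; ring.
Qed.

Lemma JF i : (i < 5)%N -> J (F i).
Proof. by move=> i5; apply/HJ; exists (delta_mx (inord i) 0); rewrite -colE mxE. Qed.

Lemma JP_hg h d : J h -> hg d h -> exists v : nat -> R,
  [/\ hg (d - 2) (v 0%N), hg (d - n%:Z - 1) (v 1%N), hg (d - n%:Z - 1) (v 2%N),
      hg (d - n%:Z - 3) (v 3%N) & hg (d - 2 * n%:Z - 4) (v 4%N)] /\
  h = v 0%N * F 0%N + v 1%N * F 1%N + v 2%N * F 2%N + v 3%N * F 3%N + v 4%N * F 4%N.
Proof.
move=> /JP [v E] Hd; have [h0 h1 h2 h3 h4] := hF.
exists (fun i => hp (d - nth 0 [:: 2; n%:Z + 1; n%:Z + 1; n%:Z + 3; 2 * n%:Z + 4] i) (v i)); split.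
  by split; apply: (hg_c (hp_hg _ _)) => /=; zlia.
by rewrite -Hd E !hpD (hpM _ _ h0) (hpM _ _ h1) (hpM _ _ h2) (hpM _ _ h3) (hpM _ _ h4).
Qed.

(** As [M2 *m M3 = 0], the nonzero part of row 4 of [M2] is a multiple of [(l x6, - l x5, p)]. The
    Koszul relation between [F i] and [F 4] comes from [M2], and its last coordinate expresses [F i]
    by that row. *)
Lemma F_H0 i : (i < 4)%N -> in3 (l * x5) (l * x6) p (F i).
Proof.
move=> i4; have [z1 z2 z3 z4] := e3_zero; have [_ h5 h6 hl] := lin4; have [y1 y2 y3 y4] := e2_row4.
pose q1 := e2 4%N 4%N; pose q2 := e2 4%N 5%N; pose p5 := e2 4%N 6%N.
have row r : (r < 3)%N -> q1 * e3 4%N r + q2 * e3 5%N r + p5 * e3 6%N r = 0.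
  move=> r3; have := congr1 (fun M : 'M_(5, 3) => M (inord 4) (inord r)) M23.
  by rewrite !mxE sum7E y1 y2 y3 y4 !mul0r !add0r.
have E1 := row 1%N isT; have E2 := row 2%N isT.
rewrite -/x5 -/x6 z4 in E1; rewrite -/a5 -/a6 -/l in E2.
have [|m [Em1 Em2]] := @reg2_syz _ x5 x6 q1 q2 x56_reg; first by lc E1.
have [m' Em'] : in1 l m.
  have [] // := lin_prime hl l_neq0 (f := m) (g := p).
    by exists p5; rewrite /p; rewrite Em1 Em2 in E2; lc E2.
  by case/l_ndvd_p.
have Ep5 : p5 = m' * p.
  by apply: (mulIf l_neq0); rewrite /p; rewrite Em1 Em2 Em' in E2; lc E2.
have [|w Ew] := ex1 (v := \col_j (if j == inord i then F 4%N else if j == inord 4 then - F i else 0)).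
  apply/rowP=> a; rewrite ord1 !mxE (bigD1 (inord i)) //= (bigD1 (inord 4)) /=; last first.
    by apply/eqP=> /(congr1 val); rewrite /= !inordK //; zlia.
  rewrite big1 ?mxE ?eqxx; last by move=> j /andP[/negbTE h /negbTE h']; rewrite !mxE h h' mulr0.
  rewrite (_ : (inord 4 == inord i :> 'I_5) = false); first by ring.
  by apply/eqP=> /(congr1 val); rewrite /= !inordK //; zlia.
have := congr1 (fun M : 'cV_5 => M (inord 4) 0) Ew; rewrite !mxE sum7E y1 y2 y3 y4 eqxx.
rewrite (_ : (inord 4 == inord i :> 'I_5) = false); last first.
  by apply/eqP=> /(congr1 val); rewrite /= !inordK //; zlia.
rewrite -/q1 -/q2 -/p5 Em1 Em2 Ep5 Em' => E.
exists (m' * w (inord 5) 0), (- (m' * w (inord 4) 0)), (- (m' * w (inord 6) 0)).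
by lc E.
Qed.

Lemma J_low h d : J h -> hg d h -> d <= n%:Z -> in1 (F 0%N) h.
Proof.
move=> Jh Hd dn; have [v [[h0 h1 h2 h3 h4] ->]] := JP_hg Jh Hd.
by exists (v 0%N); rewrite (hg_neg h1) ?(hg_neg h2) ?(hg_neg h3) ?(hg_neg h4); try zlia; ring.
Qed.

Lemma F0_split : exists x, [/\ hg 1 x, x != 0, F 0%N = x * l & in2 x5 x6 x].
Proof.
have [z1 z2 z3 z4] := e3_zero; have [_ h5 h6 hl] := lin4; have [h0 _ _ _ _] := hF.
have [u [v [w [[hu hv hw] E]]]] : exists u v w, [/\ hg 0 u, hg 0 v & hg (2 - n%:Z) w] /\
    F 0%N = u * (l * x5) + v * (l * x6) + w * p.
  have [u [v [w [E hu hv hw]]]] := in3_hg h0 (hgM hl h5) (hgM hl h6) p_hg (F_H0 (i := 0) isT).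
  by exists u, v, w.
move: E; rewrite (hg_neg hw) ?mul0r ?addr0; last by zlia.
move=> E; exists (u * x5 + v * x6); split.
- by apply: hgD; [apply: (hgM_c hu h5)|apply: (hgM_c hv h6)].
- apply/eqP => x0; have [_] := hf (inord 0); have -> : F 0%N = 0; last by rewrite eqxx.
  by rewrite E; lc (eqM l x0).
- by rewrite E; ring.
- by exists u, v.
Qed.

(** Tested on the generators [Y] of a colon ideal: [h] kills [Y 1] and [Y 2] by rows 4, 5, 6 of
    [M3], row 3 settles [xh * h * Y 0], and reflexivity concludes. *)
Lemma xh_H0 h : in3 (l * x5) (l * x6) p h -> J (xh * h).
Proof.
have [z1 z2 z3 z4] := e3_zero.
have [y [Hy _ _ refl]] := res_link0 HJ fM2 ex1 M23 ex2 inj3 (c := (c1, c2, c3)) rJ (And3 J1 J2 J3).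
set C := (c1, c2, c3) in Hy refl; pose Y i := y (inord i) 0.
have row j : vin C (M3 (inord j) (inord 0) * Y 0%N + M3 (inord j) (inord 1) * Y 1%N +
    M3 (inord j) (inord 2) * Y 2%N) by have := Hy (inord j); rewrite mxE sum3E.
have r6 : vin C (l * Y 2%N) by have := row 6%N; rewrite z3 z4 !mul0r !add0r.
have r4 : vin C (x5 * Y 1%N + a5 * Y 2%N) by have := row 4%N; rewrite z1 !mul0r !add0r.
have r5 : vin C (x6 * Y 1%N + a6 * Y 2%N) by have := row 5%N; rewrite z2 !mul0r !add0r.
have r3 := row 3%N; rewrite -/xh in r3.
move=> [u [v [w E]]]; have k1 : vin C (h * Y 1%N).
  rewrite (_ : _ * _ = (u * l) * (x5 * Y 1%N + a5 * Y 2%N) + (v * l) * (x6 * Y 1%N + a6 * Y 2%N)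
    + w * (a6 * (x5 * Y 1%N + a5 * Y 2%N) - a5 * (x6 * Y 1%N + a6 * Y 2%N))
    - (u * a5 + v * a6) * (l * Y 2%N)); last by rewrite E /p; ring.
  apply: vinB; last exact: vinM.
  by apply: vinD; [apply: vinD; apply: vinM|apply/vinM/vinB; apply: vinM].
have k2 : vin C (h * Y 2%N).
  rewrite (_ : _ * _ = (u * x5 + v * x6) * (l * Y 2%N)
    + w * (x5 * (x6 * Y 1%N + a6 * Y 2%N) - x6 * (x5 * Y 1%N + a5 * Y 2%N))); last by rewrite E /p; ring.
  by apply: vinD; [apply: vinM|apply/vinM/vinB; apply: vinM].
apply: refl => r.
have [||] : [\/ r = inord 0, r = inord 1 | r = inord 2].
  case: r => [[|[|[|//]]] Hr]; [apply: Or31|apply: Or32|apply: Or33]; apply: val_inj; by rewrite /= inordK.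
- move=> ->; rewrite -/(Y 0%N) (_ : _ * _ = h * (xh * Y 0%N + e3 3%N 1%N * Y 1%N + e3 3%N 2%N * Y 2%N)
    - e3 3%N 1%N * (h * Y 1%N) - e3 3%N 2%N * (h * Y 2%N)); last by ring.
  by do 2![apply: vinB; last exact: vinM]; apply: vinM.
- by move=> ->; rewrite -/(Y 1%N) -mulrA; apply: vinM.
- by move=> ->; rewrite -/(Y 2%N) -mulrA; apply: vinM.
Qed.

(** [xh * l * x5] and [xh * l * x6] are elements of [J] of degree 3, hence multiples of [x * l]; as
    [x5] and [x6] are coprime, [x] divides [xh]. *)
Lemma xh_x x : hg 1 x -> x != 0 -> F 0%N = x * l -> in2 x5 x6 x ->
  exists2 c, hg 0 c & x = c * xh.
Proof.
move=> hx x0 EF Hx; have [hxh h5 h6 hl] := lin4.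
have step y : hg 1 y -> in3 (l * x5) (l * x6) p (l * y) -> in1 x xh \/ in1 x y.
  move=> hy /xh_H0 /(J_low (d := 3)) [||g]; first by apply: (hgM_c hxh (hgM hl hy)).
    by zlia.
  rewrite EF => E; apply: lin_prime => //; exists g.
  by apply: (mulIf l_neq0); lc E.
have : in1 x xh.
  case: (step x5 h5) => //; first by exists 1, 0, 0; ring.
  move=> d5; case: (step x6 h6) => //; first by exists 0, 1, 0; ring.
  move=> d6; have h1 := reg2_nocommon x56_reg d5 d6.
  by case: (hg_pos_no1 hx _ h1).
move=> /(in1_hg hxh hx) [u hu E].
have u0 : u != 0 by apply: contraNneq xh_neq0 => u0; rewrite E u0 mul0r.
have [v hv Ev] := hg_unit (hg_c hu (subrr _)) u0.
by exists v => //; rewrite E mulrA Ev mul1r.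
Qed.

Lemma base_data : exists x l2, [/\ S1 n%:Z J x l l2 p, ~ in1 x l2, F 0%N = x * l,
   (forall i, (i < 4)%N -> in3 (x * l) (l2 * l) p (F i)) & exists2 c, hg 0 c & x = c * xh].
Proof.
have [hxh h5 h6 hl] := lin4; have [x [hx x0 EF [u' [v' Hx']]]] := F0_split.
have Hx : in2 x5 x6 x by exists u', v'.
have [c hc Ec] := xh_x hx x0 EF Hx.
have [u [v [Euv hu hv]]] := in2_hg hx h5 h6 Hx.
(* [l2] is whichever of [x5], [x6] completes [x] to a basis of the pencil. *)
have [l2 [hl2 S5 S6 nd]] : exists l2, [/\ hg 1 l2, in2 x l2 x5, in2 x l2 x6 & ~ in1 x l2].
  have hu0 := hg_c hu (subrr _); have hv0 := hg_c hv (subrr _).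
  case: (eqVneq u 0) => [u0|u0].
    have v0 : v != 0 by apply: contraNneq x0 => v0; rewrite Euv u0 v0; apply/eqP; ring.
    have [w hw Ew] := hg_unit hv0 v0; exists x5; split=> //.
    - by exists 0, 1; ring.
    - by exists w, 0; rewrite Euv u0; lc (eqM x6 Ew).
    - move=> /(in1_hg h5 hx) [m hm Em]; have := @x56_indep (-1) (m * v).
      case; [by apply: hgN; apply: hg1|by apply: (hgM_c hm hv)|by apply: (lcomb (eqM (-1) Em)); rewrite Euv u0; ring|].
      by move/eqP; rewrite oppr_eq0 oner_eq0.
  have [w hw Ew] := hg_unit hu0 u0; exists x6; split=> //.
  - by exists w, (- (w * v)); rewrite Euv; lc (eqM x5 Ew).
  - by exists 0, 1; ring.
  - move=> /(in1_hg h6 hx) [m hm Em]; have := @x56_indep (m * u) (m * v - 1).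
    case; [by apply: (hgM_c hm hu)|by apply: hgB; [apply: (hgM_c hm hv)|apply: hg1]|
      by move: Em; rewrite Euv => e; lc e|].
    move=> mu0 /eqP; rewrite subr_eq0 => /eqP mv; have m0 : m = 0.
      by move/eqP: mu0; rewrite mulf_eq0 (negbTE u0) orbF => /eqP.
    by move/eqP: mv; rewrite m0 mul0r eq_sym oner_eq0.
have H0 h : in3 (l * x5) (l * x6) p h -> in3 (x * l) (l2 * l) p h.
  case: S5 => [s1 [s2 E5]]; case: S6 => [s3 [s4 E6]] [w1 [w2 [w3 ->]]].
  exists (w1 * s1 + w2 * s3), (w1 * s2 + w2 * s4), w3.
  by apply: (lcomb (eqD (eqM (w1 * l) E5) (eqM (w2 * l) E6))); ring.
have FH i : (i < 4)%N -> in3 (x * l) (l2 * l) p (F i) by move=> /F_H0 /H0.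
have KH (w : nat -> R) : in3 (x * l) (l2 * l) p
    (w 0%N * F 0%N + w 1%N * F 1%N + w 2%N * F 2%N + w 3%N * F 3%N).
  by apply: in3D; [apply: in3D; [apply: in3D|]|]; apply: in3M; apply: FH.
have Hlp h : in3 (x * l) (l2 * l) p h -> in2 l p h := @H_lp _ _ _ _ _ _ h.
exists x, l2; split=> //; last by exists c.
have PH h d : J h -> hg d h -> d < 2 * n%:Z + 4 -> in3 (x * l) (l2 * l) p h.
  move=> Jh Hd dn; have [w [[_ _ _ _ h4] ->]] := JP_hg Jh Hd.
  by rewrite (hg_neg h4) ?mul0r ?addr0; [apply: KH|zlia].
split=> //; last first.
  case: S5 => [s1 [s2 E5]]; case: S6 => [s3 [s4 E6]].
  exists (s1 * a6 - s3 * a5), (s2 * a6 - s4 * a5); rewrite /p.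
  by apply: (lcomb (eqD (eqM a6 E5) (eqM (- a5) E6))); ring.
split.
- by split=> //; apply: l_neq0.
- by split; [apply: p_hg|apply: l_ndvd_p].
- split; first by rewrite -EF; apply: JF.
  have Jp : J (xh * p) by apply: xh_H0; exists 0, 0, 1; ring.
  rewrite Ec -mulrA; move: Jp => /JP [w ->]; apply/JP; exists (fun i => c * w i); ring.
- split; first by rewrite -EF; apply: J_low.
  by move=> h d Jh Hd dn; apply/Hlp/(PH _ d).
split=> [_ e1 e2 /JP_hg H1 /JP_hg H2 /H1 [v1 [[_ _ _ _ g1] E1]] /H2 [v2 [[_ _ _ _ g2] E2]]|].
  have [//||d1 [d2 [nz E]]] := @const_dep _ _ (v1 4%N) (v2 4%N); [apply: (hg_c g1); zlia|apply: (hg_c g2); zlia|].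
  exists d1, d2; split=> //; apply: Hlp.
  have := KH (fun i => d1%:MP * v1 i + d2%:MP * v2 i); rewrite E1 E2; set G := (G in in3 _ _ _ G -> _).
  by rewrite (_ : _ + _ = G) //; rewrite /G; lc (eqM (F 4%N) E).
(* Below degree [tot t - (2n + 7)] only [Y 2], of degree [tot t - (3n + 5)], contributes, and rows
   4, 5, 6 of [M3] show that [l] and [p] kill it modulo [C]. *)
move=> t C Ct sub g d Hg hgd dt.
have [y [gy [Hy _ gen _]]] := res_link HJ fM2 ex1 M23 ex2 inj3 gmx_f gmx_M2 gmx_M3 Ct sub.
have [z1 z2 z3 z4] := e3_zero; pose Y i := y (inord i) 0.
have row j : vin C (M3 (inord j) (inord 0) * Y 0%N + M3 (inord j) (inord 1) * Y 1%N +
    M3 (inord j) (inord 2) * Y 2%N) by have := Hy (inord j); rewrite mxE sum3E.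
have r6 : vin C (l * Y 2%N) by have := row 6%N; rewrite z3 z4 !mul0r !add0r.
have r4 : vin C (x5 * Y 1%N + a5 * Y 2%N) by have := row 4%N; rewrite z1 !mul0r !add0r.
have r5 : vin C (x6 * Y 1%N + a6 * Y 2%N) by have := row 5%N; rewrite z2 !mul0r !add0r.
have rp : vin C (p * Y 2%N).
  rewrite (_ : _ * _ = x5 * (x6 * Y 1%N + a6 * Y 2%N) - x6 * (x5 * Y 1%N + a5 * Y 2%N)); last by rewrite /p; ring.
  by apply: vinB; apply: vinM.
have [rho] := gen _ Hg; rewrite mxE sum3E -/(Y 0%N) -/(Y 1%N) -/(Y 2%N) => Hr.
have [_ [hc1 hc2 hc3] _] := Ct.
have := in3_hp d hc1 hc2 hc3 Hr; rewrite hpB !hpD hgd.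
have := gy (inord 0) 0; have := gy (inord 1) 0; have := gy (inord 2) 0; sh => y2 y1 y0.
rewrite (hpM _ _ y0) (hpM _ _ y1) (hpM _ _ y2) (hg_neg (hp_hg (d - _) (rho 0 (inord 0)))); last by zlia.
rewrite (hg_neg (hp_hg (d - _) (rho 0 (inord 1)))); last by zlia.
rewrite !mul0r !add0r; set w := hp _ _ => Hw.
have fin h : vin C (h * Y 2%N) -> vin C (h * g).
  move=> Hh; rewrite (_ : h * g = h * (g - w * Y 2%N) + w * (h * Y 2%N)); last by ring.
  by apply: vinD; apply: vinM.
by split; apply: fin.
Qed.

End Base.

(** * Greatest common divisors *)

Section GCD.
Variable A : idomainType.
Implicit Types (a b c d e : A).

(** In a domain, regularity of [(a', b')] expresses coprimality of the cofactors. *)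
Definition gcd_domain (B : idomainType) := forall a b : B, a != 0 ->
  exists d a' b' : B, [/\ a = a' * d, b = b' * d & reg2 a' b'].

Lemma in1_trans (B : idomainType) (a b c : B) : in1 a b -> in1 b c -> in1 a c.
Proof. by move=> [u ->] [v ->]; exists (v * u); ring. Qed.
Lemma in1_refl (B : idomainType) (a : B) : in1 a a. Proof. by exists 1; ring. Qed.

Hypothesis GA : gcd_domain A.

Lemma gcd_ex a b : exists d, [/\ in1 d a, in1 d b & forall e, in1 e a -> in1 e b -> in1 e d].
Proof.
have [->|a0] := eqVneq a 0; first by exists b; split=> //; [exists 0; ring|exact: in1_refl].
have [d [a' [b' [Ea Eb [a'0 co]]]]] := GA b a0.
exists d; split; [by exists a'|by exists b'|] => e [e1 E1] [e2 E2].
have d0 : d != 0 by apply: contraNneq a0 => d0; rewrite Ea d0 mulr0.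
have e0 : e != 0 by apply: contraNneq a0 => e0; rewrite E1 e0 mulr0.
have [|w Ew] := co e1.
  exists e2; apply: (mulIf (mulf_neq0 d0 e0)); rewrite Ea in E1; rewrite Eb in E2.
  by apply: (lcomb (eqD (eqM (- (b' * d)) E1) (eqM (a' * d) E2))); ring.
exists w; apply: (mulIf a'0); rewrite Ea in E1; rewrite Ew in E1; by lc E1.
Qed.

Lemma coprime_cancel c b e x : c != 0 -> (forall d, in1 d c -> in1 d b -> in1 d 1) ->
  in1 e (c * x) -> in1 e (b * x) -> in1 e x.
Proof.
move=> c0 H [w1 E1] [w2 E2]; have [d [c' [b' [Ec Eb [c'0 co]]]]] := GA b c0.
have [v Ev] : in1 d 1 by apply: H; [exists c'|exists b'].
have [e0|e0] := eqVneq e 0.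
  exists 0; move: E1; rewrite e0 mulr0 => /eqP; rewrite mulf_eq0 (negbTE c0) => /eqP ->; ring.
have d0 : d != 0 by apply: contraNneq c0 => d0; rewrite Ec d0 mulr0.
have [|w3 E3] := co w1.
  exists w2; apply: (mulIf (mulf_neq0 d0 e0)); rewrite Ec in E1; rewrite Eb in E2.
  by apply: (lcomb (eqD (eqM (- (b' * d)) E1) (eqM (c' * d) E2))); ring.
exists (v * w3); apply: (mulIf (mulf_neq0 c'0 d0)); rewrite E3 Ec in E1.
by apply: (lcomb (eqD E1 (eqM (w3 * e * c') Ev))); ring.
Qed.

Definition primitive (p : {poly A}) := forall d, in1 d%:P p -> in1 d 1.

Lemma dvdCP e (p : {poly A}) : in1 e%:P p <-> forall i, in1 e p`_i.
Proof.
split=> [[u ->] i|H]; first by exists u`_i; rewrite coefMC.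
have H' i : {u | p`_i == u * e}.
  by apply: sigW; case: (H i) => u ->; exists u.
exists (\poly_(i < size p) sval (H' i)); apply/polyP=> i.
rewrite coefMC coef_poly; case: ltnP => [_|lt]; first exact/eqP/(svalP (H' i)).
by rewrite nth_default // mul0r.
Qed.

Lemma content (p : {poly A}) : p != 0 -> exists c p0, [/\ p = c%:P * p0, primitive p0, c != 0 & p0 != 0].
Proof.
move=> p0; have [c [Hc Hm]] : exists c, (forall i, in1 c p`_i) /\
    forall e, (forall i, in1 e p`_i) -> in1 e c.
  suff H m : exists c, (forall i, (i < m)%N -> in1 c p`_i) /\
      forall e, (forall i, (i < m)%N -> in1 e p`_i) -> in1 e c.
    have [c [H1 H2]] := H (size p); exists c; split=> [i|e He]; last by apply: H2.
    by case: (ltnP i (size p)) => [/H1 //|lt]; rewrite nth_default //; exists 0; ring.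
  elim: m => [|m [c [H1 H2]]]; first by exists 0; split=> // e _; exists 0; ring.
  have [d [D1 D2 D3]] := gcd_ex c p`_m; exists d; split=> [i|e He].
    by rewrite ltnS leq_eqVlt => /orP[/eqP -> //|/H1]; apply: in1_trans.
  by apply: D3; [apply: H2 => i im; apply: He; apply: ltnW|apply: He].
have /dvdCP [q Eq] := Hc; exists c, q; have c0 : c != 0.
  by apply: contraNneq p0 => c0; rewrite Eq c0 mulr0.
split=> //; first by rewrite Eq mulrC.
  move=> d [w Ew]; have [|v Ev] := Hm (d * c); last first.
    by exists v; apply: (mulIf c0); rewrite mul1r {1}Ev mulrA.
  by apply/dvdCP; exists w; rewrite Eq Ew polyCM; ring.
by apply: contraNneq p0 => q0; rewrite Eq q0 mul0r.
Qed.

Lemma size_sub_lead (p : {poly A}) : p != 0 ->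
  (size (p - (lead_coef p)%:P * 'X^((size p).-1))%R < size p)%N.
Proof.
move=> p0; rewrite [X in (_ < X)%N](polySpred p0) ltnS.
apply/leq_sizeP=> j; rewrite leq_eqVlt => /orP[/eqP <-|lt].
  by rewrite coefB coefCM coefXn eqxx mulr1 lead_coefE subrr.
rewrite coefB coefCM coefXn gtn_eqF // mulr0 subr0 nth_default //.
by rewrite (polySpred p0).
Qed.

(* Gauss's lemma without factorisation: the leading coefficient of [p] absorbs the
   part [g] of [e], and the rest of [e] divides the leading coefficient of [q]. *)
Lemma gauss m : forall (p q : {poly A}) e, (size p + size q <= m)%N -> primitive q -> q != 0 ->
  in1 e%:P (p * q) -> in1 e%:P p.
Proof.
elim: m => [|m IH] p q e; first by rewrite leqn0 addn_eq0 => /andP[_]; rewrite size_poly_eq0 => /eqP ->; rewrite eqxx.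
move=> sz pq q0 H; have [->|p0] := eqVneq p 0; first by exists 0; ring.
pose a := lead_coef p; pose b := lead_coef q; have a0 : a != 0 by rewrite lead_coef_eq0.
have [g [a' [e' [Ea Ee [a'0 co]]]]] := GA e a0.
have g0 : g != 0 by apply: contraNneq a0 => g0; rewrite Ea g0 mulr0.
have Eap : a%:P = a'%:P * g%:P by rewrite Ea polyCM.
have [p2 Ep2] : in1 g%:P p.
  have [w0 Ew0] : in1 g%:P (p * q) by apply: in1_trans H; exists e'%:P; rewrite Ee polyCM.
  have [||w Ew] := IH (p - a%:P * 'X^((size p).-1)) q g _ pq q0.
  - by rewrite -ltnS; apply: leq_trans sz; rewrite ltn_add2r; apply: size_sub_lead.
  - exists (w0 - a'%:P * 'X^((size p).-1) * q).
    by apply: (lcomb (eqD Ew0 (eqM (- ('X^((size p).-1) * q)) Eap))); ring.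
  - by exists (w + a'%:P * 'X^((size p).-1)); apply: (lcomb (eqD Ew (eqM 'X^((size p).-1) Eap))); ring.
have gP0 : g%:P != 0 by rewrite polyC_eq0.
have H2 : in1 e'%:P (p2 * q).
  case: H => w Ew; exists w; apply: (mulIf gP0).
  by rewrite Ee polyCM Ep2 in Ew; lc Ew.
have La : a' = lead_coef p2.
  by apply: (mulIf g0); rewrite -Ea /a Ep2 lead_coefM lead_coefC.
have Lb : in1 e' b.
  have /dvdCP/(_ (size (p2 * q)).-1) := H2; rewrite -lead_coefE lead_coefM -La -/b => - [w Ew].
  have [e'0|e'0] := eqVneq e' 0.
    by move: Ew; rewrite e'0 mulr0 => /eqP; rewrite mulf_eq0 (negbTE a'0) => /eqP ->; exists 0; ring.
  have [|w2 Ew2] := co w; first by exists b; lc Ew.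
  by exists w2; apply: (mulIf a'0); rewrite [LHS]mulrC Ew Ew2; ring.
suff [w Ew] : in1 e'%:P p2 by exists w; rewrite Ep2 Ew Ee polyCM; ring.
have sp2 : size p2 = size p by rewrite Ep2 mulrC mul_polyC size_scale.
have H3 : in1 e'%:P (b%:P * p2) by case: Lb => w ->; exists (w%:P * p2); rewrite polyCM; ring.
pose q1 := q - b%:P * 'X^((size q).-1).
have H4 : in1 e'%:P (p2 * q1).
  case: H2 => w Ew; case: H3 => v Ev; exists (w - v * 'X^((size q).-1)).
  by apply: (lcomb (eqD Ew (eqM (- 'X^((size q).-1)) Ev))); rewrite /q1; ring.
have [q10|q10] := eqVneq q1 0.
  have [v Ev] : in1 b 1.
    apply: pq; exists 'X^((size q).-1); move/eqP: q10; rewrite subr_eq0 => /eqP {1}->; ring.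
  case: H3 => w Ew; exists (v%:P * w).
  rewrite -[LHS]mul1r (_ : 1 = (v * b)%:P); last by rewrite -Ev.
  by rewrite polyCM -mulrA Ew; ring.
have [c [q1' [Eq1 pq1 c0 q1'0]]] := content q10.
have H5 : in1 e'%:P (c%:P * p2).
  apply: (IH _ q1') => //.
    have -> : size q1' = size q1 by rewrite Eq1 mul_polyC size_scale.
    rewrite mul_polyC size_scale // sp2 -ltnS; apply: leq_trans sz.
    by rewrite ltn_add2l; apply: size_sub_lead.
  by rewrite -mulrA mulrCA -Eq1.
apply/dvdCP=> i; apply: (@coprime_cancel c b) => //.
- move=> d [v Ev] [w Ew]; apply: pq; exists (v%:P * q1' + w%:P * 'X^((size q).-1)).
  have Ecp : c%:P = v%:P * d%:P by rewrite Ev polyCM.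
  have Ebp : b%:P = w%:P * d%:P by rewrite Ew polyCM.
  rewrite /q1 in Eq1; apply: (lcomb (eqD Eq1 (eqD (eqM q1' Ecp) (eqM 'X^((size q).-1) Ebp)))); ring.
- by have /dvdCP/(_ i) := H5; rewrite coefCM.
- by have /dvdCP/(_ i) := H3; rewrite coefCM.
Qed.

Lemma gauss_dvd (p q : {poly A}) e : primitive q -> q != 0 -> in1 e%:P (p * q) -> in1 e%:P p.
Proof. exact: (@gauss (size p + size q)). Qed.

(** [h] is a combination of least size; pseudo-division by it leaves a smaller combination, hence
    remainder zero. *)
Lemma bezout_min (f g : {poly A}) : f != 0 -> exists h u v : {poly A}, [/\ h != 0, h = u * f + v * g &
  exists c : A, [/\ c != 0, in1 h (c%:P * f) & in1 h (c%:P * g)]].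
Proof.
move=> f0; have [m [h [u [v [Em h0 Eh min]]]]] : exists m (h u v : {poly A}), [/\ size h = m, h != 0, h = u * f + v * g &
    forall h' u' v' : {poly A}, h' = u' * f + v' * g -> (size h' < m)%N -> h' = 0].
  have : exists h u v : {poly A}, [/\ (size h <= size f)%N, h != 0 & h = u * f + v * g].
    by exists f, 1, 0; split=> //; ring.
  elim: {1}(size f) => [[h [u [v [s h0 E]]]]|m IH].
    by move: s h0; rewrite leqn0 size_poly_eq0 => ->.
  move=> [h [u [v [s h0 E]]]].
  case: (classic (exists h u v : {poly A}, [/\ (size h <= m)%N, h != 0 & h = u * f + v * g])) => [/IH //|nex].
  have sm : size h = m.+1.
    by apply/eqP; rewrite eqn_leq s ltnNge; apply/negP => s'; apply: nex; exists h, u, v.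
  exists m.+1, h, u, v; split=> // h' u' v' E' lt; apply/eqP; apply/negPn/negP => h'0.
  by apply: nex; exists h', u', v'; split.
exists h, u, v; split=> //.
have dv w : (exists u' v' : {poly A}, w = u' * f + v' * g) -> in1 h ((lead_coef h ^+ scalp w h)%:P * w).
  move=> [u' [v' Ew]]; have E := Pdiv.Idomain.divp_eq w h; rewrite mul_polyC E.
  suff -> : w %% h = 0 by exists (w %/ h); ring.
  set L := (lead_coef h ^+ scalp w h)%:P.
  apply: (min _ (L * u' - (w %/ h) * u) (L * v' - (w %/ h) * v)).
    rewrite -mul_polyC -/L in E.
    by apply: (lcomb (eqD (eqM (-1) E) (eqD (eqM L Ew) (eqM (- (w %/ h)) Eh)))); ring.
  by rewrite -Em ltn_modp.
have [[w1 E1] [w2 E2]] : in1 h ((lead_coef h ^+ scalp f h)%:P * f) /\ in1 h ((lead_coef h ^+ scalp g h)%:P * g).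
  by split; apply: dv; [exists 1, 0|exists 0, 1]; ring.
set L1 := _ ^+ scalp f h in E1; set L2 := _ ^+ scalp g h in E2.
exists (L1 * L2); split; first by rewrite mulf_neq0 // expf_neq0 // lead_coef_eq0.
- by exists (L2%:P * w1); rewrite polyCM; lc (eqM L2%:P E1).
- by exists (L1%:P * w2); rewrite polyCM; lc (eqM L1%:P E2).
Qed.

(** The primitive part [hh] of a least combination divides [f] and [g] by Gauss's lemma; the gcd [d]
    of the contents of the cofactors supplies the constant factor. *)
Lemma gcd_domain_poly : gcd_domain {poly A}.
Proof.
move=> f g f0; have [->|g0] := eqVneq g 0.
  exists f, 1, 0; split; [ring|ring|split; [exact: oner_neq0|]] => u _.
  by exists u; ring.
have [h [u [v [h0 Eh [c [c0 H1 H2]]]]]] := bezout_min g f0.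
have [ch [hh [Ehh ph ch0 hh0]]] := content h0.
have cP0 (e : A) : e != 0 -> e%:P != 0 by rewrite polyC_eq0.
have dv w : in1 h (c%:P * w) -> exists w', w = w' * hh.
  move=> [m Em]; have [|m' Em'] := @gauss_dvd (m * ch%:P) hh c ph hh0.
    by exists w; rewrite Ehh in Em; lc Em.
  by exists m'; apply: (mulIf (cP0 _ c0)); rewrite Ehh in Em; apply: (lcomb (eqD Em (eqM hh Em'))); ring.
have [f' Ef] := dv _ H1; have [g' Eg] := dv _ H2.
have Ech : ch%:P = u * f' + v * g'.
  by apply: (mulIf hh0); rewrite Ehh Ef Eg in Eh; lc Eh.
have f'0 : f' != 0 by apply: contraNneq f0 => e; rewrite Ef e mul0r.
have g'0 : g' != 0 by apply: contraNneq g0 => e; rewrite Eg e mul0r.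
have [al [f1 [Ef1 pf1 al0 f10]]] := content f'0; have [be [g1 [Eg1 pg1 be0 g10]]] := content g'0.
have [d [al' [be' [Eal Ebe [al'0 co]]]]] := GA be al0.
have be'0 : be' != 0 by apply: contraNneq be0 => e; rewrite Ebe e mul0r.
exists (d%:P * hh), (al'%:P * f1), (be'%:P * g1); split.
- by rewrite Ef Ef1 Eal polyCM; ring.
- by rewrite Eg Eg1 Ebe polyCM; ring.
split=> [|w [m Em]]; first by rewrite mulf_neq0 // cP0.
have [w1 Ew1] : exists w1, w = w1 * f1.
  have [|m2 Em2] := @gauss_dvd (w * be'%:P * u * al%:P + be%:P * v * m * al'%:P) f1 (be' * ch) pf1 f10.
    exists w; rewrite polyCM Ech Ef1 Eg1.
    by apply: (lcomb (eqM (- (be%:P * v)) Em)); ring.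
  exists m2; apply: (mulIf (cP0 _ (mulf_neq0 be'0 ch0))).
  have E : w * (be' * ch)%:P = (w * be'%:P * u * al%:P + be%:P * v * m * al'%:P) * f1.
    rewrite polyCM Ech Ef1 Eg1.
    by apply: (lcomb (eqM (be%:P * v) Em)); ring.
  by rewrite E Em2; ring.
have [|w2 Ew2] := @gauss_dvd (w1 * be'%:P) g1 al' pg1 g10.
  by exists m; apply: (mulIf f10); rewrite Ew1 in Em; lc Em.
have /dvdCP [w3 Ew3] : forall i, in1 al' w1`_i.
  move=> i; apply: co; exists w2`_i.
  by have := congr1 (fun q : {poly A} => q`_i) Ew2; rewrite !coefMC.
by exists w3; rewrite Ew1 Ew3; ring.
Qed.
End GCD.

(** * Multivariate polynomials as univariate ones in the last variable *)

Section Transport.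
Variables (k : fieldType) (n : nat).
Local Notation P := {mpoly k[n.+1]}.
Local Notation Q := {poly {mpoly k[n]}}.

(** The inverse of [muni], through which greatest common divisors and noetherianity are transported
    by induction on the number of variables. *)
Definition mback (p : Q) : P := (map_poly (@mwiden n k) p).['X_ord_max].

Lemma mbackD p q : mback (p + q) = mback p + mback q.
Proof. by rewrite /mback rmorphD hornerD. Qed.
Lemma mbackM p q : mback (p * q) = mback p * mback q.
Proof. by rewrite /mback rmorphM hornerM. Qed.
Lemma mback0 : mback 0 = 0. Proof. by rewrite /mback rmorph0 horner0. Qed.

Lemma muniK : cancel (@muni n k) mback.
Proof.
move=> p; rewrite muniE [RHS]mpolyE.
have -> : mback (\sum_(m <- msupp p) p@_m *: 'X_[[multinom m (widen_ord (leqnSn n) i) | i < n]] *: 'X^(m ord_max))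
  = \sum_(m <- msupp p) mback (p@_m *: 'X_[[multinom m (widen_ord (leqnSn n) i) | i < n]] *: 'X^(m ord_max)).
  by apply: (big_morph mback mbackD mback0).
apply: eq_bigr => m _; rewrite -!mul_polyC mbackM.
rewrite /mback map_polyC hornerC map_polyXn hornerXn /= mwidenZ mwidenX -scalerAl; congr (_ *: _).
rewrite mpolyXn -mpolyXD; congr 'X_[_]; apply/mnmP=> i; rewrite mnmDE mulmnE mnm1E.
case: (unliftP ord_max i) => [j ->|->].
  rewrite (_ : lift ord_max j = widen_ord (leqnSn n) j); last by apply: val_inj; rewrite /= /bump leqNgt ltn_ord.
  rewrite mnmwiden_widen mnmE (_ : (ord_max == _) = false) ?mul0n ?addn0 //.
  by apply/eqP=> /(congr1 val) /= E; have := ltn_ord j; rewrite -E ltnn.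
by rewrite mnmwiden_ordmax eqxx mul1n.
Qed.

Lemma muni_mwiden (c : {mpoly k[n]}) : muni (mwiden c) = c%:P.
Proof.
rewrite {1}[c]mpolyE (big_morph (@mwiden n k) (@mwidenD n k) (@mwiden0 n k)).
rewrite (big_morph (@muni n k) (@muniD n k) (@muni0 n k)) [RHS](_ : _ = \sum_(i <- msupp c) (c@_i *: 'X_[i])%:P).
  apply: eq_bigr => m _; rewrite mwidenZ mwidenX muniZ muniE msuppX big_seq1 mcoeffX eqxx scale1r.
  rewrite mnmwiden_ordmax expr0 -mul_polyC -[in RHS]mul_mpolyC polyCM; congr (_ * _).
  rewrite alg_polyC; congr ('X_[_])%:P; apply/mnmP=> i; by rewrite mnmE mnmwiden_widen.
by rewrite {1}[c]mpolyE (big_morph (@polyC _) (@polyCD _) (@polyC0 _)).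
Qed.

Lemma mbackK : cancel mback (@muni n k).
Proof.
move=> p; rewrite /mback horner_coef (big_morph (@muni n k) (@muniD n k) (@muni0 n k)).
have sp : size (map_poly (@mwiden n k) p) = size p by apply: size_map_inj_poly; [exact: inj_mwiden|exact: mwiden0].
rewrite sp [RHS](_ : p = \sum_(i < size p) p`_i *: 'X^i); last by rewrite -[LHS]coefK poly_def.
apply: eq_bigr => i _; rewrite muniM coef_map /= muni_mwiden mul_polyC; congr (_ *: _).
rewrite rmorphXn /=; congr (_ ^+ _).
rewrite muniE msuppX big_seq1 mcoeffX eqxx scale1r mnm1E eqxx expr1.
rewrite (_ : 'X_[_] = 1) ?scale1r //; rewrite -mpolyX0; congr 'X_[_]; apply/mnmP=> j.
by rewrite mnmE mnm1E mnm0E; apply/eqP; rewrite eqb0; apply/eqP=> /(congr1 val) /=; have := ltn_ord j; zlia.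
Qed.

End Transport.

Lemma gcd_domain_mpoly (k : fieldType) n : gcd_domain {mpoly k[n]}.
Proof.
elim: n => [|n IH] a b a0.
  have C (p : {mpoly k[0]}) : p = (p@_0%MM)%:MP.
    by apply/mpolyP=> m; rewrite (_ : m = 0%MM) ?mcoeffC ?eqxx ?mulr1 //; apply/mnmP=> -[].
  have [c c0 Ec] : exists2 c, c * a = 1 & True.
    exists ((a@_0%MM)^-1)%:MP => //; rewrite {2}[a]C -mpolyCM mulVf //.
    by apply: contraNneq a0 => e; rewrite [a]C e mpolyC0.
  exists a, 1, (b * c); split; [ring|by lc (eqM b c0)|split; [exact: oner_neq0|]] => u _.
  by exists u; ring.
have [|d [a' [b' [Ea Eb [a'0 co]]]]] := gcd_domain_poly IH (muni b) (a := muni a).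
  by apply: contraNneq a0 => e; rewrite -[a]muniK e mback0.
exists (mback d), (mback a'), (mback b').
split; [by rewrite -mbackM -Ea muniK|by rewrite -mbackM -Eb muniK|].
split=> [|u [w Ew]]; first by apply: contraNneq a'0 => e; rewrite -[a']mbackK e muni0.
have [|v Ev] := co (muni u).
  by exists (muni w); have := congr1 (@muni n k) Ew; rewrite !muniM !mbackK.
by exists (mback v); rewrite -mbackM -Ev muniK.
Qed.

(** * Factors of forms and coprimality over an arbitrary field *)

Section HomogFactor.
Variables (k : fieldType) (N : nat).
Local Notation R := {mpoly k[N]}.

Lemma hp_extremal (a : R) : a != 0 -> exists i j : nat, [/\ hp i a != 0, hp j a != 0,
  forall m : int, m < i -> hp m a = 0 & forall m : int, j%:Z < m -> hp m a = 0].
Proof.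
move=> a0; have [n En] := hp_partition a.
have ub (m : nat) : hp m a != 0 -> (m <= n)%N.
  apply: contraNT; rewrite -ltnNge => nm; rewrite En hp_sum big1 // => i _.
  by apply: (hp_ne (hp_hg _ _)); have := ltn_ord i; zlia.
have ex : exists m : nat, hp m a != 0.
  apply: NNPP => H; move/eqP: a0; apply; rewrite En big1 // => i _.
  by apply/eqP; apply/negPn/negP => h; apply: H; exists i.
have [i hi mi] := ex_minnP ex; have [j hj mj] := ex_maxnP ex ub.
exists i, j; split=> // -[] m //=.
- move=> lt; apply/eqP; apply: contraTT lt => /mi; zlia.
- move=> lt; apply/eqP; apply: contraTT lt => /mj; zlia.
Qed.

(** The lowest components of the two factors multiply to a nonzero component of the product, and so
    do the highest ones. The product has one degree, so each factor has only one. *)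
Lemma hg_factor d (a b : R) : hg d (a * b) -> a * b != 0 -> exists2 e, hg e a & hg (d - e) b.
Proof.
move=> Hd ab0; have a0 : a != 0 by apply: contraNneq ab0 => ->; rewrite mul0r.
have b0 : b != 0 by apply: contraNneq ab0 => ->; rewrite mulr0.
have [i [i' [ai ai' li ui]]] := hp_extremal a0; have [j [j' [bj bj' lj uj]]] := hp_extremal b0.
have key (s t : nat) : hp s a != 0 -> hp t b != 0 ->
    (forall m : nat, m <> s -> hp m a = 0 \/ hp (s%:Z + t%:Z - m%:Z) b = 0) -> s%:Z + t%:Z = d.
  move=> hs ht H; have [n En] := hp_partition a.
  have E : hp (s%:Z + t%:Z) (a * b) = hp s a * hp t b.
    have sn : (s < n)%N.
      rewrite ltnNge; apply/negP => ns; move/eqP: hs; apply; rewrite En hp_sum big1 // => m _.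
      by apply: (hp_ne (hp_hg _ _)); have := ltn_ord m; zlia.
    rewrite {1}En mulr_suml hp_sum (bigD1 (Ordinal sn)) // big1 ?Monoid.mulm1.
      by rewrite (hpMl _ _ (hp_hg _ _)) (_ : nat_of_ord (Ordinal sn) = s) //; congr (_ * hp _ _); zlia.
    move=> m ms; rewrite (hpMl _ _ (hp_hg _ _)).
    case: (H m) => [e|->|->]; [|by rewrite mul0r|by rewrite mulr0].
    by move/eqP: ms; case; apply: val_inj.
  have nz : hp (s%:Z + t%:Z) (a * b) != 0 by rewrite E mulf_neq0.
  apply/eqP/negPn/negP => ne; move/eqP: nz; apply; apply: (hp_ne Hd); by rewrite eq_sym.
have E1 : i%:Z + j%:Z = d.
  apply: key => // m /eqP; rewrite neq_ltn => /orP[lt|lt]; [left; apply: li|right; apply: lj]; zlia.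
have E2 : i'%:Z + j'%:Z = d.
  apply: key => // m /eqP; rewrite neq_ltn => /orP[lt|lt]; [right; apply: uj|left; apply: ui]; zlia.
have ii' : (i <= i')%N by rewrite leqNgt; apply/negP => lt; move/eqP: ai'; apply; apply: li; zlia.
have jj' : (j <= j')%N by rewrite leqNgt; apply/negP => lt; move/eqP: bj'; apply; apply: lj; zlia.
have pure (c : R) (s : nat) : (forall m : int, m < s -> hp m c = 0) -> (forall m : int, s%:Z < m -> hp m c = 0) -> hg s c.
  move=> lo up; have [n En] := hp_partition c; rewrite /hg {2}En.
  have [ns|sn] := leqP n s.
    rewrite big1 => [|m _]; last by apply: lo; have := ltn_ord m; zlia.
    rewrite En hp_sum big1 // => m _.
    by apply: (hp_ne (hp_hg _ _)); have := ltn_ord m; zlia.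
  rewrite (bigD1 (Ordinal sn)) // big1 ?Monoid.mulm1 // => m ms.
  have : (m : nat) != s by apply: contraNneq ms => e; apply/eqP/val_inj.
  by rewrite neq_ltn => /orP[lt|lt]; [apply: lo|apply: up]; zlia.
exists i%:Z.
  by apply: pure => // m lt; apply: ui; zlia.
have -> : d - i%:Z = j by zlia.
by apply: pure => // m lt; apply: uj; zlia.
Qed.

Lemma in1_hgl d (a b : R) : in1 a b -> hg d b -> b != 0 -> exists e, hg e a.
Proof. by move=> [u ->] Hd nz; have [e he1 he] := hg_factor Hd nz; exists (d - e). Qed.

Lemma coprime_reg2 (a b : R) : a != 0 -> (forall d, in1 d a -> in1 d b -> in1 d 1) -> reg2 a b.
Proof.
move=> a0 H; have [d [a' [b' [Ea Eb [a'0 co]]]]] := gcd_domain_mpoly b a0.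
have [v Ev] : in1 d 1 by apply: H; [exists a'|exists b'].
split=> // u [w Ew]; have d0 : d != 0 by apply: contraNneq a0 => e; rewrite Ea e mulr0.
have [|z Ez] := co u; first by exists w; apply: (mulIf d0); rewrite Ea Eb in Ew; lc Ew.
by exists (z * v); rewrite Ea Ez; lc (eqM (z * a') Ev).
Qed.

Lemma reg2M (a b c : R) : reg2 a c -> reg2 b c -> reg2 (a * b) c.
Proof.
move=> [a0 ra] [b0 rb]; split=> [|u [w E]]; first exact: mulf_neq0.
have [|u1 E1] := ra u; first by exists (w * b); lc E.
have [|u2 E2] := rb u1; last by exists u2; rewrite E1 E2; ring.
by exists w; apply: (mulIf a0); rewrite E1 in E; lc E.
Qed.

Lemma reg2Xr (a b : R) m : reg2 a b -> reg2 a (b ^+ m).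
Proof.
move=> [a0 r]; split=> // u; elim: m => [|m IH]; first by rewrite expr0 mulr1.
by rewrite exprS mulrCA mulrC => /r; apply: IH.
Qed.

Lemma reg2Xl (a b : R) m : reg2 a b -> reg2 (a ^+ m) b.
Proof.
move=> r; elim: m => [|m IH]; last by rewrite exprS; apply: reg2M.
by rewrite expr0; split; [exact: oner_neq0|move=> u _; exists u; ring].
Qed.

(** Induction on the degree of [a]: the common factor with [F] is moved into [a1] until it is a
    constant. *)
Lemma split_coprime (m : nat) : forall (a F : R) (d e : int), hg d a -> a != 0 -> hg e F -> d <= m%:Z ->
  exists a1 a2 d1 d2 i, [/\ a = a1 * a2, hg d1 a1, hg d2 a2, reg2 a2 F & in1 a1 (F ^+ i)].
Proof.
elim: m => [|m IH] a F d e Hd a0 He dm; have d0 := hg_ge0 Hd a0.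
  have [v [_ Ev]] := nz_mul_const 0 Hd dm a0.
  exists 1, a, 0, d, 0%N; split=> //; [ring|exact: hg1| |by exists 1; ring].
  by split=> // u _; exists (u * v); lc (eqM u Ev).
have [g [a' [F' [Ea EF r]]]] := gcd_domain_mpoly F a0.
have [dg hdg hda'] : exists2 dg, hg dg a' & hg (d - dg) g by apply: hg_factor; rewrite -Ea.
have g0 : g != 0 by apply: contraNneq a0 => z; rewrite Ea z mulr0.
have a'0 : a' != 0 by case: r.
have [lt|ge] := ltP 0 (d - dg).
  have [|a1 [a2 [d1 [d2 [i [E1 h1 h2 r2 h3]]]]]] := IH a' F dg e hdg a'0 He; first zlia.
  exists (g * a1), a2, (d - dg + d1), d2, i.+1; split=> //.
  - by rewrite Ea E1; ring.
  - exact: hgM.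
  - by case: h3 => w Ew; rewrite exprS Ew {1}EF; exists (F' * w); ring.
have [v [_ Ev]] := nz_mul_const 0 hda' ge g0.
exists 1, a, 0, d, 0%N; split=> //; [ring|exact: hg1| |by exists 1; ring].
apply: coprime_reg2 => // c ca cF; apply: (reg2_nocommon r).
  by case: ca => w Ew; exists (w * v); rewrite Ea in Ew; apply: (lcomb (eqD (eqM v Ew) (eqM (- a') Ev))); ring.
by case: cF => w Ew; exists (w * v); rewrite EF in Ew; apply: (lcomb (eqD (eqM v Ew) (eqM (- F') Ev))); ring.
Qed.

(** Valid over finite fields. If [a = X^i b] with [i > 0] and [X] not dividing [b], the form
    [X^e + b Y^m] is prime to [X] and to [b]; if [i = 0], [X^e] serves. *)
Lemma coprime_form (X Y a : R) (d e : int) : hg 1 X -> hg 1 Y -> X != 0 -> ~ in1 X Y ->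
  hg d a -> a != 0 -> d <= e -> exists2 y, hg e y & reg2 a y.
Proof.
move=> hX hY X0 nXY Hd a0 de; have d0 := hg_ge0 Hd a0.
have Y0 : Y != 0 by apply/eqP => y0; apply: nXY; rewrite y0; exists 0; ring.
have [i [b [Ea nb]]] : exists (i : nat) b, a = X ^+ i * b /\ ~ in1 X b.
  have [m Em] : exists m : nat, d <= m%:Z by exists `|d|%N; zlia.
  elim: m a d Hd a0 {de d0} Em => [|m IH] a d Hd a0 dm.
    exists 0%N, a; split=> [|/(in1_hg Hd hX) [u hu E]]; first by rewrite expr0 mul1r.
    by move: a0; rewrite E (hg_neg hu) ?mul0r ?eqxx; zlia.
  case: (classic (in1 X a)) => [/(in1_hg Hd hX) [u hu E]|nX]; last by exists 0%N, a; rewrite expr0 mul1r.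
  have u0 : u != 0 by apply: contraNneq a0 => z; rewrite E z mul0r.
  have [|i [b [Eu nb]]] := IH u _ hu u0; first zlia.
  by exists i.+1, b; split=> //; rewrite E Eu exprS; ring.
have b0 : b != 0 by apply/eqP => z; apply: nb; rewrite z; exists 0; ring.
have hXi m : hg m%:Z (X ^+ m) by apply: (hg_c (hgXn m hX)); zlia.
have hb : hg (d - i%:Z) b by apply: (hg_div _ (hXi i) _); [rewrite mulrC -Ea|rewrite expf_neq0].
have rbX m : reg2 b (X ^+ m) by apply: reg2Xr; apply: reg2_sym => //; apply: reg2_lin.
have de' := hg_ge0 hb b0.
case: i Ea hb de' => [|i] Ea hb de'.
  exists (X ^+ `|e|%N); first by apply: (hg_c (hXi _)); zlia.
  by rewrite Ea expr0 mul1r.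
pose m := absz (e - (d - i.+1%:Z))%R.
exists (X ^+ `|e|%N + b * Y ^+ m).
  apply: hgD; first by apply: (hg_c (hXi _)); zlia.
  by apply: (hgM_c hb (hgXn _ hY)); zlia.
rewrite Ea; apply: reg2M.
  apply/reg2Xl/reg2_lin => // H; have : in1 X (b * Y ^+ m).
    case: H => w Ew; exists (w - X ^+ `|e|.-1); apply: (lcomb Ew).
    have -> : X ^+ `|e|%N = X * X ^+ (`|e|%N).-1 by rewrite -exprS; congr (_ ^+ _); zlia.
    ring.
  move=> /(lin_prime hX X0) [//|].
  clear H; elim: m => [|m IH]; first by rewrite expr0 => /(hg_pos_no1 hX); apply.
  by rewrite exprS => /(lin_prime hX X0) [].
split=> // u [w Ew]; have [_ r] := rbX `|e|%N; apply: r.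
by exists (w - u * Y ^+ m); lc Ew.
Qed.

(** Split [a = a1 a2] with [a2] prime to [F] and [a1] dividing a power of [F], and take [h = a2 y]
    with [y] prime to [a1]: modulo [a2] the sum is [F], and modulo a common factor of [a1] and [F]
    it is [a2 y G]. *)
Lemma coprime_shift (X Y a F G : R) (d e g : int) : hg 1 X -> hg 1 Y -> X != 0 -> ~ in1 X Y ->
  hg d a -> a != 0 -> hg e F -> hg g G -> d <= e - g ->
  (forall c, in1 c a -> in1 c F -> in1 c G -> in1 c 1) ->
  exists2 h, hg (e - g) h & reg2 a (F + h * G).
Proof.
move=> hX hY X0 nXY Hd a0 He Hg deg H; have d0 := hg_ge0 Hd a0.
have [|a1 [a2 [d1 [d2 [i [Ea h1 h2 r2 [w Ew]]]]]]] := @split_coprime `|d|%N a F d e Hd a0 He; first zlia.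
have a10 : a1 != 0 by apply: contraNneq a0 => z; rewrite Ea z mul0r.
have a20 : a2 != 0 by case: r2.
have E12 : d = d1 + d2 by apply: (hg_uniq Hd _ a0); rewrite Ea; apply: hgM.
have [|y hy ry] := @coprime_form X Y a1 d1 (e - g - d2) hX hY X0 nXY h1 a10; first zlia.
exists (a2 * y); first by apply: (hgM_c h2 hy); zlia.
rewrite Ea; apply: reg2M; last first.
  split=> // u [v Ev]; case: r2 => _; apply; exists (v - u * y * G); by lc Ev.
apply: coprime_reg2 => // c ca1 cF'.
have c0 : c != 0 by apply: contraNneq a10 => z; case: ca1 => u ->; rewrite z mulr0.
have key b : in1 b c -> in1 b F -> in1 b 1.
  move=> bc bF; have b0 : b != 0 by apply: contraNneq c0 => z; case: bc => u ->; rewrite z mulr0.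
  have ba1 := in1_trans bc ca1.
  have [_ rb2] : reg2 b a2.
    by apply: coprime_reg2 => // q qb qa; apply: (reg2_nocommon r2) => //; apply: in1_trans qb bF.
  have [_ rby] : reg2 b y.
    by apply: coprime_reg2 => // q qb qa; apply: (reg2_nocommon ry) => //; apply: in1_trans qb ba1.
  apply: H => //; first by rewrite Ea mulrC; apply: in1M.
  apply: rby; apply: rb2; have [u Eu] := in1_trans bc cF'; case: bF => v Ev.
  by exists (u - v); apply: (lcomb (eqD Eu (eqM (-1) Ev))); ring.
have [_ rcF] : reg2 c F by apply: coprime_reg2.
have : in1 c (1 * F ^+ i) by rewrite mul1r; apply: in1_trans ca1 _; exists w.
elim: i {w Ew} => [|i IH]; first by rewrite expr0 mulr1.
by rewrite exprS mulrCA mulrC => /rcF; apply: IH.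
Qed.
End HomogFactor.

(** * Coprimality modulo a linear form *)

Section LinearQuotient.
Variable k : fieldType.

Lemma quot_lin M (l : {mpoly k[M.+1]}) : hg 1 l -> l != 0 ->
  exists (pi : {mpoly k[M.+1]} -> {mpoly k[M]}) (rho : {mpoly k[M]} -> {mpoly k[M.+1]}),
  [/\ [/\ (forall d f, hg d f -> hg d (pi f)), (forall d f, hg d f -> hg d (rho f)) & cancel rho pi],
      [/\ {morph pi : f g / f + g}, {morph pi : f g / f * g} & pi 1 = 1],
      (forall f, in1 l f <-> pi f = 0) & forall f g, in2 l f g <-> in1 (pi f) (pi g)].
Proof.
move=> hl l0; have [lq [lp [hq hp_ E0 K mod_]]] := lin_quot hl l0.
have piM : {morph (fun f => f \mPo lq) : f g / f * g} by move=> f g; apply: rmorphM.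
have piD : {morph (fun f => f \mPo lq) : f g / f + g} by move=> f g; apply: rmorphD.
exists (fun f => f \mPo lq), (fun f => f \mPo lp); split.
- by split; [move=> d f; apply: hg_comp|move=> d f; apply: hg_comp|exact: K].
- by split=> //; apply: rmorph1.
- move=> f; split=> [[u ->]|f0]; first by rewrite piM E0 mulr0.
  by have := mod_ f; rewrite f0 comp_mpoly0 subr0.
- move=> f g; split=> [[u [v ->]]|[w Ew]].
    by exists (v \mPo lq); rewrite piD !piM E0 mulr0 add0r.
  have [u Eu] := mod_ g; have [v Ev] := mod_ f.
  rewrite Ew rmorphM /= in Eu; exists (u - (w \mPo lp) * v), (w \mPo lp).
  by apply: (lcomb (eqD Eu (eqM (- (w \mPo lp)) Ev))); ring.
Qed.

Variables (N : nat).
Local Notation R := {mpoly k[N]}.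

Lemma coprime_mod_lin (l a b : R) : hg 1 l -> l != 0 -> ~ in1 l a ->
  (forall d, in2 l d a -> in2 l d b -> in2 l d 1) -> reg3 l a b.
Proof.
case: N l a b => [|M] l a b hl l0 na H; first by move: l0; rewrite (lin_sum hl) big_ord0 eqxx.
have [pi [rho [[hpi hrho K] [piD piM pi1] in1P in2P]]] := quot_lin hl l0.
split; first exact: reg2_lin.
have [_ r] : reg2 (pi a) (pi b).
  apply: coprime_reg2; first by apply/eqP => /in1P.
  move=> d; rewrite -[d]K -!in2P -pi1 -in2P; exact: H.
by move=> u; rewrite !in2P piM; apply: r.
Qed.

Lemma coprime_shift_lin (l a F G : R) (d e g : int) : (3 <= N)%N -> hg 1 l -> l != 0 -> ~ in1 l a ->
  hg d a -> hg e F -> hg g G -> d <= e - g ->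
  (forall c, in2 l c a -> in2 l c F -> in2 l c G -> in2 l c 1) ->
  exists2 h, hg (e - g) h & reg3 l a (F + h * G).
Proof.
case: N l a F G => [//|M] l a F G N3 hl l0 na Hd He Hg deg H.
have [pi [rho [[hpi hrho K] [piD piM pi1] in1P in2P]]] := quot_lin hl l0.
(* Here [3 <= N] enters: the quotient by [l] keeps the two variables on which [coprime_form]
   relies. *)
have M0 : (0 < M)%N by zlia. have M1 : (1 < M)%N by zlia.
pose X : {mpoly k[M]} := 'X_(Ordinal M0); pose Y : {mpoly k[M]} := 'X_(Ordinal M1).
have hX : hg 1 X by apply: hgX. have hY : hg 1 Y by apply: hgX.
have X0 : X != 0.
  apply/eqP => /(congr1 (mcoeff U_(Ordinal M0))); rewrite mcoeff0 mcoeffX eqxx => /eqP.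
  by rewrite oner_eq0.
have nXY : ~ in1 X Y.
  move=> /(in1_hg hY hX) [u /hg_const [c ->]]; rewrite mul_mpolyC.
  move=> /(congr1 (mcoeff U_(Ordinal M1))); rewrite mcoeffZ !mcoeffX eqxx.
  have -> : (U_(Ordinal M0) == U_(Ordinal M1))%MM = false.
    by apply/eqP => /mnmP /(_ (Ordinal M0)); rewrite !mnm1E eqxx.
  by rewrite mulr0 => /eqP; rewrite oner_eq0.
have pa0 : pi a != 0 by apply/eqP => /in1P.
have [|h hh [_ r]] := coprime_shift hX hY X0 nXY (hpi _ _ Hd) pa0 (hpi _ _ He) (hpi _ _ Hg) deg.
  by move=> c; rewrite -[c]K -!in2P -pi1 -in2P; apply: H.
exists (rho h); first exact: hrho.
split; first exact: reg2_lin.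
by move=> u; rewrite !in2P piM piD piM K; apply: r.
Qed.
End LinearQuotient.

(** * Homogeneous prime avoidance *)

Section Span.
Variable A : comNzRingType.

Inductive span (S : A -> Prop) : A -> Prop :=
  | span0 : span S 0
  | spanS u a b : S a -> span S b -> span S (u * a + b).

Definition before (u : nat -> A) m := fun a => exists2 i, (i < m)%N & a = u i.

Definition noetherian := forall u : nat -> A, exists m, span (before u m) (u m).

Lemma span_in (S : A -> Prop) a : S a -> span S a.
Proof. by move=> Sa; rewrite -[a]mul1r -[_ * _]addr0; apply: spanS => //; apply: span0. Qed.

Lemma spanD S a b : span S a -> span S b -> span S (a + b).
Proof. by elim=> [|u c d Sc _ IH] Sb; rewrite ?add0r // -addrA; apply: spanS => //; apply: IH. Qed.

Lemma spanM S h a : span S a -> span S (h * a).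
Proof.
elim=> [|u c d Sc _ IH]; first by rewrite mulr0; apply: span0.
by rewrite mulrDr mulrA; apply: spanS.
Qed.

Lemma spanB S a b : span S a -> span S b -> span S (a - b).
Proof. by move=> ha hb; rewrite -mulN1r; apply: spanD => //; apply: spanM. Qed.

Lemma span_sub (S T : A -> Prop) a : (forall b, S b -> span T b) -> span S a -> span T a.
Proof.
move=> H; elim=> [|u c d Sc _ IH]; first exact: span0.
by apply: spanD => //; apply: spanM; apply: H.
Qed.
End Span.

(** Hilbert's basis theorem: elements of least size outside the span of the earlier ones are chosen
    in turn; a relation between their leading coefficients would produce one of smaller size. *)
Lemma noetherian_poly (A : comNzRingType) : noetherian A -> noetherian {poly A}.
Proof.
move=> nA u; apply: NNPP => nex.
pose I := span (fun f : {poly A} => exists i, f = u i).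
have nfg (s : seq {poly A}) : (forall f, f \in s -> I f) ->
    exists f, [/\ I f, ~ span (fun g => g \in s) f &
      forall g, I g -> ~ span (fun g => g \in s) g -> (size f <= size g)%N].
  move=> Hs; have [m Hm] : exists m, forall f, f \in s -> span (before u m) f.
    elim: s Hs => [|f s IH] Hs; first by exists 0%N.
    have [|m Hm] := IH; first by move=> g gs; apply: Hs; rewrite inE gs orbT.
    have [m' Hm'] : exists m', span (before u m') f.
      have := Hs f (mem_head _ _); elim=> [|v a b [i ->] _ [m' IH']]; first by exists 0%N; apply: span0.
      exists (maxn m' i.+1); apply: spanS; first by exists i; rewrite ?leq_maxr.
      by apply: span_sub IH' => _ [j jm ->]; apply: span_in; exists j => //; apply: leq_trans jm (leq_maxl _ _).
    exists (maxn m m') => g; rewrite inE => /orP[/eqP ->|gs].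
      by apply: span_sub Hm' => _ [j jm ->]; apply: span_in; exists j => //; apply: leq_trans jm (leq_maxr _ _).
    by apply: span_sub (Hm g gs) => _ [j jm ->]; apply: span_in; exists j => //; apply: leq_trans jm (leq_maxl _ _).
  have ex : exists d f, [/\ I f, ~ span (fun g => g \in s) f & size f = d].
    exists (size (u m)), (u m); split=> //; first by apply: span_in; exists m.
    by move=> H; apply: nex; exists m; apply: span_sub H.
  have [d [[f [If nf sf]] min]] : exists d, (exists f, [/\ I f, ~ span (fun g => g \in s) f & size f = d]) /\
      forall d', (d' < d)%N -> ~ exists f, [/\ I f, ~ span (fun g => g \in s) f & size f = d'].
    case: ex => d; elim/ltn_ind: d => d IH Hd.
    case: (classic (exists d', (d' < d)%N /\ exists f, [/\ I f, ~ span (fun g => g \in s) f & size f = d'])).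
      by move=> [d' [lt]]; apply: IH.
    by move=> H; exists d; split=> // d' lt H'; apply: H; exists d'.
  exists f; split=> // g Ig ng; rewrite leqNgt sf; apply/negP => /min; apply; by exists g.
pose nxt (s : seq {poly A}) := epsilon (inhabits (0 : {poly A})) (fun f => [/\ I f, ~ span (fun g => g \in s) f &
      forall g, I g -> ~ span (fun g => g \in s) g -> (size f <= size g)%N]).
pose L := fix L n : seq {poly A} := if n is n'.+1 then nxt (L n') :: L n' else [::].
pose f n := nxt (L n).
have Lf n : forall g, g \in L n <-> before f n g.
  elim: n => [|n IH] g /=; first by split=> // -[].
  rewrite inE; split=> [/orP[/eqP ->|/IH [i im ->]]|[i]]; first by exists n.
    by exists i => //; apply: ltnW.
  rewrite ltnS leq_eqVlt => /orP[/eqP -> ->|lt ->]; first by rewrite eqxx.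
  by apply/orP; right; apply/IH; exists i.
have LI n : forall g, g \in L n -> I g.
  elim: n => [//|n IH] g; rewrite /= inE => /orP[/eqP ->|/IH //].
  by have [] := epsilon_spec (inhabits (0 : {poly A})) _ (nfg _ IH).
have sp n : [/\ I (f n), ~ span (fun g => g \in L n) (f n) &
      forall g, I g -> ~ span (fun g => g \in L n) g -> (size (f n) <= size g)%N].
  exact: (epsilon_spec (inhabits (0 : {poly A})) _ (nfg _ (LI n))).
have mono i n : (i < n)%N -> (size (f i) <= size (f n))%N.
  move=> lt; have [If nf _] := sp n; have [_ _ min] := sp i; apply: min => // H; apply: nf.
  apply: span_sub H => g /Lf [j ji ->]; apply: span_in; apply/Lf; exists j => //; exact: ltn_trans ji lt.
have [m Hm] := nA (fun n => lead_coef (f n)).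
have [If nf min] := sp m.
have f0 : f m != 0 by apply/eqP => f0; apply: nf; rewrite f0; apply: span0.
have [g [Sg sg Eg]] : exists g, [/\ span (fun g => g \in L m) g, (size g <= size (f m))%N &
    g`_(size (f m)).-1 = lead_coef (f m)].
  elim: Hm => [|v a b [i im ->] _ [g [Sg sg Eg]]].
    by exists 0; split; [exact: span0|rewrite size_poly0|rewrite coef0].
  have si := mono _ _ im.
  have fi0 : f i != 0 by apply/eqP => fi0; have [_ nfi _] := sp i; apply: nfi; rewrite fi0; apply: span0.
  exists ((v *: 'X^(size (f m) - size (f i))) * f i + g); split.
  - by apply: spanS => //; apply/Lf; exists i.
  - apply: leq_trans (size_polyD _ _) _; rewrite geq_max sg andbT -scalerAl.
    apply: leq_trans (size_scale_leq _ _) _; rewrite mulrC size_mulXn // subnK //.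
  - rewrite coefD Eg -scalerAl coefZ ['X^_ * _]mulrC coefMXn.
    have p1 : (0 < size (f i))%N by rewrite size_poly_gt0.
    have p2 : (0 < size (f m))%N by rewrite size_poly_gt0.
    case: ltnP => [lt|_]; first by zlia.
    by congr (_ * _ + _); rewrite lead_coefE; congr (_ `_ _); zlia.
have := min (f m - g); rewrite leqNgt => H.
suff : (size (f m - g)%R < size (f m))%N.
  apply/negP; apply: H; last by move=> S; apply: nf; rewrite -(subrK g (f m)); apply: spanD.
  by apply: spanB => //; apply: span_sub Sg => h /LI.
rewrite (polySpred f0) ltnS; apply/leq_sizeP => j.
rewrite leq_eqVlt => /orP[/eqP <-|lt]; first by rewrite coefB Eg lead_coefE subrr.
by rewrite coefB !nth_default ?subrr //; [apply: leq_trans sg _|]; rewrite (polySpred f0).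
Qed.

Lemma noetherian_mpoly (k : fieldType) n : noetherian {mpoly k[n]}.
Proof.
elim: n => [|n /noetherian_poly IH] u.
  have [u0|u0] := eqVneq (u 0%N) 0; first by exists 0%N; rewrite u0; apply: span0.
  have C (p : {mpoly k[0]}) : p = (p@_0%MM)%:MP.
    by apply/mpolyP=> m; rewrite (_ : m = 0%MM) ?mcoeffC ?eqxx ?mulr1 //; apply/mnmP=> -[].
  exists 1%N; rewrite (_ : u 1%N = (u 1%N * ((u 0%N)@_0%MM)^-1%:MP) * u 0%N + 0).
    by apply: spanS; [exists 0%N|exact: span0].
  rewrite addr0 -mulrA [X in _ * (_ * X)]C -mpolyCM mulVf ?mulr1 //.
  by apply: contraNneq u0 => e; rewrite [u 0%N]C e mpolyC0.
have [m Hm] := IH (fun i => muni (u i)); exists m; rewrite -[u m]muniK.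
elim: Hm => [|v a b [i im ->] _ IHb]; first by rewrite mback0; apply: span0.
by rewrite mbackD mbackM muniK; apply: spanS => //; exists i.
Qed.

(** * Forms of an ideal that are regular modulo another *)

Section Avoid.
Variables (k : fieldType) (N : nat).
Local Notation R := {mpoly k[N]}.
Variables (C I : R -> Prop).
Hypotheses (hC : hideal C) (hI : hideal I).
Hypothesis Ipos : forall f d, I f -> hg d f -> f != 0 -> 0 < d.
Hypothesis CI : forall s, (forall i, I i -> C (i * s)) -> C s.

Let hom (f : R) := exists d, hg d f.
Let homM f g : hom f -> hom g -> hom (f * g).
Proof. by move=> [d hd] [e he]; exists (d + e); apply: hgM. Qed.

(** [C : t] is maximal among the annihilators of forms outside [C]; these are associated primes,
    tested here on forms only. *)
Definition max_ann t := [/\ hom t, ~ C t & forall t', hom t' -> ~ C t' ->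
  (forall b, hom b -> C (b * t) -> C (b * t')) -> forall b, hom b -> C (b * t') -> C (b * t)].

Lemma max_ann_prime t a b : max_ann t -> hom a -> hom b -> C (a * b * t) -> C (a * t) \/ C (b * t).
Proof.
case: hC => C0 CD CM Ch [ht nt mx] ha hb H; case: (classic (C (a * t))); first by left.
move=> na; right; apply: (mx (a * t)) => //; first exact: homM.
  by move=> c hc Hc; rewrite mulrCA; apply: CM.
by rewrite mulrA [b * a]mulrC.
Qed.

Lemma max_ann_exp t a n : max_ann t -> hom a -> C (a ^+ n * t) -> C (a * t).
Proof.
move=> mt ha; have [_ nt _] := mt; elim: n => [|n IH]; first by rewrite expr0 mul1r.
have hb : hom (a ^+ n) by case: ha => d hd; exists (d * n%:Z); apply: hgXn.
by rewrite exprS => H; case: (max_ann_prime mt ha hb H) => [//|/IH].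
Qed.

(** Otherwise annihilators could be enlarged for ever, and the forms [b] witnessing the growth would
    contradict noetherianity. *)
Lemma max_ann_ex s : hom s -> ~ C s -> exists2 t, max_ann t & forall b, hom b -> C (b * s) -> C (b * t).
Proof.
case: hC => C0 CD CM Ch hs ns; apply: NNPP => nex.
pose ok t := [/\ hom t, ~ C t & forall b, hom b -> C (b * s) -> C (b * t)].
have step t : ok t -> exists tb : R * R, [/\ ok tb.1, C (tb.2 * tb.1), ~ C (tb.2 * t) &
    forall b, hom b -> C (b * t) -> C (b * tb.1)] /\ hom tb.2.
  move=> [ht nt st]; apply: NNPP => H; apply: nex; exists t => //; split=> // t' ht' nt' sub b hb Hb.
  apply: NNPP => nb; apply: H; exists (t', b); split=> //; split=> //.
  by split=> // c hc Hc; apply: sub => //; apply: st.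
pose nx t := epsilon (inhabits ((0, 0) : R * R)) (fun tb : R * R => [/\ ok tb.1, C (tb.2 * tb.1), ~ C (tb.2 * t) &
    forall b, hom b -> C (b * t) -> C (b * tb.1)] /\ hom tb.2).
pose T := fix T n := if n is n'.+1 then (nx (T n')).1 else s.
have okT n : ok (T n).
  elim: n => [|n IH]; first by split.
  by have [[]] := epsilon_spec (inhabits ((0, 0) : R * R)) _ (step _ IH).
have P n : [/\ ok (T n.+1), C ((nx (T n)).2 * T n.+1), ~ C ((nx (T n)).2 * T n) &
    forall b, hom b -> C (b * T n) -> C (b * T n.+1)] /\ hom (nx (T n)).2.
  exact: (epsilon_spec (inhabits ((0, 0) : R * R)) _ (step _ (okT n))).
have up i n b : (i <= n)%N -> hom b -> C (b * T i) -> C (b * T n).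
  move=> le hb Hb; elim: n le => [|n IH]; first by rewrite leqn0 => /eqP <-.
  rewrite leq_eqVlt => /orP[/eqP <- //|]; rewrite ltnS => /IH H.
  by have [[_ _ _ H'] _] := P n; apply: H'.
have [m Hm] := @noetherian_mpoly k N (fun n => (nx (T n)).2).
have [[_ _ n2 _] _] := P m; apply: n2.
elim: Hm => [|u a b [i im ->] _ IH]; first by rewrite mul0r.
rewrite mulrDl -mulrA; apply: CD => //; apply: CM.
by have [[_ H _ _] hb] := P i; apply: (up i.+1).
Qed.

Lemma separate (L : seq R) t : max_ann t -> (forall s, s \in L -> exists b, [/\ hom b, C (b * s) & ~ C (b * t)]) ->
  exists b, [/\ hom b, forall s, s \in L -> C (b * s) & ~ C (b * t)].
Proof.
case: hC => C0 CD CM Ch mt; have [_ nt _] := mt; elim: L => [|s L IH] H.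
  by exists 1; split=> //; [exists 0; apply: hg1|rewrite mul1r].
have [|b [hb Hb nb]] := IH; first by move=> s' s'L; apply: H; rewrite inE s'L orbT.
have [b' [hb' Hb' nb']] := H s (mem_head _ _).
exists (b' * b); split; [exact: homM| |by case/(max_ann_prime mt hb' hb)].
move=> s'; rewrite inE => /orP[/eqP ->|/Hb s'L]; last by rewrite -mulrA; apply: CM.
by rewrite -mulrA mulrCA; apply: CM.
Qed.

Lemma max_ann_incomp s t b : max_ann s -> max_ann t -> hom b -> C (b * t) -> ~ C (b * s) ->
  exists b', [/\ hom b', C (b' * s) & ~ C (b' * t)].
Proof.
move=> [hs ns ms] [ht nt mt] hb Hb nb; apply: NNPP => H; apply: nb; apply: (ms t) => // c hc Hc.
by apply: NNPP => nc; apply: H; exists c.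
Qed.

(** If [phi] misses the earlier primes but lies in the new one, a form of [I] lying in the earlier
    ones and not in the new one is added to it; powers make the degrees equal. *)
Lemma avoid_list (L : seq R) : (forall s, s \in L -> max_ann s) ->
  exists phi d, [/\ I phi, hg d phi, 0 < d & forall s, s \in L -> ~ C (phi * s)].
Proof.
case: hC => C0 CD CM Ch; case: hI => I0 ID IM Ih.
have Iexp f n : I f -> I (f ^+ n.+1) by move=> If; rewrite exprSr; apply: IM.
have single t : max_ann t -> exists e d, [/\ I e, hg d e, 0 < d & ~ C (e * t)].
  move=> [ht nt _]; apply: NNPP => H; apply: nt; apply: CI => i Ii.
  have [n En] := hp_partition i; rewrite En mulr_suml.
  apply: (big_ind C) => // j _; apply: NNPP => nj; apply: H; exists (hp j i), j%:Z.
  split=> //; [exact: Ih|exact: hp_hg|]; apply: (Ipos (Ih _ _ Ii)); first exact: hp_hg.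
  by apply/eqP => z; apply: nj; rewrite z mul0r.
elim: L => [|t L IH] HL; first by exists 0, 1; split=> //; apply: hg0.
have mt : max_ann t by apply: HL; rewrite mem_head.
have [|phi [d [Ip hp_ dp av]]] := IH; first by move=> s sL; apply: HL; rewrite inE sL orbT.
case: (classic (C (phi * t))) => [Ct|nCt]; last first.
  by exists phi, d; split=> // s; rewrite inE => /orP[/eqP ->|/av].
have [|b [[db hb] Hb nb]] := @separate L t mt.
  move=> s sL; apply: (@max_ann_incomp s t phi) => //; [|by exists d|exact: av].
  by apply: HL; rewrite inE sL orbT.
have [e [d' [Ie he d'p ne]]] := single _ mt.
have psit : ~ C (e * b * t).
  by case/(max_ann_prime mt); [exists d'|exists db| |].
have Ipsi : I (e * b) by rewrite mulrC; apply: IM.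
have hpsi := hgM he hb.
have dpsi : 0 < d' + db.
  by apply: (Ipos Ipsi hpsi); apply/eqP => z; apply: psit; rewrite z mul0r.
exists (phi ^+ (absz (d' + db)%R) + (e * b) ^+ `|d|%N), (d * (d' + db)); split.
- have [m ->] : exists m, absz (d' + db)%R = m.+1 by exists (absz (d' + db)%R).-1; zlia.
  have [m' ->] : exists m, `|d|%N = m.+1 by exists (`|d|%N).-1; zlia.
  by apply: ID; apply: Iexp.
- apply: hgD; first by apply: (hg_c (hgXn _ hp_)); zlia.
  by apply: (hg_c (hgXn _ hpsi)); zlia.
- exact: mulr_gt0.
move=> s; rewrite inE => /orP[/eqP ->|sL] H.
  apply: psit; apply: (max_ann_exp (n := `|d|%N) mt); first by exists (d' + db).
  have [m Em] : exists m, absz (d' + db)%R = m.+1 by exists (absz (d' + db)%R).-1; zlia.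
  have : C (phi ^+ (absz (d' + db)%R) * t) by rewrite Em exprSr -mulrA; apply: CM.
  move=> /(CM (-1)) H'; have := CD _ _ H H'; by rewrite mulrDl mulN1r addrAC subrr add0r.
have ms : max_ann s by apply: HL; rewrite inE sL orbT.
apply: (av _ sL); apply: (max_ann_exp (n := absz (d' + db)%R) ms); first by exists d.
have [m Em] : exists m, `|d|%N = m.+1 by exists (`|d|%N).-1; zlia.
have : C ((e * b) ^+ `|d| * s) by rewrite Em exprSr -mulrA; apply: (CM); rewrite -mulrA; apply: (CM); apply: (Hb).
move=> /(CM (-1)) H'; have := CD _ _ H H'; by rewrite mulrDl mulN1r -addrA subrr addr0.
Qed.

(** If every form failed at some prime, there would be a sequence of elements [t], none of whose
    annihilators contains that of a predecessor. By noetherianity one [t] is a combination of its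
    predecessors, while [separate] gives a form killing these and not [t]. A final power pushes the
    degree beyond [B]. *)
Lemma avoid (B : nat) : exists phi d, [/\ I phi, hg d phi, B%:Z < d & forall s, C (s * phi) -> C s].
Proof.
case: hC => C0 CD CM Ch; case: hI => I0 ID IM Ih.
suff [phi [d [Ip hp_ dp av]]] : exists phi d, [/\ I phi, hg d phi, 0 < d & forall t, max_ann t -> ~ C (phi * t)].
  exists (phi ^+ B.+1), (d * B.+1%:Z); split.
  - by rewrite exprSr; apply: IM.
  - exact: hgXn.
  - by rewrite -[X in X < _]mul1r; nia.
  move=> s Hs; have [n En] := hp_partition s; rewrite En; apply: (big_ind C) => // j _.
  apply: NNPP => nj; have [|t mt sub] := @max_ann_ex (hp j s) _ nj; first by exists j%:Z; apply: hp_hg.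
  apply: (av _ mt); apply: (max_ann_exp (n := B.+1) mt); first by exists d.
  apply: sub; first by exists (d * B.+1%:Z); apply: hgXn.
  by rewrite mulrC -[X in hp X _](addrK (d * B.+1%:Z)) -(hpM _ _ (hgXn _ hp_)); apply: Ch.
apply: NNPP => nex.
have step (L : seq R) : (forall s, s \in L -> max_ann s) -> exists t, max_ann t /\
    forall s, s \in L -> exists b, [/\ hom b, C (b * s) & ~ C (b * t)].
  move=> HL; have [phi [d [Ip hp_ dp av]]] := avoid_list HL.
  apply: NNPP => H; apply: nex; exists phi, d; split=> // t mt Ct; apply: H; exists t; split=> // s sL.
  by apply: (@max_ann_incomp s t phi) => //; [apply: HL|exists d|apply: av].
pose nx (L : seq R) := epsilon (inhabits (0 : R)) (fun t => max_ann t /\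
    forall s, s \in L -> exists b, [/\ hom b, C (b * s) & ~ C (b * t)]).
pose L := fix L n : seq R := if n is n'.+1 then nx (L n') :: L n' else [::].
have LM n : forall s, s \in L n -> max_ann s.
  elim: n => [//|n IH] s; rewrite /= inE => /orP[/eqP ->|/IH //].
  by have [] := epsilon_spec (inhabits (0 : R)) _ (step _ IH).
have P n : max_ann (nx (L n)) /\ forall s, s \in L n -> exists b, [/\ hom b, C (b * s) & ~ C (b * nx (L n))].
  exact: (epsilon_spec (inhabits (0 : R)) _ (step _ (LM n))).
have [m Hm] := @noetherian_mpoly k N (fun n => nx (L n)).
have [mt /(separate mt) [b [hb Hb]]] := P m; apply.
elim: Hm => [|u a c [i im ->] _ IH]; first by rewrite mulr0.
rewrite mulrDr mulrCA; apply: CD => //; apply: CM; apply: Hb.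
elim: m im {mt IH} => [//|m IH]; rewrite ltnS leq_eqVlt /= inE => /orP[/eqP ->|/IH ->]; first by rewrite eqxx.
by rewrite orbT.
Qed.
End Avoid.

(** * Grade bounds and double links *)

Section Links.
Variables (k : fieldType) (N : nat).
Local Notation R := {mpoly k[N]}.

Lemma reg4_colon (c : vec R) g1 g2 g3 g4 h : vreg c -> reg4 g1 g2 g3 g4 ->
  vin c (h * g1) -> vin c (h * g2) -> vin c (h * g3) -> vin c (h * g4) -> vin c h.
Proof.
move=> rc [rg r4] h1 h2 h3 h4.
have [h' E] := @exch_ex0 _ _ c (g1, g2, g3) h rc h1 h2 h3.
apply: (exch_out (g := (g1, g2, g3)) rg E); apply: r4; rewrite mulrC.
by apply: (exch_in rc (exchM g4 E)); rewrite mulrC.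
Qed.

(** An element outside [c] that [I] multiplies into [c] bounds the grade: [reg4_colon] shows that
    four regular elements of [I] would force it into [c]. *)
Lemma grade3_intro (c : vec R) I h : vreg c -> ~ vin c 1 -> csub c I -> ~ vin c h ->
  (forall f, I f -> vin c (h * f)) -> grade_eq I 3.
Proof.
case: c => [[a b] c] rc n1 [Ia Ib Ic] nh H; split.
  exists [:: a; b; c]; split=> //; first exact/regular3P.
  by move=> [|[|[|//]]].
move=> [[|g1 [|g2 [|g3 [|g4 [|? ?]]]]] [] // _ rg Ig]; apply: nh.
have /regular3P [r3 _] := regular_take 3 rg.
have r4 u : in3 g1 g2 g3 (u * g4) -> in3 g1 g2 g3 u.
  by case: rg => H4 _; have := H4 3%N isT u; rewrite /= !gen3.
apply: (reg4_colon rc (conj r3 r4)); apply: H.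
- exact: (Ig 0%N). - exact: (Ig 1%N). - exact: (Ig 2%N). - exact: (Ig 3%N).
Qed.

(* Linking along [(a, b, be)] and then along [(a, b, be1)] multiplies by [be1 / be]. *)
Lemma double_link a b be be1 (J : R -> Prop) : reg3 a b be -> reg3 a b be1 ->
  (forall e, J e -> exists e', in2 a b (e * be1 - e' * be)) ->
  (forall f, vcolon (a, b, be) (vcolon (a, b, be) J) f -> J f) -> J be ->
  vcolon (a, b, be) J be1 /\ forall g, vcolon (a, b, be1) (vcolon (a, b, be) J) g <->
    exists2 e, J e & in2 a b (e * be1 - g * be).
Proof.
move=> [r2 rbe] [_ rbe1] HE refl Jbe.
have H1 : vcolon (a, b, be) J be1.
  move=> e /HE [e' [u [v E]]]; exists u, v, e'; rewrite /=; by lc E.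
split=> // g; split=> [Hg|[e Je [u [v E]]] i Hi].
  have [u [v [g' Eg']]] : vin (a, b, be1) (g * be) by apply: Hg => h _; exists 0, 0, h; rewrite /=; ring.
  exists g'; last by exists (- u), (- v); rewrite /= in Eg'; lc Eg'.
  apply: refl => i Hi; have [u1 [v1 [w1 /= E1]]] := Hg i Hi.
  have [|u2 [v2 E2]] := rbe1 (g' * i - w1 * be).
    exists (u1 * be - u * i), (v1 * be - v * i).
    by rewrite /= in Eg'; apply: (lcomb (eqD (eqM (- i) Eg') (eqM be E1))); ring.
  by exists u2, v2, w1; rewrite /=; lc E2.
have [u1 [v1 [w1 /= E1]]] := Hi e Je.
have [|u2 [v2 E2]] := rbe (g * i - w1 * be1).
  exists (u1 * be1 - u * i), (v1 * be1 - v * i).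
  by apply: (lcomb (eqD (eqM (- i) E) (eqM be1 E1))); ring.
by exists u2, v2, w1; rewrite /=; lc E2.
Qed.
End Links.

(** * The chain of links of [J] *)

Section FiveGens.
Variables (k : fieldType) (N : nat).
Local Notation R := {mpoly k[N]}.

Definition in5 (g0 g1 g2 g3 g4 f : R) := exists v0 v1 v2 v3 v4 : R,
  f = v0 * g0 + v1 * g1 + v2 * g2 + v3 * g3 + v4 * g4.

Variables (g0 g1 g2 g3 g4 : R) (d0 d1 d2 d3 d4 : int).
Hypotheses (h0 : hg d0 g0) (h1 : hg d1 g1) (h2 : hg d2 g2) (h3 : hg d3 g3) (h4 : hg d4 g4).

Lemma in5_hp d v0 v1 v2 v3 v4 : hp d (v0 * g0 + v1 * g1 + v2 * g2 + v3 * g3 + v4 * g4) =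
  hp (d - d0) v0 * g0 + hp (d - d1) v1 * g1 + hp (d - d2) v2 * g2 + hp (d - d3) v3 * g3 + hp (d - d4) v4 * g4.
Proof. by rewrite !hpD (hpM _ _ h0) (hpM _ _ h1) (hpM _ _ h2) (hpM _ _ h3) (hpM _ _ h4). Qed.

Lemma in5_hideal : hideal (in5 g0 g1 g2 g3 g4).
Proof.
split.
- by exists 0, 0, 0, 0, 0; ring.
- move=> f g [v0 [v1 [v2 [v3 [v4 ->]]]]] [w0 [w1 [w2 [w3 [w4 ->]]]]].
  by exists (v0 + w0), (v1 + w1), (v2 + w2), (v3 + w3), (v4 + w4); ring.
- move=> h f [v0 [v1 [v2 [v3 [v4 ->]]]]].
  by exists (h * v0), (h * v1), (h * v2), (h * v3), (h * v4); ring.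
- move=> f d [v0 [v1 [v2 [v3 [v4 ->]]]]]; rewrite in5_hp.
  by exists (hp (d - d0) v0), (hp (d - d1) v1), (hp (d - d2) v2), (hp (d - d3) v3), (hp (d - d4) v4).
Qed.

Lemma in5_hg d f : hg d f -> in5 g0 g1 g2 g3 g4 f -> exists v0 v1 v2 v3 v4,
  [/\ hg (d - d0) v0, hg (d - d1) v1, hg (d - d2) v2, hg (d - d3) v3 & hg (d - d4) v4] /\
  f = v0 * g0 + v1 * g1 + v2 * g2 + v3 * g3 + v4 * g4.
Proof.
move=> Hf [v0 [v1 [v2 [v3 [v4 E]]]]].
exists (hp (d - d0) v0), (hp (d - d1) v1), (hp (d - d2) v2), (hp (d - d3) v3), (hp (d - d4) v4).
by split; [split; apply: hp_hg|rewrite -Hf E in5_hp].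
Qed.

Lemma in5_pos d f : 0 < d0 -> 0 < d1 -> 0 < d2 -> 0 < d3 -> 0 < d4 ->
  in5 g0 g1 g2 g3 g4 f -> hg d f -> f != 0 -> 0 < d.
Proof.
move=> p0 p1 p2 p3 p4 /[swap] Hf /(in5_hg Hf) [v0 [v1 [v2 [v3 [v4 [[k0 k1 k2 k3 k4] ->]]]]]] nz.
rewrite ltNge; apply/negP => dle; move/eqP: nz; apply.
by rewrite (hg_neg k0) ?(hg_neg k1) ?(hg_neg k2) ?(hg_neg k3) ?(hg_neg k4); try zlia; ring.
Qed.
End FiveGens.

(** * Colon ideals as links *)

Section ColonIdeals.
Variables (k : fieldType) (N : nat).
Local Notation R := {mpoly k[N]}.

Lemma hideal_vcolon t (c : vec R) K : vhg t c -> hideal K -> hideal (vcolon c K).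
Proof.
case: c t => [[c1 c2] c3] [[t1 t2] t3] [/= H1 H2 H3] [K0 KD KM Kh]; split.
- by move=> h _; rewrite mul0r; apply: vin0.
- by move=> f g Hf Hg h Kh'; rewrite mulrDl; apply: vinD; [apply: Hf|apply: Hg].
- by move=> u f Hf h Kh'; rewrite -mulrA; apply: vinM; apply: Hf.
- move=> f d Hf h Kh'; have [m ->] := hp_partition h; rewrite mulr_sumr.
  apply: (big_ind (vin (c1, c2, c3))); [exact: vin0|by move=> *; apply: vinD|] => i _.
  rewrite -(addrK (i%:Z) d) -hpM; last exact: hp_hg.
  by apply: (in3_hp _ H1 H2 H3); apply: Hf; apply: Kh.
Qed.

Lemma homog_of_hideal (I : R -> Prop) : hideal I -> is_homog_ideal I.
Proof. by move=> [I0 ID IM Ih]; split=> // f d If; apply: (Ih f d%:Z). Qed.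

(** A colon ideal is reflexive along its own complete intersection, and [colon_colon_indep] carries
    this to any other one inside it. *)
Lemma link_refl t t' (c c' : vec R) K : ci t c -> ci t' c' -> hideal K ->
  csub c' (vcolon c K) -> forall f, vcolon c' (vcolon c' (vcolon c K)) f -> vcolon c K f.
Proof.
move=> Cc Cc' hK sub f Hf; have [_ vc _] := Cc.
have hI := hideal_vcolon vc hK; have [_ _ _ hh] := hideal_vcolon vc hI.
move=> h Kh; apply: (colon_colon_indep Cc' Cc sub hh Hf) => g Hg.
by rewrite mulrC; apply: Hg.
Qed.

Lemma colon_link (a b c : nat) (v : vec R) (I I' : R -> Prop) : ci (a%:Z, b%:Z, c%:Z) v ->
  (a <= b)%N -> (b <= c)%N -> hideal I -> (forall f, I' f <-> vcolon v I f) ->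
  (forall f, vcolon v I' f -> I f) -> grade_eq I 3 -> grade_eq I' 3 ->
  homog_CI 3 [:: v.1.1; v.1.2; v.2] [:: a; b; c] /\
  directly_linked 3 I I' (ideal_gen [:: v.1.1; v.1.2; v.2]).
Proof.
move=> [rv [/= h1 h2 h3] n1] ab bc hI EI' refl gI gI'; split.
  split=> //; [exact/regular3P| |by rewrite /= ab bc].
  by move=> [|[|[|//]]] _; apply/hgE.
have hI' : hideal I'.
  have [z0 zD zM zh] := hideal_vcolon (t := (a%:Z, b%:Z, c%:Z)) (And3 h1 h2 h3) hI.
  split; first by apply/EI'.
  - by move=> f g /EI' hf /EI' hg; apply/EI'; apply: zD.
  - by move=> h f /EI' hf; apply/EI'; apply: zM.
  - by move=> f d /EI' hf; apply/EI'; apply: zh.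
have vE f : ideal_gen [:: v.1.1; v.1.2; v.2] f <-> vin v f by apply: gen3.
split=> //; first by split; apply: homog_of_hideal.
- move=> f; split=> [If h /EI' Hh|H]; first by apply/vE; rewrite mulrC; apply: Hh.
  by apply: refl => h Ih; apply/vE; apply: H.
- by move=> f; rewrite EI'; split=> H h Ih; apply/vE; apply: H.
Qed.

Lemma reg3_lin_nocommon (l a b c : R) : hg 1 l -> l != 0 -> ~ in1 l a -> reg3 l a b ->
  in2 l c a -> in2 l c b -> in2 l c 1.
Proof.
move=> hl l0 na [_ r] [u1 [v1 Ea]] [u2 [v2 Eb]].
have [|u3 [v3 E3]] := r v1.
  by exists (v1 * u2 - v2 * u1), v2; rewrite Ea Eb; ring.
have [[w Ew]|//] : in1 l (1 - v3 * c) \/ in1 l a.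
  apply: lin_prime => //; exists (u1 + u3 * c).
  by rewrite E3 in Ea; apply: (lcomb Ea); ring.
by exists w, v3; rewrite -Ew; ring.
Qed.

(* [(q, r) = (l, a)] times a 2x2 matrix with determinant [r']. *)
Lemma det_colon (l a s t u v : R) : let q := s * l - t * a in let r := u * l - v * a in
  let r' := t * u - s * v in hg 1 l -> reg2 l a -> reg2 q r ->
  (forall w, in2 q r (w * l) -> in2 q r (w * a) -> exists m, in2 q r (w - m * r')) /\
  (forall m, in2 q r (m * r') -> in2 l a m).
Proof.
move=> q r r' hl rla rqr; have [l0 rl] := rla; split.
  move=> w [al [be E1]] [ga [de E2]].
  have [|m [Em1 Em2]] := @reg2_syz _ q r (a * al - l * ga) (a * be - l * de) rqr.
    by apply: (lcomb (eqD (eqM (- a) E1) (eqM l E2))); ring.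
  have [|n1 En1] := rl (al + m * v).
    by exists (ga + m * u); rewrite /r in Em1; lc Em1.
  have [|n2 En2] := rl (be - m * t).
    by exists (de - m * s); rewrite /q in Em2; lc Em2.
  exists m, n1, n2; apply: (mulfI l0).
  by apply: (lcomb (eqD E1 (eqD (eqM q En1) (eqM r En2)))); rewrite /q /r /r'; ring.
move=> m [al [be E]].
have [|n1 [En1 En2]] := @reg2_syz _ q r (l * al + m * v) (l * be - m * t) rqr.
  by apply: (lcomb (eqM (- l) E)); rewrite /q /r /r'; ring.
have Et : in1 l (m + n1 * a) \/ in1 l t.
  by apply: lin_prime => //; exists (be + n1 * s); rewrite /q in En2; lc En2.
have Ev : in1 l (m + n1 * a) \/ in1 l v.
  by apply: lin_prime => //; exists (n1 * u - al); rewrite /r in En1; lc En1.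
case: Et => [[w Ew]|[t' Et]]; first by exists w, (- n1); lc Ew.
case: Ev => [[w Ew]|[v' Ev]]; first by exists w, (- n1); lc Ew.
case: (hg_pos_no1 hl ltr01); apply: (reg2_nocommon rqr).
- by exists (s - t' * a); rewrite /q Et; ring.
- by exists (u - v' * a); rewrite /r Ev; ring.
Qed.
End ColonIdeals.

(** * The two double links that lead from [J] to [(l, a, z)] *)

Section Chain.
Variables (k : fieldType) (N n : nat).
Local Notation R := {mpoly k[N]}.
Variables (J : R -> Prop) (x l l2 p a b s t u v f5 : R).
Hypotheses (N3 : (3 <= N)%N) (n4 : (4 <= n)%N).
Hypotheses (hx : hg 1 x) (hl : hg 1 l) (hl2 : hg 1 l2) (hp_ : hg n%:Z p) (ha : hg (n%:Z - 1) a)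
  (hb : hg (n%:Z - 1) b) (hs : hg (n%:Z - 1) s) (ht : hg 1 t) (hu : hg (n%:Z + 1) u) (hv : hg 3 v)
  (hf5 : hg (2 * n%:Z + 4) f5).
Hypotheses (x0 : x != 0) (l0 : l != 0) (Ep : p = x * b - l2 * a) (nlp : ~ in1 l p)
  (nxl2 : ~ in1 x l2) (nla : ~ in1 l a).
Let g2 := s * (l2 * l) + t * p.
Let g3 := u * (l2 * l) + v * p.
Let q := s * l - t * a.
Let r := u * l - v * a.
Let r' := t * u - s * v.
Hypotheses (JP : forall h, J h <-> in5 (x * l) (x * p) g2 g3 f5 h)
  (JQ : forall e, J e -> exists z1 z2 z3 z4, e = z1 * x + z2 * q + z3 * r + z4 * r').
Variables (c1 c2 c3 : R).
Hypotheses (rJ : reg3 c1 c2 c3) (J1 : J c1) (J2 : J c2) (J3 : J c3) (gJ : grade_eq J 3).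
Hypothesis refl : forall t c, ci t c -> csub c J -> forall f, vcolon c (vcolon c J) f -> J f.

Let rla : reg2 l a. Proof. exact: reg2_lin. Qed.

Let hq : hg n%:Z q.
Proof. by apply: hgB; [apply: (hgM_c hs hl)|apply: (hgM_c ht ha)]; zlia. Qed.
Let hr : hg (n%:Z + 2) r.
Proof. by apply: hgB; [apply: (hgM_c hu hl)|apply: (hgM_c hv ha)]; zlia. Qed.
Let hr' : hg (n%:Z + 2) r'.
Proof. by apply: hgB; [apply: (hgM_c ht hu)|apply: (hgM_c hs hv)]; zlia. Qed.
Let hg2 : hg (n%:Z + 1) g2.
Proof. by apply: hgD; [apply: (hgM_c hs (hgM hl2 hl))|apply: (hgM_c ht hp_)]; zlia. Qed.
Let hg3 : hg (n%:Z + 3) g3.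
Proof. by apply: hgD; [apply: (hgM_c hu (hgM hl2 hl))|apply: (hgM_c hv hp_)]; zlia. Qed.

Lemma J_in2 y z : hg 1 y -> y != 0 -> (forall e, J e -> in2 y z e) -> in2 y z 1.
Proof.
move=> hy y0 H; case: (classic (in1 y z)) => [[w Ew]|nz].
  have H1 e : J e -> in1 y e by move=> /H [u1 [v1 ->]]; exists (u1 + v1 * w); rewrite Ew; ring.
  have [r2 _] := rJ; case: (hg_pos_no1 hy ltr01).
  exact: (reg2_nocommon r2 (H1 _ J1) (H1 _ J2)).
by apply: (three_in2 (reg2_lin hy y0 nz) rJ); apply: H.
Qed.

Lemma J_lp y : in2 l y p -> in2 l y f5 -> forall e, J e -> in2 l y e.
Proof.
move=> [p1 [p2 E1]] [w1 [w2 E2]] e /JP [v0 [v1 [v2 [v3 [v4 ->]]]]].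
exists (v0 * x + v1 * x * p1 + v2 * (s * l2 + t * p1) + v3 * (u * l2 + v * p1) + v4 * w1),
  (v1 * x * p2 + v2 * t * p2 + v3 * v * p2 + v4 * w2).
rewrite /g2 /g3; move: E1 E2; clear; move=> -> ->; ring.
Qed.

(** A common factor [c] of [a], [f5] and [x p] modulo [l] is prime to [p], because no proper
    [(l, d)] contains [J]. So [x] is in [(l, c)], and with it [p = x b - l2 a], which leaves only a
    unit. *)
Lemma coprime_a_f5 : exists2 h, hg (n%:Z + 3) h & reg3 l a (f5 + h * (x * p)).
Proof.
have [||h hh H] := coprime_shift_lin N3 hl l0 nla ha hf5 (hgM hx hp_); first zlia.
  move=> c [a1 [a2 Ea]] cf cxp; case: (classic (in1 l c)) => [[w Ew]|nlc].
    by case: nla; exists (a1 + a2 * w); rewrite Ea Ew; ring.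
  have [|_ rcp] := @coprime_mod_lin _ _ l c p hl l0 nlc.
    move=> d [d1 [d2 Ed]] dp; apply: J_in2 => //; apply: J_lp => //.
    by case: cf => w1 [w2 ->]; exists (w1 + w2 * d1), (w2 * d2); rewrite Ed; ring.
  have [y1 [y2 Ey]] := rcp _ cxp.
  apply: rcp; exists (y1 * b - l2 * a1), (y2 * b - l2 * a2).
  by rewrite mul1r Ep Ea Ey; ring.
exists h => //; apply: (hg_c hh); zlia.
Qed.

Hypothesis raf : reg3 l a f5.

(** [z] may be changed by multiples of [r'] at the expense of [y3]; this freedom makes it coprime to
    [a] modulo [l]. *)
Lemma f5_split : exists z y1 y2 y3, [/\ hg (2 * n%:Z + 3) z, f5 = z * x + y1 * q + y2 * r + y3 * r' & reg3 l a z].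
Proof.
have [|z1 [z2 [z3 [z4 E]]]] := JQ (e := f5).
  by apply/JP; exists 0, 0, 0, 0, 1; ring.
have E' := congr1 (hp (2 * n%:Z + 4)) E; rewrite hf5 !hpD (hpM _ _ hx) (hpM _ _ hq) (hpM _ _ hr) (hpM _ _ hr') in E'.
move: E' (hp_hg (2 * n%:Z + 4 - 1) z1); set z := hp _ z1; set y1 := hp _ z2; set y2 := hp _ z3; set y3 := hp _ z4.
move=> E' hz0; have hz : hg (2 * n%:Z + 3) z by apply: (hg_c hz0); zlia.
have [||h hh H] := coprime_shift_lin N3 hl l0 nla ha hz hr'; first zlia.
  move=> c ca cz cr'; apply: (reg3_lin_nocommon hl l0 nla raf ca).
  case: ca => a1 [a2 Ea]; case: cz => w1 [w2 Ez]; case: cr' => w3 [w4 Er].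
  exists (w1 * x + y1 * (s - t * a1) + y2 * (u - v * a1) + y3 * w3),
    (w2 * x - y1 * t * a2 - y2 * v * a2 + y3 * w4).
  apply: (lcomb (eqD E' (eqD (eqM x Ez) (eqD (eqM (- (y1 * t + y2 * v)) Ea) (eqM y3 Er))))).
  by rewrite /q /r; ring.
exists (z + h * r'), y1, y2, (y3 - h * x); split=> //.
  by apply: hgD => //; apply: (hgM_c hh hr'); zlia.
by rewrite {1}E'; ring.
Qed.

Let lr' : l * r' = t * r - v * q. Proof. by rewrite /r' /r /q; ring. Qed.
Let ar' : a * r' = s * r - u * q. Proof. by rewrite /r' /r /q; ring. Qed.

(** A common factor [d] of [q] and [r] divides [r'], by [lr'], [ar'] and the regularity of [(l, a)];
    then [J] would lie in [(x, d)]. *)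
Lemma rqr : reg2 q r.
Proof.
have [_ rl] := rla; have q0 : q != 0.
  apply/eqP => q0; have [m Em] : in1 l t by apply: rl; exists s; rewrite /q in q0; lc q0.
  have Es : s = m * a by apply: (mulIf l0); move: q0; rewrite /q Em => e; lc e.
  have n0 : 0 < n%:Z + 2 :> int by zlia.
  apply: (hg_pos_no1_2 hx hr ltr01 n0); apply: J_in2 => // e /JQ [z1 [z2 [z3 [z4 ->]]]].
  by exists z1, (z3 + z4 * m); rewrite q0 /r' Es Em /r; ring.
apply: coprime_reg2 => // d dq dr.
have [e he] := in1_hgl dq hq q0.
have d0 : d != 0 by apply: contraNneq q0 => z; case: dq => w ->; rewrite z mulr0.
have [w3 E3] : in1 d r'.
  case: dq => w1 E1; case: dr => w2 E2.
  have [|m Em] := rl (t * w2 - v * w1).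
    exists (s * w2 - u * w1); apply: (mulIf d0).
    have e1 := lr'; have e2 := ar'; rewrite E1 E2 in e1 e2.
    by apply: (lcomb (eqD (eqM (- a) e1) (eqM l e2))); ring.
  exists m; apply: (mulfI l0); rewrite lr' E1 E2.
  by apply: (lcomb (eqM d Em)); ring.
have : in2 x d 1.
  apply: J_in2 => // e' /JQ [z1 [z2 [z3 [z4 ->]]]].
  case: dq => w1 E1; case: dr => w2 E2; exists z1, (z2 * w1 + z3 * w2 + z4 * w3).
  by rewrite E1 E2 E3; ring.
have [epos|] := ltP 0 e; first by move/(hg_pos_no1_2 hx he ltr01 epos).
by move=> ele _; have [w [_ Ew]] := nz_mul_const 0 he ele d0; exists w; rewrite Ew.
Qed.

Lemma rxl_f5 : reg2 (x * l) f5.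
Proof.
apply: reg2M; apply: reg2_lin => //.
  move=> [w Ew]; apply: (hg_pos_no1_2 hx hl2 ltr01 ltr01).
  apply: J_in2 => // e /JP [v0 [v1 [v2 [v3 [v4 ->]]]]].
  exists (v0 * l + v1 * p + v2 * t * b + v3 * v * b + v4 * w), (v2 * q + v3 * r).
  by rewrite Ew /g2 /g3 /q /r Ep; ring.
move=> [w Ew]; have n0 : 0 < n%:Z :> int by zlia.
apply: (hg_pos_no1_2 hl hp_ ltr01 n0); apply: J_in2 => //; apply: J_lp; first by exists 0, 1; ring.
by exists w, 0; rewrite Ew; ring.
Qed.

Let hideal_in2 (y z : R) d e : hg d y -> hg e z -> hideal (in2 y z).
Proof.
move=> hy hz; split; [exact: in2_0|by move=> f g; apply: in2D|by move=> h f; apply: in2M|].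
move=> f m [w1 [w2 ->]]; rewrite hpD (hpM _ _ hy) (hpM _ _ hz).
by exists (hp (m - d) w1), (hp (m - e) w2).
Qed.

Let hJ : hideal J.
Proof.
have [z0 zD zM zh] := in5_hideal (hgM hx hl) (hgM hx hp_) hg2 hg3 hf5; split.
- exact/JP.
- by move=> f g /JP hf /JP hg; apply/JP; apply: zD.
- by move=> h f /JP hf; apply/JP; apply: zM.
- by move=> f d /JP hf; apply/JP; apply: zh.
Qed.

Definition double_link_ideal := in5 (x * l) (x * a) q r f5.

Lemma first_double_link : exists (db : nat) be be1, [/\ (2 * n + 6 < db)%N, hg db%:Z be /\ hg (db%:Z - 1) be1,
  reg3 (x * l) f5 be /\ reg3 (x * l) f5 be1, J be &
  forall C0 C1, C0 = (x * l, f5, be) -> C1 = (x * l, f5, be1) ->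
    vcolon C0 J be1 /\ forall g, vcolon C1 (vcolon C0 J) g <-> double_link_ideal g].
Proof.
have hC := hideal_in2 (hgM hx hl) hf5.
have [||be [db [Jbe hbe dbn nzd]]] := @avoid _ _ (in2 (x * l) f5) J hC hJ _ _ (2 * n + 6)%N.
- move=> f d /JP Hf hf f0; apply: (in5_pos (hgM hx hl) (hgM hx hp_) hg2 hg3 hf5 _ _ _ _ _ Hf hf f0); zlia.
- by move=> w Hw; apply: (reg3_colon_reg2 rxl_f5 rJ); rewrite [w * _]mulrC; apply: Hw.
have rbe : reg3 (x * l) f5 be by split; [exact: rxl_f5|exact: nzd].
have [v0 [v1 [v2 [v3 [v4 [[k0 k1 k2 k3 k4] Ebe]]]]]] :=
  in5_hg (hgM hx hl) (hgM hx hp_) hg2 hg3 hf5 hbe (proj1 (JP _) Jbe).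
(* The substitution [x p -> - x a], [g2 -> q], [g3 -> r], with [x l] and [f5] sent to 0. By [key] it
   acts on all of [J], modulo [(x l, f5)], as multiplication by [be1 / be]. *)
pose be1 := - (v1 * (x * a)) + v2 * q + v3 * r.
have hbe1 : hg (db - 1) be1.
  apply: hgD; [apply: hgD; [apply: hgN; apply: (hgM_c k1 (hgM hx ha))|apply: (hgM_c k2 hq)]|
    apply: (hgM_c k3 hr)]; zlia.
have Ex : in1 x (l2 * be1 - be + v4 * f5).
  by exists (- (v0 * l) - v1 * p - v1 * a * l2 - (v2 * t + v3 * v) * b); rewrite Ebe /be1 /q /r /g2 /g3 Ep; ring.
have El : in1 l (p * be1 + a * be - v4 * a * f5).
  exists (v0 * x * a + (v2 * s + v3 * u) * (p + a * l2)).
  by rewrite Ebe /be1 /q /r /g2 /g3; ring.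
have [[_ rx] [_ rl']] : reg3 x f5 be /\ reg3 l f5 be.
  by split; [exact: (reg3_divl rbe)|apply: (reg3_divl (v := x)); rewrite mulrC].
have [_ nlf] : x != 0 /\ ~ in1 x f5.
  split=> // [] [w Ew]; have [xl0 rxf] := rxl_f5.
  have [|w2 E2] := rxf l; first by exists w; rewrite Ew; ring.
  have : 1 = w2 * x by apply: (mulIf l0); rewrite mul1r {1}E2; ring.
  by move=> E1; apply: (hg_pos_no1 hx ltr01); exists w2.
have rbe1 : reg3 (x * l) f5 be1.
  split; first exact: rxl_f5.
  move=> h [u1 [w1 E1]].
  have [|al [ga Eh]] := rx h.
    case: Ex => m Em; exists (l2 * u1 * l - h * m), (l2 * w1 + h * v4).
    by apply: (lcomb (eqD (eqM l2 E1) (eqM (- h) Em))); ring.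
  have [w2 Ew2] : in1 x (w1 - ga * be1).
    have [] // := @lin_prime _ _ x (w1 - ga * be1) f5 hx x0.
    by exists (al * be1 - u1 * l); rewrite Eh in E1; lc E1.
  have Eal : al * be1 = u1 * l + w2 * f5.
    by apply: (mulfI x0); rewrite Eh in E1; apply: (lcomb (eqD E1 (eqM f5 Ew2))); ring.
  have [m1 [m2 Em]] : in2 l f5 al.
    have H1 : in2 l f5 (a * al * be).
      case: El => m Em; exists (al * m - p * u1), (al * v4 * a - p * w2).
      by apply: (lcomb (eqD (eqM al Em) (eqM (- p) Eal))); ring.
    have [m1 [m2 Em]] := rl' _ H1.
    have [m3 [m4 Em']] : in2 l a m2.
      by case: raf => _; apply; exists (- m1), al; lc Em.
    have [|w Ew] := (proj2 rla) (al - m4 * f5).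
      by exists (m1 + m3 * f5); apply: (lcomb (eqD Em (eqM f5 Em'))); ring.
    by exists w, m4; lc Ew.
  by exists m1, (x * m2 + ga); rewrite Eh Em; ring.
have key w0 w1 w2 w3 w4 : in2 (x * l) f5 ((w0 * (x * l) + w1 * (x * p) + w2 * g2 + w3 * g3 + w4 * f5) * be1 -
    (- (w1 * (x * a)) + w2 * q + w3 * r) * be).
  exists (w0 * be1 - v0 * (- (w1 * (x * a)) + w2 * q + w3 * r) + (w1 * v2 - w2 * v1) * x * s * b +
    (w1 * v3 - w3 * v1) * x * u * b + (w2 * v3 - w3 * v2) * r' * b),
    (w4 * be1 - v4 * (- (w1 * (x * a)) + w2 * q + w3 * r)).
  by rewrite Ebe /be1 /q /r /r' /g2 /g3 Ep; ring.
exists `|db|%N, be, be1; rewrite (_ : `|db|%N%:Z = db); last zlia.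
split=> //; first zlia.
move=> C0 C1 -> ->.
have cbe : ci (2, 2 * n%:Z + 4, db) (x * l, f5, be).
  split=> //; first by split=> //=; apply: (hgM_c hx hl).
  by apply: (hg_pos_no1_3 (hgM hx hl) hf5 hbe); zlia.
have sub : csub (x * l, f5, be) J.
  split=> //=; apply/JP; [by exists 1, 0, 0, 0, 0; ring|by exists 0, 0, 0, 0, 1; ring].
have [|H1 H2] := double_link rbe rbe1 _ (refl cbe sub) Jbe.
  move=> e /JP [w0 [w1 [w2 [w3 [w4 ->]]]]]; exists (- (w1 * (x * a)) + w2 * q + w3 * r); exact: key.
split=> // g; rewrite H2; split=> [[e /JP [w0 [w1 [w2 [w3 [w4 ->]]]]] He]|[w0 [w1 [w2 [w3 [w4 ->]]]]]].
  have [|u1 [u2 Eu]] := nzd (- (w1 * (x * a)) + w2 * q + w3 * r - g).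
    case: He => j1 [j2 Ej]; have [j3 [j4 Ej']] := key w0 w1 w2 w3 w4.
    by exists (j1 - j3), (j2 - j4); apply: (lcomb (eqD Ej (eqM (-1) Ej'))); ring.
  exists (- u1), (- w1), w2, w3, (- u2); by lc Eu.
exists (0 * (x * l) + (- w1) * (x * p) + w2 * g2 + w3 * g3 + 0 * f5).
  by apply/JP; exists 0, (- w1), w2, w3, 0.
have [m1 [m2 Em]] := key 0 (- w1) w2 w3 0.
exists (m1 - w0 * be), (m2 - w4 * be); by lc Em.
Qed.

Lemma double_link_ideal_hideal : hideal double_link_ideal.
Proof. exact: (in5_hideal (hgM hx hl) (hgM hx ha) hq hr hf5). Qed.

Lemma double_link_ideal_pos f d : double_link_ideal f -> hg d f -> f != 0 -> 0 < d.
Proof.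
by move=> Hf hf f0; apply: (in5_pos (hgM hx hl) (hgM hx ha) hq hr hf5 _ _ _ _ _ Hf hf f0); zlia.
Qed.

Lemma second_double_link : exists (d2 : nat) ph ps z, [/\ (n + 4 < d2)%N, hg d2%:Z ph /\ hg (d2%:Z - 1) ps,
  reg3 q r ph /\ reg3 q r ps, double_link_ideal ph & [/\ reg3 l a z, hg (2 * n%:Z + 3) z, in3 l a z ps &
  forall C2 C3, C2 = (q, r, ph) -> C3 = (q, r, ps) -> (forall f, vcolon C2 (vcolon C2 double_link_ideal) f -> double_link_ideal f) ->
    vcolon C2 double_link_ideal ps /\ forall g, vcolon C3 (vcolon C2 double_link_ideal) g <-> in3 l a z g]].
Proof.
have [colA colB] := det_colon hl rla rqr; have [_ rf] := raf.
have [z [y1 [y2 [y3 [hz Ef rz]]]]] := f5_split.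
have r'la m : in2 l a m -> in2 q r (m * r').
  move=> [m1 [m2 ->]]; exists (- (m1 * v) - m2 * u), (m1 * t + m2 * s).
  by apply: (lcomb (eqD (eqM m1 lr') (eqM m2 ar'))); ring.
have [||ph [d2 [Kph hph d2n nzd]]] := @avoid _ _ (in2 q r) double_link_ideal (hideal_in2 hq hr) double_link_ideal_hideal _ _ (n + 4)%N.
- exact: double_link_ideal_pos.
(* From [w x l], [w x a] in [(q, r)] and the form of [J], also [w l] and [w a] are in [(q, r)], so
   [w = m r'] modulo [(q, r)]. Then [f5 w] gives [m f5], hence [m], in [(l, a)], and [r'] times
   [(l, a)] is in [(q, r)]. *)
- move=> w Hw.
  have Hxl : in2 q r (w * x * l).
    have := Hw (x * l); rewrite (_ : x * l * w = w * x * l); last by ring.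
    by apply; exists 1, 0, 0, 0, 0; ring.
  have Hxa : in2 q r (w * x * a).
    have := Hw (x * a); rewrite (_ : x * a * w = w * x * a); last by ring.
    by apply; exists 0, 1, 0, 0, 0; ring.
  have step y : in2 l a y -> in2 q r (w * x * y) -> in2 q r (w * y).
    move=> Hy Hxy; have Hy' := r'la _ Hy.
    have H e : J e -> in2 q r (w * y * e).
      move=> /JQ [z1 [z2 [z3 [z4 ->]]]]; case: Hxy => w1 [w2 E1]; case: Hy' => w3 [w4 E2].
      exists (z1 * w1 + z2 * w * y + z4 * w * w3), (z1 * w2 + z3 * w * y + z4 * w * w4).
      by apply: (lcomb (eqD (eqM z1 E1) (eqM (z4 * w) E2))); ring.
    by apply: (reg3_colon_reg2 rqr rJ); apply: H.
  have [||m [m1 [m2 Em]]] := colA w; [by apply: step => //; exists 1, 0; ring|by apply: step => //; exists 0, 1; ring|].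
  have : in2 l a m.
    apply: rf; apply: colB.
    have [w1 [w2 E1]] : in2 q r (f5 * w) by apply: Hw; exists 0, 0, 0, 0, 1; ring.
    exists (w1 - m1 * f5), (w2 - m2 * f5).
    by apply: (lcomb (eqD E1 (eqM (- f5) Em))); rewrite -/q -/r -/r'; ring.
  move=> /r'la [w1 [w2 E1]]; exists (m1 + w1), (m2 + w2).
  by apply: (lcomb (eqD Em E1)); rewrite -/q -/r -/r'; ring.
have rph : reg3 q r ph by split; [exact: rqr|exact: nzd].
have [m0 [m1 [m2 [m3 [m4 [[k0 k1 k2 k3 k4] Eph]]]]]] := in5_hg (hgM hx hl) (hgM hx ha) hq hr hf5 hph Kph.
(* This substitution divides by [x]: [x l], [x a], [f5] become [l], [a], [z], and [q], [r] become 0.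
   The terms with [r'] in [key] have coefficients in [(l, a)] and so vanish modulo [(q, r)]. *)
pose ps := m0 * l + m1 * a + m4 * z.
have hps : hg (d2 - 1) ps.
  by apply: hgD; [apply: hgD; [apply: (hgM_c k0 hl)|apply: (hgM_c k1 ha)]|apply: (hgM_c k4 hz)]; zlia.
have key w0 w1 w2 w3 w4 : in2 q r ((w0 * (x * l) + w1 * (x * a) + w2 * q + w3 * r + w4 * f5) * ps -
    (w0 * l + w1 * a + w4 * z) * ph).
  pose e' := w0 * l + w1 * a + w4 * z.
  have : in2 q r (y3 * (w4 * (m0 * l + m1 * a) - m4 * (w0 * l + w1 * a)) * r').
    by apply: r'la; exists (y3 * (w4 * m0 - m4 * w0)), (y3 * (w4 * m1 - m4 * w1)); ring.
  move=> [u1 [u2 Eu]].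
  exists (u1 + (w2 + w4 * y1) * ps - e' * (m2 + m4 * y1)), (u2 + (w3 + w4 * y2) * ps - e' * (m3 + m4 * y2)).
  rewrite Eph; apply: (lcomb (eqD Eu (eqM (w4 * ps - e' * m4) Ef))).
  by rewrite /e' /ps -/q -/r -/r'; ring.
have rps : reg3 q r ps.
  split=> [|h Hh]; first exact: rqr.
  have kill w0 w1 : in2 q r (h * (w0 * l + w1 * a)).
    apply: nzd; have [u1 [u2 Eu]] := key w0 w1 0 0 0; case: Hh => u3 [u4 E4].
    exists (- (h * u1) + (w0 * (x * l) + w1 * (x * a)) * u3), (- (h * u2) + (w0 * (x * l) + w1 * (x * a)) * u4).
    by apply: (lcomb (eqD (eqM (- h) Eu) (eqM (w0 * (x * l) + w1 * (x * a)) E4))); ring.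
  have [||m [n1 [n2 Em]]] := colA h.
  - by have := kill 1 0; rewrite mul1r mul0r addr0.
  - by have := kill 0 1; rewrite mul1r mul0r add0r.
  have H1 : in2 l a (m * ps).
    apply: colB; case: Hh => u3 [u4 E4]; exists (u3 - n1 * ps), (u4 - n2 * ps).
    by apply: (lcomb (eqD E4 (eqM (- ps) Em))); rewrite -/q -/r -/r'; ring.
  have H2 : in2 l a (m * m4).
    case: rz => _; apply; case: H1 => u3 [u4 E4]; exists (u3 - m * m0), (u4 - m * m1).
    by apply: (lcomb E4); rewrite /ps; ring.
  have H3 : in2 l a (m * ph).
    case: H2 => u3 [u4 E4]; rewrite Eph.
    exists (m * (m0 * x + m2 * s + m3 * u) + u3 * f5), (m * (m1 * x - m2 * t - m3 * v) + u4 * f5).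
    by apply: (lcomb (eqM f5 E4)); rewrite /q /r; ring.
  have : in2 q r (m * r').
    by apply: nzd; rewrite (_ : m * r' * ph = m * ph * r'); [apply: r'la|ring].
  move=> [w1 [w2 E1]]; exists (n1 + w1), (n2 + w2).
  by apply: (lcomb (eqD Em E1)); rewrite -/q -/r -/r'; ring.
exists `|d2|%N, ph, ps, z; rewrite (_ : `|d2|%N%:Z = d2); last zlia.
split=> //; first zlia.
split=> //; first by exists m0, m1, m4.
move=> C2 C3 -> -> rfl.
have [|H1 H2] := double_link rph rps _ rfl Kph.
  by move=> e [w0 [w1 [w2 [w3 [w4 ->]]]]]; exists (w0 * l + w1 * a + w4 * z); apply: key.
split=> // g; rewrite H2; split=> [[e [w0 [w1 [w2 [w3 [w4 ->]]]]] He]|[w0 [w1 [w4 ->]]]].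
  have [|u1 [u2 Eu]] := nzd (w0 * l + w1 * a + w4 * z - g).
    case: He => j1 [j2 Ej]; have [j3 [j4 Ej']] := key w0 w1 w2 w3 w4.
    by exists (j1 - j3), (j2 - j4); apply: (lcomb (eqD Ej (eqM (-1) Ej'))); ring.
  exists (w0 - u1 * s - u2 * u), (w1 + u1 * t + u2 * v), w4.
  by apply: (lcomb (eqM (-1) Eu)); rewrite /q /r; ring.
exists (w0 * (x * l) + w1 * (x * a) + 0 * q + 0 * r + w4 * f5); first by exists w0, w1, 0, 0, w4.
exact: key.
Qed.

Lemma vcolon_ext (c : vec R) (I I' : R -> Prop) : (forall f, I f <-> I' f) ->
  forall f, vcolon c I f -> vcolon c I' f.
Proof. by move=> E f H h /E; apply: H. Qed.

Lemma licci_chain : exists s Is Cf Cd, homog_link_seq J 3 s Is Cf Cd.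
Proof.
have [db [be [be1 [dbn [hbe hbe1] [rbe rbe1] Jbe DL1]]]] := first_double_link.
have [d2 [ph [ps [z [d2n [hph hps] [rph rps] Kph [rz hz Aps DL2]]]]]] := second_double_link.
pose C0 : vec R := (x * l, f5, be); pose C1 : vec R := (x * l, f5, be1).
pose C2 : vec R := (q, r, ph); pose C3 : vec R := (q, r, ps).
have hxl : hg 2 (x * l) by apply: (hgM_c hx hl).
have hf5' : hg (2 * n + 4)%N%:Z f5 by apply: (hg_c hf5); zlia.
have hr2 : hg (n + 2)%N%:Z r by apply: (hg_c hr); zlia.
have hbe1' : hg db.-1%:Z be1 by apply: (hg_c hbe1); zlia.
have hps' : hg d2.-1%:Z ps by apply: (hg_c hps); zlia.
have ci0 : ci (2%N%:Z, (2 * n + 4)%N%:Z, db%:Z) C0.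
  by split; [|split|apply: (hg_pos_no1_3 hxl hf5' hbe); zlia].
have ci1 : ci (2%N%:Z, (2 * n + 4)%N%:Z, db.-1%:Z) C1.
  by split; [|split|apply: (hg_pos_no1_3 hxl hf5' hbe1'); zlia].
have ci2 : ci (n%:Z, (n + 2)%N%:Z, d2%:Z) C2.
  by split; [|split|apply: (hg_pos_no1_3 hq hr2 hph); zlia].
have ci3 : ci (n%:Z, (n + 2)%N%:Z, d2.-1%:Z) C3.
  by split; [|split|apply: (hg_pos_no1_3 hq hr2 hps'); zlia].
have [_ vh0 n10] := ci0; have [_ vh1 n11] := ci1; have [_ vh2 n12] := ci2; have [_ vh3 n13] := ci3.
have [I1be1 K2E] := DL1 C0 C1 erefl erefl.
pose I1 := vcolon C0 J; pose I3 := vcolon C2 double_link_ideal; pose A := in3 l a z.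
have hI1 : hideal I1 := hideal_vcolon vh0 hJ.
have hI3 : hideal I3 := hideal_vcolon vh2 double_link_ideal_hideal.
have inC (c : vec R) I : csub c (vcolon c I).
  by split=> h _; [apply/in3Mr/in31|apply/in3Mr/in32|apply/in3Mr/in33].
have subJ : csub C0 J.
  split=> //=; apply/JP; [by exists 1, 0, 0, 0, 0; ring|by exists 0, 0, 0, 0, 1; ring].
have sub1 : csub C1 I1 by have [i1 i2 _] := inC C0 J; split.
have refl1 f : vcolon C1 (vcolon C1 I1) f -> I1 f by apply: (link_refl ci0 ci1 hJ sub1).
have sub2 : csub C2 double_link_ideal.
  by split=> //=; [exists 0, 0, 1, 0, 0; ring|exists 0, 0, 0, 1, 0; ring].
have refl2 f : vcolon C2 (vcolon C2 double_link_ideal) f -> double_link_ideal f.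
  move=> Hf; apply/K2E; apply: (link_refl ci1 ci2 hI1).
    by case: sub2 => i1 i2 i3; split; apply/K2E.
  apply: vcolon_ext Hf => g; split; apply: vcolon_ext => h; [exact: iff_sym (K2E h)|exact: K2E].
have [I3ps AE] := DL2 C2 C3 erefl erefl refl2.
have sub3 : csub C3 I3 by have [i1 i2 _] := inC C2 double_link_ideal; split.
have refl3 f : vcolon C3 (vcolon C3 I3) f -> I3 f by apply: (link_refl ci2 ci3 double_link_ideal_hideal sub3).
(* The element needed by [grade3_intro] is [x * p] or [x * l] for the colon ideals [I1] and [I3];
   for the two other ideals its absence would put 1 in them. *)
have gI1 : grade_eq I1 3.
  apply: (@grade3_intro _ _ C0 I1 (x * p)) => //; [exact: inC| |].
    move=> /(in3_low1 (hgM hx hp_) hxl hf5' hbe) [||w Ew]; [zlia|zlia|].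
    by apply: nlp; exists w; apply: (mulfI x0); rewrite Ew; ring.
  by move=> f Hf; rewrite mulrC; apply: Hf; apply/JP; exists 0, 1, 0, 0, 0; ring.
have gK2 : grade_eq double_link_ideal 3.
  have [h [Ih nh]] : exists h, I1 h /\ ~ vin C1 h.
    apply: NNPP => H; have K1 : double_link_ideal 1.
      by apply/K2E => h Ih; rewrite mul1r; apply: NNPP => nh; apply: H; exists h.
    by have := double_link_ideal_pos K1 (hg1 _ _) (oner_neq0 _).
  apply: (@grade3_intro _ _ C1 double_link_ideal h) => //.
    by have [i1 i2 i3] := inC C1 I1; split; apply/K2E.
  by move=> f /K2E Hf; rewrite mulrC; apply: Hf.
have gI3 : grade_eq I3 3.
  apply: (@grade3_intro _ _ C2 I3 (x * l)) => //; [exact: inC| |].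
    move=> /(in3_low0 hxl hq hr2 hph) H; have /eqP : x * l = 0 by apply: H; zlia.
    by rewrite mulf_eq0 (negbTE x0) (negbTE l0).
  by move=> f Hf; rewrite mulrC; apply: Hf; exists 1, 0, 0, 0, 0; ring.
have nA1 : ~ A 1 by apply: (hg_pos_no1_3 hl ha hz); zlia.
have gA : grade_eq A 3.
  have [h [Ih nh]] : exists h, I3 h /\ ~ vin C3 h.
    apply: NNPP => H; apply: nA1; apply/AE => h Ih; rewrite mul1r.
    by apply: NNPP => nh; apply: H; exists h.
  apply: (@grade3_intro _ _ C3 A h) => //.
    by have [i1 i2 i3] := inC C3 I3; split; apply/AE.
  by move=> f /AE Hf; rewrite mulrC; apply: Hf.
exists 4%N, (fun i => match i with 0%N => J | 1%N => I1 | 2%N => double_link_ideal | 3%N => I3 | _ => A end).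
exists (fun i => match i with 0%N => [:: x * l; f5; be] | 1%N => [:: x * l; f5; be1] |
  2%N => [:: q; r; ph] | _ => [:: q; r; ps] end).
exists (fun i => match i with 0%N => [:: 2; 2 * n + 4; db]%N | 1%N => [:: 2; 2 * n + 4; db.-1]%N |
  2%N => [:: n; n + 2; d2]%N | _ => [:: n; n + 2; d2.-1]%N end).
split=> //; last first.
  exists [:: l; a; z]; split; first exact/regular3P.
  by move=> f; apply: iff_sym; apply: gen3.
move=> [|[|[|[|//]]]] _.
- by apply: (colon_link ci0) => //; [zlia|zlia|exact: refl ci0 subJ].
- apply: (colon_link ci1) => //; [zlia|zlia|by move=> f; apply: iff_sym|].
  by move=> f Hf; apply: refl1; apply: vcolon_ext Hf => g; apply: iff_sym.
- by apply: (colon_link ci2) => //; [zlia|zlia|exact: double_link_ideal_hideal].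
- apply: (colon_link ci3) => //; [zlia|zlia|by move=> f; apply: iff_sym|].
  by move=> f Hf; apply: refl3; apply: vcolon_ext Hf => g; apply: iff_sym.
Qed.
End Chain.

Lemma sum4E (V : nmodType) (F : 'I_4 -> V) :
  \sum_i F i = F (inord 0) + F (inord 1) + F (inord 2) + F (inord 3).
Proof.
rewrite !big_ord_recl big_ord0 addr0 !addrA.
by congr (F _ + F _ + F _ + F _); apply: val_inj; rewrite /= inordK.
Qed.

Lemma ordS_nat m (P : 'I_m.+1 -> Prop) : (forall i, (i < m.+1)%N -> P (inord i)) -> forall i, P i.
Proof. by move=> H i; rewrite -[i]inord_val; apply: H. Qed.

(** * Generators of [J] adapted to the chain *)

Section Generators.
Variables (k : fieldType) (N n : nat).
Local Notation R := {mpoly k[N]}.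
Hypothesis n4 : (4 <= n)%N.
Variables (J : R -> Prop) (f : 'rV[R]_5) (M2 : 'M[R]_(5, 7)) (M3 : 'M[R]_(7, 3)).
Hypotheses (hf : forall j : 'I_5, (f ord0 j) \is (nth 0%N (shifts1 n) j).-homog /\ f ord0 j != 0)
  (hM2 : forall (j : 'I_5) (l : 'I_7), min_entry (nth 0%N (shifts1 n) j) (nth 0%N (shifts2 n) l) (M2 j l))
  (hM3 : forall (j : 'I_7) (l : 'I_3), min_entry (nth 0%N (shifts2 n) j) (nth 0%N (shifts3 n) l) (M3 j l)).
Hypotheses (HJ : forall h, J h <-> exists v : 'cV[R]_5, h = (f *m v) 0 0).
Hypotheses (fM2 : f *m M2 = 0) (ex1 : ker_sub_im f M2) (M23 : M2 *m M3 = 0)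
  (ex2 : ker_sub_im M2 M3) (inj3 : forall v : 'cV_3, M3 *m v = 0 -> v = 0).
Variables (c1 c2 c3 : R).
Hypotheses (rJ : reg3 c1 c2 c3) (J1 : J c1) (J2 : J c2) (J3 : J c3).
Local Notation F i := (f 0 (inord i)).
Local Notation m2 i j := (M2 (inord i) (inord j)).
Local Notation m3 i j := (M3 (inord i) (inord j)).

Variables (x l l2 p : R).
Hypotheses (HS : S1 n%:Z J x l l2 p) (nxl2 : ~ in1 x l2) (EF0 : F 0%N = x * l).
Hypothesis FH : forall i, (i < 4)%N -> in3 (x * l) (l2 * l) p (F i).

Let hx : hg 1 x. Proof. by case: HS => -[[]]. Qed.
Let x0 : x != 0. Proof. by case: HS => -[[]]. Qed.
Let hl : hg 1 l. Proof. by case: HS => -[[]]. Qed.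
Let l0 : l != 0. Proof. by case: HS => -[[]]. Qed.
Let hp_ : hg n%:Z p. Proof. by case: HS => -[_ []]. Qed.
Let nlp : ~ in1 l p. Proof. by case: HS => -[_ []]. Qed.
Let hl2 : hg 1 l2. Proof. by case: HS. Qed.
Let hF1 := hF n4 hf.

Lemma H_form i d : (i < 4)%N -> hg d (F i) -> exists e s t,
  [/\ hg (d - 2) e, hg (d - 2) s, hg (d - n%:Z) t & F i = e * F 0%N + s * (l2 * l) + t * p].
Proof.
move=> i4 hd; have [e [s [t [E h1 h2 h3]]]] := in3_hg hd (hgM hx hl) (hgM hl2 hl) hp_ (FH i4).
by exists e, s, t; rewrite EF0.
Qed.

Lemma xp_form : exists y0 y1 y2, [/\ hg (n%:Z - 1) y0, hg 0 y1, hg 0 y2,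
  x * p = y0 * F 0%N + y1 * F 1%N + y2 * F 2%N & y1 != 0 \/ y2 != 0].
Proof.
have Jxp : J (x * p) by case: HS => -[_ _ []].
have [w [[h0 h1 h2 h3 h4] E]] := JP_hg n4 hf HJ Jxp (hgM hx hp_).
have E' : x * p = w 0%N * F 0%N + w 1%N * F 1%N + w 2%N * F 2%N.
  by rewrite E (hg_neg h3) ?(hg_neg h4); try zlia; ring.
exists (w 0%N), (w 1%N), (w 2%N).
split; [by apply: (hg_c h0); zlia|by apply: (hg_c h1); zlia|by apply: (hg_c h2); zlia|exact: E'|].
case: (eqVneq (w 1%N) 0) => [e1|]; last by left.
case: (eqVneq (w 2%N) 0) => [e2|]; last by right.
case: nlp; exists (w 0%N); apply: (mulfI x0); rewrite E' e1 e2 EF0; ring.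
Qed.

(** [x * p] involves [F 1] or [F 2] with a nonzero constant coefficient and can replace it. The
    other one and [F 3], reduced modulo [x * l], become [g2] and [g3]; [w] inverts the determinant
    of this change. *)
Lemma gens_form : exists s t u v y0 y1 y2 e0 e1 e2 e3 w, let g2 := s * (l2 * l) + t * p in
  let g3 := u * (l2 * l) + v * p in
  [/\ [/\ hg (n%:Z - 1) s, hg 1 t, hg (n%:Z + 1) u & hg 3 v],
      [/\ hg (n%:Z - 1) y0, hg 0 y1, hg 0 y2 & x * p = y0 * F 0%N + y1 * F 1%N + y2 * F 2%N],
      [/\ hg (n%:Z - 1) e0, hg 0 e1, hg 0 e2 & g2 = e0 * F 0%N + e1 * F 1%N + e2 * F 2%N],
      hg (n%:Z + 1) e3 /\ g3 = e3 * F 0%N + F 3%N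
    & hg 0 w /\ w * (y1 * e2 - y2 * e1) = 1].
Proof.
have [h0 h1 h2 h3 _] := hF1.
have [a1 [s1 [t1 [ha1 hs1 ht1 E1]]]] := H_form (i := 1) isT h1.
have [a2 [s2 [t2 [ha2 hs2 ht2 E2]]]] := H_form (i := 2) isT h2.
have [a3 [s3 [t3 [ha3 hs3 ht3 E3]]]] := H_form (i := 3) isT h3.
have [y0 [y1 [y2 [hy0 hy1 hy2 Ey nz]]]] := xp_form.
have [y10|y10] := eqVneq y1 0.
  have y20 : y2 != 0 by case: nz => //; rewrite y10 eqxx.
  have [w hw Ew] := hg_unit hy2 y20.
  exists s1, t1, s3, t3, y0, y1, y2, (- a1), 1, 0, (- a3), (- w) => /=; split.
  - by split; [apply: (hg_c hs1)|apply: (hg_c ht1)|apply: (hg_c hs3)|apply: (hg_c ht3)]; zlia.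
  - by [].
  - split; [by apply: hgN; apply: (hg_c ha1); zlia|exact: hg1|exact: hg0|by rewrite E1; ring].
  - split; [by apply: hgN; apply: (hg_c ha3); zlia|by rewrite E3; ring].
  - by split; [apply: hgN|lc Ew].
have [w hw Ew] := hg_unit hy1 y10.
exists s2, t2, s3, t3, y0, y1, y2, (- a2), 0, 1, (- a3), w => /=; split.
- by split; [apply: (hg_c hs2)|apply: (hg_c ht2)|apply: (hg_c hs3)|apply: (hg_c ht3)]; zlia.
- by [].
- split; [by apply: hgN; apply: (hg_c ha2); zlia|exact: hg0|exact: hg1|by rewrite E2; ring].
- split; [by apply: hgN; apply: (hg_c ha3); zlia|by rewrite E3; ring].
- by split=> //; lc Ew.
Qed.

Variables (s t u v y0 y1 y2 e0 e1 e2 e3 w a b : R).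
Let g2 := s * (l2 * l) + t * p.
Let g3 := u * (l2 * l) + v * p.
Let q := s * l - t * a.
Let r := u * l - v * a.
Let r' := t * u - s * v.
Hypotheses (hs : hg (n%:Z - 1) s) (ht : hg 1 t) (hu : hg (n%:Z + 1) u) (hv : hg 3 v).
Hypotheses (hy0 : hg (n%:Z - 1) y0) (hy1 : hg 0 y1) (hy2 : hg 0 y2)
  (Exp : x * p = y0 * F 0%N + y1 * F 1%N + y2 * F 2%N).
Hypotheses (he0 : hg (n%:Z - 1) e0) (he1 : hg 0 e1) (he2 : hg 0 e2)
  (Eg2 : g2 = e0 * F 0%N + e1 * F 1%N + e2 * F 2%N).
Hypotheses (he3 : hg (n%:Z + 1) e3) (Eg3 : g3 = e3 * F 0%N + F 3%N).
Hypotheses (hw : hg 0 w) (Ew : w * (y1 * e2 - y2 * e1) = 1).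
Hypotheses (ha : hg (n%:Z - 1) a) (hb : hg (n%:Z - 1) b) (Ep : p = x * b - l2 * a).

Lemma J_gens h : J h <-> in5 (x * l) (x * p) g2 g3 (F 4%N) h.
Proof.
rewrite (JP HJ); split=> [[c ->]|[v0 [v1 [v2 [v3 [v4 ->]]]]]].
  exists (c 0%N - c 1%N * w * (e2 * y0 - y2 * e0) - c 2%N * w * (y1 * e0 - e1 * y0) - c 3%N * e3),
    (c 1%N * w * e2 - c 2%N * w * e1), (c 2%N * w * y1 - c 1%N * w * y2), (c 3%N), (c 4%N).
  rewrite Exp Eg2 Eg3 -EF0.
  by apply: (lcomb (eqM (- (c 1%N * F 1%N + c 2%N * F 2%N)) Ew)); ring.
exists (fun i => nth 0 [:: v0 + v1 * y0 + v2 * e0 + v3 * e3; v1 * y1 + v2 * e1; v1 * y2 + v2 * e2; v3; v4] i) => /=.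
by rewrite Exp Eg2 Eg3 -EF0; ring.
Qed.

(** The columns are relations among the generators other than [F 4]. [V] is a relation of degree
    [2n + 4] among the columns, with entries generating [(x, q, r, r')]. *)
Let X : 'M[R]_(5, 4) := \matrix_(i, j) nth 0 (nth [::]
  [:: [:: p - y0 * l; - (s * l2) - y0 * t + e0 * x; - (u * l2) - y0 * v + e3 * x; - (r' * b) + e0 * r - e3 * q];
      [:: - (y1 * l); - (y1 * t) + e1 * x; - (y1 * v); e1 * r];
      [:: - (y2 * l); - (y2 * t) + e2 * x; - (y2 * v); e2 * r];
      [:: 0; 0; x; - q]; [:: 0; 0; 0; 0]] i) j.
Let dX (j : 'I_4) : int := nth 0 [:: n%:Z + 2; n%:Z + 2; n%:Z + 4; 2 * n%:Z + 3] j.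
Let V : 'cV[R]_4 := \col_j nth 0 [:: r'; - r; q; x] j.

Let hq : hg n%:Z q.
Proof. by apply: hgB; [apply: (hgM_c hs hl)|apply: (hgM_c ht ha)]; zlia. Qed.
Let hr : hg (n%:Z + 2) r.
Proof. by apply: hgB; [apply: (hgM_c hu hl)|apply: (hgM_c hv ha)]; zlia. Qed.
Let hr' : hg (n%:Z + 2) r'.
Proof. by apply: hgB; [apply: (hgM_c ht hu)|apply: (hgM_c hs hv)]; zlia. Qed.

Lemma gX : gmx (sh1 n) dX X.
Proof.
apply: ordS_nat => i i5; apply: ordS_nat => j j4; rewrite mxE /sh1 /dX !inordK // /shifts1.
case: i i5 => [|[|[|[|[|//]]]]] _; case: j j4 => [|[|[|[|//]]]] _ /=; try exact: hg0;
  repeat first [apply: hgN | apply: hgD | apply: hgB];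
  (first [apply: (hg_c hp_) | apply: (hgM_c hs hl) | apply: (hgM_c ht ha) | apply: (hg_c hx) | apply: (hg_c hq)
    | apply: (hgM_c hy0 hl) | apply: (hgM_c hs hl2) | apply: (hgM_c hy0 ht)
    | apply: (hgM_c he0 hx) | apply: (hgM_c hu hl2) | apply: (hgM_c hy0 hv)
    | apply: (hgM_c he3 hx) | apply: (hgM_c hr' hb) | apply: (hgM_c he0 hr)
    | apply: (hgM_c he3 hq) | apply: (hgM_c hy1 hl) | apply: (hgM_c hy1 ht)
    | apply: (hgM_c he1 hx) | apply: (hgM_c hy1 hv) | apply: (hgM_c he1 hr)
    | apply: (hgM_c hy2 hl) | apply: (hgM_c hy2 ht)
    | apply: (hgM_c he2 hx) | apply: (hgM_c hy2 hv) | apply: (hgM_c he2 hr)]; zlia).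
Qed.

Lemma gV : gmx dX (fun=> 2 * n%:Z + 4) V.
Proof.
apply: ordS_nat => i i4 j; rewrite mxE /dX inordK //.
case: i i4 => [|[|[|[|//]]]] _ /=; [apply: (hg_c hr')|apply: hgN; apply: (hg_c hr)|apply: (hg_c hq)|apply: (hg_c hx)]; zlia.
Qed.

Lemma fX : f *m X = 0.
Proof.
apply/rowP; apply: ordS_nat => j j4; rewrite !mxE sum5E !mxE !inordK //.
case: j j4 => [|[|[|[|//]]]] _ /=.
- by apply: (lcomb (eqD (eqM l Exp) (eqM (- p) (esym EF0)))); ring.
- apply: (lcomb (eqD (eqM (- x) Eg2) (eqD (eqM t Exp) (eqM (- (s * l2)) EF0)))); rewrite /g2; ring.
- apply: (lcomb (eqD (eqM (- x) Eg3) (eqD (eqM v Exp) (eqM (- (u * l2)) EF0)))); rewrite /g3; ring.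
- apply: (lcomb (eqD (eqM (- r) Eg2) (eqD (eqM q Eg3) (eqM (- (r' * b)) EF0)))).
  by rewrite /g2 /g3 /q /r /r' Ep; ring.
Qed.

Lemma XV : X *m V = 0.
Proof.
apply/matrixP; apply: ordS_nat => i i5 j; rewrite !mxE sum4E !mxE !inordK //.
case: i i5 => [|[|[|[|[|//]]]]] _ /=; rewrite /q /r /r' ?Ep; ring.
Qed.

(** Lift [X = M2 *m W]. By degree, [W *m V] is a constant [rh] times the first column of [M3]. If
    [rh] is nonzero, that column lies in [(x, q, r, r')] and the homotopy expresses each element of
    [J] by it. If [rh = 0], [x] divides [q] and [r], so [J] lies in [(x, F 4)], against its
    grade. *)
Lemma J_Q e : J e -> exists z1 z2 z3 z4, e = z1 * x + z2 * q + z3 * r + z4 * r'.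
Proof.
have gM2 : gmx (sh1 n) (sh2 n) M2 by apply: gmx_M2.
have gM3 : gmx (sh2 n) (sh3 n) M3 by apply: gmx_M3.
have [W gW EW] := gmx_ker_lift (fun=> 0) ex1 gM2 gX fX.
have [|rho grho Er] := @gmx_ker_lift _ _ _ _ _ _ (sh1 n) (sh2 n) (sh3 n) (fun=> 2 * n%:Z + 4) M2 M3 (W *m V) ex2 gM3 (gmxM gW gV).
  by rewrite mulmxA -EW XV.
have hW i j : (i < 7)%N -> (j < 4)%N -> hg (nth 0 [:: n%:Z + 2; n%:Z + 2; n%:Z + 4; 2 * n%:Z + 3] j -
    (nth 0%N (shifts2 n) i)%:Z) (W (inord i) (inord j)).
  by move=> i7 j4; have := gW (inord i) (inord j); rewrite /dX /sh2 !inordK.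
have W0 i j : (i < 7)%N -> (j < 4)%N -> nth 0 [:: n%:Z + 2; n%:Z + 2; n%:Z + 4; 2 * n%:Z + 3] j <
    (nth 0%N (shifts2 n) i)%:Z -> W (inord i) (inord j) = 0.
  by move=> i7 j4 lt; apply: (hg_neg (hW i j i7 j4)); zlia.
have rho1 : rho (inord 1) 0 = 0.
  by apply: (hg_neg (grho (inord 1) 0)); rewrite /sh3 inordK //=; zlia.
have rho2 : rho (inord 2) 0 = 0.
  by apply: (hg_neg (grho (inord 2) 0)); rewrite /sh3 inordK //=; zlia.
pose rh := rho (inord 0) 0.
have hrh : hg 0 rh by apply: (hg_c (grho (inord 0) 0)); rewrite /sh3 inordK //=; zlia.
have row i : (i < 7)%N -> W (inord i) (inord 0) * r' - W (inord i) (inord 1) * r +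
    W (inord i) (inord 2) * q + W (inord i) (inord 3) * x = m3 i 0%N * rh.
  move=> i7; have := congr1 (fun M : 'cV_7 => M (inord i) 0) Er.
  rewrite !mxE sum4E sum3E !mxE !inordK //= rho1 rho2 -/rh => E; by lc E.
have [rh0|rh0] := eqVneq rh 0; last first.
  move=> /(res_homotopy HJ fM2 ex1 M23 ex2 inj3) [_ [_ [h2 [_ _ E]]]].
  have [k1 [k2 k3]] : m3 4%N 0%N = 0 /\ m3 5%N 0%N = 0 /\ m3 6%N 0%N = 0 by have [? ? ? _] := e3_zero n4 hM3.
  have := congr1 (fun M : 'M_3 => M (inord 0) (inord 0)) E.
  rewrite !mxE sum7E eqxx mulr1n k1 k2 k3 => <-; have [z hz Ez] := hg_unit hrh rh0.
  pose H i := h2 (inord 0) (inord i); pose Q i := (W (inord i) (inord 0) * r' - W (inord i) (inord 1) * r +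
    W (inord i) (inord 2) * q + W (inord i) (inord 3) * x).
  have Em i : (i < 7)%N -> m3 i 0%N = z * Q i.
    by move=> i7; rewrite /Q row //; lc (eqM (m3 i 0%N) Ez).
  rewrite !Em // -/(H 0%N) -/(H 1%N) -/(H 2%N) -/(H 3%N).
  pose S j := z * (H 0%N * W (inord 0) (inord j) + H 1%N * W (inord 1) (inord j) +
    H 2%N * W (inord 2) (inord j) + H 3%N * W (inord 3) (inord j)).
  exists (S 3%N), (S 2%N), (- S 1%N), (S 0%N); rewrite /S /Q; ring.
have rowX i j : (i < 5)%N -> (j < 4)%N -> X (inord i) (inord j) = \sum_a' M2 (inord i) a' * W a' (inord j).
  by move=> i5 j4; rewrite EW mxE.
have W22 : W (inord 2) (inord 2) != 0.
  apply/eqP => z22; have := rowX 3%N 2%N isT isT; rewrite sum7E mxE !inordK //=.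
  rewrite z22 !(W0 3%N, W0 4%N, W0 5%N, W0 6%N) //=; try zlia.
  have -> : m2 3%N 0%N = 0 by apply: (min_entry_0 (hM2 _ _)); rewrite !inordK //=; zlia.
  have -> : m2 3%N 1%N = 0 by apply: (min_entry_0 (hM2 _ _)); rewrite !inordK //=; zlia.
  by rewrite !mul0r !mulr0 !addr0 => z; move: x0; rewrite z eqxx.
have xdvd c m : hg 0 c -> c != 0 -> in1 x (c * m) -> in1 x m.
  move=> hc c0 [m' Em]; have [z _ Ez] := hg_unit hc c0; exists (z * m').
  by apply: (lcomb (eqD (eqM z Em) (eqM (- m) Ez))); ring.
have hWc i j : (i < 7)%N -> (j < 4)%N -> nth 0 [:: n%:Z + 2; n%:Z + 2; n%:Z + 4; 2 * n%:Z + 3] j =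
    (nth 0%N (shifts2 n) i)%:Z -> hg 0 (W (inord i) (inord j)).
  by move=> i7 j4 e0'; apply: (hg_c (hW i j i7 j4)); zlia.
have xq : in1 x q.
  apply: (xdvd (W (inord 2) (inord 2))) => //; first by apply: hWc => //=; zlia.
  have := row 2%N isT; rewrite rh0 mulr0 !(W0 2%N 0%N, W0 2%N 1%N) //=; try zlia.
  by move=> E; exists (- W (inord 2) (inord 3)); lc E.
(* By degree the first two columns of [W] are constants in rows 0 and 1 and zero below. The block is
   invertible because the first two columns of [X] are independent. *)
pose w00 := W (inord 0) (inord 0); pose w01 := W (inord 0) (inord 1).
pose w10 := W (inord 1) (inord 0); pose w11 := W (inord 1) (inord 1).
have [h00 h01 h10 h11] : [/\ hg 0 w00, hg 0 w01, hg 0 w10 & hg 0 w11] by split; apply: hWc => //=; zlia.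
have col01 (c d : R) : c * w00 + d * w01 = 0 -> c * w10 + d * w11 = 0 -> c = 0 /\ d = 0.
  move=> E0 E1.
  have rX i : (i < 5)%N -> c * X (inord i) (inord 0) + d * X (inord i) (inord 1) = 0.
    move=> i5; rewrite !rowX // !sum7E !(W0 2%N 0%N, W0 2%N 1%N, W0 3%N 0%N, W0 3%N 1%N, W0 4%N 0%N, W0 4%N 1%N,
      W0 5%N 0%N, W0 5%N 1%N, W0 6%N 0%N, W0 6%N 1%N) //=; try zlia.
    by apply: (lcomb (eqD (eqM (m2 i 0%N) E0) (eqM (m2 i 1%N) E1))); rewrite /w00 /w01 /w10 /w11; ring.
  have := rX 1%N isT; have := rX 2%N isT; rewrite !mxE !inordK //= => R2 R1.
  have d0 : d = 0.
    have : d * x = 0.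
      by apply: (lcomb (eqD (eqM (w * y1) R2) (eqD (eqM (- (w * y2)) R1) (eqM (- (d * x)) Ew)))); ring.
    by move/eqP; rewrite mulf_eq0 (negbTE x0) orbF => /eqP.
  split=> //; have : c * l = 0.
    apply: (lcomb (eqD (eqM (- (w * e2)) R1) (eqD (eqM (w * e1) R2) (eqM (- (c * l)) Ew)))); rewrite d0; ring.
  by move/eqP; rewrite mulf_eq0 (negbTE l0) orbF => /eqP.
have det0 : w00 * w11 - w01 * w10 != 0.
  apply/eqP => D0; have [||a1 a2] := col01 w11 (- w10); [by lc D0|ring|].
  have [||a3 a4] := col01 (- w01) w00; [ring|by lc D0|].
  have a2' : w10 = 0 by apply/eqP; rewrite -oppr_eq0 a2.
  have [||/eqP] := col01 1 0; [by rewrite a4; ring|by rewrite a2' a1; ring|].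
  by rewrite oner_eq0.
have hdet : hg 0 (w00 * w11 - w01 * w10) by apply: hgB; [apply: (hgM_c h00 h11)|apply: (hgM_c h01 h10)].
have [q' Eq] := xq.
have [k0 Ek0] : in1 x (w00 * r' - w01 * r).
  have := row 0%N isT; rewrite rh0 mulr0 -/w00 -/w01 Eq => E.
  by exists (- (W (inord 0) (inord 2) * q') - W (inord 0) (inord 3)); lc E.
have [k1 Ek1] : in1 x (w10 * r' - w11 * r).
  have := row 1%N isT; rewrite rh0 mulr0 -/w10 -/w11 Eq => E.
  by exists (- (W (inord 1) (inord 2) * q') - W (inord 1) (inord 3)); lc E.
have [rr Err] : in1 x r.
  apply: (xdvd _ _ hdet det0); exists (w10 * k0 - w00 * k1).
  by apply: (lcomb (eqD (eqM w10 Ek0) (eqM (- w00) Ek1))); ring.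
have [_ _ _ _ hF4] := hF1.
have Jx e' : J e' -> in2 x (F 4%N) e'.
  move=> /J_gens [v0 [v1 [v2 [v3 [v4 ->]]]]].
  exists (v0 * l + v1 * p + v2 * (l2 * q' + t * b) + v3 * (l2 * rr + v * b)), v4.
  have Eg2' : g2 = l2 * q + x * t * b by rewrite /g2 /q Ep; ring.
  have Eg3' : g3 = l2 * r + x * v * b by rewrite /g3 /r Ep; ring.
  by rewrite Eg2' Eg3' Eq Err; ring.
have n0 : 0 < 2 * n%:Z + 4 :> int by zlia.
case: (hg_pos_no1_2 hx hF4 ltr01 n0).
exact: (@J_in2 _ _ J c1 c2 c3 rJ J1 J2 J3 x (F 4%N) hx x0 Jx).
Qed.
End Generators.

(** * Perfection and assembly of the two halves *)

Lemma resolution_perfect (k : fieldType) N (J : {mpoly k[N]} -> Prop) b1 b2 b3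
    (f : 'rV[{mpoly k[N]}]_b1) (M2 : 'M[{mpoly k[N]}]_(b1, b2)) (M3 : 'M[{mpoly k[N]}]_(b2, b3)) :
  grade_eq J 3 -> ideal_eq J (fun h => exists v : 'cV[{mpoly k[N]}]_b1, h = (f *m v) ord0 ord0) ->
  f *m M2 = 0 -> ker_sub_im f M2 -> M2 *m M3 = 0 -> ker_sub_im M2 M3 ->
  (forall v : 'cV[{mpoly k[N]}]_b3, M3 *m v = 0 -> v = 0) -> perfect J.
Proof.
move=> gJ HJ fM2 ex1 M23 ex2 inj3; exists 3%N; split=> //.
exists (fun i => match i with 0%N => b1 | 1%N => b2 | 2%N => b3 | _ => 0%N end), f.
exists (fun i => match i return 'M_(match i with 0%N => b1 | 1%N => b2 | 2%N => b3 | _ => 0%N end,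
  match i.+1 with 0%N => b1 | 1%N => b2 | 2%N => b3 | _ => 0%N end) with
  0%N => M2 | 1%N => M3 | _ => 0 end).
split=> //; first by case=> [|[|[|]]].
case=> [|[|i]]; split=> //.
- exact: mulmx0.
- by move=> v /inj3 ->; exists 0; rewrite mulmx0.
- exact: mulmx0.
- by case: i => [|i] v _; exists 0; apply/matrixP => -[].
Qed.

(** If [l] divides [a] it does not divide [x], since it does not divide [p]; adding [x^(n-1)] to [a]
    and [l2 x^(n-2)] to [b] leaves [p] unchanged. *)
Lemma split_not_dvd (k : fieldType) N n (x l l2 p : {mpoly k[N]}) : (4 <= n)%N -> hg 1 x -> hg 1 l -> l != 0 ->
  hg 1 l2 -> hg n%:Z p -> ~ in1 l p -> in2 x l2 p ->
  exists a b, [/\ hg (n%:Z - 1) a, hg (n%:Z - 1) b, p = x * b - l2 * a & ~ in1 l a].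
Proof.
move=> n4 hx hl l0 hl2 hp_ nlp /(in2_hg hp_ hx hl2) [b [a [E hb ha]]].
case: (classic (in1 l a)) => [[a' Ea]|na]; last first.
  exists (- a), b; split=> //; [exact: hgN|by rewrite E; ring|].
  by move=> [w Ew]; apply: na; exists (- w); lc Ew.
have hX m : hg m%:Z (x ^+ m) by apply: (hg_c (hgXn m hx)); zlia.
have EX : x ^+ n.-1 = x * x ^+ n.-2 by rewrite -exprS; congr (_ ^+ _); zlia.
exists (- a + x ^+ n.-1), (b + l2 * x ^+ n.-2); split.
- by apply: hgD; [apply: hgN|apply: (hg_c (hX _)); zlia].
- by apply: hgD => //; apply: (hgM_c hl2 (hX _)); zlia.
- by rewrite E EX; ring.
move=> [w Ew]; have : in1 l (x ^+ n.-1) by exists (w + a'); rewrite Ea in Ew; lc Ew.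
have lx m : in1 l (x ^+ m) -> in1 l x.
  elim: m => [|m IH]; first by rewrite expr0 => /(hg_pos_no1 hl); case.
  by rewrite exprS => /(lin_prime hl l0) [].
by move=> /lx [c Ec]; apply: nlp; exists (b * c + a' * l2); rewrite E Ec Ea; ring.
Qed.

Theorem theorem3p12 (k : fieldType) (N n : nat) (J : {mpoly k[N]} -> Prop) :
  (3 <= N)%N -> (4 <= n)%N ->
  is_homog_ideal J -> grade_eq J 3 -> has_resolution_3p12 n J ->
  homog_licci J /\ ~ SBL J.
Proof.
move=> N3 n4 idJ gJ [f [M2 [M3 [hf hM2 hM3 EJ [fM2 ex1 M23 ex2 inj3]]]]].
have HJ h : J h <-> exists v : 'cV[{mpoly k[N]}]_5, h = (f *m v) 0 0 by apply: EJ.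
have [c1 [c2 [c3 [rJ J1 J2 J3]]]] : exists c1 c2 c3, [/\ reg3 c1 c2 c3, J c1, J c2 & J c3].
  case: gJ => -[fs [sf rf Jf]] _; case: fs sf rf Jf => [|c1 [|c2 [|c3 [|]]]] // _ /regular3P [r3 _] Jf.
  by exists c1, c2, c3; split=> //; [exact: (Jf 0%N)|exact: (Jf 1%N)|exact: (Jf 2%N)].
have [x [l2]] := base_data n4 hf hM2 hM3 HJ fM2 ex1 M23 ex2 inj3 rJ J1 J2 J3.
set l := M3 _ _; set p := _ - _; move=> [HS nxl2 EF0 FH _].
split; last by apply: (not_SBL n4 gJ); exists x, l, l2, p.
split=> //; first exact: resolution_perfect gJ EJ fM2 ex1 M23 ex2 inj3.
have [[[hx x0 hl l0] [hp_ nlp] _ _ _] hl2 pxl2 _] := HS.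
have [s [t [u [v [y0 [y1 [y2 [e0 [e1 [e2 [e3 [w [[hs ht hu hv] [hy0 hy1 hy2 Exp] [he0 he1 he2 Eg2]
  [he3 Eg3] [hw Ew]]]]]]]]]]]]]] := gens_form n4 hf HJ HS EF0 FH.
have [a [b [ha hb Ep nla]]] := split_not_dvd n4 hx hl l0 hl2 hp_ nlp pxl2.
have JP := J_gens HJ EF0 Exp Eg2 Eg3 Ew.
have JQ := J_Q n4 hf hM2 hM3 HJ fM2 ex1 M23 ex2 inj3 rJ J1 J2 J3 HS EF0 hs ht hu hv hy0 hy1 hy2 Exp
  he0 he1 he2 Eg2 he3 Eg3 Ew ha hb Ep.
have [_ _ _ _ hf5] := hF n4 hf.
(* The last generator is replaced by its sum with [h * (x * p)], which does not change [J]. *)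
have [h hh rF] := coprime_a_f5 N3 n4 hx hl hp_ ha hf5 l0 Ep nla JP rJ J1 J2 J3.
have hF5 : hg (2 * n%:Z + 4) (f 0 (inord 4) + h * (x * p)).
  by apply: hgD => //; apply: (hgM_c hh (hgM hx hp_)); zlia.
have JP' e : J e <-> in5 (x * l) (x * p) (s * (l2 * l) + t * p) (u * (l2 * l) + v * p)
    (f 0 (inord 4) + h * (x * p)) e.
  rewrite JP; split=> -[v0 [v1 [v2 [v3 [v4 ->]]]]].
    by exists v0, (v1 - v4 * h), v2, v3, v4; ring.
  by exists v0, (v1 + v4 * h), v2, v3, v4; ring.
have refl t0 c : ci t0 c -> csub c J -> forall e, vcolon c (vcolon c J) e -> J e.
  move=> Cc sub e He.
  have [rc _ _] := Cc; have [y [_ Hy _ H]] := res_link0 HJ fM2 ex1 M23 ex2 inj3 rc sub.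
  by apply: H => r; apply: He.
have [m [Is [Cf [Cd HC]]]] := licci_chain N3 n4 hx hl hl2 hp_ ha hs ht hu hv hF5 x0 l0 Ep nlp nla JP' JQ
  rJ J1 J2 J3 gJ refl rF.
by exists 3%N, m, Is, Cf, Cd.
Qed.
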